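(* Let $u_0\in L^2(\Omega;V_{h,\mathrm{div}})$ be $\mathcal F_0$-measurable and let the operators $(G_n)_{n\in[N]}$ satisfy the data stability assumption (see context). Consider the scheme: find $u=(u_n)_{n=1}^N\in[V_{h,\mathrm{div}}]^N$ such that for all $\xi\in V_{h,\mathrm{div}}$, all $n\in[N]$ and $\mathbb P$-a.s. $$(u_n-u_{n-1},\xi)+\tau\,(S(\varepsilon u_n),\nabla\xi)=\big(G_n(u_{(n-2)\vee 0})\,\Delta_n\mathbb W,\xi\big).\qquad(\ast)$$ Then: (1) (Existence) There exists a random variable $u$ with values in $[V_{h,\mathrm{div}}]^N$ solving $(\ast)$. (2) (Measurability) $u_n$ is $\mathcal F^N_n$-measurable for all $n\in[N]$. (3) (Stability) It holds $$\mathbb E\Big[\max_{n\in[N]}\|u_n\|_{L^2_x}^2+\sum_{n\in[N]}\tau\|\varepsilon u_n\|_{L^p_x}^p\Big]+\max_{k\in[N]}\sum_{n=k}^N\mathbb E\Big[\frac{\|u_n-u_{n-k}\|_{L^2_x}^2}{k}\Big]\lesssim \mathbb E\big[\|u_0\|_{L^2_x}^2\big]+1 .$$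
   Context: Setting. $\mathcal O\subset\mathbb R^n$ is a bounded Lipschitz domain, $T>0$, $I=(0,T)$, $p\in(1,\infty)$, $p'=p/(p-1)$. $L^q_x=L^q(\mathcal O)$, $W^{1,q}_x=W^{1,q}(\mathcal O)$, $W^{1,q}_{0,x}$ is the subspace with zero boundary values, $L^q_{0,x}$ the mean-value free functions; scalar, vector and matrix fields are not distinguished in notation; $(\cdot,\cdot)$ is the $L^2(\mathcal O)$ inner product (duality pairing). $(\Omega,\mathcal F,(\mathcal F_t)_{t\in I},\mathbb P)$ is a stochastic basis with complete right-continuous filtration, $W$ a cylindrical $(\mathcal F_t)$-Wiener process on a separable Hilbert space $\mathfrak U$, and $L_2(\mathfrak U;L^2_x)$ the Hilbert–Schmidt operators. $\varepsilon u=\frac12(\nabla u+(\nabla u)^T)$ and $S(A)=|A|^{p-2}A$ (the case $\kappa=0$ of $S(A)=(\kappa+|A|)^{p-2}A$). $[N]=\{1,\dots,N\}$, $a\vee b=\max\{a,b\}$. Space discretization. For $h\in(0,1]$, $V_h\subset W^{1,\infty}_x\cap W^{1,1}_{0,x}$ (vector fields) and $Q_h\subset L^\infty_x\cap L^1_{0,x}$ (scalar functions) are finite dimensional linear spaces and $V_{h,\mathrm{div}}=\{v\in V_h:\ (q,\operatorname{div}v)=0\ \forall q\in Q_h\}$. Time discretization. $N\in\mathbb N$, $\tau=T/(N+1)$, $t_n=n\tau$, $J_n=[t_n-\tau/2,t_n+\tau/2]$ for $n\ge1$, $J_0=[0,\tau/2]$. Weights: $a_1(t)=1_{J_0}(t)+\frac{t_1+\tau/2-t}{\tau}1_{J_1}(t)$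 and, for $n\ge2$, $a_n(t)=\frac{t-(t_{n-1}-\tau/2)}{\tau}1_{J_{n-1}}(t)+\frac{t_n+\tau/2-t}{\tau}1_{J_n}(t)$. Increments $\Delta_n\mathbb W=\int a_n(t)\,dW(t)$, so that $G_n(v)\Delta_n\mathbb W=\int a_n(t)G_n(v)\,dW(t)$. Discrete filtration: $\mathcal F^N_n=\mathcal F_{t_n+\tau/2}$ for $n\ge1$, $\mathcal F^N_0=\mathcal F_0$. Data stability assumption. There is $C>0$ independent of $n,N$ such that for all $n\in[N]$: (1) $G_n:\Omega\times L^2_x\to L_2(\mathfrak U;L^2_x)$ is $\mathcal F^N_{(n-2)\vee0}$-measurable; (2) $\mathbb E[\|G_n(v_n)\|_{L_2(\mathfrak U;L^2_x)}^2]\le C(1+\|v_n\|^2_{L^2(\Omega;L^2_x)})$ for all $\mathcal F^N_{(n-2)\vee0}$-measurable $v_n\in L^2(\Omega;L^2_x)$; (3) $\mathbb E[\|G_n(v_n)-G_n(w_n)\|_{L_2(\mathfrak U;L^2_x)}^2]\le C\|v_n-w_n\|^2_{L^2(\Omega;L^2_x)}$ for all $\mathcal F^N_{(n-2)\vee0}$-measurable $v_n,w_n\in L^2(\Omega;L^2_x)$. $f\lesssim g$ means $f\le c\,g$ with a constant $c$ independent of the discretization parameters $h$, $N$, $\tau$ (and of $u_0$). *)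

(* Defs.v *)
From HB Require Import structures.
From mathcomp Require Import all_boot all_order all_algebra.
From mathcomp Require Import all_classical all_reals all_analysis.
From mathcomp Require Import measurable_realfun.
Set Implicit Arguments. Unset Strict Implicit. Unset Printing Implicit Defensive.
Import Order.TTheory GRing.Theory Num.Theory.
Import numFieldNormedType.Exports.
Local Open Scope classical_set_scope.
Local Open Scope ring_scope.

Notation borel_rV R n := (g_sigma_algebraType (@open 'rV[R%type]_n)).

Lemma measurable_rV (R : realType) d (T : measurableType d) n
    (f : T -> borel_rV R n) :
  (forall i, measurable_fun setT (fun x => (f x : 'rV[R]_n) ord0 i)) ->
  measurable_fun setT f.
Proof.
move=> mf.
apply: (@measurability _ _ _ _ setT f (@open 'rV[R]_n)) => // _ [U oU <-].
pose c (q : 'rV[rat]_n) : 'rV[R]_n := map_mx ratr q.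
pose r (k : nat) : R := k.+1%:R^-1.
pose good := [set qk : 'rV[rat]_n * nat | ball (c qk.1) (r qk.2) `<=` U].
have -> : U = \bigcup_(qk in good) ball (c qk.1) (r qk.2).
  apply/seteqP; split=> [x Ux|x [qk /= g b]]; last exact: g.
  have /nbhs_ballP[e /= e0 be] : nbhs x U by exact: open_nbhs_nbhs.
  have [k ke] : exists k, r k < e / 2.
    have := @ltr_add_invr R 0 (e / 2); rewrite divr_gt0// => /(_ isT)[k].
    by rewrite add0r => ?; exists k.
  have rk0 : 0 < r k by rewrite invr_gt0.
  have H i : exists q : rat, `|x ord0 i - ratr q| < r k.
    have [|q] := @rat_in_itvoo R (x ord0 i - r k) (x ord0 i + r k).
      by rewrite ltrBlDr -addrA ltrDl addr_gt0.
    rewrite in_itv/= => /andP[q1 q2]; exists q.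
    by rewrite ltr_distl ltrBlDr q2 -ltrBlDr q1.
  have [q qP] := choice H.
  pose Q : 'rV[rat]_n := \row_i q i.
  exists (Q, k) => /=.
    move=> y /= [_ by_]; apply: be; split=> // i j.
    rewrite (ord1 i) /ball/=.
    have := by_ 0 j; rewrite !mxE /ball/= => h.
    rewrite (splitr e) (le_lt_trans (ler_distD (ratr (q j)) _ _))// ltrD//.
      exact: lt_trans (qP j) ke.
    exact: lt_trans h ke.
  split=> // i j; rewrite (ord1 i) !mxE /ball/= distrC; exact: qP.
rewrite setTI preimage_bigcup bigcup_mkcond.
apply: countable_bigcupT_measurable; first exact: countableP.
move=> [q k] /=; case: ifPn => // _.
have -> : f @^-1` ball (c q) (r k) =
    \bigcap_(i in [set: 'I_n]) ((fun x => (f x : 'rV[R]_n) ord0 i) @^-1` ball (c q ord0 i) (r k)).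
  apply/seteqP; split=> x /=.
    by move=> [_ H] i _; exact: H.
  move=> H; split; first by rewrite invr_gt0.
  by move=> i j; rewrite (ord1 i); exact: H.
apply: fin_bigcap_measurable; first exact: finite_finset.
move=> i _; rewrite -[X in measurable X]setTI.
apply: mf => //; exact: measurable_ball.
Qed.


Section lebesgue_rV.
Variable R : realType.

Definition consV n (p : R * borel_rV R n) : borel_rV R n.+1 :=
  (row_mx (const_mx p.1) p.2 : 'rV[R]_(1 + n)).

Lemma consVl n (p : R * borel_rV R n) (j : 'I_1) :
  (consV p : 'rV[R]_n.+1) ord0 (lshift n j : 'I_n.+1) = p.1.
Proof. by etransitivity; [exact: row_mxEl|rewrite mxE]. Qed.

Lemma consVr n (p : R * borel_rV R n) (j : 'I_n) :
  (consV p : 'rV[R]_n.+1) ord0 (rshift 1 j : 'I_n.+1) = (p.2 : 'rV[R]_n) ord0 j.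
Proof. exact: row_mxEr. Qed.

Lemma measurable_coord n (i : 'I_n) :
  measurable_fun setT (fun v : borel_rV R n => (v : 'rV[R]_n) ord0 i).
Proof.
apply: (measurability _ (RGenOpens.measurableE R)).
move=> _ [U [a [b ->]] <-]; rewrite setTI.
apply: sub_sigma_algebra.
move/continuousP : (@coord_continuous R 1 n ord0 i); apply.
exact: interval_open.
Qed.

Lemma measurable_consV n : measurable_fun setT (@consV n).
Proof.
apply: measurable_rV => i.
case: (split_ordP (i : 'I_(1 + n))) => j ->.
  rewrite [X in measurable_fun _ X](_ : _ = fst); first exact: measurable_fst.
  by apply/funext => p; exact: consVl.
rewrite [X in measurable_fun _ X](_ : _ =
    (fun v : borel_rV R n => (v : 'rV[R]_n) ord0 j) \o snd); last first.
  by apply/funext => p; exact: consVr.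
exact: (measurableT_comp (measurable_coord j) measurable_snd).
Qed.

Definition locfin n (m : set (borel_rV R n) -> \bar R) :=
  forall k : nat, (m (ball (0%R : 'rV[R]_n) k.+1%:R) < +oo)%E.

Lemma measurable_rV_ball n (x : 'rV[R]_n) (r : R) :
  measurable (ball x r : set (borel_rV R n)).
Proof. by apply: sub_sigma_algebra; exact: ball_open. Qed.

Section sigma_finite.
Variables (n : nat) (m : {measure set (borel_rV R n) -> \bar R}).
Hypothesis mfin : locfin m.

Definition locfin_measure of locfin m : set (borel_rV R n) -> \bar R := m.
Local Notation lm := (locfin_measure mfin).
HB.instance Definition _ := Measure.on lm.

Let locfin_sigma_finite : sigma_finite setT lm.
Proof.
exists (fun k : nat => ball (0 : 'rV[R]_n) k.+1%:R); last first.
  by move=> k; split; [exact: measurable_rV_ball|exact: mfin].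
apply/esym; rewrite -subTset => x _.
exists (Num.truncn `|x : 'rV[R]_n|) => //.
by rewrite -ball_normE /= sub0r normrN truncnS_gt.
Qed.
HB.instance Definition _ := Measure_isSigmaFinite.Build _ _ _ lm locfin_sigma_finite.

Definition lebesgue_step : {measure set (borel_rV R n.+1) -> \bar R} :=
  measure_function_pushforward__canonical__measure_function_Measure
    (product_measure1 (@lebesgue_measure R) lm) (@measurable_consV n).

Lemma lebesgue_step_locfin : locfin lebesgue_step.
Proof.
move=> k; rewrite /lebesgue_step /= /pushforward.
have sub : @consV n @^-1` ball (0 : 'rV[R]_n.+1) k.+1%:R `<=`
    ball (0 : R) k.+1%:R `*` ball (0 : 'rV[R]_n) k.+1%:R.
  move=> [a v] /= [k0 H]; split => /=.
    by have := H ord0 (lshift n (ord0 : 'I_1)); rewrite consVl mxE.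
  split => // i j; have := H ord0 (rshift 1 j).
  by rewrite consVr (ord1 i) !mxE.
apply: (@le_lt_trans _ _ ((product_measure1 (@lebesgue_measure R) lm)
    (ball (0 : R) k.+1%:R `*` ball (0 : 'rV[R]_n) k.+1%:R))).
  apply: le_measure => //; rewrite inE.
    by rewrite -[X in measurable X]setTI; apply: measurable_consV => //; exact: measurable_rV_ball.
  by apply: measurableX; [exact: measurable_ball|exact: measurable_rV_ball].
rewrite product_measure1E; [|exact: measurable_ball|exact: measurable_rV_ball].
apply: lte_mul_pinfty; [exact: measure_ge0| |exact: mfin].
have E := @lebesgue_measure_ball R 0 k.+1%:R (ltW (ltr0Sn _ _)).
exact: (eq_ind_r (fun x => x \is a fin_num) _ E).
Qed.
End sigma_finite.

Lemma locfin_dirac :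
  locfin (@dirac _ (borel_rV R 0) (0 : 'rV[R]_0) R).
Proof. by move=> k; rewrite diracE ltry. Qed.

(* Lebesgue measure on R^n, by recursion on n: lambda^0 is the unit mass, and
   lambda^(n+1) is the image of lambda (x) lambda^n under (t, v) |-> (t, v_1, .., v_n). *)
Fixpoint lebesgue_rV_rec n :
    {m : {measure set (borel_rV R n) -> \bar R} | locfin m} :=
  match n with
  | 0 => exist (fun m : {measure set (borel_rV R 0) -> \bar R} => locfin m)
      (@dirac _ (borel_rV R 0) (0 : 'rV[R]_0) R) locfin_dirac
  | n.+1 => exist (fun m : {measure set (borel_rV R n.+1) -> \bar R} => locfin m)
      (lebesgue_step (proj2_sig (lebesgue_rV_rec n)))
      (lebesgue_step_locfin (proj2_sig (lebesgue_rV_rec n)))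
  end.

Definition lebesgue_rV n : {measure set (borel_rV R n) -> \bar R} :=
  proj1_sig (lebesgue_rV_rec n).

End lebesgue_rV.

Section boundary.
Context {R : realType} {n : nat}.

Definition vdot (x y : 'rV[R]_n) : R := \sum_i x ord0 i * y ord0 i.

(* Near each boundary point, in a rotated coordinate system whose last axis
   is nu, the set is the region strictly above the graph of a Lipschitz
   function g over the hyperplane nu^\perp; x - (x . nu) nu is the projection
   of x onto that hyperplane. The values of g outside it are irrelevant. *)
Definition lipschitz_boundary (D : set 'rV[R]_n) : Prop :=
  forall x0, closure D x0 -> ~ interior D x0 ->
  exists (r : R) (nu : 'rV[R]_n) (g : 'rV[R]_n -> R) (k : R),
    [/\ 0 < r, vdot nu nu = 1, k.-lipschitz g &
      forall x, ball x0 r x ->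
        (D x <-> g (x - vdot x nu *: nu) < vdot x nu)].

End boundary.

Record lipschitz_domain (R : realType) (n : nat) := LipschitzDomain {
  dom_set :> set 'rV[R]_n;
  dom_open : open dom_set;
  dom_nonempty : dom_set !=set0;
  dom_connected : connected dom_set;
  dom_bounded : bounded_set dom_set;
  dom_lipschitz : lipschitz_boundary dom_set
}.

Section function_spaces.
Context {R : realType} {n : nat}.
Implicit Types D : lipschitz_domain R n.

Lemma measurable_dom D : measurable (dom_set D : set (borel_rV R n)).
Proof. by apply: sub_sigma_algebra; exact: dom_open. Qed.

(* Lebesgue measure restricted to D: integrals over the whole space against
   vol D are integrals over D, and functions are identified when they agree
   almost everywhere on D. *)
Definition vol D : {measure set (borel_rV R n) -> \bar R} :=
  mrestr (@lebesgue_rV R n) (measurable_dom D).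

(* L^2(D), through representatives (the library's quotient Lspace has no
   vector space structure). *)
Definition L2 D : Type := LfunType (vol D) (lee1n 2).
HB.instance Definition _ D := GRing.Lmodule.on (L2 D).
Definition L2_fun D (q : L2 D) : borel_rV R n -> R := q.
Coercion L2_fun : L2 >-> Funclass.

Definition vfield D : Type := {ffun 'I_n -> L2 D}.
HB.instance Definition _ D := GRing.Lmodule.on (vfield D).

Definition vfield_fun D (v : vfield D) : 'I_n -> L2 D := v.
Coercion vfield_fun : vfield >-> Funclass.

Definition L2_eq D (q r : L2 D) : Prop :=
  {ae vol D, forall x, q x = r x}.
Definition vfield_eq D (v w : vfield D) : Prop :=
  forall i, L2_eq (v i) (w i).

Definition fdot D (v w : vfield D) : R :=
  \sum_i \int[vol D]_x (v i x * w i x).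
Definition fnormsq D (v : vfield D) : R := fdot v v.
Definition fnorm D (v : vfield D) : R := Num.sqrt (fnormsq v).
Definition fdist D (v w : vfield D) : R := fnorm (v - w).

Definition partial (i : 'I_n) (f : 'rV[R]_n -> R) : 'rV[R]_n -> R :=
  fun x => 'D_(delta_mx ord0 i) f x.

Definition smooth (f : 'rV[R]_n -> R) : Prop :=
  forall s : seq 'I_n, let g := foldr partial f s in
    continuous g /\ forall i x, derivable g x (delta_mx ord0 i).

Definition test_fun D (f : 'rV[R]_n -> R) : Prop :=
  smooth f /\ exists K : set 'rV[R]_n,
    [/\ compact K, K `<=` D & forall x, ~ K x -> f x = 0].

(* A is the weak gradient of v, (A x) i j being the weak partial derivative
   of the component v i in direction j. *)
Definition is_weak_grad D (v : vfield D) (A : borel_rV R n -> 'M[R]_n) : Prop :=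
  forall i j, (fun x => A x i j) \in Lfun (vol D) 1%E /\
    forall f, test_fun D f ->
      \int[vol D]_x (v i x * partial j f x) = - \int[vol D]_x (A x i j * f x).

(* The weak gradient, which is unique up to a null set; 0 when there is none. *)
Definition grad D (v : vfield D) : borel_rV R n -> 'M[R]_n :=
  xget (fun=> 0) [set A | is_weak_grad v A].

Definition sgrad D (v : vfield D) (x : borel_rV R n) : 'M[R]_n :=
  2^-1 *: (grad v x + (grad v x)^T).

Definition W1inf D (v : vfield D) : Prop :=
  (forall i, (v i : borel_rV R n -> R) \in Lfun (vol D) +oo%E) /\
  exists2 A, is_weak_grad v A &
    forall i j, (fun x => A x i j) \in Lfun (vol D) +oo%E.

(* The closure of C_c^\infty(D) in W^{1,1}(D), i.e. zero boundary values *)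
Definition W110 D (v : vfield D) : Prop :=
  exists A (f : nat -> 'I_n -> 'rV[R]_n -> R),
    [/\ is_weak_grad v A, forall k i, test_fun D (f k i),
      forall i, (fun k => \int[vol D]_x `|(v i x - f k i x)%:E|)%E
        @ \oo --> 0%E &
      forall i j, (fun k => \int[vol D]_x `|(A x i j - partial j (f k i) x)%:E|)%E
        @ \oo --> 0%E].

Definition fin_dim (E : lmodType R) (eqE : E -> E -> Prop) (V : set E) : Prop :=
  exists (m : nat) (b : 'I_m -> E), forall v,
    V v <-> exists c : 'I_m -> R, eqE v (\sum_i c i *: b i).

Definition velocity_space D (V : set (vfield D)) : Prop :=
  fin_dim (@vfield_eq D) V /\ forall v, V v -> W1inf v /\ W110 v.

Definition pressure_space D (Q : set (L2 D)) : Prop :=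
  fin_dim (@L2_eq D) Q /\ forall q, Q q ->
    (q : borel_rV R n -> R) \in Lfun (vol D) +oo%E /\ \int[vol D]_x q x = 0.

Definition div_free D (V : set (vfield D)) (Q : set (L2 D)) : set (vfield D) :=
  [set v | V v /\ forall q, Q q -> \int[vol D]_x (q x * \tr (grad v x)) = 0].

Definition frob_dot (A B : 'M[R]_n) : R := \sum_i \sum_j A i j * B i j.
Definition frob (A : 'M[R]_n) : R := Num.sqrt (frob_dot A A).

Definition stress (p : R) (A : 'M[R]_n) : 'M[R]_n := frob A `^ (p - 2) *: A.

Definition stress_dot D p (v xi : vfield D) : R :=
  \int[vol D]_x frob_dot (stress p (sgrad v x)) (grad xi x).
Definition sgrad_pow D p (v : vfield D) : \bar R :=
  (\int[vol D]_x (frob (sgrad v x) `^ p)%:E)%E.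

End function_spaces.

Record hilbert (R : realType) := Hilbert {
  hil_sort :> completeNormedModType R;
  hil_dot : hil_sort -> hil_sort -> R;
  hil_dotC : forall x y, hil_dot x y = hil_dot y x;
  hil_dotP : forall a x y z,
    hil_dot (a *: x + y) z = a * hil_dot x z + hil_dot y z;
  hil_dotxx : forall x, hil_dot x x = `|x| ^+ 2
}.

Definition separable (T : topologicalType) : Prop :=
  exists2 A : set T, countable A & dense A.

(* A complete orthonormal system, indexed by a set of integers so as to allow
   finite dimension; onb_vec k is irrelevant for k outside onb_idx. *)
Record onb (R : realType) (U : hilbert R) := Onb {
  onb_idx : set nat;
  onb_vec :> nat -> U;
  onb_orthonormal : forall i j, onb_idx i -> onb_idx j ->
    hil_dot (onb_vec i) (onb_vec j) = (i == j)%:R;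
  onb_complete : forall x : U,
    (forall k, onb_idx k -> hil_dot x (onb_vec k) = 0) -> x = 0
}.

Section hilbert_schmidt.
Context {R : realType} {n : nat} {U : hilbert R}.
Variables (e : onb U) (D : lipschitz_domain R n).

Definition columns_normsq (A : nat -> vfield D) : \bar R :=
  (\sum_(k <oo | k \in onb_idx e) (fnormsq (A k))%:E)%E.

Record hs_op := HsOp {
  hs_fun :> U -> vfield D;
  hs_linear : forall a x y,
    vfield_eq (hs_fun (a *: x + y)) (a *: hs_fun x + hs_fun y);
  hs_bounded : exists M : R, forall x, fnorm (hs_fun x) <= M * `|x|;
  hs_finite : (columns_normsq (fun k => hs_fun (e k)) < +oo)%E
}.

Definition hs_normsq (A : hs_op) : \bar R := columns_normsq (fun k => A (e k)).
Definition hs_distsq (A B : hs_op) : \bar R :=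
  columns_normsq (fun k => A (e k) - B (e k)).
Definition hs_dist (A B : hs_op) : R := Num.sqrt (fine (hs_distsq A B)).

End hilbert_schmidt.

(* For a pseudometric these sets do not separate points at distance 0, so
   measurability below only depends on L^2 classes. *)
Definition borel (R : realType) (X : Type) (dist : X -> X -> R) : set (set X) :=
  <<s [set B | forall x, B x ->
         exists2 r, 0 < r & forall y, dist x y < r -> B y] >>.

Definition meas_wrt (O X : Type) (F : set (set O)) (B : set (set X))
    (f : O -> X) : Prop :=
  forall A, B A -> F (f @^-1` A).

Definition prod_sigma (X Y : Type) (F : set (set X)) (B : set (set Y)) :
    set (set (X * Y)) :=
  <<s [set C | exists2 A, F A & exists2 A', B A' & C = A `*` A'] >>.

Section stochastics.
Context {R : realType} {d : measure_display} {Om : measurableType d}.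
Variables (P : probability Om R) (T : R).
Implicit Types (F : R -> set (set Om)).

Definition complete_filtration F : Prop :=
  [/\ forall t, 0 <= t <= T ->
        sigma_algebra setT (F t) /\ F t `<=` measurable,
      forall s t, 0 <= s -> s <= t -> t <= T -> F s `<=` F t,
      forall t, 0 <= t < T -> F t = \bigcap_(s in `]t, T]) F s &
      forall A, P.-negligible A -> F 0 A].

(* W = \sum_(k in K) W_k e_k, where (W_k) are independent real (F_t)-Wiener
   processes: the increments after time s are centred Gaussian of variance
   t - s, independent of each other and jointly independent of F_s. *)
Definition cylindrical_wiener F (K : set nat) (W : nat -> R -> Om -> R) : Prop :=
  [/\ forall k t, K k -> 0 <= t <= T -> meas_wrt (F t) measurable (W k t),
      forall k, K k -> {ae P, forall w, W k 0 w = 0},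
      forall k, K k ->
        {ae P, forall w, {within `[0, T], continuous (fun t => W k t w)}} &
      forall s t (ks : seq nat) (A : set Om) (B : nat -> set R),
        0 <= s -> s < t -> t <= T -> uniq ks -> (forall k, k \in ks -> K k) ->
        F s A -> (forall k, measurable (B k)) ->
        P (A `&` [set w | forall k, k \in ks -> B k (W k t w - W k s w)]) =
          (P A * \prod_(k <- ks) normal_prob 0 (Num.sqrt (t - s)) (B k))%E].

Section ito.
Context {n : nat} (D : lipschitz_domain R n).
Variables (F : R -> set (set Om)) (K : set nat) (W : nat -> R -> Om -> R).

Definition mean_normsq (X : Om -> vfield D) : \bar R :=
  (\int[P]_w (fnormsq (X w))%:E)%E.

(* Elementary processes sum_i 1_(s_i, t_i](t) X_i (x) e_(k_i), where X (x) e
   is the rank-one operator u |-> (u, e) X. *)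
Record elementary := Elementary {
  el_size : nat;
  el_left : 'I_el_size -> R;
  el_right : 'I_el_size -> R;
  el_idx : 'I_el_size -> nat;
  el_coef : 'I_el_size -> Om -> vfield D;
  el_time : forall i, 0 <= el_left i /\ el_left i <= el_right i <= T;
  el_idxK : forall i, K (el_idx i);
  el_meas : forall i,
    meas_wrt (F (el_left i)) (borel (@fdist R n D)) (el_coef i);
  el_fin : forall i, (mean_normsq (el_coef i) < +oo)%E
}.

(* An operator-valued process is given by its columns Phi t w k = Phi_t(w) e_k. *)
Definition el_proc (q : elementary) (t : R) (w : Om) (k : nat) : vfield D :=
  \sum_(i | (el_idx i == k) && (el_left i < t <= el_right i)) @el_coef q i w.

Definition el_int (q : elementary) (w : Om) : vfield D :=
  \sum_i (W (el_idx i) (el_right i) w - W (el_idx i) (el_left i) w)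
    *: @el_coef q i w.

Definition ito_integral (Phi : R -> Om -> nat -> vfield D) (I : Om -> vfield D) :
    Prop :=
  meas_wrt (F T) (borel (@fdist R n D)) I /\
  exists q : nat -> elementary,
    (fun m => \int[P]_w \int[lebesgue_measure]_(t in `[0%R, T])
        \sum_(k <oo | k \in K) (fnormsq (el_proc (q m) t w k - Phi t w k))%:E)%E
      @ \oo --> 0%E /\
    mean_normsq (fun w => el_int (q m) w - I w) @[m --> \oo] --> 0%E.

End ito.

Section scheme.
Context {n : nat} {U : hilbert R} (e : onb U) (D : lipschitz_domain R n).
Variables (F : R -> set (set Om)) (W : nat -> R -> Om -> R) (N : nat).

Definition tau : R := T / N.+1%:R.
Definition tgrid (i : nat) : R := i%:R * tau.
Definition Jint (i : nat) : set R :=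
  if i is 0%N then `[0, tau / 2] else `[tgrid i - tau / 2, tgrid i + tau / 2].

Definition weight (i : nat) (t : R) : R :=
  if (i <= 1)%N then
    \1_(Jint 0) t + (tgrid 1 + tau / 2 - t) / tau * \1_(Jint 1) t
  else (t - (tgrid i.-1 - tau / 2)) / tau * \1_(Jint i.-1) t
       + (tgrid i + tau / 2 - t) / tau * \1_(Jint i) t.

Definition FN (i : nat) : set (set Om) :=
  if i is 0%N then F 0 else F (tgrid i + tau / 2).

(* The truncated subtraction i - 2 on nat is (i - 2) \vee 0. *)
Definition square_int_at (i : nat) (v : Om -> vfield D) : Prop :=
  meas_wrt (FN (i - 2)) (borel (@fdist R n D)) v /\ (mean_normsq v < +oo)%E.

Definition data_stability (C : R) (G : nat -> Om -> vfield D -> hs_op e D) :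
    Prop :=
  forall i, (1 <= i <= N)%N ->
  [/\ meas_wrt (prod_sigma (FN (i - 2)) (borel (@fdist R n D)))
        (borel (@hs_dist R n U e D)) (fun z => G i z.1 z.2),
      forall v, square_int_at i v ->
        (\int[P]_w hs_normsq (G i w (v w)) <= C%:E * (1 + mean_normsq v))%E &
      forall v v', square_int_at i v -> square_int_at i v' ->
        (\int[P]_w hs_distsq (G i w (v w)) (G i w (v' w))
           <= C%:E * mean_normsq (fun w => v w - v' w)%R)%E].

(* I is G_i(v) Delta_i W, the stochastic integral of t |-> a_i(t) G_i(v). *)
Definition noise (G : nat -> Om -> vfield D -> hs_op e D) (i : nat)
    (v I : Om -> vfield D) : Prop :=
  ito_integral F (onb_idx e) W
    (fun t w k => weight i t *: G i w (v w) (e k)) I.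

(* Only u 0 = u_0, .., u N are meaningful. *)
Definition scheme_solution (p : R) (G : nat -> Om -> vfield D -> hs_op e D)
    (Vdiv : set (vfield D)) (u0 : Om -> vfield D) (u : nat -> Om -> vfield D) :
    Prop :=
  u 0%N = u0 /\
  forall i, (1 <= i <= N)%N ->
  [/\ meas_wrt measurable (borel (@fdist R n D)) (u i),
      forall w, Vdiv (u i w) &
      exists2 I, noise G i (u (i - 2)%N) I &
        forall xi, Vdiv xi -> {ae P, forall w,
          fdot (u i w - u i.-1 w) xi + tau * stress_dot p (u i w) xi
            = fdot (I w) xi}].

Definition stability_lhs (p : R) (u : nat -> Om -> vfield D) : \bar R :=
  (\int[P]_w ((\big[Num.max/0%R]_(1 <= i < N.+1) fnormsq (u i w))%:E
       + \sum_(1 <= i < N.+1) tau%:E * sgrad_pow p (u i w))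
   + \big[maxe/0]_(1 <= k < N.+1) \sum_(k <= i < N.+1)
       \int[P]_w (fnormsq (u i w - u (i - k)%N w)%R / k%:R)%:E)%E.

End scheme.

End stochastics.

(* Main.v *)
(* Fix an L^2-orthonormal basis of V_{h,div}. In coordinates the n-th step of the
   scheme reads x_n + tau A(x_n) = x_{n-1} + z_n, where p A is a subgradient of the
   finite convex function Phi(c) = ||eps u||_p^p. Hence id + tau A has an inverse,
   which is a contraction: this gives existence, and measurability of every
   solution, since the noise coordinates z_n are F_n-measurable.

   The Ito isometry yields E |z_n|^2 <= const tau (1 + E |u_{n-2}|^2), and the
   averaged noise z_n is orthogonal to L^2(F_{n-2}). Testing the n-th equation
   with x_n = x_{n-2} + (x_n - x_{n-2}) and Gronwall's lemma bound the energy; the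
   maximum is controlled by the pathwise Davis inequality (which replaces the
   Burkholder-Davis-Gundy inequality) for the even and for the odd indices; the
   increments follow from summing k consecutive equations, tested with
   x_n - x_{n-k}, and |A(c) . y| <= Phi(c) + Phi(y). *)
Require Import Defs.
From HB Require Import structures.
From mathcomp Require Import all_boot all_order all_algebra.
From mathcomp Require Import all_classical all_reals all_analysis.
From mathcomp Require Import measurable_realfun.
From mathcomp Require Import ring lra.
Set Implicit Arguments.
Unset Strict Implicit.
Unset Printing Implicit Defensive.
Import Order.TTheory GRing.Theory Num.Theory.
Import numFieldNormedType.Exports.
Local Open Scope classical_set_scope.
Local Open Scope ring_scope.

(** * Integrable and square-integrable functions *)

(** Three obstacles shape the proof. The supports of consecutive weights overlap, so the noise of
    step n is correlated with that of step n - 1; this forces the lag of two indices everywhere, the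
    splitting by parity and the test with x_(n-2). Next, [ito_integral] is a relation: the existence
    of an integral, its adaptedness to the end of its time window, its orthogonality to the past of
    the window and its energy bound are all derived from approximation by elementary processes.
    Finally, fields are representatives and their Borel sets come from a pseudometric on a space not
    known to be separable, so the measurability of sums and of products with random coefficients
    goes through countable covers by rational boxes. A solution is only assumed measurable for the
    full sigma-algebra; it becomes F_n-measurable by almost sure equality with the resolvent formula
    and completeness of the filtration. The noise constant is [kap] = 32 [gauss2] C, where 4
    [gauss2] is the price of the approximate isometry and 8 [tau] bounds the integral of the squared
    weight. Neither the dimension of V_h nor the basis enters the final constant. *)

Section almost_everywhere.
Context d (T : measurableType d) (R : realType) (mu : {measure set T -> \bar R}).

Lemma ae_imp (P Q : T -> Prop) : (forall x, P x -> Q x) ->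
  {ae mu, forall x, P x} -> {ae mu, forall x, Q x}.
Proof. by move=> PQ; apply: (@filterS _ _ (ae_filter_ringOfSetsType mu)). Qed.

Lemma ae_imp2 (P Q S : T -> Prop) : (forall x, P x -> Q x -> S x) ->
  {ae mu, forall x, P x} -> {ae mu, forall x, Q x} -> {ae mu, forall x, S x}.
Proof. by move=> PQ; apply: (@filterS2 _ _ (ae_filter_ringOfSetsType mu)). Qed.

Lemma ae_all (I : countType) (P : I -> T -> Prop) :
  (forall i, {ae mu, forall x, P i x}) -> {ae mu, forall x i, P i x}.
Proof.
move=> H.
have H' (k : nat) : {ae mu, forall x, forall i, unpickle k = Some i -> P i x}.
  case e : (unpickle k) => [i|]; last by apply: aeW.
  by apply: ae_imp (H i) => x Px j [<-].
have : mu.-negligible (\bigcup_k ~` [set x | forall i : I, unpickle k = Some i -> P i x]).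
  by apply: negligible_bigcup => k; exact: H'.
apply: negligibleS => x /= nP; apply: contrapT => nb; apply: nP => i.
apply: contrapT => nPi; apply: nb; exists (pickle i) => //= h; apply: nPi; apply: h.
by rewrite pickleK.
Qed.

End almost_everywhere.

Section L1L2.
Context d (T : measurableType d) (R : realType) (mu : {measure set T -> \bar R}).
Implicit Types f g h : T -> R.

Definition int1 f := mu.-integrable setT (EFin \o f).
Definition int2 f := measurable_fun setT f /\ int1 (fun x => f x ^+ 2).

Lemma int1_meas f : int1 f -> measurable_fun setT f.
Proof. by move=> /measurable_int /measurable_EFinP. Qed.

Lemma int1_lty f : int1 f -> (\int[mu]_x `|f x|%:E < +oo)%E.
Proof. by move=> /integrableP[]. Qed.

Lemma int1P f : measurable_fun setT f -> (\int[mu]_x `|f x|%:E < +oo)%E -> int1 f.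
Proof. by move=> mf fy; apply/integrableP; split => //; exact/measurable_EFinP. Qed.

Lemma int1_le f g : measurable_fun setT f -> (forall x, `|f x| <= g x) ->
  int1 g -> int1 f.
Proof.
move=> mf fg ig; apply: (le_integrable _ _ _ ig) => //; first exact/measurable_EFinP.
by move=> x _ /=; rewrite lee_fin (le_trans (fg x))// ler_norm.
Qed.

Lemma int1D f g : int1 f -> int1 g -> int1 (fun x => f x + g x).
Proof. by move=> i1 i2; exact: (integrableD measurableT i1 i2). Qed.

Lemma int1N f : int1 f -> int1 (fun x => - f x).
Proof. by move=> i1; exact: (integrableN i1). Qed.

Lemma int1B f g : int1 f -> int1 g -> int1 (fun x => f x - g x).
Proof. by move=> i1 i2; apply: int1D => //; exact: int1N. Qed.

Lemma int1Z c f : int1 f -> int1 (fun x => c * f x).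
Proof. by move=> i1; exact: (integrableZl measurableT c i1). Qed.

Lemma int1_0 : int1 (fun=> 0).
Proof. exact: integrable0. Qed.

Lemma int1_sum (I : Type) (s : seq I) (Q : pred I) (F : I -> T -> R) :
  (forall i, Q i -> int1 (F i)) -> int1 (fun x => \sum_(i <- s | Q i) F i x).
Proof.
move=> H; elim: s => [|a s ih].
  by under eq_fun do rewrite big_nil; exact: int1_0.
have [Qa|nQa] := boolP (Q a).
  by under eq_fun do rewrite big_cons Qa; apply: int1D => //; exact: H.
by under eq_fun do rewrite big_cons (negbTE nQa).
Qed.

Lemma int1_norm f : int1 f -> int1 (fun x => `|f x|).
Proof.
move=> i1; apply: (int1_le _ _ (g := fun x => `|f x|)).
- apply: measurableT_comp => //; exact: int1_meas.
- by move=> x; rewrite normr_id.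
- apply: int1P; first by apply: measurableT_comp => //; exact: int1_meas.
  by under eq_integral do rewrite normr_id; exact: int1_lty.
Qed.

Lemma RintE f : int1 f -> (\int[mu]_x f x)%:E = (\int[mu]_x (f x)%:E)%E.
Proof. by move=> i1; rewrite /Rintegral fineK//; exact: integrable_fin_num. Qed.

Lemma RintD f g : int1 f -> int1 g ->
  \int[mu]_x (f x + g x) = \int[mu]_x f x + \int[mu]_x g x.
Proof. by move=> i1 i2; rewrite RintegralD. Qed.

Lemma RintB f g : int1 f -> int1 g ->
  \int[mu]_x (f x - g x) = \int[mu]_x f x - \int[mu]_x g x.
Proof. by move=> i1 i2; rewrite RintegralB. Qed.

Lemma RintZ c f : int1 f -> \int[mu]_x (c * f x) = c * \int[mu]_x f x.
Proof. by move=> i1; rewrite RintegralZl. Qed.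

Lemma Rint_zero : \int[mu]_x (0 : R) = 0.
Proof. by rewrite /Rintegral integral0. Qed.

Lemma Rint_sum (I : Type) (s : seq I) (Q : pred I) (F : I -> T -> R) :
  (forall i, Q i -> int1 (F i)) ->
  \int[mu]_x (\sum_(i <- s | Q i) F i x) = \sum_(i <- s | Q i) \int[mu]_x F i x.
Proof.
move=> H; elim: s => [|a s ih].
  by under eq_Rintegral do rewrite big_nil; rewrite Rint_zero big_nil.
under eq_Rintegral do rewrite big_cons; rewrite big_cons; case: ifPn => // Qa.
by rewrite RintD ?ih//; [exact: H|exact: int1_sum].
Qed.

Lemma Rint_le f g : int1 f -> int1 g -> (forall x, f x <= g x) ->
  \int[mu]_x f x <= \int[mu]_x g x.
Proof. by move=> i1 i2 fg; apply: le_Rintegral. Qed.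

Lemma Rint_le_ae f g : int1 f -> int1 g -> {ae mu, forall x, f x <= g x} ->
  \int[mu]_x f x <= \int[mu]_x g x.
Proof.
move=> i1 i2 fg; rewrite -lee_fin !RintE// -subre_ge0 ?integrable_fin_num//.
rewrite -(@integralB _ _ _ mu setT measurableT (EFin \o g) (EFin \o f))//.
(* The difference is nonnegative only almost everywhere; its positive part is so everywhere and has
   the same integral. *)
rewrite (ae_eq_integral (fun x => (Num.max (g x - f x) 0)%:E))//.
- by apply: integral_ge0 => x _; rewrite lee_fin le_max lexx orbT.
- apply: emeasurable_funB; [exact: measurable_int i2|exact: measurable_int i1].
- apply/measurable_EFinP; apply: measurable_maxr => //.
  by apply: measurable_funB; exact: int1_meas.
- apply: filterS fg => x fg _ /=; rewrite -EFinB; congr EFin.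
  by rewrite max_l// subr_ge0.
Qed.

Lemma Rint_ge0 f : (forall x, 0 <= f x) -> 0 <= \int[mu]_x f x.
Proof. by move=> f0; apply: Rintegral_ge0. Qed.

Lemma Rint_abs f : int1 f -> `|\int[mu]_x f x| <= \int[mu]_x `|f x|.
Proof. by move=> i1; apply: le_normr_Rintegral. Qed.

Lemma int1_ae f g : measurable_fun setT g -> {ae mu, forall x, f x = g x} ->
  int1 f -> int1 g.
Proof.
move=> mg fg i1; apply: int1P => //.
rewrite (ae_eq_integral (fun x => `|f x|%:E))//; first exact: int1_lty.
- by apply: measurableT_comp => //; apply: measurableT_comp.
- by do 2 apply: measurableT_comp => //; exact: int1_meas.
- by apply: filterS fg => x -> _.
Qed.

Lemma Rint_ae f g : measurable_fun setT f -> measurable_fun setT g ->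
  {ae mu, forall x, f x = g x} -> \int[mu]_x f x = \int[mu]_x g x.
Proof.
move=> mf mg fg; congr fine; apply: ae_eq_integral => //.
- exact/measurable_EFinP.
- exact/measurable_EFinP.
- by apply: filterS fg => x -> _.
Qed.

Lemma int2_meas f : int2 f -> measurable_fun setT f. Proof. by case. Qed.

Lemma int2P f : measurable_fun setT f -> (\int[mu]_x (f x ^+ 2)%:E < +oo)%E -> int2 f.
Proof.
move=> mf h; split => //; apply: int1P; first exact: measurable_funX.
by under eq_integral do rewrite ger0_norm ?sqr_ge0//.
Qed.

Lemma int2_lty f : int2 f -> (\int[mu]_x (f x ^+ 2)%:E < +oo)%E.
Proof.
move=> [_ /int1_lty]; apply: le_lt_trans.
by under [leRHS]eq_integral do rewrite ger0_norm ?sqr_ge0//.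
Qed.

Lemma int2_Lfun f : f \in Lfun mu 2%:E <-> int2 f.
Proof.
split.
  move=> f2; have /= i := Lfun2_integrable_sqr f2; split => //.
  by move: f2; rewrite inE => /andP[]; rewrite inE.
move=> f2; rewrite inE; apply/andP; rewrite !inE /=; split; first by case: f2.
rewrite /finite_norm unlock /Lnorm poweR_lty//.
apply: le_lt_trans (int2_lty f2); apply: ge0_le_integral => //=.
- apply/measurable_EFinP.
  apply/(@measurableT_comp _ _ _ _ _ _ (fun x : R => x `^ 2)%R) => //.
  by apply: measurableT_comp => //; exact: int2_meas.
- by apply/measurable_EFinP; case: f2 => _ /int1_meas.
- by move=> x _; rewrite powR_mulrn// real_normK// num_real.
Qed.

Lemma int2_mul f g : int2 f -> int2 g -> int1 (fun x => f x * g x).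
Proof.
move=> [mf i1] [mg i2]; apply: (int1_le _ _ (int1D i1 i2)).
  exact: measurable_funM.
move=> x; rewrite normrM -(real_normK (num_real (f x))) -(real_normK (num_real (g x))).
have := sqr_ge0 (`|f x| - `|g x|); have := normr_ge0 (f x); have := normr_ge0 (g x).
nra.
Qed.

Lemma int2D f g : int2 f -> int2 g -> int2 (fun x => f x + g x).
Proof.
move=> f2 g2; split; first by apply: measurable_funD; exact: int2_meas.
have e x : (f x + g x) ^+ 2 = f x ^+ 2 + g x ^+ 2 + 2 * (f x * g x) by ring.
under eq_fun do rewrite e; apply: int1D; last exact/int1Z/int2_mul.
by apply: int1D; [case: f2|case: g2].
Qed.

Lemma int2Z c f : int2 f -> int2 (fun x => c * f x).
Proof.
move=> [mf i1]; split; first exact: measurable_funM.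
by under eq_fun do rewrite exprMn; exact: int1Z.
Qed.

Lemma int2N f : int2 f -> int2 (fun x => - f x).
Proof. by move=> /(int2Z (-1)); under eq_fun do rewrite mulN1r. Qed.

Lemma int2B f g : int2 f -> int2 g -> int2 (fun x => f x - g x).
Proof. by move=> i1 i2; apply: int2D => //; exact: int2N. Qed.

Lemma int2_0 : int2 (fun=> 0).
Proof. by split => //; under eq_fun do rewrite expr0n; exact: int1_0. Qed.

Lemma int2_sum (I : Type) (s : seq I) (Q : pred I) (F : I -> T -> R) :
  (forall i, Q i -> int2 (F i)) -> int2 (fun x => \sum_(i <- s | Q i) F i x).
Proof.
move=> H; elim: s => [|a s ih].
  by under eq_fun do rewrite big_nil; exact: int2_0.
have [Qa|nQa] := boolP (Q a).
  by under eq_fun do rewrite big_cons Qa; apply: int2D => //; exact: H.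
by under eq_fun do rewrite big_cons (negbTE nQa).
Qed.

Lemma int2_le f g : measurable_fun setT f -> (forall x, `|f x| <= `|g x|) ->
  int2 g -> int2 f.
Proof.
move=> mf fg [mg g2]; split => //; apply: (int1_le _ _ g2).
  exact: measurable_funX.
by move=> x; rewrite normrX -(real_normK (num_real (g x))) lerXn2r// nnegrE.
Qed.

Lemma Rint_CS f g : int2 f -> int2 g ->
  (\int[mu]_x (f x * g x)) ^+ 2 <= \int[mu]_x (f x ^+ 2) * \int[mu]_x (g x ^+ 2).
Proof.
move=> f2 g2; set a := \int[mu]_x (f x ^+ 2); set b := \int[mu]_x (g x ^+ 2).
set c := \int[mu]_x _.
have a0 : 0 <= a by apply: Rint_ge0 => x; exact: sqr_ge0.
have b0 : 0 <= b by apply: Rint_ge0 => x; exact: sqr_ge0.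
have key (t s : R) : 0 <= t ^+ 2 * a + s ^+ 2 * b + (2 * t * s) * c.
  have <- : \int[mu]_x ((t * f x + s * g x) ^+ 2) = t ^+ 2 * a + s ^+ 2 * b + (2 * t * s) * c.
    have e x : (t * f x + s * g x) ^+ 2 =
      (t ^+ 2 * f x ^+ 2 + s ^+ 2 * g x ^+ 2) + (2 * t * s) * (f x * g x) by ring.
    under eq_Rintegral do rewrite e.
    have i1 : int1 (fun x => f x ^+ 2) by case: f2.
    have i2 : int1 (fun x => g x ^+ 2) by case: g2.
    have i3 := int2_mul f2 g2.
    rewrite RintD; [|by apply: int1D; exact: int1Z|exact: int1Z].
    by rewrite RintD ?RintZ//; exact: int1Z.
  by apply: Rint_ge0 => x; exact: sqr_ge0.
have h1 := key c (- a); have h2 := key (- b) c.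
have [a00|an0] := eqVneq a 0; last first.
  have ap : 0 < a by rewrite lt_neqAle eq_sym an0.
  have : 0 <= a * (a * b - c ^+ 2) by rewrite (le_trans h1)//; lra.
  by rewrite pmulr_rge0// subr_ge0.
rewrite a00 mul0r.
have [->|c0] := eqVneq c 0; first by rewrite expr0n.
(* For a = 0 and c nonzero the form is linear in its first argument, and this choice gives it the
   value -1. *)
have := key ((b + 1) / (2 * c)) (-1); rewrite a00 mulr0 add0r.
have -> : 2 * ((b + 1) / (2 * c)) * -1 * c = - (b + 1) by field.
by rewrite sqrrN expr1n mul1r opprD addrA subrr add0r oppr_ge0 ler10.
Qed.

Lemma Rint_eq0_ae f : int1 f -> (forall x, 0 <= f x) -> \int[mu]_x f x = 0 ->
  {ae mu, forall x, f x = 0}.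
Proof.
move=> i1 f0 e0.
have e1 : (\int[mu]_x `|(f x)%:E| = 0)%E.
  rewrite -[RHS](congr1 EFin e0) RintE//; apply: eq_integral => x _.
  by rewrite gee0_abs// lee_fin.
have m1 : measurable_fun setT (fun x => (f x)%:E) by exact/measurable_EFinP/int1_meas.
by apply: ae_imp ((ae_eq_integral_abs mu measurableT m1).1 e1) => x /(_ I) [].
Qed.

End L1L2.

(** * Completeness of L^2 along rapidly convergent sequences *)

Section L2_complete.
Context d (T : measurableType d) (R : realType) (mu : {measure set T -> \bar R}).

(** Cauchy-Schwarz with the weights 2^-j and 2^j; the factor 2 * 2^-J is the geometric tail of the
    weights 2^-j from J on. The induction on k applies |a + b|^2 <= 2|a|^2 + 2|b|^2 at each step. *)
Lemma fast_cauchy_sqr (u : nat -> R) (J k : nat) :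
  (u (J + k)%N - u J) ^+ 2 <=
  2 * 2^-1 ^+ J * \sum_(J <= j < J + k) 2 ^+ j * (u j.+1 - u j) ^+ 2.
Proof.
elim: k J => [|k ih] J; first by rewrite addn0 subrr expr0n/= big_geq ?mulr0.
rewrite big_ltn; last by rewrite addnS ltnS leq_addr.
have -> : (J + k.+1 = J.+1 + k)%N by rewrite addnS addSn.
have := ih J.+1.
set a := u (J.+1 + k)%N; set s := \sum_(_ <= j < _) _; rewrite (exprS 2^-1) => h.
have e1 : 2^-1 ^+ J * 2 ^+ J = 1 :> R by rewrite -exprMn mulVf// expr1n.
have -> : 2 * 2^-1 ^+ J * (2 ^+ J * (u J.+1 - u J) ^+ 2 + s) =
  2 * (u J.+1 - u J) ^+ 2 * (2^-1 ^+ J * 2 ^+ J) + 2 * 2^-1 ^+ J * s by ring.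
have e2 : 2 * (2^-1 * 2^-1 ^+ J) * s = 2^-1 ^+ J * s by field.
rewrite e1 mulr1; rewrite e2 in h.
apply: (@le_trans _ _ (2 * (u J.+1 - u J) ^+ 2 + 2 * (a - u J.+1) ^+ 2)).
  by have := sqr_ge0 (a - u J.+1 - (u J.+1 - u J)); lra.
by rewrite lerD2l -mulrA ler_pM2l.
Qed.

Lemma fast_cauchy_cvg (u : nat -> R) (s : R) :
  (forall n, \sum_(0 <= j < n) 2 ^+ j * (u j.+1 - u j) ^+ 2 <= s) ->
  cvgn u /\ forall J, (limn u - u J) ^+ 2 <= 2 * 2^-1 ^+ J * s.
Proof.
move=> us.
have le J k : (u (J + k)%N - u J) ^+ 2 <= 2 * 2^-1 ^+ J * s.
  apply: (le_trans (fast_cauchy_sqr u J k)); apply: ler_wpM2l.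
    by rewrite mulr_ge0// exprn_ge0.
  apply: le_trans (us (J + k)%N); rewrite [leRHS](@big_cat_nat _ _ _ J)//= ?leq_addr//.
  by rewrite lerDr sumr_ge0// => j _; rewrite mulr_ge0 ?sqr_ge0 ?exprn_ge0.
have s0 : 0 <= s by have := us 0%N; rewrite big_geq.
have cu : cvgn u.
  have h0 : (fun J => 2 * 2^-1 ^+ J * s) @ \oo --> (0 : R).
    rewrite -[X in _ --> X](mul0r s); apply: cvgMl.
    rewrite -[X in _ --> X](mulr0 2); apply: cvgMr.
    by apply: cvg_expr; rewrite ger0_norm ?invr_ge0// invf_lt1// ltr1n.
  apply: cauchy_cvg; apply: cauchy_exP => e e0.
  have e20 : 0 < e ^+ 2 by rewrite exprn_gt0.
  have [M _ hM] := (cvgr_lt _ h0 _ e20).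
  exists (u M), M => // m /= Mm; rewrite /ball /= distrC.
  rewrite -(subnKC Mm) -(@ltr_pXn2r _ 2)// ?nnegrE ?normr_ge0 ?ltW//.
  by rewrite real_normK ?num_real//; apply: le_lt_trans (le _ _) _; apply: (hM M) => /=.
split=> // J.
have h : (fun k => (u (J + k)%N - u J) ^+ 2) @ \oo --> (limn u - u J) ^+ 2.
  have h1 : (fun k => u (J + k)%N - u J) @ \oo --> limn u - u J.
    apply: cvgB; last exact: cvg_cst.
    have cu' : u @ \oo --> limn u := cu.
    by under eq_fun do rewrite addnC; rewrite -(cvg_shiftn J) in cu'.
  by under eq_fun do rewrite expr2; rewrite expr2; exact: cvgM.
by apply: (cvgr_to_le h); apply: nearW => k; exact: le.
Qed.

(** Riesz-Fischer in quantitative form. The weighted series of squared increments has integral at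
    most S, hence is finite almost everywhere, and [fast_cauchy_cvg] applies at each such point;
    integrating its rate bounds the L^2 distance. The almost sure convergence is what later carries
    measurability for a sub-sigma-algebra to the limit. *)
Lemma L2_fast_cvg (f : nat -> T -> R) (S : R) :
  (forall j, int2 mu (f j)) ->
  (forall n, \sum_(0 <= j < n) 2 ^+ j * \int[mu]_x ((f j.+1 x - f j x) ^+ 2) <= S) ->
  exists g, [/\ int2 mu g,
    (forall J, \int[mu]_x ((g x - f J x) ^+ 2) <= 2 * 2^-1 ^+ J * S) &
    {ae mu, forall x, f ^~ x @ \oo --> g x}].
Proof.
move=> f2 hS.
pose D j x := 2 ^+ j * (f j.+1 x - f j x) ^+ 2.
have D0 j x : 0 <= D j x by rewrite mulr_ge0 ?sqr_ge0 ?exprn_ge0.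
have D1 j : int1 mu (D j) by apply: int1Z; case: (int2B (f2 j.+1) (f2 j)).
have mD j : measurable_fun setT (EFin \o D j) by apply/measurable_EFinP; exact: int1_meas.
pose s x := (\sum_(j <oo) (D j x)%:E)%E.
have s0 x : (0 <= s x)%E by apply: nneseries_ge0 => j _ _; rewrite lee_fin.
have ms : measurable_fun setT s.
  by apply: (@ge0_emeasurable_sum _ _ _ setT (fun j => EFin \o D j) xpredT) => // j x ? ?; rewrite lee_fin.
have Is : (\int[mu]_x s x <= S%:E)%E.
  rewrite /s integral_nneseries//; last by move=> j x _; rewrite lee_fin.
  apply: lime_le; first by apply: is_cvg_nneseries => j _ _; apply: integral_ge0 => x _; rewrite lee_fin.
  near=> n; rewrite (_ : (\sum_(0 <= j < n) _)%E = (\sum_(0 <= j < n) 2 ^+ j * \int[mu]_x ((f j.+1 x - f j x) ^+ 2))%:E) ?lee_fin//.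
  rewrite -sumEFin; apply: eq_bigr => j _; rewrite -RintE//= RintZ//.
  by case: (int2B (f2 j.+1) (f2 j)).
pose E := [set x | (s x < +oo)%E].
have mE : measurable E by rewrite -[E]setTI; apply: emeasurable_fun_o_infty || exact: emeasurable_fun_infty_o.
have aeE : {ae mu, forall x, E x}.
  have iss : mu.-integrable setT s.
    apply/integrableP; split => //.
    by under eq_integral do rewrite gee0_abs//; apply: le_lt_trans Is _; rewrite ltry.
  by have := integrable_ae measurableT iss; apply: filterS => x /(_ I); rewrite fin_numElt => /andP[].
(* Cut off to [E], the sequence converges at every point, so its limit is measurable. *)
pose h j x := f j x * \1_E x.
have key x : E x -> cvgn (f ^~ x) /\ forall J, (limn (f ^~ x) - f J x) ^+ 2 <= 2 * 2^-1 ^+ J * fine (s x).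
  move=> Ex; apply: fast_cauchy_cvg => n.
  rewrite -lee_fin fineK ?ge0_fin_numE// -sumEFin.
  by apply: (@nneseries_lim_ge _ (fun j => (D j x)%:E) xpredT 0) => j _ _; rewrite lee_fin.
pose g x := limn (h ^~ x).
have hg x : h ^~ x @ \oo --> g x.
  have [xE|xE] := pselect (E x).
    have [c _] := key _ xE; rewrite /g /h; under eq_fun do rewrite indicE mem_set// mulr1.
    by [].
  by rewrite /g /h; under eq_fun do rewrite indicE memNset// mulr0; rewrite lim_cst//; exact: cvg_cst.
have gE x : E x -> g x = limn (f ^~ x).
  by move=> Ex; rewrite /g /h; under eq_fun do rewrite indicE mem_set// mulr1.
have mg : measurable_fun setT g.
  apply: (measurable_fun_cvg (h := h)) => [j|x _]; last exact: hg.
  by apply: measurable_funM; [exact: int2_meas|exact: measurable_indic].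
have Sfin : (\int[mu]_x s x)%E \is a fin_num.
  by rewrite ge0_fin_numE ?integral_ge0//; apply: le_lt_trans Is _; rewrite ltry.
have bd J : (\int[mu]_x ((g x - f J x) ^+ 2)%:E <= (2 * 2^-1 ^+ J * S)%:E)%E.
  rewrite EFinM; apply: (@le_trans _ _ ((2 * 2^-1 ^+ J)%:E * \int[mu]_x s x)%E); last first.
    by apply: lee_wpmul2l => //; rewrite lee_fin mulr_ge0// exprn_ge0.
  have c0 : 0 <= 2 * 2^-1 ^+ J :> R by rewrite mulr_ge0// exprn_ge0.
  rewrite -ge0_integralZl//.
  apply: ae_ge0_le_integral => //.
  - by move=> x _; rewrite lee_fin sqr_ge0.
  - apply/measurable_EFinP; apply: measurable_funX; apply: measurable_funB => //.
    exact: int2_meas.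
  - by move=> x _; rewrite mule_ge0// lee_fin mulr_ge0// exprn_ge0.
  - exact: measurable_funeM.
  - apply: filterS aeE => x Ex _; have [_ /(_ J)] := key _ Ex.
    by rewrite gE// -lee_fin (EFinM _ (fine (s x))) fineK// ge0_fin_numE.
have gf J : int2 mu (fun x => g x - f J x).
  apply: int2P; first by apply: measurable_funB => //; exact: int2_meas.
  by apply: le_lt_trans (bd J) _; rewrite ltry.
exists g; split.
- have := int2D (gf 0%N) (f2 0%N); by under eq_fun do rewrite subrK.
- by move=> J; rewrite -lee_fin RintE; [exact: bd|case: (gf J)].
- by apply: filterS aeE => x Ex; rewrite gE//; case: (key _ Ex).
Unshelve. all: by end_near.
Qed.

(** The rate 4^-j is chosen against the weights 2^j of [L2_fast_cvg]: the weighted increments then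
    sum to at most 2, see [fast_sum]. *)
Lemma fast_subsequence (a : nat -> nat -> R) :
  (forall e, 0 < e -> exists M, forall m m', (M <= m)%N -> (M <= m')%N -> a m m' <= e) ->
  exists phi : nat -> nat, [/\ (forall j, (j <= phi j)%N),
    forall j m, (phi j <= m)%N -> a (phi j) m <= 4^-1 ^+ j &
    forall j, (phi j <= phi j.+1)%N].
Proof.
move=> H.
have H' j : exists M, forall m m', (M <= m)%N -> (M <= m')%N -> a m m' <= 4^-1 ^+ j.
  by apply: H; rewrite exprn_gt0.
have [M MP] := choice H'.
pose phi := fix phi j := if j is k.+1 then maxn (phi k).+1 (M j) else M 0%N.
have pM j : (M j <= phi j)%N by case: j => [|j] //=; rewrite leq_maxr.
exists phi; split.
- by elim=> // j ih /=; rewrite leq_max ltnS ih.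
- by move=> j m jm; apply: MP => //; exact: leq_trans jm.
- by move=> j /=; rewrite leq_max leqnSn.
Qed.

Lemma fast_sum (a : nat -> R) : (forall j, a j <= 4^-1 ^+ j) ->
  forall n, \sum_(0 <= j < n) 2 ^+ j * a j <= 2.
Proof.
move=> ha n; apply: (@le_trans _ _ (\sum_(0 <= j < n) 2^-1 ^+ j)).
  apply: ler_sum => j _; apply: (@le_trans _ _ (2 ^+ j * 4^-1 ^+ j)).
    by rewrite ler_wpM2l// exprn_ge0.
  by rewrite -exprMn (_ : 2 * 4^-1 = 2^-1 :> R)//; field.
rewrite (_ : \sum_(_ <= _ < _) _ = 2 - 2 * 2^-1 ^+ n :> R).
  by rewrite gerBl mulr_ge0// exprn_ge0.
elim: n => [|n ih]; first by rewrite big_geq// expr0; lra.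
by rewrite big_nat_recr//= ih exprS; field.
Qed.

End L2_complete.

Section dominated.
Context d (T : measurableType d) (R : realType) (mu : {measure set T -> \bar R}).

Lemma Rint_dct (F : nat -> T -> R) (f g : T -> R) :
  (forall k, measurable_fun setT (F k)) -> measurable_fun setT f ->
  {ae mu, forall x, F ^~ x @ \oo --> f x} -> int1 mu g ->
  {ae mu, forall x k, `|F k x| <= g x} ->
  int1 mu f /\ (fun k => \int[mu]_x F k x) @ \oo --> \int[mu]_x f x.
Proof.
move=> mF mf Ff ig Fg.
have [|||||i1 _ c] := @dominated_convergence _ _ _ mu setT measurableT
  (fun k => EFin \o F k) (EFin \o f) (EFin \o g).
- by move=> k; exact/measurable_EFinP.
- exact/measurable_EFinP.
- by apply: filterS Ff => x h _; apply: cvg_EFin; [exact: nearW|exact: h].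
- exact: ig.
- by apply: filterS Fg => x h k _; exact: h.
split => //.
have iF k : int1 mu (F k).
  apply: (int1_ae (f := fun x => Num.max (- g x) (Num.min (F k x) (g x)))) => //.
    apply: filterS Fg => x /(_ k); rewrite ler_norml => /andP[h1 h2].
    by rewrite min_l// max_r.
  apply: (int1_le (g := fun x => `|g x|)) => [|x|]; last exact: int1_norm.
    have mg := int1_meas ig.
    by apply: measurable_maxr; [exact: measurableT_comp|exact: measurable_minr].
  rewrite ler_norml le_max ge_max ge_min ler_norm orbT andbT.
  by rewrite lerN2 ler_norm/= -normrN ler_norm.
have c' := c; rewrite -RintE// in c'; exact: fine_cvg c'.
Qed.

End dominated.

(** * Test functions and the fundamental lemma *)

Section bump.
Variable R : realType.

(* These functions are stable under differentiation ([is_derive_psi]), which makes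
   [exp (-1/y)] smooth without a formula for its higher derivatives. *)
Definition psi (p : {poly R}) (y : R) : R :=
  if 0 < y then p.[y^-1] * expR (- y^-1) else 0.

Lemma poly_expRN_bound (p : {poly R}) :
  exists C : R, 0 <= C /\ forall z, 0 < z -> `|p.[z]| * expR (- z) <= C.
Proof.
elim/poly_ind: p => [|p c [C [C0 hC]]].
  by exists 0; split => // z _; rewrite horner0 normr0 mul0r.
suff [C' [C'0 hC']] : exists C : R, 0 <= C /\ forall z, 0 < z -> `|z * p.[z]| * expR (- z) <= C.
  exists (C' + `|c|); split => [|z z0]; first by rewrite addr_ge0.
  rewrite hornerD hornerM hornerX hornerC (mulrC p.[z]).
  apply: (@le_trans _ _ ((`|z * p.[z]| + `|c|) * expR (- z))).
    by rewrite ler_wpM2r ?expR_ge0// ler_normD.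
  rewrite mulrDl lerD ?hC'// -[leRHS]mulr1 ler_wpM2l//.
  by rewrite -expR0 ler_expR oppr_le0 ltW.
have [q hq] : exists q : {poly R}, forall z, q.[z] = z * p.[z].
  by exists ('X * p) => z; rewrite hornerM hornerX.
pose m := size q.
pose S := \sum_(i < m) `|q`_i| * (i.+1)`!%:R.
have S0 : 0 <= S by apply: sumr_ge0 => i _; rewrite mulr_ge0.
exists (S + S); split => [|z z0]; first by rewrite addr_ge0.
have ez : 1 <= expR z by rewrite -expR0 ler_expR ltW.
have hz k : z ^+ k <= (k.+1)`!%:R * expR z.
  case: k => [|k]; first by rewrite expr0 (_ : 1`!%:R = 1 :> R)// mul1r.
  have := expR_ge1Dxn k (ltW z0) => h.
  have f0 : 0 < (k.+1)`!%:R :> R by rewrite ltr0n fact_gt0.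
  have : z ^+ k.+1 / (k.+1)`!%:R <= expR z by rewrite (le_trans _ h)// lerDr.
  rewrite ler_pdivrMr// mulrC => /le_trans; apply.
  by rewrite ler_wpM2r ?expR_ge0// ler_nat factS leq_pmull.
rewrite -hq expRN ler_pdivrMr ?expR_gt0//.
apply: (@le_trans _ _ (S * expR z)); last first.
  by rewrite ler_wpM2r ?expR_ge0// lerDl.
rewrite horner_coef (le_trans (ler_norm_sum _ _ _))// /S mulr_suml.
apply: ler_sum => i _; rewrite normrM normrX -mulrA ler_wpM2l//.
by rewrite (gtr0_norm z0); exact: hz.
Qed.

(** Vanishing to second order at 0 is what makes [psi p] differentiable there; it is the bound of
    z^2 p(z) exp(-z) at z = 1/y. *)
Lemma psi_bound (p : {poly R}) : exists C : R, 0 <= C /\ forall y, `|psi p y| <= C * y ^+ 2.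
Proof.
have [C [C0 hC]] := poly_expRN_bound ('X^2 * p).
exists C; split => // y; rewrite /psi; case: ifPn => [y0|_]; last first.
  by rewrite normr0 mulr_ge0// sqr_ge0.
have yi : 0 < y^-1 by rewrite invr_gt0.
have := hC _ yi; rewrite hornerM hornerXn normrM normrX gtr0_norm// => h.
rewrite normrM (ger0_norm (expR_ge0 _)) -ler_pdivrMr ?exprn_gt0//.
by rewrite -exprVn mulrC mulrA.
Qed.

Lemma is_derive_psi (p : {poly R}) (y : R) :
  is_derive y 1 (psi p) (psi ('X^2 * (p - p^`())) y).
Proof.
have [y0|y0|->] := ltgtP y 0.
- rewrite [psi (_ * _) y]/psi ltNge (ltW y0)/=.
  apply: (@near_eq_is_derive _ _ _ (cst 0)).
  near=> z; rewrite /psi ltNge ifF//; apply/negbTE; rewrite negbK ltW//.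
  by near: z; exact: lt_nbhsl.
- rewrite [psi (_ * _) y]/psi y0.
  have yn0 : y != 0 by rewrite gt_eqF.
  have dV : is_derive y 1 (fun z : R => z^-1) (- y ^- 2).
    by apply: is_derive_eq (is_deriveV yn0 (is_derive_id y 1)) _; rewrite /= [LHS]mulr1.
  have dN : is_derive y 1 (fun z : R => - z^-1) (y ^- 2).
    by apply: is_derive_eq (is_deriveN dV) _; rewrite opprK.
  have d1 : is_derive y 1 (horner p \o (fun z : R => z^-1)) (p^`().[y^-1] * - y ^- 2).
    exact: is_derive1_comp.
  have d2 : is_derive y 1 (expR \o (fun z : R => - z^-1)) (expR (- y^-1) * y ^- 2).
    exact: is_derive1_comp.
  have d3 : is_derive y 1 (fun z => p.[z^-1] * expR (- z^-1))
      (('X^2 * (p - p^`())).[y^-1] * expR (- y^-1)).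
    apply: is_derive_eq (is_deriveM d1 d2) _.
    by rewrite !hornerE /= /GRing.scale/=; field.
  apply: near_eq_is_derive d3.
  near=> z; rewrite /psi ifT//.
  by near: z; exact: lt_nbhsr.
- rewrite [psi (_ * _) 0]/psi ltxx; apply/is_derive1_caratheodory.
  (* The Caratheodory slope at 0; it takes the value 0 at 0 because the inverse of 0 is 0, and tends
     to 0 by [psi_bound]. *)
  exists (fun z => psi p z / z); split.
  + move=> z; rewrite [psi p 0]/psi ltxx !subr0; have [->|z0] := eqVneq z 0.
      by rewrite mulr0 /psi ltxx.
    by rewrite divfK.
  + have [C [C0 hC]] := psi_bound p.
    rewrite /prop_for /continuous_at invr0 mulr0.
    have C1 : 0 < C + 1 by rewrite ltr_wpDl.
    apply/cvgr0Pnorm_le => e e0.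
    near=> z; rewrite normrM normfV.
    have [->|z0] := eqVneq z 0; first by rewrite normr0 invr0 mulr0 ltW.
    rewrite ler_pdivrMr ?normr_gt0// (le_trans (hC z))//.
    rewrite -(real_normK (num_real z)) expr2 mulrA ler_wpM2r//.
    apply: (@le_trans _ _ ((C + 1) * `|z|)); first by rewrite ler_wpM2r// lerDl.
    rewrite mulrC -ler_pdivlMr//.
    by near: z; have := @nbhs0_le R R (e / (C + 1)) (divr_gt0 e0 C1); exact.
  + by rewrite invr0 mulr0.
Unshelve. all: by end_near.
Qed.

Lemma psi1_ge0 y : 0 <= psi 1 y.
Proof. by rewrite /psi; case: ifP => // _; rewrite hornerC mul1r expR_ge0. Qed.

Lemma psi1_le1 y : psi 1 y <= 1.
Proof.
rewrite /psi; case: ifP => // y0; rewrite hornerC mul1r -[leRHS]expR0 ler_expR.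
by rewrite oppr_le0 invr_ge0 ltW.
Qed.

Lemma psi1_eq0 y : y <= 0 -> psi 1 y = 0.
Proof. by move=> y0; rewrite /psi ltNge y0. Qed.

Lemma psi1_cvg1 y : 0 < y -> (fun k : nat => psi 1 (k.+1%:R * y)) @ \oo --> (1 : R).
Proof.
move=> y0; have -> : (fun k : nat => psi 1 (k.+1%:R * y)) =
    (fun k : nat => expR (- (y^-1 * k.+1%:R^-1))).
  apply/funext => k; rewrite /psi mulr_gt0// hornerC mul1r invfM//.
  by rewrite mulrC.
rewrite -[X in _ --> X]expR0; apply: continuous_cvg; first exact: continuous_expR.
rewrite -oppr0; apply: cvgN; rewrite -[X in _ --> X](mulr0 y^-1); apply: cvgMr.
exact: cvg_harmonic.
Qed.

End bump.

Section smooth_class.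
Context {R : realType} {n : nat}.

(* Stability under partial derivatives makes every member of this class smooth. *)
Inductive bumpy : ('rV[R]_n -> R) -> Prop :=
| bumpy_psi p c b (i : 'I_n) : bumpy (fun x => psi p (c * x ord0 i + b))
| bumpy_cst c : bumpy (fun=> c)
| bumpyD f g : bumpy f -> bumpy g -> bumpy (fun x => f x + g x)
| bumpyM f g : bumpy f -> bumpy g -> bumpy (fun x => f x * g x).

Lemma bumpy_derive f : bumpy f -> forall j : 'I_n, exists f', bumpy f' /\
  forall x, is_derive x (delta_mx ord0 j) f (f' x).
Proof.
elim=> {f} [p c b i|c|f g _ ihf _ ihg|f g bf ihf bg ihg] j.
- pose k : R := c * (i == j)%:R.
  exists (fun x => k * psi ('X^2 * (p - p^`())) (c * x ord0 i + b)); split.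
    by apply: bumpyM; [exact: bumpy_cst|exact: bumpy_psi].
  move=> x; set y := c * x ord0 i + b.
  have d1 : is_derive (0 : R) 1 (psi p \o (fun h : R => h * k + y))
      (psi ('X^2 * (p - p^`())) (0 * k + y) * k).
    apply: is_derive1_comp; first exact: is_derive_psi.
    apply: is_derive_eq (is_deriveD (is_deriveM (is_derive_id (0 : R^o) (1 : R^o))
      (is_derive_cst k (0 : R^o) (1 : R^o))) (is_derive_cst y (0 : R^o) (1 : R^o))) _.
    by rewrite /GRing.scale/= /cst; ring.
  rewrite mul0r add0r in d1.
  have e : (fun h : R => (fun x0 : 'rV[R]_n => psi p (c * x0 ord0 i + b))
       (h *: delta_mx ord0 j + x)) = (psi p \o (fun h : R => h * k + y)).
    by apply/funext => h /=; congr psi; rewrite !mxE eqxx/= /y /k; ring.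
  split.
    by apply/derivable1P; rewrite e; case: d1.
  rewrite mulrC; have := @derive_val _ _ _ _ _ _ _ d1; rewrite -e => <-.
  rewrite /derive; set g1 := fun h => h^-1 *: _; set g2 := fun h => h^-1 *: _.
  suff -> : g1 = g2 by [].
  apply/funext => h; rewrite /g1 /g2 /=.
  by rewrite addr0 scale0r add0r [_%:A]mulr1.
- exists (fun=> 0); split; first exact: bumpy_cst.
  by move=> x; exact: is_derive_cst.
- have [f' [bf' df]] := ihf j; have [g' [bg' dg]] := ihg j.
  exists (fun x => f' x + g' x); split; first exact: bumpyD.
  by move=> x; exact: is_deriveD.
- have [f' [bf' df]] := ihf j; have [g' [bg' dg]] := ihg j.
  exists (fun x => f x * g' x + g x * f' x); split.
    by apply: bumpyD; exact: bumpyM.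
  by move=> x; exact: is_deriveM.
Qed.

Lemma bumpy_continuous f : bumpy f -> continuous f.
Proof.
elim=> {f} [p c b i|c|f g _ ihf _ ihg|f g bf ihf bg ihg] x.
- apply: (@continuous_comp _ _ _ (fun x : 'rV[R]_n => x ord0 i) (fun t => psi p (c * t + b))).
    exact: coord_continuous.
  apply: (@continuous_comp _ _ _ (fun t : R => c * t + b) (psi p)).
    by apply: cvgD; [apply: cvgMr|exact: cvg_cst].
  apply/differentiable_continuous/derivable1_diffP.
  by case: (is_derive_psi p (c * x ord0 i + b)).
- exact: cst_continuous.
- exact: (continuousD (ihf x) (ihg x)).
- exact: (continuousM (ihf x) (ihg x)).
Qed.

Lemma bumpy_partial f j : bumpy f -> bumpy (partial j f).
Proof.
move=> /bumpy_derive /(_ j)[f' [bf' df]].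
rewrite (_ : partial j f = f')//; apply/funext => x.
by rewrite /partial; case: (df x).
Qed.

Lemma bumpy_smooth f : bumpy f -> smooth f.
Proof.
move=> bf s; have bg : bumpy (foldr partial f s).
  by elim: s => //= j s; exact: bumpy_partial.
split; first exact: bumpy_continuous.
by move=> i x; have [f' [_ /(_ x)[]]] := bumpy_derive bg i.
Qed.

Lemma bumpy_prod (I : Type) (s : seq I) (F : I -> 'rV[R]_n -> R) :
  (forall i, bumpy (F i)) -> bumpy (fun x => \prod_(i <- s) F i x).
Proof.
move=> bF; elim: s => [|a s ih].
  by under eq_fun do rewrite big_nil; exact: bumpy_cst.
by under eq_fun do rewrite big_cons; exact: bumpyM.
Qed.

End smooth_class.

Section dbr.
Context {R : realType} {n : nat}.

Lemma cvg_big_prod (I : Type) (s : seq I) (F : I -> nat -> R) (l : I -> R) :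
  (forall i, F i @ \oo --> l i) ->
  (fun k => \prod_(i <- s) F i k) @ \oo --> \prod_(i <- s) l i.
Proof.
move=> H; elim: s => [|a s ih].
  by under eq_fun do rewrite big_nil; rewrite big_nil; exact: cvg_cst.
by under eq_fun do rewrite big_cons; rewrite big_cons; exact: cvgM.
Qed.

(** For r > 0 this is supported in the cube of centre q and radius r, each coordinate contributing
    one factor per face. As exp(-1/y) tends to 1 for large y, it converges to the indicator of the
    open cube when k grows. *)
Definition cube_bump (q : 'rV[R]_n) (r : R) (k : nat) (x : 'rV[R]_n) : R :=
  \prod_(i < n) (psi 1 (k.+1%:R * x ord0 i + k.+1%:R * (r - q ord0 i)) *
                 psi 1 (- k.+1%:R * x ord0 i + k.+1%:R * (r + q ord0 i))).

Lemma bumpy_cube q r k : bumpy (cube_bump q r k).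
Proof. by apply: bumpy_prod => i; apply: bumpyM; exact: bumpy_psi. Qed.

Lemma cube_bump01 q r k x : 0 <= cube_bump q r k x <= 1.
Proof.
rewrite prodr_ge0 => [|i _]; last by rewrite mulr_ge0// psi1_ge0.
apply: Num.Theory.prodr_ile1 => i _; rewrite mulr_ge0 ?psi1_ge0//=.
by rewrite mulr_ile1 ?psi1_ge0 ?psi1_le1.
Qed.

Lemma cube_bump0 q r k x : 0 < r -> ~ ball q r x -> cube_bump q r k x = 0.
Proof.
move=> r0 qx; have [i hi] : exists i, r <= `|q ord0 i - x ord0 i|.
  apply: contrapT => H; apply: qx; split => // a i; rewrite (ord1 a) /ball/=.
  by rewrite ltNge; apply/negP => h; apply: H; exists i.
rewrite /cube_bump (bigD1 i)//=; have [h|h] := leP 0 (q ord0 i - x ord0 i).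
  rewrite ger0_norm// in hi; rewrite psi1_eq0 ?mul0r//.
  by rewrite -mulrDr pmulr_rle0//; lra.
rewrite ltr0_norm// in hi; rewrite [X in _ * X * _]psi1_eq0 ?mulr0 ?mul0r//.
by rewrite mulNr -mulrN -mulrDr pmulr_rle0//; lra.
Qed.

Lemma cube_bump_cvg q r x : ball q r x -> cube_bump q r ^~ x @ \oo --> (1 : R).
Proof.
move=> [r0 h]; rewrite /cube_bump.
have e1 : \prod_(i < n) (1 * 1) = 1 :> R by rewrite big1// => i _; rewrite mulr1.
rewrite -[X in _ --> X]e1; apply: (cvg_big_prod (l := fun=> 1 * 1)) => i; have := h ord0 i; rewrite /ball/= ltr_norml => /andP[h1 h2].
apply: cvgM.
  under eq_fun do rewrite -mulrDr; apply: psi1_cvg1; lra.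
under eq_fun do rewrite mulNr -mulrN -mulrDr; apply: psi1_cvg1; lra.
Qed.

Section open_approx.
Variable O : set 'rV[R]_n.
Hypothesis oO : open O.

(* The [phi m] run through the bump functions of the rational cubes well inside O. *)
Let rho (l : nat) : R := l.+1%:R^-1.
Let good (ql : 'rV[rat]_n * nat) : Prop :=
  ball (map_mx ratr ql.1 : 'rV[R]_n) (2 * rho ql.2) `<=` O.

Let phi (m k : nat) (x : 'rV[R]_n) : R :=
  if unpickle m is Some ql then
    if `[< good ql >] then cube_bump (map_mx ratr ql.1) (rho ql.2) k x else 0
  else 0.

(** One minus the product of the complements is a smooth union: it stays in [0, 1], vanishes where
    all bumps vanish and tends to 1 where one of them does. The index k both sharpens the bumps and
    counts them. *)
Definition open_bump (k : nat) (x : 'rV[R]_n) : R :=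
  1 - \prod_(m < k) (1 - phi m k x).

Let bumpy_phi m k : bumpy (phi m k).
Proof.
rewrite /phi; case: unpickle => [ql|]; last exact: bumpy_cst.
by case: asboolP => _; [exact: bumpy_cube|exact: bumpy_cst].
Qed.

Let phi01 m k x : 0 <= phi m k x <= 1.
Proof.
rewrite /phi; case: unpickle => [ql|]; last by rewrite lexx ler01.
by case: asboolP => _; [exact: cube_bump01|rewrite lexx ler01].
Qed.

Let rho0 l : 0 < rho l. Proof. by rewrite invr_gt0. Qed.

Let phi_supp k (s : seq nat) : exists K : set 'rV[R]_n,
  [/\ compact K, K `<=` O & forall x, ~ K x -> forall m, m \in s -> phi m k x = 0].
Proof.
elim: s => [|a s [K [cK KO hK]]]; first by exists set0; split => //; exact: compact0.
rewrite /phi; case ea : (unpickle a) => [ql|]; last first.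
  by exists K; split => // x Kx m; rewrite inE => /predU1P[->|/hK]; [rewrite ea|exact].
have [gq|ngq] := pselect (good ql); last first.
  exists K; split => // x Kx m; rewrite inE => /predU1P[->|/hK]; last exact.
  by rewrite ea asboolF.
pose q : 'rV[R]_n := map_mx ratr ql.1.
pose B : set 'rV[R]_n := [set x | `|q - x| <= rho ql.2].
exists (K `|` B); split.
- apply: compactU => //; apply: bounded_closed_compact.
    exists (`|q| + rho ql.2); split; first by rewrite num_real.
    move=> M hM x Bx; apply: (le_trans _ (ltW hM)).
    have -> : x = q - (q - x) by rewrite opprB addrC subrK.
    by rewrite (le_trans (ler_normB _ _))// lerD2l.
  have -> : B = closed_ball q (rho ql.2) by rewrite closed_ballE.
  exact: closed_ball_closed.
- move=> x [/KO//|Bx]; apply: gq; rewrite -ball_normE /=.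
  by apply: le_lt_trans Bx _; rewrite mulr_natl mulr2n ltrDl.
- move=> x /not_orP[Kx Bx] m; rewrite inE => /predU1P[->|/(hK _ Kx)//].
  rewrite ea asboolT// cube_bump0//; apply: contra_not Bx => h.
  by move: h; rewrite -ball_normE /B /=; exact: ltW.
Qed.

Lemma open_bump01 k x : 0 <= open_bump k x <= 1.
Proof.
have h m : 0 <= 1 - phi m k x <= 1.
  by have /andP[h1 h2] := phi01 m k x; rewrite subr_ge0 h2 gerBl.
rewrite /open_bump gerBl subr_ge0 Num.Theory.prodr_ile1 ?prodr_ge0// => m _.
by case/andP: (h m).
Qed.

Lemma open_bump_test k : smooth (open_bump k) /\ exists K : set 'rV[R]_n,
  [/\ compact K, K `<=` O & forall x, ~ K x -> open_bump k x = 0].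
Proof.
split.
  apply: bumpy_smooth; rewrite /open_bump.
  have b1 : bumpy (fun x => \prod_(m < k) (1 + -1 * phi m k x)).
    apply: bumpy_prod => m; apply: bumpyD; first exact: bumpy_cst.
    by apply: bumpyM; [exact: bumpy_cst|exact: bumpy_phi].
  have := bumpyD (bumpy_cst 1) (bumpyM (bumpy_cst (-1)) b1).
  congr bumpy; apply/funext => x; rewrite mulN1r; congr (1 - _).
  by apply: eq_bigr => m _; rewrite mulN1r.
have [K [cK KO hK]] := phi_supp k (iota 0 k).
exists K; split => // x Kx; rewrite /open_bump big1 ?subrr// => m _.
by rewrite hK ?subr0// mem_iota/= add0n.
Qed.

Lemma open_bump_out k x : ~ O x -> open_bump k x = 0.
Proof.
have [_ [K [_ KO]]] := open_bump_test k; move=> h Ox; apply: h.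
by apply: contra_not Ox; exact: KO.
Qed.

Lemma open_bump_cvg x : O x -> open_bump ^~ x @ \oo --> (1 : R).
Proof.
move=> Ox; have /nbhs_ballP[e /= e0 be] : nbhs x O by exact: open_nbhs_nbhs.
(* A cube of radius 2 rho around a point at distance less than rho from x stays in the ball of
   radius e, as 3 rho < e. *)
have [l le] : exists l, rho l < e / 3.
  have := @ltr_add_invr R 0 (e / 3); rewrite divr_gt0// => /(_ isT)[k].
  by rewrite add0r => ?; exists k.
have H i : exists q : rat, `|x ord0 i - ratr q| < rho l.
  have [|q] := @rat_in_itvoo R (x ord0 i - rho l) (x ord0 i + rho l).
    by rewrite ltrBlDr -addrA ltrDl addr_gt0.
  rewrite in_itv/= => /andP[q1 q2]; exists q.
  by rewrite ltr_distl ltrBlDr q2 -ltrBlDr q1.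
have [q qP] := choice H.
pose Q : 'rV[rat]_n := \row_i q i.
have gQ : good (Q, l).
  move=> y [_ by_]; apply: be; split => // i j; have := by_ i j.
  rewrite (ord1 i) !mxE /ball/= => h.
  rewrite (le_lt_trans (ler_distD (ratr (q j)) _ _))//.
  have -> : e = e / 3 + 2 * (e / 3) by field.
  by rewrite ltrD ?(lt_trans (qP j))// (lt_trans h)// ltr_pM2l.
have bQ : ball (map_mx ratr Q : 'rV[R]_n) (rho l) x.
  by split => // i j; rewrite (ord1 i) !mxE /ball/= distrC; exact: qP.
pose m0 := pickle (Q, l).
have c0 : (fun k => 1 - phi m0 k x) @ \oo --> (0 : R).
  rewrite -[X in _ --> X](subrr (1 : R)); apply: cvgB; first exact: cvg_cst.
  rewrite /phi pickleK asboolT//; exact: cube_bump_cvg.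
rewrite -[X in _ --> X](subr0 (1 : R)); apply: cvgB; first exact: cvg_cst.
apply: (@squeeze_cvgr _ _ _ _ (fun=> 0) (fun k => 1 - phi m0 k x)) => //; last exact: cvg_cst.
have h m k : 0 <= 1 - phi m k x <= 1.
  by have /andP[h1 h2] := phi01 m k x; rewrite subr_ge0 h2 gerBl.
exists m0.+1 => // k /= mk; rewrite prodr_ge0 => [|m _]; last by case/andP: (h m k).
rewrite (bigD1 (Ordinal mk))//= ler_piMr//; first by case/andP: (h m0 k).
by apply: Num.Theory.prodr_ile1 => m _; exact: h.
Qed.

End open_approx.

Lemma ae_dom (D : lipschitz_domain R n) : {ae vol D, forall x, dom_set D x}.
Proof.
exists (~` dom_set D); split => //.
- by apply: measurableC; exact: measurable_dom.
- by rewrite /vol /= /mrestr setICl measure0.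
Qed.

Lemma measurable_smooth (f : 'rV[R]_n -> R) : smooth f ->
  measurable_fun setT (f : borel_rV R n -> R).
Proof.
move=> /(_ [::])[cf _]; apply: (measurability _ (RGenOpens.measurableE R)).
move=> _ [U [a [b ->]] <-]; rewrite setTI; apply: sub_sigma_algebra.
by move/continuousP : cf; apply; exact: interval_open.
Qed.

(** Testing with [open_bump] and dominated convergence make the integral of g vanish over every open
    set; open sets are stable under intersection, so the pi-lambda theorem extends this to all Borel
    sets, and g vanishes almost everywhere. *)
Lemma du_bois_reymond (D : lipschitz_domain R n) (g : borel_rV R n -> R) :
  int1 (vol D) g ->
  (forall f, test_fun D f -> \int[vol D]_x (g x * f x) = 0) ->
  {ae vol D, forall x, g x = 0}.
Proof.
move=> ig hg; have mg := int1_meas ig.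
have intO (U : set 'rV[R]_n) : open U -> (\int[vol D]_(x in (U : set (borel_rV R n))) (g x)%:E = 0)%E.
  move=> oU; have oUD : open (U `&` D) by apply: openI => //; exact: dom_open.
  have mUD : measurable (U `&` D : set (borel_rV R n)) by exact: sub_sigma_algebra.
  have mU : measurable (U : set (borel_rV R n)) by exact: sub_sigma_algebra.
  have cv x : (fun k => g x * open_bump (U `&` D) k x) @ \oo --> g x * \1_(U `&` D) x.
    apply: cvgMr; have [h|h] := pselect ((U `&` D) x).
      by rewrite indicE mem_set//; exact: open_bump_cvg.
    rewrite indicE memNset//; under eq_fun do rewrite open_bump_out//.
    exact: cvg_cst.
  have mb k : measurable_fun setT (open_bump (U `&` D) k : borel_rV R n -> R).
    by apply: measurable_smooth; case: (open_bump_test (U `&` D) k).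
  have [|||||i1 c] := @Rint_dct _ _ _ (vol D) (fun k x => g x * open_bump (U `&` D) k x)
      (fun x => g x * \1_(U `&` D) x) (fun x => `|g x|).
  - by move=> k; exact: measurable_funM.
  - by apply: measurable_funM => //; exact: measurable_indic.
  - exact/aeW.
  - exact: int1_norm.
  - apply: aeW => x k; have /andP[h1 h2] := open_bump01 (U `&` D) k x.
    by rewrite normrM (ger0_norm h1) ler_piMr.
  have e0 : \int[vol D]_x (g x * \1_(U `&` D) x) = 0.
    have e k : \int[vol D]_x (g x * open_bump (U `&` D) k x) = 0.
      apply: hg; have [s1 [K [K1 K2 K3]]] := open_bump_test (U `&` D) k; split => //.
      by exists K; split => // x /K2[].
    move: c; under eq_fun do rewrite e; move=> c.
    by rewrite -(cvg_lim _ c)// lim_cst.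
  rewrite integral_mkcond.
  transitivity ((\int[vol D]_x (g x * \1_(U `&` D) x))%:E); last by rewrite e0.
  rewrite RintE//; apply: ae_eq_integral => //.
  - by apply/(measurable_restrictT _ mU); exact/measurable_funTS/measurable_EFinP.
  - by apply/measurable_EFinP/measurable_funM => //; exact: measurable_indic.
  - apply: ae_imp (ae_dom D) => x Dx _; rewrite patchE indicE in_setI [x \in dom_set D]mem_set// andbT.
    by case: ifPn => _; rewrite ?mulr1 ?mulr0.
have all0 (A : set (borel_rV R n)) : measurable A -> (\int[vol D]_(x in A) (g x)%:E = 0)%E.
  move: A; apply: (@dynkin_induction _ (borel_rV R n) (@open 'rV[R]_n)
    (fun A => (\int[vol D]_(x in A) (g x)%:E = 0)%E)) => //.
  - exact: openI.
  - by apply: intO; exact: openT.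
  - move=> S mS S0.
    have := @integral_setU _ _ _ (vol D) S (~` S) (EFin \o g) mS (measurableC mS).
    rewrite setUv S0 add0e => <-//.
    - by apply: intO; exact: openT.
    - exact/measurable_EFinP.
    - by apply/disj_setPS; rewrite setICr.
  - move=> F mF tF F0; rewrite integral_bigcup//.
      by rewrite eseries0// => i _ _; exact: F0.
    by apply: integrableS ig => //; exact: bigcup_measurable.
have := @integral_ae_eq _ _ _ (vol D) setT measurableT (cst 0)%E (EFin \o g) ig
  (measurable_cst _) _.
move=> H; have : ae_eq (vol D) setT (EFin \o g) (cst 0)%E.
  by apply: H => E _ mE; rewrite all0// integral0.
by apply: ae_imp => x /(_ I) [].
Qed.

End dbr.

(** * Vector fields and weak gradients *)

Section vector_fields.
Context {R : realType} {n : nat} (D : lipschitz_domain R n).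
Implicit Types v w : vfield D.

Lemma vfDE v w i x : (v + w) i x = v i x + w i x.
Proof. by rewrite /vfield_fun ffunE. Qed.

Lemma vfZE a v i x : (a *: v) i x = a * v i x.
Proof. by rewrite /vfield_fun ffunE. Qed.

Lemma vfNE v i x : (- v) i x = - v i x.
Proof. by rewrite /vfield_fun ffunE. Qed.

Lemma vfBE v w i x : (v - w) i x = v i x - w i x.
Proof. by rewrite vfDE vfNE. Qed.

Lemma vf0E i x : (0 : vfield D) i x = 0.
Proof. by rewrite /vfield_fun ffunE. Qed.

Lemma vf_sumE (I : Type) (s : seq I) (Q : pred I) (F : I -> vfield D) i x :
  (\sum_(j <- s | Q j) F j) i x = \sum_(j <- s | Q j) F j i x.
Proof. by elim/big_rec2: _ => [|j y1 y2 Qj <-]; [exact: vf0E|exact: vfDE]. Qed.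

Lemma vf_int2 v i : int2 (vol D) (v i).
Proof. by apply/int2_Lfun; exact: LfunP. Qed.

Definition vf_of (f : 'I_n -> borel_rV R n -> R) (hf : forall i, int2 (vol D) (f i)) :
    vfield D :=
  [ffun i => Lfun_Sub (lee1n 2) (proj2 (int2_Lfun (vol D) (f i)) (hf i)) : L2 D].

Lemma vf_ofE f (hf : forall i, int2 (vol D) (f i)) i x : vf_of hf i x = f i x.
Proof. by rewrite /vf_of /vfield_fun ffunE. Qed.

Lemma fdotC v w : fdot v w = fdot w v.
Proof.
by rewrite /fdot; apply: eq_bigr => i _; apply: eq_Rintegral => x _; rewrite mulrC.
Qed.

Lemma fdotDl u v w : fdot (u + v) w = fdot u w + fdot v w.
Proof.
rewrite /fdot -big_split; apply: eq_bigr => i _ /=.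
under eq_Rintegral do rewrite vfDE mulrDl.
by rewrite RintD//; apply: int2_mul; exact: vf_int2.
Qed.

Lemma fdotZl a v w : fdot (a *: v) w = a * fdot v w.
Proof.
rewrite /fdot mulr_sumr; apply: eq_bigr => i _ /=.
under eq_Rintegral do rewrite vfZE -mulrA.
by rewrite RintZ//; apply: int2_mul; exact: vf_int2.
Qed.

Lemma fdotNl v w : fdot (- v) w = - fdot v w.
Proof. by rewrite -scaleN1r fdotZl mulN1r. Qed.

Lemma fdotBl u v w : fdot (u - v) w = fdot u w - fdot v w.
Proof. by rewrite fdotDl fdotNl. Qed.

Lemma fdotDr u v w : fdot w (u + v) = fdot w u + fdot w v.
Proof. by rewrite ![fdot w _]fdotC fdotDl. Qed.

Lemma fdotZr a v w : fdot w (a *: v) = a * fdot w v.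
Proof. by rewrite ![fdot w _]fdotC fdotZl. Qed.

Lemma fdotBr u v w : fdot w (u - v) = fdot w u - fdot w v.
Proof. by rewrite ![fdot w _]fdotC fdotBl. Qed.

Lemma fdot0l w : fdot 0 w = 0.
Proof. by rewrite -(scale0r w) fdotZl mul0r. Qed.

Lemma fdot_suml (I : Type) (s : seq I) (Q : pred I) (F : I -> vfield D) w :
  fdot (\sum_(j <- s | Q j) F j) w = \sum_(j <- s | Q j) fdot (F j) w.
Proof. by elim/big_rec2: _ => [|j y1 y2 Qj <-]; [exact: fdot0l|exact: fdotDl]. Qed.

Lemma fdot_sumr (I : Type) (s : seq I) (Q : pred I) (F : I -> vfield D) w :
  fdot w (\sum_(j <- s | Q j) F j) = \sum_(j <- s | Q j) fdot w (F j).
Proof. by rewrite fdotC fdot_suml; apply: eq_bigr => i _; rewrite fdotC. Qed.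

Lemma fnormsq_ge0 v : 0 <= fnormsq v.
Proof.
rewrite /fnormsq /fdot sumr_ge0// => i _; apply: Rint_ge0 => x.
by rewrite -expr2 sqr_ge0.
Qed.

Lemma fnorm_ge0 v : 0 <= fnorm v.
Proof. exact: sqrtr_ge0. Qed.

Lemma sqr_fnorm v : fnorm v ^+ 2 = fnormsq v.
Proof. by rewrite sqr_sqrtr// fnormsq_ge0. Qed.

Lemma fnormsqD v w : fnormsq (v + w) = fnormsq v + 2 * fdot v w + fnormsq w.
Proof. by rewrite /fnormsq fdotDl !fdotDr (fdotC w v); ring. Qed.

Lemma fnormsqZ a v : fnormsq (a *: v) = a ^+ 2 * fnormsq v.
Proof. by rewrite /fnormsq fdotZl fdotZr; ring. Qed.

Lemma fnormsqN v : fnormsq (- v) = fnormsq v.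
Proof. by rewrite -scaleN1r fnormsqZ sqrrN expr1n mul1r. Qed.

Lemma fnormsqBC v w : fnormsq (v - w) = fnormsq (w - v).
Proof. by rewrite -fnormsqN opprB. Qed.

Lemma fnormsqB v w : fnormsq (v - w) = fnormsq v - 2 * fdot v w + fnormsq w.
Proof. by rewrite /fnormsq fdotBl !fdotBr (fdotC w v); ring. Qed.

Lemma fnormsqD_le v w : fnormsq (v + w) <= 2 * fnormsq v + 2 * fnormsq w.
Proof.
have := fnormsq_ge0 (v - w); rewrite fnormsqB fnormsqD; lra.
Qed.

Lemma fdot_CS v w : fdot v w ^+ 2 <= fnormsq v * fnormsq w.
Proof.
have [w0|w0] := eqVneq (fnormsq w) 0.
  have key (t : R) : 0 <= fnormsq v - 2 * t * fdot v w.
    have := fnormsq_ge0 (v - t *: w).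
    by rewrite fnormsqB fdotZr fnormsqZ w0 mulr0 addr0 mulrA.
  rewrite w0 mulr0; have [->|c0] := eqVneq (fdot v w) 0; first by rewrite expr0n.
  have := key ((fnormsq v + 1) / (2 * fdot v w)).
  have -> : 2 * ((fnormsq v + 1) / (2 * fdot v w)) * fdot v w = fnormsq v + 1 by field.
  by rewrite opprD addrA subrr add0r oppr_ge0 ler10.
have wp : 0 < fnormsq w by rewrite lt_neqAle eq_sym w0 fnormsq_ge0.
have := fnormsq_ge0 (v - (fdot v w / fnormsq w) *: w).
rewrite fnormsqB fdotZr fnormsqZ.
have -> : fnormsq v - 2 * (fdot v w / fnormsq w * fdot v w) +
  (fdot v w / fnormsq w) ^+ 2 * fnormsq w = (fnormsq v * fnormsq w - fdot v w ^+ 2) / fnormsq w.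
  by field.
by rewrite pmulr_lge0 ?invr_gt0// subr_ge0.
Qed.

Lemma fdot_le v w : `|fdot v w| <= fnorm v * fnorm w.
Proof.
rewrite -(@ler_pXn2r _ 2)// ?nnegrE ?mulr_ge0 ?fnorm_ge0//.
by rewrite real_normK ?num_real// exprMn !sqr_fnorm fdot_CS.
Qed.

Lemma fnormD v w : fnorm (v + w) <= fnorm v + fnorm w.
Proof.
rewrite -(@ler_pXn2r _ 2)// ?nnegrE ?addr_ge0 ?fnorm_ge0//.
rewrite sqr_fnorm fnormsqD sqrrD !sqr_fnorm lerD2r lerD2l.
rewrite -[leRHS]mulr_natl; apply: ler_wpM2l => //.
by rewrite (le_trans (ler_norm _))// fdot_le.
Qed.

Lemma fnormZ a v : fnorm (a *: v) = `|a| * fnorm v.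
Proof. by rewrite /fnorm fnormsqZ sqrtrM ?sqr_ge0// sqrtr_sqr. Qed.

Lemma fnormN v : fnorm (- v) = fnorm v.
Proof. by rewrite /fnorm fnormsqN. Qed.

Lemma fdistC v w : fdist v w = fdist w v.
Proof. by rewrite /fdist -fnormN opprB. Qed.

Lemma fdist_trans u v w : fdist u w <= fdist u v + fdist v w.
Proof.
rewrite /fdist; have -> : u - w = (u - v) + (v - w) by rewrite addrA subrK.
exact: fnormD.
Qed.

Lemma vfield_eq_sym v w : vfield_eq v w -> vfield_eq w v.
Proof. by move=> vw i; apply: ae_imp (vw i) => x ->. Qed.

Lemma fdot_eql v v' w : vfield_eq v v' -> fdot v w = fdot v' w.
Proof.
move=> vv; apply: eq_bigr => i _; apply: Rint_ae.
- by apply: measurable_funM; exact: int2_meas (vf_int2 _ _).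
- by apply: measurable_funM; exact: int2_meas (vf_int2 _ _).
- by apply: ae_imp (vv i) => x ->.
Qed.

Lemma fdot_eq v v' w w' : vfield_eq v v' -> vfield_eq w w' -> fdot v w = fdot v' w'.
Proof. by move=> vv ww; rewrite (fdot_eql _ vv) fdotC (fdot_eql _ ww) fdotC. Qed.

Lemma fnormsq_eq0 v w : fnormsq (v - w) = 0 -> vfield_eq v w.
Proof.
rewrite /fnormsq /fdot => /eqP; rewrite psumr_eq0 => [/allP H i|i _]; last first.
  by apply: Rint_ge0 => x; rewrite -expr2 sqr_ge0.
have := H i; rewrite mem_index_enum => /(_ isT) /eqP => e0.
have i1 : int1 (vol D) (fun x => (v - w) i x * (v - w) i x).
  by apply: int2_mul; exact: vf_int2.
have h : forall x, 0 <= (v - w) i x * (v - w) i x by move=> x; rewrite -expr2 sqr_ge0.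
apply: ae_imp (Rint_eq0_ae i1 h e0) => x.
by move=> /eqP; rewrite mulf_eq0 orbb vfBE subr_eq0 => /eqP.
Qed.

Lemma vfield_eq_fnormsq v w : vfield_eq v w -> fnormsq (v - w) = 0.
Proof.
move=> vw; have h : vfield_eq (v - w) 0.
  by move=> i; apply: ae_imp (vw i) => x e; rewrite vfBE vf0E e subrr.
by rewrite /fnormsq (fdot_eql _ h) fdot0l.
Qed.

End vector_fields.

(** * Weak gradients and bounded chosen gradients *)

Section weak_gradient.
Context {R : realType} {n : nat} (D : lipschitz_domain R n).
Implicit Types (v w : vfield D) (A B : borel_rV R n -> 'M[R]_n).

Lemma vol_fin : (vol D setT < +oo)%E.
Proof.
have [M [_ hM]] := dom_bounded D.
pose k := Num.truncn (`|M| + 1).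
have h x : dom_set D x -> ball (0 : 'rV[R]_n) k.+1%:R x.
  move=> Dx; rewrite -ball_normE /= sub0r normrN.
  apply: le_lt_trans (truncnS_gt _ ).
  by apply: (hM (`|M| + 1)) => //; rewrite (le_lt_trans (ler_norm M))// ltrDl.
apply: (@le_lt_trans _ _ (lebesgue_rV R n (ball (0 : 'rV[R]_n) k.+1%:R))).
  rewrite /vol /= /mrestr setTI; apply: le_measure; rewrite ?inE.
  - exact: measurable_dom.
  - exact: measurable_rV_ball.
  - exact: h.
exact: (proj2_sig (lebesgue_rV_rec R n)).
Qed.

Lemma int1_cst_vol (c : R) : int1 (vol D) (fun=> c).
Proof.
apply: int1P => //; rewrite integral_cst//.
by apply: lte_mul_pinfty => //; exact: vol_fin.
Qed.

Lemma int1_bounded (f : borel_rV R n -> R) (M : R) : measurable_fun setT f ->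
  {ae vol D, forall x, `|f x| <= M} -> int1 (vol D) f.
Proof.
move=> mf fM; apply: int1P => //.
apply: (@le_lt_trans _ _ (\int[vol D]_x (`|M|)%:E)%E); last first.
  by have := int1_lty (int1_cst_vol M).
apply: ae_ge0_le_integral => //.
- by apply/measurable_EFinP; exact: measurableT_comp.
- by apply: ae_imp fM => x h _; rewrite lee_fin (le_trans h)// ler_norm.
Qed.

Lemma int2_bounded (f : borel_rV R n -> R) (M : R) : measurable_fun setT f ->
  {ae vol D, forall x, `|f x| <= M} -> int2 (vol D) f.
Proof.
move=> mf fM; split => //; apply: (int1_bounded (M := M ^+ 2)).
  exact: measurable_funX.
by apply: ae_imp fM => x h; rewrite normrX lerXn2r// nnegrE ?(le_trans _ h).
Qed.

Lemma int1_bounded_mul (f g : borel_rV R n -> R) (M : R) : measurable_fun setT f ->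
  {ae vol D, forall x, `|f x| <= M} -> int1 (vol D) g -> int1 (vol D) (fun x => g x * f x).
Proof.
move=> mf fM ig; have mg := int1_meas ig.
apply: int1P; first exact: measurable_funM.
apply: (@le_lt_trans _ _ (\int[vol D]_x (Num.norm (`|M| * g x))%:E)%E); last first.
  exact: (int1_lty (int1Z `|M| ig)).
apply: ae_ge0_le_integral => //.
- apply/measurable_EFinP; apply: measurableT_comp => //; exact: measurable_funM.
- by apply/measurable_EFinP; apply: measurableT_comp => //; exact: measurable_funM.
- apply: ae_imp fM => x h _; rewrite lee_fin !normrM normr_id mulrC ler_wpM2r//.
  by rewrite (le_trans h)// ler_norm.
Qed.

Lemma test_fun_partial (f : 'rV[R]_n -> R) j : test_fun D f -> test_fun D (partial j f).
Proof.
move=> [sf [K [cK KD hK]]]; split.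
  by move=> s; have := sf (rcons s j); rewrite -cats1 foldr_cat.
exists K; split => // x Kx.
have oK : open (~` K) by apply: closed_openC; apply: compact_closed => //; exact: norm_hausdorff.
rewrite /partial (@near_eq_derive _ _ _ f (cst 0)) ?derive_cst//.
by have := open_nbhs_nbhs (conj oK Kx); apply: filterS => y; exact: hK.
Qed.

Lemma test_fun_bounded (f : 'rV[R]_n -> R) : test_fun D f ->
  measurable_fun setT (f : borel_rV R n -> R) /\ exists M, forall x, `|f x| <= M.
Proof.
move=> [sf [K [cK KD hK]]]; split; first exact: measurable_smooth.
have [cf _] := sf [::].
have /compact_bounded [M [_ hM]] : compact (f @` K).
  by apply: continuous_compact => //; exact: continuous_subspaceT.
exists (`|M| + 1) => x; have [Kx|Kx] := pselect (K x); last first.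
  by rewrite hK// normr0 addr_ge0.
apply: hM; last by exists x.
by rewrite (le_lt_trans (ler_norm M))// ltrDl.
Qed.

Lemma int1_test v i f : test_fun D f -> int1 (vol D) (fun x => v i x * f x).
Proof.
move=> /test_fun_bounded[mf [M hM]].
apply: int2_mul; first exact: vf_int2.
by apply: (int2_bounded (M := M)) => //; exact: aeW.
Qed.

Lemma weak_grad_int1 v A i j : is_weak_grad v A -> int1 (vol D) (fun x => A x i j).
Proof. by move=> /(_ i j)[/Lfun1_integrable]. Qed.

Lemma weak_grad_test v A i j f : is_weak_grad v A -> test_fun D f ->
  int1 (vol D) (fun x => A x i j * f x).
Proof.
move=> wA /test_fun_bounded[mf [M hM]].
apply: (int1_bounded_mul (M := M)) => //; first exact: aeW.
exact: weak_grad_int1 wA.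
Qed.

Lemma weak_grad_unique v A B : is_weak_grad v A -> is_weak_grad v B ->
  {ae vol D, forall x, A x = B x}.
Proof.
move=> wA wB; have H i j : {ae vol D, forall x, A x i j - B x i j = 0}.
  apply: du_bois_reymond; first by apply: int1B; [exact: weak_grad_int1 wA|exact: weak_grad_int1 wB].
  move=> f tf; under eq_Rintegral do rewrite mulrBl.
  rewrite RintB; [|exact: weak_grad_test wA tf|exact: weak_grad_test wB tf].
  have [_ /(_ f tf) eA] := wA i j; have [_ /(_ f tf) eB] := wB i j.
  by apply: oppr_inj; rewrite opprB oppr0 addrC -eA eB; ring.
have H2 := ae_all (fun i => ae_all (H i)).
by apply: ae_imp H2 => x h; apply/matrixP => i j; apply/eqP; rewrite -subr_eq0 h.
Qed.

Lemma weak_grad_linear a v w A B : is_weak_grad v A -> is_weak_grad w B ->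
  is_weak_grad (a *: v + w) (fun x => a *: A x + B x).
Proof.
move=> wA wB i j; split.
  apply/Lfun1_integrable.
  have := int1D (int1Z a (weak_grad_int1 i j wA)) (weak_grad_int1 i j wB).
  by congr (_.-integrable _ _); apply/funext => x /=; rewrite !mxE.
move=> f tf; have tp := test_fun_partial j tf.
under eq_Rintegral do rewrite vfDE vfZE mulrDl -mulrA.
rewrite RintD; [|by apply: int1Z; exact: int1_test|exact: int1_test].
rewrite RintZ; last exact: int1_test.
under [in RHS]eq_Rintegral do rewrite !mxE mulrDl -mulrA.
rewrite RintD; [|by apply: int1Z; exact: weak_grad_test wA tf|exact: weak_grad_test wB tf].
rewrite RintZ; last exact: weak_grad_test wA tf.
have [_ /(_ f tf) ->] := wA i j; have [_ /(_ f tf) ->] := wB i j; ring.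
Qed.

Lemma weak_grad0 : is_weak_grad (0 : vfield D) (fun=> 0).
Proof.
move=> i j; split.
  by apply/Lfun1_integrable; under eq_fun do rewrite mxE; exact: int1_0.
move=> f tf; under eq_Rintegral do rewrite vf0E mul0r.
under [in RHS]eq_Rintegral do rewrite mxE mul0r.
by rewrite Rint_zero oppr0.
Qed.

Lemma weak_grad_eq v w A : vfield_eq v w -> is_weak_grad v A -> is_weak_grad w A.
Proof.
move=> vw wA i j; have [h1 h2] := wA i j; split => // f tf; rewrite -h2//.
have tp := test_fun_partial j tf.
apply: Rint_ae; [exact: int1_meas (int1_test _ _ tp)|exact: int1_meas (int1_test _ _ tp)|].
by apply: ae_imp (vw i) => x ->.
Qed.

(** Almost everywhere equal fields have the same set of weak gradients, so the choice made by [grad]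
    is literally the same function for both. *)
Lemma grad_eq v w : vfield_eq v w -> grad v = grad w.
Proof.
move=> vw; rewrite /grad; congr (xget _ _); apply/seteqP; split => A; apply: weak_grad_eq => //.
exact: vfield_eq_sym.
Qed.

Lemma gradP v A : is_weak_grad v A -> is_weak_grad v (grad v).
Proof. by move=> wA; apply: (@xgetPex _ (fun=> 0) (is_weak_grad v)); exists A. Qed.

Lemma gradE v A : is_weak_grad v A -> {ae vol D, forall x, grad v x = A x}.
Proof. by move=> wA; apply: (weak_grad_unique (gradP wA) wA). Qed.

(* Fields whose chosen gradient [grad v] is bounded; [W1inf] only provides some
   bounded weak gradient ([W1inf_nice]). *)
Definition nice v := [/\ is_weak_grad v (grad v),
  forall i j, measurable_fun setT (fun x => grad v x i j) &
  exists M : R, {ae vol D, forall x, forall i j, `|grad v x i j| <= M}].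

Lemma Linf_bounded (f : borel_rV R n -> R) : f \in Lfun (vol D) +oo%E ->
  exists M : R, {ae vol D, forall x, `|f x| <= M}.
Proof.
rewrite inE => /andP[_]; rewrite inE /= /finite_norm unlock /=.
case: ifPn => [v0|v0 _].
  set E := ess_sup_inf.ess_sup _ _ => Efin; exists (fine E).
  have := @ess_sup_inf.ess_sup_ge _ _ _ (vol D) (abse \o (EFin \o f)).
  rewrite -/E; move: Efin; case: E => [r|//|] _; apply: ae_imp => x //=.
(* Here [vol D] has no mass, and any bound holds almost everywhere. *)
exists 0; exists setT; split => //.
apply/eqP; rewrite eq_le measure_ge0 andbT leNgt; exact: v0.
Qed.

Lemma W1inf_nice v : W1inf v -> nice v.
Proof.
move=> [_ [A wA hA]]; have wg := gradP wA; split => //.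
  by move=> i j; exact: int1_meas (weak_grad_int1 i j wg).
have H i : exists M : 'I_n -> R, forall j, {ae vol D, forall x, `|A x i j| <= M j}.
  have h j : exists M : R, {ae vol D, forall x, `|A x i j| <= M} by exact: Linf_bounded.
  by have [M hM] := choice h; exists M.
have [M hM] := choice H.
exists (\big[Num.max/0]_i \big[Num.max/0]_j M i j).
have H2 := ae_all (fun i => ae_all (hM i)).
apply: ae_imp2 (gradE wA) H2 => x -> h i j; apply: (le_trans (h i j)).
by apply: le_trans (le_bigmax _ _ i); exact: (le_bigmax _ (M i)).
Qed.

Lemma nice_grad_linear a v w : nice v -> nice w ->
  nice (a *: v + w) /\ {ae vol D, forall x, grad (a *: v + w) x = a *: grad v x + grad w x}.
Proof.
move=> [wv mv [M hM]] [ww mw [M' hM']]; have wl := weak_grad_linear a wv ww.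
have h := gradE wl; split; last exact: h.
split; first exact: gradP wl.
  by move=> i j; exact: int1_meas (weak_grad_int1 i j (gradP wl)).
exists (`|a| * M + M').
have hh := ae_imp2 (fun x => @conj _ _) hM hM'.
apply: ae_imp2 h hh => x -> [h1 h2] i j; rewrite !mxE (le_trans (ler_normD _ _))//.
by rewrite lerD// normrM ler_wpM2l.
Qed.

Lemma nice_eq v w : vfield_eq v w -> nice v -> nice w.
Proof.
move=> vw [h1 h2 h3]; rewrite /nice -(grad_eq vw); split => //.
exact: weak_grad_eq h1.
Qed.

Lemma nice0 : nice 0 /\ {ae vol D, forall x, grad (0 : vfield D) x = 0}.
Proof.
have h := gradE weak_grad0; split; last exact: h.
split; first exact: gradP weak_grad0.
  by move=> i j; exact: int1_meas (weak_grad_int1 i j (gradP weak_grad0)).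
by exists 0; apply: ae_imp h => x -> i j; rewrite mxE normr0.
Qed.

Lemma nice_sum (I : Type) (s : seq I) (c : I -> R) (b : I -> vfield D) :
  (forall i, nice (b i)) ->
  nice (\sum_(i <- s) c i *: b i) /\ {ae vol D, forall x,
    grad (\sum_(i <- s) c i *: b i) x = \sum_(i <- s) c i *: grad (b i) x}.
Proof.
move=> nb; elim: s => [|i s [ih1 ih2]].
  rewrite big_nil; split; first exact: nice0.1.
  by apply: ae_imp nice0.2 => x ->; rewrite big_nil.
rewrite big_cons; have [h1 h2] := nice_grad_linear (c i) (nb i) ih1.
by split => //; apply: ae_imp2 h2 ih2 => x -> ->; rewrite big_cons.
Qed.

End weak_gradient.

(** * The stress *)

Section frobenius.
Context {R : realType} {n : nat}.
Implicit Types E F G : 'M[R]_n.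

Lemma frob_dotC E F : frob_dot E F = frob_dot F E.
Proof. by apply: eq_bigr => i _; apply: eq_bigr => j _; rewrite mulrC. Qed.

Lemma frob_dotDr E F G : frob_dot E (F + G) = frob_dot E F + frob_dot E G.
Proof.
rewrite -big_split; apply: eq_bigr => i _ /=; rewrite -big_split.
by apply: eq_bigr => j _; rewrite mxE mulrDr.
Qed.

Lemma frob_dotZr a E F : frob_dot E (a *: F) = a * frob_dot E F.
Proof.
rewrite mulr_sumr; apply: eq_bigr => i _ /=; rewrite mulr_sumr.
by apply: eq_bigr => j _; rewrite mxE mulrCA.
Qed.

Lemma frob_dotDl E F G : frob_dot (F + G) E = frob_dot F E + frob_dot G E.
Proof. by rewrite !(frob_dotC _ E) frob_dotDr. Qed.

Lemma frob_dotZl a E F : frob_dot (a *: F) E = a * frob_dot F E.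
Proof. by rewrite !(frob_dotC _ E) frob_dotZr. Qed.

Lemma frob_dotBr E F G : frob_dot E (F - G) = frob_dot E F - frob_dot E G.
Proof. by rewrite frob_dotDr -scaleN1r frob_dotZr mulN1r. Qed.

Lemma frob_dot_tr E F : frob_dot E^T F^T = frob_dot E F.
Proof.
rewrite /frob_dot exchange_big; apply: eq_bigr => i _; apply: eq_bigr => j _.
by rewrite !mxE.
Qed.

Lemma frob_dot_ge0 E : 0 <= frob_dot E E.
Proof. by do 2 apply: sumr_ge0 => ? _; rewrite -expr2 sqr_ge0. Qed.

Lemma frob_ge0 E : 0 <= frob E. Proof. exact: sqrtr_ge0. Qed.

Lemma sqr_frob E : frob E ^+ 2 = frob_dot E E.
Proof. by rewrite sqr_sqrtr// frob_dot_ge0. Qed.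

Lemma frob_eq0 E : frob E = 0 -> E = 0.
Proof.
move=> e0; have : frob_dot E E = 0 by rewrite -sqr_frob e0 expr0n.
move=> /eqP; rewrite psumr_eq0 => [/allP H|i _]; last first.
  by apply: sumr_ge0 => j _; rewrite -expr2 sqr_ge0.
apply/matrixP => i j; rewrite mxE.
have := H i; rewrite mem_index_enum => /(_ isT)/=.
rewrite psumr_eq0 => [/allP H'|k _]; last by rewrite -expr2 sqr_ge0.
by have := H' j; rewrite mem_index_enum => /(_ isT)/=; rewrite mulf_eq0 orbb => /eqP.
Qed.

Lemma frob0 : frob (0 : 'M[R]_n) = 0.
Proof. by rewrite /frob -(scale0r 0) frob_dotZr mul0r sqrtr0. Qed.

Lemma frobZ a E : frob (a *: E) = `|a| * frob E.
Proof.
by rewrite /frob frob_dotZl frob_dotZr mulrA -expr2 sqrtrM ?sqr_ge0// sqrtr_sqr.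
Qed.

Lemma frob_CS E F : `|frob_dot E F| <= frob E * frob F.
Proof.
have [F0|F0] := eqVneq (frob F) 0.
  by rewrite (frob_eq0 F0) -(scale0r 0) frob_dotZr mul0r normr0 mulr_ge0 ?frob_ge0.
have fp : 0 < frob_dot F F by rewrite -sqr_frob exprn_gt0// lt_neqAle eq_sym F0 frob_ge0.
rewrite -(@ler_pXn2r _ 2)// ?nnegrE ?mulr_ge0 ?frob_ge0// exprMn !sqr_frob.
rewrite real_normK ?num_real//.
have := frob_dot_ge0 (E - (frob_dot E F / frob_dot F F) *: F).
rewrite frob_dotBr !(frob_dotC (E - _)) !frob_dotBr !frob_dotZr !frob_dotZl.
rewrite (frob_dotC F E); set a := frob_dot E F; set b := frob_dot F F; set c := frob_dot E E.
have bn0 : b != 0 by rewrite gt_eqF.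
have -> : c - a / b * a - (a / b * a - a / b * (a / b * b)) = (c * b - a ^+ 2) / b by field.
by rewrite pmulr_lge0 ?invr_gt0// subr_ge0.
Qed.

Lemma frob_bound E (M : R) : (forall i j, `|E i j| <= M) -> frob E <= n%:R * M.
Proof.
move=> h; have [n0|n0] := posnP n.
  have -> : frob E = 0.
    rewrite /frob /frob_dot big1 ?sqrtr0// => i _.
    by have h0 := leq_ltn_trans (leq0n i) (ltn_ord i); rewrite n0 in h0.
  by rewrite n0 mul0r.
have M0 : 0 <= M by rewrite (le_trans _ (h (Ordinal n0) (Ordinal n0))).
rewrite -(@ler_pXn2r _ 2)// ?nnegrE ?mulr_ge0 ?frob_ge0// sqr_frob exprMn.
apply: (@le_trans _ _ (\sum_(i < n) \sum_(j < n) M ^+ 2)).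
  apply: ler_sum => i _; apply: ler_sum => j _.
  by rewrite -expr2 -(real_normK (num_real (E i j))) lerXn2r// nnegrE.
by rewrite !sumr_const !card_ord -mulrnA -[leLHS]mulr_natl natrM -expr2.
Qed.

Lemma frobD E F : frob (E + F) <= frob E + frob F.
Proof.
rewrite -(@ler_pXn2r _ 2)// ?nnegrE ?addr_ge0 ?frob_ge0//.
rewrite sqr_frob frob_dotDr !frob_dotDl sqrrD !sqr_frob (frob_dotC F E).
have := frob_CS E F; have := ler_norm (frob_dot E F); lra.
Qed.

Variables (p : R) (p_gt1 : 1 < p).

Lemma stress_self E : frob_dot (stress p E) E = frob E `^ p.
Proof.
rewrite /stress frob_dotZl -sqr_frob; have [->|e0] := eqVneq (frob E) 0.
  by rewrite expr0n mulr0 powR0// gt_eqF// (lt_trans ltr01).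
rewrite -powR_mulrn ?frob_ge0// -powRD ?subrK//.
by apply/implyP; rewrite e0.
Qed.

(** Cauchy-Schwarz bounds the pairing by |E|^(p-1) |F|; Young's inequality with the exponents
    p/(p-1) and p does the rest. *)
Lemma stress_young E F :
  p * `|frob_dot (stress p E) F| <= (p - 1) * frob E `^ p + frob F `^ p.
Proof.
have p0 : 0 < p by rewrite (lt_trans ltr01).
have p10 : 0 < p - 1 by rewrite subr_gt0.
rewrite /stress frob_dotZl normrM ger0_norm ?powR_ge0//.
apply: (@le_trans _ _ (p * (frob E `^ (p - 1) * frob F))).
  rewrite ler_pM2l//; apply: (@le_trans _ _ (frob E `^ (p - 2) * (frob E * frob F))).
    by rewrite ler_wpM2l ?powR_ge0// frob_CS.
  rewrite mulrA ler_wpM2r ?frob_ge0//; have [->|e0] := eqVneq (frob E) 0.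
    by rewrite mulr0 powR_ge0.
  rewrite -[X in _ * X]powRr1 ?frob_ge0// -powRD; last by apply/implyP; rewrite e0.
  by rewrite (_ : p - 2 + 1 = p - 1)//; ring.
have pq : (p / (p - 1))^-1 + p^-1 = 1.
  by rewrite invf_div; field; rewrite ?gt_eqF.
have := conjugate_powR (powR_ge0 (frob E) (p - 1)) (frob_ge0 F)
  (divr_gt0 p0 p10) p0 pq.
rewrite -powRrM (_ : (p - 1) * (p / (p - 1)) = p); last by field; rewrite gt_eqF.
move=> h; have := ler_wpM2l (ltW p0) h.
rewrite (_ : p * (frob E `^ p / (p / (p - 1)) + frob F `^ p / p) =
  (p - 1) * frob E `^ p + frob F `^ p)//.
by move: (frob E `^ p) (frob F `^ p) => a b; field; rewrite !gt_eqF.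
Qed.

Lemma stress_le E F : `|frob_dot (stress p E) F| <= frob E `^ p + frob F `^ p.
Proof.
have p0 : 0 < p by rewrite (lt_trans ltr01).
have h := stress_young E F; rewrite -(ler_pM2l p0) (le_trans h)// mulrDr.
apply: lerD; first by rewrite ler_wpM2r ?powR_ge0// gerBl.
by rewrite ler_peMl ?powR_ge0// ltW.
Qed.

(** The subgradient inequality of |.|^p is Young's inequality rearranged, since S(E) : E = |E|^p. *)
Lemma stress_convex E F :
  frob E `^ p + p * frob_dot (stress p E) (F - E) <= frob F `^ p.
Proof.
have p0 : 0 < p by rewrite (lt_trans ltr01).
have h := stress_young E F; rewrite frob_dotBr stress_self.
have := ler_wpM2l (ltW p0) (ler_norm (frob_dot (stress p E) F)); move: h.
by move: (frob_dot (stress p E) F) (frob E `^ p) (frob F `^ p) => x a b; lra.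
Qed.

(** Continuity along rays suffices for the Euler-Lagrange equation. Away from 0 it is the continuity
    of the powers; at E = 0, where |E|^(p-2) may blow up, homogeneity gives S(tF) : F = t^(p-1)
    |F|^p, and p > 1 concludes. *)
Lemma stress_line_cvg E F : (fun k : nat =>
  frob_dot (stress p (E + k.+1%:R^-1 *: F)) F) @ \oo --> frob_dot (stress p E) F.
Proof.
have p10 : 0 < p - 1 by rewrite subr_gt0.
have [e0|e0] := eqVneq (frob E) 0.
  rewrite (frob_eq0 e0).
  have -> : frob_dot (stress p 0) F = 0 by rewrite /stress scaler0 -(scale0r 0) frob_dotZl mul0r.
  have -> : (fun k : nat => frob_dot (stress p (0 + k.+1%:R^-1 *: F)) F) =
      (fun k : nat => frob F `^ p * k.+1%:R^-1 `^ (p - 1)).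
    apply/funext => k; set t : R := k.+1%:R^-1.
    have t0 : 0 < t by rewrite invr_gt0.
    have := stress_self (t *: F); rewrite add0r frob_dotZr frobZ (gtr0_norm t0).
    rewrite powRM ?frob_ge0 ?(ltW t0)// => h; apply: (mulfI (lt0r_neq0 t0)); rewrite h.
    rewrite (_ : t `^ p = t * t `^ (p - 1)); first by ring.
    rewrite -[X in X * _]powRr1 ?ltW// -powRD; last by apply/implyP => _; rewrite gt_eqF.
    by rewrite addrC subrK.
  rewrite -[X in _ --> X](mulr0 (frob F `^ p)); apply: cvgMr.
  apply/cvgr0Pnorm_le => eps eps0.
  have d0 : 0 < eps `^ (p - 1)^-1 by rewrite powR_gt0.
  have : \forall k \near \oo, k.+1%:R^-1 < eps `^ (p - 1)^-1.
    by apply: (@cvgr_lt R _ _ _ _ 0) => //; exact: cvg_harmonic.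
  apply: filterS => k hk; rewrite ger0_norm ?powR_ge0//.
  apply: (@le_trans _ _ ((eps `^ (p - 1)^-1) `^ (p - 1))).
    by apply: ge0_ler_powR; rewrite ?nnegrE ?ltW.
  by rewrite -powRrM mulVf ?gt_eqF// powRr1// ltW.
have ct : (fun k : nat => k.+1%:R^-1 : R) @ \oo --> (0 : R) by exact: cvg_harmonic.
have cf : (fun k : nat => frob (E + k.+1%:R^-1 *: F)) @ \oo --> frob E.
  apply: (@continuous_cvg _ _ _ _ _ _ Num.sqrt); first exact: sqrt_continuous.
  have -> : (fun k : nat => frob_dot (E + k.+1%:R^-1 *: F) (E + k.+1%:R^-1 *: F)) =
    (fun k : nat => frob_dot E E + k.+1%:R^-1 * (2 * frob_dot E F)
       + k.+1%:R^-1 * (k.+1%:R^-1 * frob_dot F F)).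
    apply/funext => k; rewrite frob_dotDr !frob_dotDl !frob_dotZr !frob_dotZl.
    by rewrite (frob_dotC F E); ring.
  rewrite -[X in _ --> X]addr0 -[X in _ --> X]addr0; apply: cvgD.
    apply: cvgD; first exact: cvg_cst.
    by rewrite -[X in _ --> X](mul0r (2 * frob_dot E F)); apply: cvgMl.
  rewrite -[X in _ --> X](mul0r (0 * frob_dot F F)); apply: cvgM => //.
  exact: cvgMl.
have -> : (fun k : nat => frob_dot (stress p (E + k.+1%:R^-1 *: F)) F) =
  (fun k : nat => frob (E + k.+1%:R^-1 *: F) `^ (p - 2) *
     (frob_dot E F + k.+1%:R^-1 * frob_dot F F)).
  by apply/funext => k; rewrite /stress frob_dotZl frob_dotDl frob_dotZl.
rewrite /stress frob_dotZl; apply: cvgM.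
  apply: (@continuous_cvg _ _ _ _ _ _ (fun a : R => a `^ (p - 2))) => //.
  have ep : 0 < frob E by rewrite lt_neqAle eq_sym e0 frob_ge0.
  apply/differentiable_continuous/derivable1_diffP.
  by case: (is_derive1_powR (p - 2) ep).
rewrite -[X in _ --> X]addr0; apply: cvgD; first exact: cvg_cst.
by rewrite -[X in _ --> X](mul0r (frob_dot F F)); apply: cvgMl.
Qed.

End frobenius.

Section stress_fields.
Context {R : realType} {n : nat} (D : lipschitz_domain R n) (p : R) (p_gt1 : 1 < p).
Implicit Types v w : vfield D.

Definition spow v : R := \int[vol D]_x (frob (sgrad v x) `^ p).

Lemma spow_ge0 v : 0 <= spow v.
Proof. by apply: Rint_ge0 => x; exact: powR_ge0. Qed.

Lemma sgrad_sym v x : (sgrad v x)^T = sgrad v x.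
Proof. by rewrite /sgrad linearZ/= linearD/= trmxK addrC. Qed.

Lemma sgrad_meas v i j : nice v -> measurable_fun setT (fun x => sgrad v x i j).
Proof.
move=> [_ m _]; under eq_fun do rewrite !mxE.
by apply: measurable_funM => //; apply: measurable_funD; exact: m.
Qed.

Lemma sgrad_bounded v : nice v ->
  exists M : R, {ae vol D, forall x, frob (sgrad v x) <= M}.
Proof.
move=> [_ _ [M hM]]; exists (n%:R * M); apply: ae_imp hM => x h.
apply: frob_bound => i j; rewrite !mxE normrM ger0_norm ?invr_ge0//.
rewrite ler_pdivrMl//; have := h i j; have := h j i.
have := ler_normD (grad v x i j) (grad v x j i); lra.
Qed.

Lemma sgrad_linear a v w : nice v -> nice w ->
  {ae vol D, forall x, sgrad (a *: v + w) x = a *: sgrad v x + sgrad w x}.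
Proof.
move=> nv nw; have [_] := nice_grad_linear a nv nw; apply: ae_imp => x e.
have tr_lin (G H : 'M[R]_n) : (a *: G + H)^T = a *: G^T + H^T.
  by apply/matrixP => i j; rewrite !mxE.
by rewrite /sgrad e tr_lin addrACA -scalerDr [LHS]scalerDr !scalerA (mulrC a).
Qed.

Lemma meas_frob_dot (E F : borel_rV R n -> 'M[R]_n) :
  (forall i j, measurable_fun setT (fun x => E x i j)) ->
  (forall i j, measurable_fun setT (fun x => F x i j)) ->
  measurable_fun setT (fun x => frob_dot (E x) (F x)).
Proof.
move=> mE mF; apply: measurable_sum => i; apply: measurable_sum => j.
exact: measurable_funM.
Qed.

Lemma meas_frob (E : borel_rV R n -> 'M[R]_n) :
  (forall i j, measurable_fun setT (fun x => E x i j)) ->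
  measurable_fun setT (fun x => frob (E x)).
Proof.
move=> mE; apply: (@measurableT_comp _ _ _ _ _ _ (@Num.sqrt R)); last exact: meas_frob_dot.
exact: measurable_sqrt || (apply: continuous_measurable_fun; exact: sqrt_continuous).
Qed.

Lemma meas_stress (E F : borel_rV R n -> 'M[R]_n) :
  (forall i j, measurable_fun setT (fun x => E x i j)) ->
  (forall i j, measurable_fun setT (fun x => F x i j)) ->
  measurable_fun setT (fun x => frob_dot (stress p (E x)) (F x)).
Proof.
move=> mE mF; under eq_fun do rewrite /stress frob_dotZl.
apply: measurable_funM; last exact: meas_frob_dot.
by apply: (measurableT_comp (measurable_powR _)); exact: meas_frob.
Qed.

Lemma meas_spow v : nice v -> measurable_fun setT (fun x => frob (sgrad v x) `^ p).
Proof.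
move=> nv; apply: (measurableT_comp (measurable_powR _)); apply: meas_frob => i j.
exact: sgrad_meas.
Qed.

Lemma int1_spow v : nice v -> int1 (vol D) (fun x => frob (sgrad v x) `^ p).
Proof.
move=> nv; have [M hM] := sgrad_bounded nv.
apply: (int1_bounded (M := M `^ p)); first exact: meas_spow.
apply: ae_imp hM => x h; rewrite ger0_norm ?powR_ge0//.
apply: ge0_ler_powR; rewrite ?nnegrE ?frob_ge0//.
- by rewrite ltW// (lt_trans ltr01).
- by rewrite (le_trans _ h)// frob_ge0.
Qed.

Lemma sgrad_powE v : nice v -> sgrad_pow p v = (spow v)%:E.
Proof. by move=> nv; rewrite /sgrad_pow /spow RintE//; exact: int1_spow. Qed.

Lemma spow_eq v w : vfield_eq v w -> spow v = spow w.
Proof. by move=> vw; rewrite /spow /sgrad (grad_eq vw). Qed.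

Lemma stress_dot_eq v v' w w' : vfield_eq v v' -> vfield_eq w w' ->
  stress_dot p v w = stress_dot p v' w'.
Proof. by move=> vv ww; rewrite /stress_dot /sgrad (grad_eq vv) (grad_eq ww). Qed.

(** The stress of a symmetric matrix is symmetric, so pairing it with the gradient only sees the
    symmetric part. *)
Lemma stress_dotE v w :
  stress_dot p v w = \int[vol D]_x frob_dot (stress p (sgrad v x)) (sgrad w x).
Proof.
apply: eq_Rintegral => x _; have st : (stress p (sgrad v x))^T = stress p (sgrad v x).
  by rewrite /stress linearZ/= sgrad_sym.
rewrite [sgrad w x]/sgrad frob_dotZr frob_dotDr -[X in _ + X]frob_dot_tr trmxK st.
by field.
Qed.

Lemma int1_stress v w : nice v -> nice w ->
  int1 (vol D) (fun x => frob_dot (stress p (sgrad v x)) (sgrad w x)).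
Proof.
move=> nv nw; apply: int1_le (int1D (int1_spow nv) (int1_spow nw)).
  by apply: meas_stress => i j; exact: sgrad_meas.
by move=> x; exact: stress_le.
Qed.

Lemma stress_dot_linear v a w w' : nice v -> nice w -> nice w' ->
  stress_dot p v (a *: w + w') = a * stress_dot p v w + stress_dot p v w'.
Proof.
move=> nv nw nw'; rewrite !stress_dotE.
have [nl _] := nice_grad_linear a nw nw'.
rewrite -RintZ; last exact: int1_stress.
rewrite -RintD; [|by apply: int1Z; exact: int1_stress|exact: int1_stress].
apply: Rint_ae; first exact: int1_meas (int1_stress nv nl).
  by apply: measurable_funD; first apply: measurable_funM => //;
    apply: meas_stress => i j; exact: sgrad_meas.
apply: ae_imp (sgrad_linear a nw nw') => x ->.
by rewrite frob_dotDr frob_dotZr.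
Qed.

Lemma stress_dot_self v : nice v -> stress_dot p v v = spow v.
Proof. by move=> nv; rewrite stress_dotE; apply: eq_Rintegral => x _; exact: stress_self. Qed.

Lemma stress_dot_le v w : nice v -> nice w -> `|stress_dot p v w| <= spow v + spow w.
Proof.
move=> nv nw; have i1 := int1_stress nv nw; rewrite stress_dotE.
apply: (le_trans (Rint_abs i1)).
rewrite /spow -RintD; [|exact: int1_spow|exact: int1_spow].
apply: Rint_le; [exact: int1_norm|by apply: int1D; exact: int1_spow|].
by move=> x; exact: stress_le.
Qed.

Lemma stress_dot_convex v w : nice v -> nice w ->
  spow v + p * (stress_dot p v w - stress_dot p v v) <= spow w.
Proof.
move=> nv nw; rewrite !stress_dotE.
have i1 := int1_stress nv nw; have i2 := int1_stress nv nv.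
rewrite -RintB// -RintZ; last exact: int1B.
rewrite /spow -RintD; [|exact: int1_spow|by apply: int1Z; exact: int1B].
apply: Rint_le; [|exact: int1_spow|].
  by apply: int1D; [exact: int1_spow|apply: int1Z; exact: int1B].
by move=> x; rewrite -frob_dotBr; exact: stress_convex.
Qed.

Lemma stress_dot_line v w : nice v -> nice w ->
  (fun k : nat => stress_dot p (k.+1%:R^-1 *: w + v) w) @ \oo --> stress_dot p v w.
Proof.
move=> nv nw; rewrite stress_dotE.
under eq_fun do rewrite stress_dotE.
have nl k : nice (k.+1%:R^-1 *: w + v) by case: (nice_grad_linear k.+1%:R^-1 nw nv).
have [M hM] := sgrad_bounded nv; have [M' hM'] := sgrad_bounded nw.
have lin := ae_all (fun k : nat => sgrad_linear k.+1%:R^-1 nw nv).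
(* The majorant is a constant: the symmetric gradients are bounded by M and M' almost everywhere and
   the step 1/(k+1) is at most 1. *)
have := @Rint_dct _ _ _ (vol D) (fun k x => frob_dot (stress p (sgrad (k.+1%:R^-1 *: w + v) x)) (sgrad w x))
  (fun x => frob_dot (stress p (sgrad v x)) (sgrad w x))
  (fun=> (`|M| + `|M'|) `^ p + `|M'| `^ p).
case => //.
- move=> k; apply: meas_stress => i j; last exact: sgrad_meas.
  exact: (sgrad_meas i j (nice_grad_linear _ nw nv).1).
- by apply: meas_stress => i j; exact: sgrad_meas.
- apply: ae_imp lin => x h; under eq_fun do rewrite h addrC.
  exact: stress_line_cvg.
- exact: int1_cst_vol.
- apply: ae_imp2 (ae_imp2 (fun x => @conj _ _) hM hM') lin => x [h1 h2] h k.
  rewrite h (le_trans (stress_le p_gt1 _ _))// lerD//.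
    apply: ge0_ler_powR; rewrite ?nnegrE ?frob_ge0 ?addr_ge0//.
      by rewrite ltW// (lt_trans ltr01).
    apply: (le_trans (frobD _ _)); rewrite addrC; apply: lerD.
      by rewrite (le_trans h1)// ler_norm.
    rewrite frobZ ger0_norm ?invr_ge0// (le_trans _ (ler_norm M'))//.
    apply: (le_trans _ h2); rewrite ler_piMl ?frob_ge0// invf_le1// ?ltr0Sn//.
    by rewrite (_ : 1 = 1%:R :> R)// ler_nat.
  apply: ge0_ler_powR; rewrite ?nnegrE ?frob_ge0//.
    by rewrite ltW// (lt_trans ltr01).
  by rewrite (le_trans h2)// ler_norm.
Qed.

End stress_fields.

(** * The implicit step in coordinates *)

Section vdot_theory.
Context {R : realType} {r : nat}.
Implicit Types x y z : 'rV[R]_r.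

Lemma vdotC x y : vdot x y = vdot y x.
Proof. by apply: eq_bigr => i _; rewrite mulrC. Qed.

Lemma vdotDr x y z : vdot x (y + z) = vdot x y + vdot x z.
Proof. by rewrite /vdot -big_split; apply: eq_bigr => i _; rewrite mxE mulrDr. Qed.

Lemma vdotZr a x y : vdot x (a *: y) = a * vdot x y.
Proof. by rewrite /vdot mulr_sumr; apply: eq_bigr => i _; rewrite mxE mulrCA. Qed.

Lemma vdotDl x y z : vdot (y + z) x = vdot y x + vdot z x.
Proof. by rewrite !(vdotC _ x) vdotDr. Qed.

Lemma vdotZl a x y : vdot (a *: y) x = a * vdot y x.
Proof. by rewrite !(vdotC _ x) vdotZr. Qed.

Lemma vdotNr x y : vdot x (- y) = - vdot x y.
Proof. by rewrite -scaleN1r vdotZr mulN1r. Qed.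

Lemma vdotNl x y : vdot (- y) x = - vdot y x.
Proof. by rewrite !(vdotC _ x) vdotNr. Qed.

Lemma vdotBr x y z : vdot x (y - z) = vdot x y - vdot x z.
Proof. by rewrite vdotDr vdotNr. Qed.

Lemma vdotBl x y z : vdot (y - z) x = vdot y x - vdot z x.
Proof. by rewrite vdotDl vdotNl. Qed.

Lemma vdot0r x : vdot x 0 = 0.
Proof. by rewrite -(scale0r 0) vdotZr mul0r. Qed.

Lemma vdot_sumr (I : Type) (s : seq I) (Q : pred I) (F : I -> 'rV[R]_r) x :
  vdot x (\sum_(i <- s | Q i) F i) = \sum_(i <- s | Q i) vdot x (F i).
Proof. by elim/big_rec2: _ => [|i y1 y2 _ <-]; [exact: vdot0r|exact: vdotDr]. Qed.

Lemma vdot_suml (I : Type) (s : seq I) (Q : pred I) (F : I -> 'rV[R]_r) x :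
  vdot (\sum_(i <- s | Q i) F i) x = \sum_(i <- s | Q i) vdot (F i) x.
Proof. by rewrite vdotC vdot_sumr; apply: eq_bigr => i _; rewrite vdotC. Qed.

Lemma vdot_ge0 x : 0 <= vdot x x.
Proof. by apply: sumr_ge0 => i _; rewrite -expr2 sqr_ge0. Qed.

Lemma vdot_eq0 x : vdot x x = 0 -> x = 0.
Proof.
move=> /eqP; rewrite psumr_eq0 => [/allP H|i _]; last by rewrite -expr2 sqr_ge0.
apply/rowP => j; rewrite mxE; have := H j; rewrite mem_index_enum => /(_ isT)/=.
by rewrite mulf_eq0 orbb => /eqP.
Qed.

Lemma vdot_young (a : R) x y : 0 < a ->
  vdot x y <= a * vdot x x + (4 * a)^-1 * vdot y y.
Proof.
move=> a0; have := vdot_ge0 (x - (2 * a)^-1 *: y).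
rewrite vdotBr !vdotBl !vdotZr !vdotZl (vdotC y x) => h.
have := mulr_ge0 (ltW a0) h; rewrite -subr_ge0 => h2; rewrite -subr_ge0.
apply: le_trans h2 _; apply/eqW || idtac.
have an0 : a != 0 by rewrite gt_eqF.
apply: eq_le_trans || idtac.
rewrite le_eqVlt; apply/orP; left; apply/eqP; field.
exact: an0.
Qed.

Lemma vdot_sqrD x y : vdot (x + y) (x + y) = vdot x x + 2 * vdot x y + vdot y y.
Proof. by rewrite !vdotDr !vdotDl (vdotC y x); ring. Qed.

Lemma coord_sqr_le x j : x ord0 j ^+ 2 <= vdot x x.
Proof.
rewrite /vdot (bigD1 j)//= -expr2 lerDl sumr_ge0// => i _.
by rewrite -expr2 sqr_ge0.
Qed.

Lemma mx_normP x (c : R) : 0 <= c -> (forall j, `|x ord0 j| <= c) -> `|x| <= c.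
Proof.
move=> c0 h; rewrite /Num.Def.normr/= mx_normrE.
apply: bigmax_le => // -[i j] _ /=; rewrite (ord1 i); exact: h.
Qed.

Lemma coord_le_norm x j : `|x ord0 j| <= `|x|.
Proof.
rewrite /Num.Def.normr/= [leRHS]mx_normrE.
exact: (le_bigmax _ (fun ij : 'I_1 * 'I_r => `|x ij.1 ij.2|) (ord0, j)).
Qed.

Lemma sqr_norm_le_vdot x : `|x| ^+ 2 <= vdot x x.
Proof.
rewrite -[leRHS]sqr_sqrtr ?vdot_ge0// lerXn2r ?nnegrE ?sqrtr_ge0//.
apply: mx_normP; first exact: sqrtr_ge0.
by move=> j; rewrite -sqrtr_sqr ler_wsqrtr// coord_sqr_le.
Qed.

Lemma vdot_le_norm x y : `|vdot x y| <= r%:R * (`|x| * `|y|).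
Proof.
apply: (le_trans (ler_norm_sum _ _ _)).
apply: (@le_trans _ _ (\sum_(i < r) `|x| * `|y|)).
  by apply: ler_sum => i _; rewrite normrM ler_pM// coord_le_norm.
by rewrite sumr_const card_ord mulr_natl.
Qed.

Lemma rV_continuous (V : normedModType R) (f : 'rV[R]_r -> V) :
  (forall x (e : R), 0 < e -> exists2 d, 0 < d & forall y, `|x - y| < d -> `|f x - f y| <= e) ->
  continuous f.
Proof.
move=> H x A /nbhs_ballP[e /= e0 be].
have e20 : 0 < e / 2 by rewrite divr_gt0.
have [d d0 hd] := H x _ e20.
apply/nbhs_ballP; exists d => //= y; rewrite -ball_normE /= => xy.
apply: be; rewrite -ball_normE /=; apply: (le_lt_trans (hd y xy)).
by rewrite ltr_pdivrMr// mulr_natr mulr2n ltrDl.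
Qed.

Lemma vdot_continuous x : continuous (vdot x).
Proof.
apply: rV_continuous => y e e0.
have d0 : 0 < e / (r%:R * `|x| + 1) by rewrite divr_gt0// ltr_wpDl// mulr_ge0.
exists (e / (r%:R * `|x| + 1)) => // z yz.
rewrite -vdotBr (le_trans (vdot_le_norm _ _))// mulrA.
apply: (@le_trans _ _ ((r%:R * `|x|) * (e / (r%:R * `|x| + 1)))).
  by rewrite ler_wpM2l ?mulr_ge0// ltW.
by rewrite mulrA ler_pdivrMr ?ltr_wpDl ?mulr_ge0// mulrC ler_pM2l// lerDl.
Qed.

Lemma vdot_self_continuous : continuous (fun x : 'rV[R]_r => vdot x x).
Proof.
apply: rV_continuous => x e e0.
have b0 : 0 <= r%:R * (2 * `|x| + 1) by rewrite mulr_ge0// addr_ge0// mulr_ge0.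
have d0 : 0 < e / (r%:R * (2 * `|x| + 1) + 1) by rewrite divr_gt0// ltr_wpDl.
exists (Num.min 1 (e / (r%:R * (2 * `|x| + 1) + 1))) => [|y].
  by rewrite lt_min ltr01.
rewrite lt_min => /andP[xy1 xy].
have -> : vdot x x - vdot y y = vdot (x - y) (x + y).
  by rewrite vdotBl !vdotDr (vdotC y x); ring.
apply: (le_trans (vdot_le_norm _ _)).
have h : `|x + y| <= 2 * `|x| + 1.
  have -> : x + y = 2 *: x - (x - y) by apply/rowP => j; rewrite !mxE; ring.
  by rewrite (le_trans (ler_normB _ _))// lerD ?(ltW xy1)// normrZ ger0_norm.
apply: (@le_trans _ _ ((e / (r%:R * (2 * `|x| + 1) + 1)) * (r%:R * (2 * `|x| + 1)))).
  by rewrite mulrCA ler_pM ?mulr_ge0 ?(ltW xy)// ler_wpM2l.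
by rewrite mulrAC ler_pdivrMr ?ltr_wpDl// ler_pM2l// lerDl.
Qed.

End vdot_theory.

(** * Existence, uniqueness and continuity of the resolvent *)

Section resolvent.
Context {R : realType} {r : nat} (p : R) (p_gt0 : 0 < p).
Variables (A : 'rV[R]_r -> 'rV[R]_r) (Phi : 'rV[R]_r -> R).
Hypothesis Phi_ge0 : forall c, 0 <= Phi c.
Hypothesis A_sub : forall c y, Phi c + p * vdot (A c) (y - c) <= Phi y.
Hypothesis A_le : forall c y, `|vdot (A c) y| <= Phi c + Phi y.
Hypothesis Phi_bounded : forall rho : R, exists M : R, forall c, `|c| <= rho -> Phi c <= M.
Hypothesis A_line : forall c y,
  (fun k : nat => vdot (A (k.+1%:R^-1 *: y + c)) y) @ \oo --> vdot (A c) y.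

Lemma A_mono c y : 0 <= vdot (A c - A y) (c - y).
Proof.
have h1 := A_sub c y; have h2 := A_sub y c.
rewrite vdotBl -(pmulr_rge0 _ p_gt0) mulrBr.
move: h1; rewrite -(opprB c y) vdotNr mulrN; move: h2; lra.
Qed.

(** [A_le] is not homogeneous in its second argument; applied to the normalised vector it becomes a
    bound linear in z. *)
Lemma A_bounded rho : exists M : R, 0 <= M /\ forall c z, `|c| <= rho -> `|vdot (A c) z| <= M * `|z|.
Proof.
have [M1 h1] := Phi_bounded rho; have [M2 h2] := Phi_bounded 1.
exists (`|M1| + `|M2|); split; first by rewrite addr_ge0.
move=> c z /h1 h; have [->|z0] := eqVneq z 0; first by rewrite vdot0r !normr0 mulr0.
have zp : 0 < `|z| by rewrite normr_gt0.
have := A_le c (`|z|^-1 *: z); rewrite vdotZr normrM gtr0_norm ?invr_gt0//.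
rewrite ler_pdivrMl// => /le_trans; apply; rewrite mulrC ler_wpM2r//.
rewrite lerD//; first by rewrite (le_trans h)// ler_norm.
rewrite (le_trans _ (ler_norm _))// h2//.
by rewrite normrZ gtr0_norm ?invr_gt0// mulVf// gt_eqF.
Qed.

(** The subgradient inequality, used in both directions, bounds the variation of Phi by that of its
    argument times p times a local bound of A, so Phi is locally Lipschitz. *)
Lemma Phi_continuous : continuous Phi.
Proof.
apply: rV_continuous => c e e0; have [M [M0 hM]] := A_bounded (`|c| + 1).
have d0 : 0 < e / (p * M + 1) by rewrite divr_gt0// ltr_wpDl// mulr_ge0// ltW.
exists (Num.min 1 (e / (p * M + 1))) => [|y]; first by rewrite lt_min ltr01.
rewrite lt_min => /andP[/ltW xy1 /ltW cy].
have cy1 : `|y| <= `|c| + 1.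
  have -> : y = c - (c - y) by rewrite opprB addrC subrK.
  by rewrite (le_trans (ler_normB _ _))// lerD2l.
have h1 := A_sub c y; have h2 := A_sub y c.
have b1 := hM c (y - c) _; have b2 := hM y (c - y) cy1.
rewrite distrC in b1.
have {}b1 := b1 (ler_wpDr ler01 (lexx _)).
have b3 : p * M * `|c - y| <= e.
  apply: (@le_trans _ _ (p * M * (e / (p * M + 1)))).
    by rewrite ler_wpM2l// mulr_ge0// ltW.
  by rewrite mulrA ler_pdivrMr ?ltr_wpDl ?mulr_ge0 ?(ltW p_gt0)// mulrC ler_pM2l// lerDl.
have c1 := ler_wpM2l (ltW p_gt0) (lerNnormlW b2).
have c2 := ler_wpM2l (ltW p_gt0) b1.
have c3 := ler_wpM2l (ltW p_gt0) (lerNnormlW b1).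
rewrite ler_distl; apply/andP; split; lra.
Qed.

Variables (tau : R) (tau_gt0 : 0 < tau).

(* By [A_sub], p A c is a subgradient of Phi at c, so the equation is the
   Euler-Lagrange equation of the coercive functional J below. *)
Lemma resolvent_exists g : exists c, c + tau *: A c = g.
Proof.
pose J c := 2^-1 * vdot c c + tau / p * Phi c - vdot g c.
have cJ : continuous J.
  move=> y; have c1 := @cst_continuous 'rV[R]_r R^o 2^-1 y.
  have c2 := @cst_continuous 'rV[R]_r R^o (tau / p) y.
  have := (continuousB (continuousD (continuousM c1 (vdot_self_continuous (x := y)))
    (continuousM c2 (Phi_continuous (x := y)))) (@vdot_continuous R r g y)).
  by congr (continuous_at y _).
pose K0 := tau / p * Phi 0.
have K00 : 0 <= K0 by rewrite mulr_ge0// divr_ge0// ltW.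
(* Beyond this radius the quadratic term of [J] beats the linear one by more than [K0], the value of
   [J] at 0, so a minimum over the ball is global. *)
pose rho := 2 * (r%:R * `|g|) + 2 * K0 + 2.
have rg0 : 0 <= r%:R * `|g| by rewrite mulr_ge0.
pose B : set 'rV[R]_r := [set c | `|c| <= rho].
have cB : compact B.
  apply: bounded_closed_compact.
    by exists rho; split; [exact: num_real|move=> M hM x /le_trans; apply; exact: ltW].
  have -> : B = (fun x : 'rV[R]_r => `|x|) @^-1` [set t : R | t <= rho] by [].
  by apply: closed_comp => [x _|]; [exact: norm_continuous|exact: closed_le].
have B0 : B !=set0 by exists 0; rewrite /B /= normr0 /rho; lra.
have [c Bc cmin] := EVT_min_rV B0 cB (continuous_subspaceT cJ).
have gmin y : J c <= J y.
  have [By|By] := leP `|y| rho; first by apply: cmin; rewrite inE.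
  apply: (@le_trans _ _ (J 0)); first by apply: cmin; rewrite inE /B /= normr0 /rho; lra.
  rewrite /J !vdot0r mulr0 add0r subr0 -/K0.
  have h1 := sqr_norm_le_vdot y; have h2 := vdot_le_norm g y.
  have h3 : 0 <= tau / p * Phi y by rewrite mulr_ge0// divr_ge0// ltW.
  have h4 := le_trans (ler_norm _) h2.
  move: By; rewrite /rho; set a := `|y| in h1 h4 *; set b := r%:R * `|g| in rg0 *.
  move=> By; have h5 : r%:R * (`|g| * a) = b * a by rewrite mulrA.
  rewrite h5 in h4; have a1 : 2 <= a by lra.
  have : (K0 + 1) * a <= 2^-1 * a ^+ 2 - b * a by nra.
  have : K0 <= (K0 + 1) * a by nra.
  lra.
exists c; apply/eqP; rewrite -subr_eq0; apply/eqP; apply: vdot_eq0.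
(* Minimality along c + t y with t = 1/(k+1): the subgradient at the moved point bounds the growth
   of Phi from above, and [A_line] passes to the limit. Testing with both signs of the residual
   annihilates it. *)
have key y : 0 <= vdot (c + tau *: A c - g) y.
  have lim1 : (fun k : nat => (vdot c y + k.+1%:R^-1 * vdot y y) +
      tau * vdot (A (k.+1%:R^-1 *: y + c)) y - vdot g y) @ \oo -->
      (vdot c y + 0 * vdot y y) + tau * vdot (A c) y - vdot g y.
    apply: cvgB; last exact: cvg_cst.
    apply: cvgD; last by apply: cvgMr; exact: A_line.
    apply: cvgD; first exact: cvg_cst.
    by apply: cvgMl; exact: cvg_harmonic.
  rewrite vdotBl vdotDl vdotZl; rewrite mul0r addr0 in lim1.
  apply: (cvgr_to_ge lim1); apply: nearW => k.
  set t : R := k.+1%:R^-1; have t0 : 0 < t by rewrite invr_gt0.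
  have := gmin (t *: y + c); have := A_sub (t *: y + c) c.
  rewrite opprD addrCA subrr addr0 vdotNr vdotZr /J => h1 h2.
  have h3 : tau / p * Phi (t *: y + c) <= tau / p * Phi c + tau * t * vdot (A (t *: y + c)) y.
    have tp : 0 <= tau / p by rewrite divr_ge0// ltW.
    have := ler_wpM2l tp h1.
    have -> : tau / p * (Phi (t *: y + c) + p * - (t * vdot (A (t *: y + c)) y)) =
      tau / p * Phi (t *: y + c) - tau * t * vdot (A (t *: y + c)) y by field; rewrite gt_eqF.
    lra.
  rewrite -(pmulr_rge0 _ t0).
  move: h2 h3; rewrite vdot_sqrD !vdotDr !vdotZr !vdotZl (vdotC y c).
  have := mulr_ge0 (mulr_ge0 (ltW t0) (ltW t0)) (vdot_ge0 y).
  set a := vdot (A _) y; set b := vdot y y; set e := vdot c y; set f := vdot g y.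
  set P1 := tau / p * _; set P2 := tau / p * _; set q := vdot g c; set q' := vdot c c.
  nra.
have h1 := key (c + tau *: A c - g); have h2 := key (- (c + tau *: A c - g)).
by apply/eqP; rewrite eq_le h1 andbT -oppr_ge0 -vdotNr.
Qed.

Definition resolvent g : 'rV[R]_r := xget 0 [set c | c + tau *: A c = g].

Lemma resolventP g : resolvent g + tau *: A (resolvent g) = g.
Proof. by have [c hc] := resolvent_exists g; apply: (@xgetPex _ 0 [set c | c + tau *: A c = g]); exists c. Qed.

(** When the square on the right is expanded, monotonicity of A makes the mixed term nonnegative. *)
Lemma resolvent_contract c c' :
  vdot (c - c') (c - c') <= vdot (c + tau *: A c - (c' + tau *: A c'))
                                 (c + tau *: A c - (c' + tau *: A c')).
Proof.
have -> : c + tau *: A c - (c' + tau *: A c') = (c - c') + tau *: (A c - A c').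
  by rewrite scalerBr opprD addrACA.
rewrite (vdot_sqrD (c - c')) !vdotZr vdotZl.
have := A_mono c c'; rewrite vdotC => h1; have := vdot_ge0 (A c - A c') => h2.
have h3 := mulr_ge0 (ltW tau_gt0) h1.
have h4 := mulr_ge0 (ltW tau_gt0) (mulr_ge0 (ltW tau_gt0) h2).
rewrite -addrA lerDl addr_ge0// mulr_ge0//.
Qed.

Lemma resolvent_unique c g : c + tau *: A c = g -> c = resolvent g.
Proof.
move=> cg; have := resolvent_contract c (resolvent g).
rewrite cg resolventP subrr vdot0r => h; apply/eqP; rewrite -subr_eq0; apply/eqP.
by apply: vdot_eq0; apply/eqP; rewrite eq_le h vdot_ge0.
Qed.

Lemma resolvent_continuous : continuous resolvent.
Proof.
apply: rV_continuous => g e e0.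
have d0 : 0 < e / (r%:R + 1) by rewrite divr_gt0// ltr_wpDl.
exists (e / (r%:R + 1)) => // y /ltW cy.
rewrite -(@ler_pXn2r _ 2)// ?nnegrE ?(ltW e0)//.
apply: (le_trans (sqr_norm_le_vdot _)).
have := resolvent_contract (resolvent g) (resolvent y); rewrite !resolventP.
move/le_trans; apply; apply: (le_trans (ler_norm _)); apply: (le_trans (vdot_le_norm _ _)).
(* The norm of rows is the sup norm, for which |x|^2 <= x . x <= r |x|^2; the factor r is absorbed
   by (r + 1)^2. *)
rewrite -expr2; apply: (@le_trans _ _ (r%:R * (e / (r%:R + 1)) ^+ 2)).
  by rewrite ler_wpM2l// lerXn2r// ?nnegrE// ltW.
rewrite exprMn exprVn mulrCA -[leRHS]mulr1 ler_wpM2l ?sqr_ge0//.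
rewrite ler_pdivrMr ?exprn_gt0 ?ltr_wpDl// mul1r.
have : 0 <= r%:R :> R by []; nra.
Qed.

End resolvent.

(** * Orthonormal bases of the discretely divergence-free fields *)

Section divergence_free.
Context {R : realType} {n : nat} (D : lipschitz_domain R n).
Variables (V : set (vfield D)) (Q : set (L2 D)).
Implicit Types v w : vfield D.
Hypothesis hV : velocity_space V.

Lemma velocity_nice v : V v -> nice v.
Proof. by move=> Vv; apply: W1inf_nice; case: (hV.2 _ Vv). Qed.

Lemma velocity_linear a v w : V v -> V w -> V (a *: v + w).
Proof.
have [[m [b hb]] _] := hV => /hb[c hc] /hb[c' hc']; apply/hb.
exists (fun i => a * c i + c' i) => i.
apply: ae_imp2 (hc i) (hc' i) => x e1 e2.
rewrite vfDE vfZE e1 e2 !vf_sumE mulr_sumr -big_split; apply: eq_bigr => j _ /=.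
by rewrite (vfZE (c j)) (vfZE (c' j)) (vfZE (a * c j + c' j)) mulrDl mulrA.
Qed.

Lemma velocity0 : V 0.
Proof.
have [[m [b hb]] _] := hV; apply/hb; exists (fun=> 0) => i.
by apply: aeW => x; rewrite vf0E vf_sumE big1// => j _; rewrite vfZE mul0r.
Qed.

Local Notation Vd := (div_free V Q).

Lemma div_nice v : Vd v -> nice v. Proof. by move=> [/velocity_nice]. Qed.

Lemma int1_qdiv (q : L2 D) v : nice v -> int1 (vol D) (fun x => q x * \tr (grad v x)).
Proof.
move=> [_ mv [M hM]]; apply: int2_mul; first by apply/int2_Lfun; exact: LfunP.
apply: (int2_bounded (M := n%:R * M)).
  by apply: measurable_sum => i; exact: mv.
apply: ae_imp hM => x h; rewrite /mxtrace (le_trans (ler_norm_sum _ _ _))//.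
rewrite (le_trans (ler_sum _ (fun i _ => h i i)))// sumr_const card_ord.
by rewrite mulr_natl.
Qed.

Lemma div_linear a v w : Vd v -> Vd w -> Vd (a *: v + w).
Proof.
move=> [Vv dv] [Vw dw]; split; first exact: velocity_linear.
move=> q Qq; have nv := velocity_nice Vv; have nw := velocity_nice Vw.
have [nl hl] := nice_grad_linear a nv nw.
transitivity (\int[vol D]_x (a * (q x * \tr (grad v x)) + q x * \tr (grad w x))).
  have i1 := int1_qdiv q nl.
  have i2 := int1D (int1Z a (int1_qdiv q nv)) (int1_qdiv q nw).
  apply: Rint_ae; [exact: int1_meas i1|exact: int1_meas i2|].
  by apply: ae_imp hl => x ->; rewrite mxtraceD mxtraceZ; ring.
rewrite RintD; [|by apply: int1Z; exact: int1_qdiv|exact: int1_qdiv].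
by rewrite RintZ ?dv ?dw// ?mulr0 ?addr0//; exact: int1_qdiv.
Qed.

Lemma div0 : Vd 0.
Proof.
split; first exact: velocity0.
move=> q Qq; transitivity (\int[vol D]_x (0 : R)); last exact: Rint_zero.
apply: Rint_ae => //; first exact: int1_meas (int1_qdiv q (nice0 D).1).
by apply: ae_imp (nice0 D).2 => x ->; rewrite mxtrace0 mulr0.
Qed.

Lemma divZ a v : Vd v -> Vd (a *: v).
Proof. by move=> dv; have := div_linear a dv div0; rewrite addr0. Qed.

Lemma divB v w : Vd v -> Vd w -> Vd (v - w).
Proof. by move=> dv dw; have := div_linear (-1) dw dv; rewrite scaleN1r addrC. Qed.

Lemma div_sum (I : Type) (s : seq I) (c : I -> R) (b : I -> vfield D) :
  (forall i, Vd (b i)) -> Vd (\sum_(i <- s) c i *: b i).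
Proof.
move=> hb; elim: s => [|i s ih]; first by rewrite big_nil; exact: div0.
by rewrite big_cons; exact: (div_linear (c i) (hb i) ih).
Qed.

Definition orthonormal_in r (o : 'I_r -> vfield D) :=
  (forall j, Vd (o j)) /\ forall j k, fdot (o j) (o k) = (j == k)%:R.

(** In terms of the spanning family the orthonormality relations read M G M^T = 1 with M of size r x
    m, so a rank comparison gives r <= m. A family b with dependent members is allowed. *)
Lemma orthonormal_size m (b : 'I_m -> vfield D) r (o : 'I_r -> vfield D) :
  (forall v, V v <-> exists c : 'I_m -> R, vfield_eq v (\sum_i c i *: b i)) ->
  orthonormal_in o -> (r <= m)%N.
Proof.
move=> hb [ho onE].
have [C hC] := choice (fun j => (hb (o j)).1 (ho j).1).
pose M : 'M[R]_(r, m) := \matrix_(j, i) C j i.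
pose G : 'M[R]_m := \matrix_(i, l) fdot (b i) (b l).
have e : M *m G *m M^T = 1%:M.
  apply/matrixP => j k; rewrite !mxE -onE (fdot_eq (hC j) (hC k)) fdot_sumr.
  apply: eq_bigr => l _; rewrite fdotZr fdot_suml !mxE mulr_suml mulr_sumr.
  by apply: eq_bigr => i _; rewrite !mxE fdotZl; ring.
rewrite -(mxrank1 R r) -e; apply: leq_trans (mxrankM_maxl _ _) _.
by apply: leq_trans (mxrankM_maxl _ _) _; exact: rank_leq_col.
Qed.

(** An orthonormal family of maximal size, which exists by [orthonormal_size], spans: otherwise the
    normalised residual of some field would extend it. Equality is up to null sets, as in
    [fin_dim]. *)
Lemma orthonormal_basis : exists r (o : 'I_r -> vfield D), orthonormal_in o /\
  forall v, Vd v -> vfield_eq v (\sum_j fdot v (o j) *: o j).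
Proof.
have [[m [b hb]] _] := hV.
pose P r := `[< exists o : 'I_r -> vfield D, orthonormal_in o >].
have P0 : exists r, P r.
  by exists 0%N; apply/asboolP; exists (fun=> 0); split => -[].
have Pm r : P r -> (r <= m)%N by move=> /asboolP [f hf]; exact: (orthonormal_size hb hf).
have [r /asboolP [ o [ho onE]] rmax] := ex_maxnP P0 Pm.
exists r, o; split => // v dv.
pose w := v - \sum_j fdot v (o j) *: o j.
have dw : Vd w := divB dv (div_sum (index_enum 'I_r) (fun j => fdot v (o j)) ho).
have wo k : fdot w (o k) = 0.
  rewrite fdotBl fdot_suml (bigD1 k)//= fdotZl onE eqxx mulr1 big1 ?addr0 ?subrr// => j jk.
  by rewrite fdotZl onE (negbTE jk) mulr0.
apply: fnormsq_eq0; apply: contrapT => w0; move/eqP: w0 => w0.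
have wp : 0 < fnormsq w by rewrite lt_neqAle eq_sym w0 fnormsq_ge0.
have wn : 0 < fnorm w by rewrite sqrtr_gt0.
pose o' (j : 'I_r.+1) := if unlift ord_max j is Some k then o k else (fnorm w)^-1 *: w.
suff : P r.+1 by move/rmax; rewrite ltnn.
apply/asboolP; exists o'; split.
  by move=> j; rewrite /o'; case: unliftP => [k _|_]; [exact: (ho k)|exact: (divZ _ dw)].
move=> j k; rewrite /o'; case: unliftP => [j' ->|->]; case: unliftP => [k' ->|->].
- by rewrite onE (inj_eq lift_inj).
- by rewrite fdotC fdotZl wo mulr0 eq_sym (negbTE (neq_lift _ _)).
- by rewrite fdotZl wo mulr0 (negbTE (neq_lift _ _)).
- rewrite fdotZl fdotZr eqxx -/(fnormsq w) -sqr_fnorm.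
  have n0 : fnorm w != 0 by rewrite gt_eqF.
  by rewrite (_ : true%:R = 1 :> R)//; field.
Qed.

End divergence_free.

(** * Galerkin coordinates *)

Section coordinates.
Context {R : realType} {n : nat} (D : lipschitz_domain R n).
Variables (V : set (vfield D)) (Q : set (L2 D)).
Hypothesis hV : velocity_space V.
Variables (r : nat) (o : 'I_r -> vfield D).
Hypothesis ho : orthonormal_in V Q o.
Hypothesis basis : forall v, div_free V Q v -> vfield_eq v (\sum_j fdot v (o j) *: o j).
Local Notation Vd := (div_free V Q).

Definition comb (c : 'rV[R]_r) : vfield D := \sum_j c ord0 j *: o j.
Definition coords (v : vfield D) : 'rV[R]_r := \row_j fdot v (o j).

Lemma comb_div c : Vd (comb c).
Proof. exact: (div_sum hV (index_enum 'I_r) (fun j => c ord0 j) ho.1). Qed.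

Lemma comb_nice c : nice (comb c).
Proof. exact: (div_nice hV (comb_div c)). Qed.

Lemma combP v : Vd v -> vfield_eq v (comb (coords v)).
Proof.
by move=> /basis; rewrite /comb; under [in X in _ -> X]eq_bigr do rewrite mxE.
Qed.

Lemma fdot_comb v c : fdot v (comb c) = vdot (coords v) c.
Proof.
rewrite /comb fdot_sumr; apply: eq_bigr => j _.
by rewrite fdotZr mxE mulrC.
Qed.

Lemma coords_comb c : coords (comb c) = c.
Proof.
apply/rowP => k; rewrite mxE /comb fdot_suml (bigD1 k)//= fdotZl ho.2 eqxx mulr1.
by rewrite big1 ?addr0// => j jk; rewrite fdotZl ho.2 (negbTE jk) mulr0.
Qed.

Lemma fnormsq_coords v : Vd v -> fnormsq v = vdot (coords v) (coords v).
Proof.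
by move=> dv; rewrite -fdot_comb; exact: (fdot_eq (fun i => aeW _ (fun=> erefl)) (combP dv)).
Qed.

(** Bessel's inequality. The field is arbitrary because it is also applied to the columns of the
    noise operator, which need not be discrete. *)
Lemma coords_le v : vdot (coords v) (coords v) <= fnormsq v.
Proof.
have := fnormsq_ge0 (v - comb (coords v)); rewrite fnormsqB fdot_comb.
rewrite (fnormsq_coords (comb_div _)) coords_comb; lra.
Qed.

Lemma comb_linear a c c' : comb (a *: c + c') = a *: comb c + comb c'.
Proof.
rewrite /comb scaler_sumr -big_split; apply: eq_bigr => j _ /=.
by rewrite !mxE scalerA scalerDl.
Qed.

Lemma combB c c' : comb (c - c') = comb c - comb c'.
Proof. by rewrite addrC -scaleN1r comb_linear scaleN1r addrC. Qed.

Variables (p : R) (p_gt1 : 1 < p).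

Definition stress_mx (c : 'rV[R]_r) : 'rV[R]_r := \row_j stress_dot p (comb c) (o j).

Lemma stress_mxE c y : vdot (stress_mx c) y = stress_dot p (comb c) (comb y).
Proof.
have ns := comb_nice c.
have no j : nice (o j) := div_nice hV (ho.1 j).
rewrite [comb y]/comb /vdot; elim: (index_enum _) => [|j s ih].
  rewrite !big_nil; have n0 := (nice0 D).1.
  have := stress_dot_linear p_gt1 (-1) ns n0 n0.
  rewrite scaler0 addr0 mulN1r addNr => ->//.
rewrite !big_cons (stress_dot_linear p_gt1 _ ns (no j)); last first.
  by case: (nice_sum s (fun j => y ord0 j) no).
by rewrite -ih mxE mulrC.
Qed.

Lemma stress_sub c y : spow p (comb c) + p * vdot (stress_mx c) (y - c) <= spow p (comb y).
Proof.
rewrite vdotBr !stress_mxE; exact: (stress_dot_convex p_gt1 (comb_nice c) (comb_nice y)).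
Qed.

Lemma stress_mx_le c y : `|vdot (stress_mx c) y| <= spow p (comb c) + spow p (comb y).
Proof. by rewrite stress_mxE; exact: (stress_dot_le p_gt1 (comb_nice c) (comb_nice y)). Qed.

Lemma stress_mx_self c : vdot (stress_mx c) c = spow p (comb c).
Proof. by rewrite stress_mxE stress_dot_self//; exact: comb_nice. Qed.

Lemma stress_mx_line c y :
  (fun k : nat => vdot (stress_mx (k.+1%:R^-1 *: y + c)) y) @ \oo --> vdot (stress_mx c) y.
Proof.
have -> : (fun k : nat => vdot (stress_mx (k.+1%:R^-1 *: y + c)) y) =
    (fun k : nat => stress_dot p (k.+1%:R^-1 *: comb y + comb c) (comb y)).
  by apply/funext => k; rewrite stress_mxE comb_linear.
rewrite stress_mxE.
exact: (stress_dot_line p_gt1 (comb_nice c) (comb_nice y)).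
Qed.

(** The symmetric gradients of the basis fields are bounded. The bound depends on the basis, hence
    on h; it serves existence and continuity only and never reaches the stability constant. *)
Lemma spow_comb_bounded rho : exists M : R, forall c, `|c| <= rho -> spow p (comb c) <= M.
Proof.
have no j : nice (o j) := div_nice hV (ho.1 j).
have [M hM] := choice (fun j => sgrad_bounded (no j)).
pose K := \sum_j `|rho| * `|M j|.
exists (\int[vol D]_x (K `^ p)) => c cr; rewrite /spow.
apply: Rint_le_ae; [exact: (int1_spow p_gt1 (comb_nice c))|exact: int1_cst_vol|].
have [_ hl] := nice_sum (index_enum 'I_r) (fun j => c ord0 j) no.
apply: ae_imp2 hl (ae_all hM) => x e h.
apply: ge0_ler_powR; rewrite ?nnegrE ?frob_ge0//.
- by rewrite ltW// (lt_trans ltr01).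
- by rewrite sumr_ge0// => j _; rewrite mulr_ge0.
rewrite /sgrad /comb e.
have -> : 2^-1 *: (\sum_j c ord0 j *: grad (o j) x + (\sum_j c ord0 j *: grad (o j) x)^T) =
    \sum_j c ord0 j *: sgrad (o j) x.
  rewrite linear_sum/= -big_split scaler_sumr; apply: eq_bigr => j _ /=.
  by rewrite /sgrad linearZ/= -scalerDr !scalerA mulrC.
rewrite /K; elim: (index_enum _) => [|j s ih]; first by rewrite !big_nil frob0.
rewrite !big_cons (le_trans (frobD _ _))// lerD// frobZ ler_pM ?frob_ge0//.
  by rewrite (le_trans (coord_le_norm _ _))// (le_trans cr)// ler_norm.
by rewrite (le_trans (h j))// ler_norm.
Qed.

Lemma stress_dot_coords v w : Vd v -> Vd w ->
  stress_dot p v w = vdot (stress_mx (coords v)) (coords w).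
Proof.
by move=> dv dw; rewrite stress_mxE; exact: (stress_dot_eq p (combP dv) (combP dw)).
Qed.

End coordinates.

(** * Wiener increments *)

Section normal_moments.
Context {R : realType}.
Local Notation mu := (@lebesgue_measure R).

(** Both the density and the Radon-Nikodym derivative integrate to the normal probability over every
    measurable set, so they agree almost everywhere. *)
Lemma ge0_integral_normal_prob (m s : R) (f : R -> \bar R) :
  measurable_fun setT f -> (forall x, 0 <= f x)%E ->
  (\int[normal_prob m s]_x f x = \int[mu]_x (f x * (normal_pdf m s x)%:E))%E.
Proof.
move=> mf f0.
have dom := normal_prob_dominates m s.
rewrite -(@Radon_Nikodym_SigmaFinite.change_of_variables _ _ _ _ _ dom)//.
have RN := Radon_Nikodym_SigmaFinite.f_integrable dom.
apply: ae_eq_integral => //.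
- by apply: emeasurable_funM => //; exact: measurable_int RN.
- apply: emeasurable_funM => //; apply/measurable_EFinP; exact: measurable_normal_pdf.
- apply: ae_eqe_mul2l => /=; apply: integral_ae_eq => //.
  + by apply/measurable_EFinP; exact: measurable_normal_pdf.
  + by move=> E _ mE; rewrite -Radon_Nikodym_SigmaFinite.f_integral.
Qed.

Lemma int1_normal_prob (m s : R) (f : R -> R) : measurable_fun setT f ->
  int1 (normal_prob m s) f <-> int1 mu (fun x => f x * normal_pdf m s x).
Proof.
move=> mf; have e : (\int[normal_prob m s]_x `|f x|%:E =
   \int[mu]_x `|f x * normal_pdf m s x|%:E)%E.
  rewrite ge0_integral_normal_prob//; last first.
    by apply/measurable_EFinP; exact: measurableT_comp.
  by apply: eq_integral => x _; rewrite -EFinM normrM (ger0_norm (normal_pdf_ge0 _ _ _)).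
split=> /int1_lty h; apply: int1P => //; [|by rewrite -e|by rewrite e].
by apply: measurable_funM => //; exact: measurable_normal_pdf.
Qed.

(* This is 1, but only its finiteness matters. *)
Definition gauss2 : R := \int[normal_prob 0 1]_x (x ^+ 2).

(** With z = x^2/4, z exp(-z) <= 1 gives x^2 exp(-x^2/2) <= 4 exp(-x^2/4), a multiple of the normal
    density of variance 2. *)
Lemma int2_normal1 : int2 (normal_prob 0 1) (id : R -> R).
Proof.
split => //; apply/int1_normal_prob => //.
pose s : R := Num.sqrt 2.
have s0 : s != 0 by rewrite sqrtr_eq0 -ltNge.
have s2 : s ^+ 2 = 2 by rewrite sqr_sqrtr.
have ip : int1 mu (normal_pdf 0 s) := integrable_normal_pdf 0 s.
pose K := 4 * (normal_peak 1 / normal_peak s).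
have mf : measurable_fun setT (fun x : R => x ^+ 2 * normal_pdf 0 1 x).
  by apply: measurable_funM; [exact: measurable_funX|exact: measurable_normal_pdf].
suff le x : `|x ^+ 2 * normal_pdf 0 1 x| <= K * normal_pdf 0 s x.
  exact: (@int1_le _ _ _ mu _ (fun x => K * normal_pdf 0 s x) mf le (int1Z K ip)).
rewrite ger0_norm; last by rewrite mulr_ge0 ?sqr_ge0// normal_pdf_ge0.
rewrite (normal_pdfE _ s0) (normal_pdfE _ (oner_neq0 _)) /normal_fun subr0 s2 expr1n.
have pn0 : normal_peak s != 0 by rewrite gt_eqF// normal_peak_gt0.
rewrite /K [leRHS](_ : _ = normal_peak 1 * (4 * expR (- x ^+ 2 / (2 *+ 2)))); last by field.
rewrite mulrCA ler_wpM2l ?normal_peak_ge0//.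
pose z := x ^+ 2 / 4.
have -> : - x ^+ 2 / (1 *+ 2) = - z + - z by rewrite /z mulr2n; field.
have -> : - x ^+ 2 / (2 *+ 2) = - z by rewrite /z mulr2n; field.
have -> : x ^+ 2 = 4 * z by rewrite /z; field.
rewrite expRD -mulrA ler_pM2l// mulrA ler_piMl ?expR_ge0//.
by rewrite expRN ler_pdivrMr ?expR_gt0// mul1r (le_trans _ (expR_ge1Dx z))// lerDr.
Qed.

(** The substitution x = s y reduces the integral to the standard normal law, whose second moment is
    kept as the constant [gauss2]. *)
Lemma normal_second_moment (s : R) : 0 < s ->
  int2 (normal_prob 0 s) (id : R -> R) /\
  \int[normal_prob 0 s]_x (x ^+ 2) = s ^+ 2 * gauss2.
Proof.
move=> s0; have sn0 : s != 0 by rewrite gt_eqF.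
have e : (\int[normal_prob 0 s]_x (x ^+ 2)%:E = (s ^+ 2 * gauss2)%:E)%E.
  rewrite ge0_integral_normal_prob//; last 2 first.
  - by apply/measurable_EFinP; exact: measurable_funX.
  - by move=> x; rewrite lee_fin sqr_ge0.
  under eq_integral do rewrite -EFinM.
  have d1 (x : R) : is_derive x 1 (fun y : R => s * y) s.
    by apply: is_derive_eq (is_deriveM (is_derive_cst s x 1) (is_derive_id x 1)) _; rewrite /GRing.scale/= /cst; ring.
  have F'E : derive1 (fun y : R => s * y) = cst s.
    by apply/funext => x; rewrite derive1E; case: (d1 x).
  rewrite (@increasing_ge0_integration_by_substitutionT _ (fun y => s * y)); first last.
  - by move=> x; rewrite mulr_ge0 ?sqr_ge0// normal_pdf_ge0.
  - move=> x; apply: cvgM; first exact: sqr_continuous.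
    exact: continuous_normal_pdf.
  - by apply/gt0_cvgMry => //; exact: cvg_id.
  - by apply/gt0_cvgMrNy => //; exact: cvg_id.
  - by move=> x; case: (d1 x).
  - by rewrite F'E; exact: is_cvg_cst.
  - by rewrite F'E; exact: is_cvg_cst.
  - by rewrite F'E => ?; exact: cvg_cst.
  - by move=> x y xy; rewrite ltr_pM2l.
  rewrite /gauss2 EFinM RintE; last by case: int2_normal1.
  rewrite ge0_integral_normal_prob//; last 2 first.
  - by apply/measurable_EFinP; exact: measurable_funX.
  - by move=> x; rewrite lee_fin sqr_ge0.
  rewrite -ge0_integralZl//; last 3 first.
  - by apply/measurable_EFinP; apply: measurable_funM; [exact: measurable_funX|exact: measurable_normal_pdf].
  - by move=> x _; rewrite lee_fin mulr_ge0 ?sqr_ge0// normal_pdf_ge0.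
  - by rewrite lee_fin sqr_ge0.
  apply: eq_integral => x _; rewrite F'E -!EFinM /= (normal_pdfE _ sn0) (normal_pdfE _ (oner_neq0 _)).
  congr EFin.
  transitivity ((s * x) ^+ 2 * (normal_peak s * normal_fun 0 s (s * x)) * s) => //.
  rewrite /normal_fun !subr0 expr1n.
  have -> : - (s * x) ^+ 2 / (s ^+ 2 *+ 2) = - x ^+ 2 / (1 *+ 2) by field.
  have -> : normal_peak 1 = normal_peak s * s.
    rewrite /normal_peak expr1n mul1r -(mulr_natr (s ^+ 2 * pi)) -mulrA sqrtrM ?sqr_ge0//.
    by rewrite (mulr_natr pi) (sqrtr_sqr s) gtr0_norm// invfM mulrAC mulVf// mul1r.
  by ring.
have i2 : int2 (normal_prob 0 s) (id : R -> R).
  by apply: int2P => //; rewrite e ltry.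
split => //; apply: EFin_inj; rewrite -e RintE//; by case: i2.
Qed.

Lemma int1_prob_int2 d (T : measurableType d) (P : probability T R) (f : T -> R) :
  int2 P f -> int1 P f.
Proof.
move=> [mf i2]; have i1 : int1 P (fun=> 1 : R).
  apply: int1P => //; under eq_integral do rewrite normr1.
  rewrite integral_cst// mul1e.
  by apply: le_lt_trans (probability_le1 P measurableT) _; rewrite ltry.
apply: (int1_le mf _ (int1D i1 i2)) => x.
rewrite -(real_normK (num_real (f x))); have := sqr_ge0 (`|f x| - 2^-1); nra.
Qed.

(** The density is even, so the integral of |x| is twice that of the positive part; hence the
    positive and negative parts have equal integrals. *)
Lemma normal_mean (s : R) : 0 < s ->
  int1 (normal_prob 0 s) (id : R -> R) /\ \int[normal_prob 0 s]_x x = 0.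
Proof.
move=> s0; have sn0 : s != 0 by rewrite gt_eqF.
have i1 : int1 (normal_prob 0 s) (id : R -> R).
  by apply: int1_prob_int2; case: (normal_second_moment s0).
split => //.
pose a (x : R) := Num.max x 0; pose b (x : R) := Num.max (- x) 0.
have ma : measurable_fun setT a by exact: measurable_maxr.
have mb : measurable_fun setT b by apply: measurable_maxr => //; exact: measurableT_comp.
have ab x : `|x| = a x + b x.
  rewrite /a /b; case/orP: (le_total 0 x) => x0; first by rewrite (max_l x0) max_r ?oppr_le0// addr0 ger0_norm.
  by rewrite (max_r x0) max_l ?add0r ?ler0_norm// oppr_ge0.
have abE x : x = a x - b x.
  rewrite /a /b; case/orP: (le_total 0 x) => x0; first by rewrite (max_l x0) max_r ?oppr_le0// subr0.
  by rewrite (max_r x0) max_l ?sub0r ?opprK// oppr_ge0.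
have a0 x : 0 <= a x by rewrite le_max lexx orbT.
have b0 x : 0 <= b x by rewrite le_max lexx orbT.
have ia : int1 (normal_prob 0 s) a.
  have ga x : `|a x| <= `|x| by rewrite ger0_norm// ab lerDl.
  exact: (@int1_le _ _ R (normal_prob 0 s) a (fun x => `|x|) ma ga (int1_norm i1)).
have ib : int1 (normal_prob 0 s) b.
  have gb x : `|b x| <= `|x| by rewrite ger0_norm// ab lerDr.
  exact: (@int1_le _ _ R (normal_prob 0 s) b (fun x => `|x|) mb gb (int1_norm i1)).
have e2 : \int[normal_prob 0 s]_x `|x| = 2 * \int[normal_prob 0 s]_x a x.
  apply: EFin_inj; rewrite EFinM !RintE//; last exact: int1_norm.
  rewrite ge0_integral_normal_prob//; last by apply/measurable_EFinP; exact: int1_meas (int1_norm i1).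
  transitivity (\int[mu]_x (`|x| * normal_pdf 0 s x)%:E)%E => //.
  rewrite ge0_symfun_integralT; last 3 first.
  - by move=> x; rewrite mulr_ge0// normal_pdf_ge0.
  - by move=> x; apply: cvgM; [exact: norm_continuous|exact: continuous_normal_pdf].
  - by move=> x /=; rewrite normrN !(normal_pdfE _ sn0) /normal_fun !subr0 sqrrN.
  congr (_ * _)%E; rewrite ge0_integral_normal_prob//; last exact/measurable_EFinP.
  rewrite integral_mkcond; apply: eq_integral => x _; rewrite patchE.
  case: ifPn => [/set_mem /= x0|]; first by rewrite /a max_l// ger0_norm.
  by rewrite notin_setE /= => /negP; rewrite -ltNge => x0; rewrite /a max_r ?(ltW x0)// mul0e.
move: e2; under eq_Rintegral do rewrite ab; rewrite RintD// => e2.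
transitivity (\int[normal_prob 0 s]_x (a x - b x)).
  by apply: eq_Rintegral => x _; rewrite -abE.
rewrite RintB//; lra.
Qed.

End normal_moments.

(** * Measurability with respect to a sub-sigma-algebra *)

Section sub_sigma_algebra.
Context d (Om : measurableType d) (R : realType).
Implicit Types (F G : set (set Om)) (X Y : Om -> R).

Definition rmeas F X := meas_wrt F measurable X.

Variables (F : set (set Om)) (sF : sigma_algebra setT F).

Lemma rmeasP X : rmeas F X <-> measurable_fun setT (X : g_sigma_algebraType F -> R).
Proof.
split=> [h _ A mA|h A mA].
  by rewrite setTI; apply: sub_sigma_algebra; exact: h.
by have := h measurableT _ mA; rewrite setTI /measurable/= sigma_algebra_id.
Qed.

Lemma rmeas_cst c : rmeas F (fun=> c).
Proof. exact/rmeasP. Qed.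

Lemma rmeasD X Y : rmeas F X -> rmeas F Y -> rmeas F (fun w => X w + Y w).
Proof. by move=> /rmeasP mX /rmeasP mY; apply/rmeasP; exact: measurable_funD. Qed.

Lemma rmeasB X Y : rmeas F X -> rmeas F Y -> rmeas F (fun w => X w - Y w).
Proof. by move=> /rmeasP mX /rmeasP mY; apply/rmeasP; exact: measurable_funB. Qed.

Lemma rmeasM X Y : rmeas F X -> rmeas F Y -> rmeas F (fun w => X w * Y w).
Proof. by move=> /rmeasP mX /rmeasP mY; apply/rmeasP; exact: measurable_funM. Qed.

Lemma rmeas_sum (I : Type) (s : seq I) (Q : pred I) (f : I -> Om -> R) :
  (forall i, Q i -> rmeas F (f i)) -> rmeas F (fun w => \sum_(i <- s | Q i) f i w).
Proof.
move=> H; elim: s => [|a s ih]; first by under eq_fun do rewrite big_nil; exact: rmeas_cst.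
have [Qa|nQa] := boolP (Q a).
  by under eq_fun do rewrite big_cons Qa; apply: rmeasD => //; exact: H.
by under eq_fun do rewrite big_cons (negbTE nQa).
Qed.

Lemma rmeas_comp (f : R -> R) X : measurable_fun setT f -> rmeas F X ->
  rmeas F (fun w => f (X w)).
Proof. by move=> mf /rmeasP mX; apply/rmeasP; exact: measurableT_comp. Qed.

Lemma rmeas_max X Y : rmeas F X -> rmeas F Y -> rmeas F (fun w => Num.max (X w) (Y w)).
Proof. by move=> /rmeasP mX /rmeasP mY; apply/rmeasP; exact: measurable_maxr. Qed.

Lemma rmeas_lim (f : nat -> Om -> R) X : (forall k, rmeas F (f k)) ->
  (forall w, f ^~ w @ \oo --> X w) -> rmeas F X.
Proof.
move=> mf fX; apply/rmeasP; apply: (@measurable_fun_cvg _ (g_sigma_algebraType F) R setT f X) => [k|w _] //.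
by apply/rmeasP; exact: mf.
Qed.

Lemma rmeas_row r (x : Om -> 'rV[R]_r) (f : 'rV[R]_r -> R) : continuous f ->
  (forall j, rmeas F (fun w => x w ord0 j)) -> rmeas F (fun w => f (x w)).
Proof.
move=> cf mx; apply/rmeasP.
have mf : measurable_fun setT (f : borel_rV R r -> R).
  apply: (measurability _ (RGenOpens.measurableE R)).
  move=> _ [U [a [b ->]] <-]; rewrite setTI; apply: sub_sigma_algebra.
  by move/continuousP : cf; apply; exact: interval_open.
apply: (measurableT_comp mf); apply: measurable_rV => j.
by apply/rmeasP; exact: mx.
Qed.

Lemma sub_sigma_setI (A B : set Om) : F A -> F B -> F (A `&` B).
Proof.
move=> FA FB; have : measurable (A `&` B : set (g_sigma_algebraType F)).
  by apply: measurableI; exact: sub_sigma_algebra.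
by rewrite /measurable/= sigma_algebra_id.
Qed.

Lemma sub_sigma_setC (A : set Om) : F A -> F (~` A).
Proof. by move=> FA; rewrite -setTD; case: sF => _ + _; apply. Qed.

Lemma sub_sigma_setU (A B : set Om) : F A -> F B -> F (A `|` B).
Proof.
move=> FA FB; have : measurable (A `|` B : set (g_sigma_algebraType F)).
  by apply: measurableU; exact: sub_sigma_algebra.
by rewrite /measurable/= sigma_algebra_id.
Qed.

End sub_sigma_algebra.

Section ae_measurability.
Context d (Om : measurableType d) (R : realType) (P : probability Om R).
Variables (F : set (set Om)) (sF : sigma_algebra setT F).
Hypothesis cF : forall A, P.-negligible A -> F A.

(** B is A modified inside a null set, and every subset of a null set belongs to F. *)
Lemma sub_sigma_ae (A B : set Om) : {ae P, forall w, A w <-> B w} -> F A -> F B.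
Proof.
move=> AB FA.
have nN : P.-negligible (~` [set w | A w <-> B w]) by exact: AB.
set N := ~` _ in nN.
have -> : B = (A `&` ~` N) `|` (B `&` N).
  apply/seteqP; split=> w.
    have [Nw|Nw] := pselect (N w); first by right.
    by left; split => //; move: Nw => /contrapT [_]; apply.
  by move=> [[Aw /contrapT [+ _]]|[]//]; apply.
apply: sub_sigma_setU => //.
  by apply: sub_sigma_setI => //; apply: sub_sigma_setC => //; exact: cF.
by apply: cF; apply: negligibleS nN => w [].
Qed.

Lemma rmeas_ae (X Y : Om -> R) : {ae P, forall w, X w = Y w} -> rmeas F X -> rmeas F Y.
Proof.
move=> XY mX A mA; apply: sub_sigma_ae (mX _ mA).
by apply: ae_imp XY => w /= ->.
Qed.

End ae_measurability.

(** * Independence *)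

Section independence.
Context d (Om : measurableType d) (R : realType) (P : probability Om R).

(** By uniqueness of product measures the pair (Y, Z) has the product law, and Fubini factorises the
    integral of y g(z). Independence is stated through the law of Z on the events of F, the form in
    which the Wiener hypothesis provides it. *)
Lemma indep_expectation (F : set (set Om)) d2 (T2 : measurableType d2)
    (nu : probability T2 R) (Z : Om -> T2) (Y : Om -> R) (g : T2 -> R) :
  F `<=` measurable -> measurable_fun setT Z ->
  (forall A B, F A -> measurable B -> P (A `&` Z @^-1` B) = (P A * nu B)%E) ->
  rmeas F Y -> int1 P Y -> int1 nu g ->
  int1 P (fun w => Y w * g (Z w)) /\
  \int[P]_w (Y w * g (Z w)) = \int[P]_w Y w * \int[nu]_z g z.
Proof.
move=> Fm mZ hZ FY iY ig.
have mY := int1_meas iY; have mg := int1_meas ig.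
have mYZ : measurable_fun setT (fun w => (Y w, Z w)) by exact: measurable_fun_pair.
pose Y' : {RV P >-> R} := mfun_Sub (mem_set mY).
pose YZ : {RV P >-> (R * T2)%type} := mfun_Sub (mem_set mYZ).
have uni (X : set (R * T2)) : measurable X -> (distribution P Y' \x nu)%E X = distribution P YZ X.
  apply: product_measure_unique => A B mA mB.
  transitivity (P (Y @^-1` A `&` Z @^-1` B)); first by congr (P _); apply/seteqP; split.
  by rewrite hZ//; exact: FY.
have eI (h : R * T2 -> \bar R) :
    (\int[distribution P YZ]_z h z = \int[(distribution P Y' \x nu)%E]_z h z)%E.
  by apply: eq_measure_integral => A mA _; apply/esym; exact: uni.
pose f (z : R * T2) := z.1 * g z.2.
have mf : measurable_fun setT f.
  by apply: measurable_funM; [exact: measurable_fst|exact: measurableT_comp].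
have mf' : measurable_fun setT (EFin \o f) by exact/measurable_EFinP.
have ifn : (\int[P]_w `|Y w * g (Z w)|%:E = (\int[P]_w `|Y w|%:E) * (\int[nu]_z `|g z|%:E))%E.
  have -> : (\int[P]_w `|Y w * g (Z w)|%:E = \int[distribution P YZ]_z `|f z|%:E)%E.
    rewrite ge0_integral_distribution//; apply/measurable_EFinP; exact: measurableT_comp.
  rewrite eI.
  rewrite fubini_tonelli1//=; last by apply/measurable_EFinP; exact: measurableT_comp.
  rewrite /fubini_F /f /=.
  under eq_integral do under eq_integral do rewrite normrM EFinM.
  have e (y : R) : (\int[nu]_z (`|y|%:E * `|g z|%:E) = `|y|%:E * \int[nu]_z `|g z|%:E)%E.
    by rewrite ge0_integralZl//; apply/measurable_EFinP; exact: measurableT_comp.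
  under eq_integral do rewrite e.
  rewrite ge0_integralZr//; last by apply: integral_ge0.
  - by rewrite ge0_integral_distribution//; apply/measurable_EFinP; exact: normr_measurable.
  - by apply/measurable_EFinP; exact: normr_measurable.
have i1 : int1 P (fun w => Y w * g (Z w)).
  apply: int1P; first by apply: measurable_funM => //; exact: measurableT_comp.
  rewrite ifn; apply: lte_mul_pinfty; last exact: int1_lty.
    by apply: integral_ge0.
  by rewrite ge0_fin_numE ?integral_ge0//; exact: int1_lty.
split => //; apply: EFin_inj; rewrite EFinM !RintE//.
have -> : (\int[P]_w (Y w * g (Z w))%:E = \int[distribution P YZ]_z (f z)%:E)%E.
  by rewrite integral_distribution.
rewrite eI.
have intf : (distribution P Y' \x nu)%E.-integrable setT (EFin \o f).
  apply/integrableP; split => //.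
  rewrite -eI.
  rewrite ge0_integral_distribution//=; last by apply/measurable_EFinP; exact: measurableT_comp.
  exact: int1_lty i1.
rewrite -integral12_prod_meas1//= /fubini_F /f /=.
have e y : (\int[nu]_z (y * g z)%:E = y%:E * \int[nu]_z (g z)%:E)%E.
  under eq_integral do rewrite EFinM.
  by rewrite integralZl.
under eq_integral do rewrite e.
have -> : (\int[nu]_z (g z)%:E = (\int[nu]_z g z)%:E)%E by rewrite RintE.
have iY' : (distribution P Y').-integrable setT (EFin \o (id : R -> R)).
  apply/integrableP; split; first exact/measurable_EFinP.
  rewrite ge0_integral_distribution//=; last by apply/measurable_EFinP; exact: normr_measurable.
  exact: int1_lty iY.
rewrite (@integralZr _ _ _ (distribution P Y') setT measurableT (EFin \o id))//.
by congr (_ * _)%E; rewrite integral_distribution//; exact/measurable_EFinP.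
Qed.

(** The sets independent of B form a Dynkin system, so independence passes from a pi-system to the
    sigma-algebra it generates. *)
Lemma indep_sigma (G : set (set Om)) (B : set Om) : setI_closed G -> G `<=` measurable ->
  measurable B -> (forall C, G C -> P (C `&` B) = (P C * P B)%E) ->
  forall C, <<s G >> C -> P (C `&` B) = (P C * P B)%E.
Proof.
move=> GI Gm mB H.
have sub : <<s G >> `<=` measurable.
  by apply: smallest_sub => //; exact: sigma_algebra_measurable.
have fP (A : set Om) : measurable A -> P A \is a fin_num by move=> mA; exact: fin_num_measure.
apply: (@dynkin_induction _ (g_sigma_algebraType G) G
  (fun C => P ((C : set Om) `&` B) = (P C * P B)%E)) => //.
- by rewrite setTI probability_setT mul1e.
- move=> S /sub mS PS.
  have e1 : P (~` S `&` B) = (P B - P (S `&` B))%E.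
    rewrite setIC -setDE measureD//; last by rewrite (le_lt_trans (probability_le1 _ _))// ltry.
    by rewrite setIC.
  by rewrite e1 PS probability_setC// muleBl ?mul1e ?fP//.
- move=> A mA tA PA; rewrite setI_bigcupl measure_bigcup//; last 2 first.
  + by move=> k _; apply: measurableI => //; exact: sub (mA k).
  + by move=> i j _ _ [x [[Ai _] [Aj _]]]; apply: tA => //; exists x.
  rewrite measure_bigcup//; last by move=> k _; exact: sub (mA k).
  rewrite muleC -(fineK (fP _ mB)) -nneseriesZl//.
  by apply: eq_eseriesr => k _; rewrite muleC fineK ?fP//; exact: PA.
Qed.

End independence.

(** * Moments of Wiener increments against the past *)

Section wiener.
Context d (Om : measurableType d) (R : realType) (P : probability Om R) (T : R).
Variables (F : R -> set (set Om)) (K : set nat) (W : nat -> R -> Om -> R).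
Hypothesis hF : complete_filtration P T F.
Hypothesis hW : cylindrical_wiener P T F K W.

Implicit Types X Y : Om -> R.

Definition incr k s t w := W k t w - W k s w.

Lemma filtration_sigma t : 0 <= t <= T -> sigma_algebra setT (F t).
Proof. by case: hF => + _ _ _ tT => /(_ t tT)[]. Qed.

Lemma filtration_measurable t : 0 <= t <= T -> F t `<=` measurable.
Proof. by case: hF => + _ _ _ tT => /(_ t tT)[]. Qed.

Lemma filtration_mono s t : 0 <= s -> s <= t -> t <= T -> F s `<=` F t.
Proof. by case: hF => _ h _ _; exact: h. Qed.

Lemma filtration_null t : 0 <= t <= T -> forall A, P.-negligible A -> F t A.
Proof.
move=> /andP[t0 tT] A nA; apply: (filtration_mono (lexx 0)) => //.
by case: hF => _ _ _; apply.
Qed.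

Lemma rmeas_mono s t X : 0 <= s -> s <= t -> t <= T -> rmeas (F s) X -> rmeas (F t) X.
Proof. by move=> s0 st tT mX A mA; apply: (filtration_mono s0 st tT); exact: mX. Qed.

Lemma rmeas_measurable t X : 0 <= t <= T -> rmeas (F t) X -> measurable_fun setT X.
Proof.
by move=> tT mX _ A mA; rewrite setTI; apply: (filtration_measurable tT); exact: mX.
Qed.

Lemma rmeas_incr k s t : K k -> 0 <= s -> s <= t -> t <= T -> rmeas (F t) (incr k s t).
Proof.
move=> Kk s0 st tT; have t0 := le_trans s0 st.
have [mW _ _ _] := hW; apply: rmeasB.
- by apply: filtration_sigma; rewrite t0.
- by apply: mW => //; rewrite t0.
- by apply: (rmeas_mono s0 st tT); apply: mW => //; rewrite s0 (le_trans st).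
Qed.

Lemma incr_law k s t A B : K k -> 0 <= s -> s < t -> t <= T -> F s A -> measurable B ->
  P (A `&` incr k s t @^-1` B) = (P A * normal_prob 0 (Num.sqrt (t - s)) B)%E.
Proof.
move=> Kk s0 st tT FA mB; have [_ _ _ h] := hW.
have := h s t [:: k] A (fun=> B) s0 st tT isT _ FA (fun=> mB).
rewrite big_seq1 => <-; last by move=> k'; rewrite inE => /eqP ->.
congr (P (_ `&` _)); apply/seteqP; split=> w /=.
  by move=> Bw k'; rewrite inE => /eqP ->.
by apply; rewrite mem_head.
Qed.

Lemma incr_law2 k k' s t A B B' : K k -> K k' -> k != k' -> 0 <= s -> s < t -> t <= T ->
  F s A -> measurable B -> measurable B' ->
  P (A `&` incr k s t @^-1` B `&` incr k' s t @^-1` B') =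
  (P A * normal_prob 0 (Num.sqrt (t - s)) B * normal_prob 0 (Num.sqrt (t - s)) B')%E.
Proof.
move=> Kk Kk' kk s0 st tT FA mB mB'; have [_ _ _ h] := hW.
have := h s t [:: k; k'] A (fun j => if j == k then B else B') s0 st tT.
rewrite /= inE kk => /(_ isT) => /(_ _ FA _).
rewrite big_cons big_seq1 eqxx eq_sym (negbTE kk) muleA => <-; last 2 first.
- by move=> j; rewrite !inE => /orP[/eqP ->|/eqP ->].
- by move=> j; case: ifP.
rewrite -setIA; congr (P (_ `&` _)); apply/seteqP; split=> w /=.
  move=> [Bw Bw'] j; rewrite !inE => /orP[/eqP ->|/eqP ->]; first by rewrite eqxx.
  by rewrite eq_sym (negbTE kk).
move=> H; split; first by have := H k; rewrite eqxx mem_head; apply.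
by have := H k'; rewrite eq_sym (negbTE kk) !inE eqxx orbT; apply.
Qed.

Lemma incr_same k s w : incr k s s w = 0. Proof. exact: subrr. Qed.

Lemma incr_expect1 k s t Y : K k -> 0 <= s -> s <= t -> t <= T ->
  rmeas (F s) Y -> int1 P Y ->
  int1 P (fun w => Y w * incr k s t w) /\ \int[P]_w (Y w * incr k s t w) = 0.
Proof.
(* The Gaussian law is available for s < t only; for s = t the increment is 0. *)
move=> Kk s0; rewrite le_eqVlt => /predU1P[<-|st] tT mY iY.
  have -> : (fun w => Y w * incr k s s w) = (fun=> 0).
    by apply/funext => w; rewrite incr_same mulr0.
  by split; [exact: int1_0|exact: Rint_zero].
have sT : 0 <= s <= T by rewrite s0 (le_trans (ltW st)).
have tT' : 0 <= t <= T by rewrite (le_trans s0 (ltW st)).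
have d0 : 0 < Num.sqrt (t - s) by rewrite sqrtr_gt0 subr_gt0.
have [i1 m0] := normal_mean d0.
have mZ := rmeas_measurable tT' (rmeas_incr Kk s0 (ltW st) tT).
have [] := @indep_expectation _ _ _ P (F s) _ _ (normal_prob 0 (Num.sqrt (t - s)))
  (incr k s t) Y id (filtration_measurable sT) mZ _ mY iY i1.
  by move=> A B FA mB; exact: incr_law.
by rewrite m0 mulr0.
Qed.

Lemma incr_expect2 k s t Y : K k -> 0 <= s -> s <= t -> t <= T ->
  rmeas (F s) Y -> int1 P Y ->
  int1 P (fun w => Y w * incr k s t w ^+ 2) /\
  \int[P]_w (Y w * incr k s t w ^+ 2) = gauss2 * (t - s) * \int[P]_w Y w.
Proof.
move=> Kk s0; rewrite le_eqVlt => /predU1P[<-|st] tT mY iY.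
  have -> : (fun w => Y w * incr k s s w ^+ 2) = (fun=> 0).
    by apply/funext => w; rewrite incr_same expr0n mulr0.
  by rewrite subrr mulr0 mul0r; split; [exact: int1_0|exact: Rint_zero].
have sT : 0 <= s <= T by rewrite s0 (le_trans (ltW st)).
have tT' : 0 <= t <= T by rewrite (le_trans s0 (ltW st)).
have d0 : 0 < Num.sqrt (t - s) by rewrite sqrtr_gt0 subr_gt0.
have [[_ i1] m0] := normal_second_moment d0.
have mZ := rmeas_measurable tT' (rmeas_incr Kk s0 (ltW st) tT).
have [] := @indep_expectation _ _ _ P (F s) _ _ (normal_prob 0 (Num.sqrt (t - s)))
  (incr k s t) Y (fun x => x ^+ 2) (filtration_measurable sT) mZ _ mY iY i1.
  by move=> A B FA mB; exact: incr_law.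
rewrite m0 sqr_sqrtr ?subr_ge0 ?ltW// => i2 ->; split => //; ring.
Qed.

(** The increment of W_k' is independent of the sigma-algebra generated by F_s together with the
    increment of W_k, by the pi-system [G] of intersections. The first two factors are measurable
    for it, so the product has the mean of a centred Gaussian as a factor. *)
Lemma incr_expect_cross k k' s t Y : K k -> K k' -> k != k' -> 0 <= s -> s <= t -> t <= T ->
  rmeas (F s) Y -> int1 P Y ->
  int1 P (fun w => Y w * incr k s t w * incr k' s t w) /\
  \int[P]_w (Y w * incr k s t w * incr k' s t w) = 0.
Proof.
move=> Kk Kk' kk s0; rewrite le_eqVlt => /predU1P[<-|st] tT mY iY.
  have -> : (fun w => Y w * incr k s s w * incr k' s s w) = (fun=> 0).
    by apply/funext => w; rewrite (incr_same k') mulr0.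
  by split; [exact: int1_0|exact: Rint_zero].
have sT : 0 <= s <= T by rewrite s0 (le_trans (ltW st)).
have tT' : 0 <= t <= T by rewrite (le_trans s0 (ltW st)).
have d0 : 0 < Num.sqrt (t - s) by rewrite sqrtr_gt0 subr_gt0.
have [i1 m0] := normal_mean d0.
have mZ := rmeas_measurable tT' (rmeas_incr Kk s0 (ltW st) tT).
have mZ' := rmeas_measurable tT' (rmeas_incr Kk' s0 (ltW st) tT).
pose G : set (set Om) := [set C | exists2 A, F s A & exists2 B : set R, measurable B &
   C = A `&` incr k s t @^-1` B].
have Gm : G `<=` measurable.
  move=> _ [A FA [B mB ->]]; apply: measurableI; first exact: filtration_measurable FA.
  by rewrite -[X in measurable X]setTI; exact: mZ.
have GI : setI_closed G.
  move=> _ _ [A FA [B mB ->]] [A' FA' [B' mB' ->]].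
  exists (A `&` A'); first exact: (sub_sigma_setI (filtration_sigma sT)).
  exists (B `&` B'); first exact: measurableI.
  by rewrite preimage_setI setIACA.
have FT : F s setT.
  by have [h0 hC _] := filtration_sigma sT; rewrite -[setT]setD0; apply: hC.
have indep (C : set Om) (B : set R) : <<s G >> C -> measurable B ->
    P (C `&` incr k' s t @^-1` B) = (P C * normal_prob 0 (Num.sqrt (t - s)) B)%E.
  move=> sC mB.
  have mB' : measurable (incr k' s t @^-1` B) by rewrite -[X in measurable X]setTI; exact: mZ'.
  have eB : P (incr k' s t @^-1` B) = normal_prob 0 (Num.sqrt (t - s)) B.
    by rewrite -[X in P X]setTI incr_law// probability_setT mul1e.
  rewrite -eB; apply: (indep_sigma GI Gm mB' _ sC) => _ [A FA [B1 mB1 ->]].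
  by rewrite incr_law2// incr_law// eB.
have [i2 _] := incr_expect1 Kk s0 (ltW st) tT mY iY.
have sG : sigma_algebra setT <<s G >> by exact: smallest_sigma_algebra.
have [] := @indep_expectation _ _ _ P <<s G >> _ _ (normal_prob 0 (Num.sqrt (t - s))) (incr k' s t)
  (fun w => Y w * incr k s t w) id _ mZ' _ _ i2 i1.
- by apply: smallest_sub => //; exact: sigma_algebra_measurable.
- by move=> A B FA mB; exact: indep.
- apply: (rmeasM sG) => A mA; apply: sub_sigma_algebra.
    exists (Y @^-1` A); first exact: mY.
    by exists setT => //; rewrite preimage_setT setIT.
  by exists setT => //; exists A => //; rewrite setTI.
by rewrite m0 mulr0.
Qed.

End wiener.

(** * Covariance of increments over arbitrary intervals *)

Section pairs.
Context d (Om : measurableType d) (R : realType) (P : probability Om R) (T : R).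
Variables (F : R -> set (set Om)) (K : set nat) (W : nat -> R -> Om -> R).
Hypothesis hF : complete_filtration P T F.
Hypothesis hW : cylindrical_wiener P T F K W.
Implicit Types X Y x y : Om -> R.
Local Notation incr := (incr W).

Lemma rmeas_int2M t X Y : 0 <= t <= T -> rmeas (F t) X -> rmeas (F t) Y ->
  rmeas (F t) (fun w => X w * Y w).
Proof. by move=> tT; apply: rmeasM; exact: (filtration_sigma hF). Qed.

Lemma incr_int2 k s t X : K k -> 0 <= s -> s <= t -> t <= T -> rmeas (F s) X -> int2 P X ->
  int2 P (fun w => X w * incr k s t w).
Proof.
move=> Kk s0 st tT mX [mX' iX].
have tT' : 0 <= t <= T by rewrite (le_trans s0 st).
have sT : 0 <= s <= T by rewrite s0 (le_trans st).
split.
  apply: measurable_funM => //; apply: (rmeas_measurable hF tT').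
  exact: (rmeas_incr hF hW).
have mX2 : rmeas (F s) (fun w => X w ^+ 2).
  by under eq_fun do rewrite expr2; exact: rmeas_int2M.
have [] := incr_expect2 hF hW Kk s0 st tT mX2 iX.
by move=> + _; under [X in int1 _ X -> _]eq_fun do rewrite -exprMn.
Qed.

Lemma incr_pair_disjoint k k' l r l' r' x x' : K k -> K k' ->
  0 <= l -> l <= r -> r <= l' -> l' <= r' -> r' <= T ->
  rmeas (F l) x -> rmeas (F l') x' -> int2 P x -> int2 P x' ->
  \int[P]_w ((x w * incr k l r w) * (x' w * incr k' l' r' w)) = 0.
Proof.
move=> Kk Kk' l0 lr rl lr' rT mx mx' ix ix'.
have rT' : r <= T by rewrite (le_trans rl)// (le_trans lr').
have l'0 : 0 <= l' by rewrite (le_trans l0)// (le_trans lr).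
have iX := incr_int2 Kk l0 lr rT' mx ix.
have l'T : 0 <= l' <= T by rewrite l'0 (le_trans lr').
have [] := incr_expect1 hF hW Kk' l'0 lr' rT _ (int2_mul iX ix').
  apply: rmeas_int2M => //; apply: rmeas_int2M => //.
    by apply: (rmeas_mono hF) mx => //; [exact: le_trans rl|rewrite (le_trans lr')].
  apply: (rmeas_mono hF _ rl) => //; rewrite ?(le_trans l0)// ?(le_trans lr')//.
  exact: (rmeas_incr hF hW).
by move=> _; under eq_Rintegral do rewrite -mulrA.
Qed.

Lemma incr_pair_same k k' l r x x' : K k -> K k' ->
  0 <= l -> l <= r -> r <= T -> rmeas (F l) x -> rmeas (F l) x' ->
  int2 P x -> int2 P x' ->
  \int[P]_w ((x w * incr k l r w) * (x' w * incr k' l r w)) =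
  gauss2 * ((k == k')%:R * (r - l)) * \int[P]_w (x w * x' w).
Proof.
move=> Kk Kk' l0 lr rT mx mx' ix ix'.
have lT : 0 <= l <= T by rewrite l0 (le_trans lr).
have mY := rmeas_int2M lT mx mx'; have iY := int2_mul ix ix'.
case: eqVneq => [<-|kk].
  have [_] := incr_expect2 hF hW Kk l0 lr rT mY iY; rewrite mul1r => <-.
  by apply: eq_Rintegral => w _; ring.
have [_] := incr_expect_cross hF hW Kk Kk' kk l0 lr rT mY iY; rewrite mul0r mulr0 mul0r => <-.
by apply: eq_Rintegral => w _; ring.
Qed.

(** Length of the intersection of the intervals ]l, r] and ]l', r']. *)
Definition overlap (l r l' r' : R) : R := Num.max 0 (Num.min r r' - Num.max l l').

Lemma overlapC l r l' r' : overlap l r l' r' = overlap l' r' l r.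
Proof. by rewrite /overlap minC maxC (maxC l) maxC. Qed.

Lemma incr_split k a b c w : incr k a c w = incr k a b w + incr k b c w.
Proof.
rewrite -[LHS]/(W k c w - W k a w) -[RHS]/(W k b w - W k a w + (W k c w - W k b w)); ring.
Qed.

(** With l <= l', both intervals are split at the endpoints of their intersection. Pieces that
    follow one another are uncorrelated, even with coefficients, because all earlier factors are
    known when the later piece starts; only the common piece contributes. *)
Let incr_pair_le k k' l r l' r' x x' : K k -> K k' -> l <= l' ->
  0 <= l -> l <= r -> r <= T -> 0 <= l' -> l' <= r' -> r' <= T ->
  rmeas (F l) x -> rmeas (F l') x' -> int2 P x -> int2 P x' ->
  \int[P]_w ((x w * incr k l r w) * (x' w * incr k' l' r' w)) =
  gauss2 * ((k == k')%:R * overlap l r l' r') * \int[P]_w (x w * x' w).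
Proof.
move=> Kk Kk' ll l0 lr rT l'0 lr' r'T mx mx' ix ix'.
rewrite /overlap (max_r ll).
have [rl|lr2] := leP r l'.
  rewrite (incr_pair_disjoint Kk Kk' l0 lr rl lr' r'T mx mx' ix ix').
  by rewrite max_l ?mulr0 ?mul0r// subr_le0 (le_trans _ rl)// ge_min lexx.
have mxl' : rmeas (F l') x by apply: (rmeas_mono hF l0 ll _ mx); exact: le_trans r'T.
have l'T := le_trans lr' r'T.
have i1 := incr_int2 Kk l0 ll l'T mx ix.
have i2 := incr_int2 Kk l'0 (ltW lr2) rT mxl' ix.
have i' := incr_int2 Kk' l'0 lr' r'T mx' ix'.
transitivity (\int[P]_w ((x w * incr k l l' w) * (x' w * incr k' l' r' w)
   + (x w * incr k l' r w) * (x' w * incr k' l' r' w))).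
  by apply: eq_Rintegral => w _; rewrite (incr_split k l l' r); ring.
rewrite RintD; [|exact: int2_mul|exact: int2_mul].
rewrite (incr_pair_disjoint Kk Kk' l0 ll (lexx _) lr' r'T mx mx' ix ix') add0r.
have [rr|rr] := leP r r'.
  have r0 := le_trans l'0 (ltW lr2).
  have i3 := incr_int2 Kk' l'0 (ltW lr2) rT mx' ix'.
  have mxr : rmeas (F r) x' by apply: (rmeas_mono hF l'0 (ltW lr2) rT mx').
  have i4 := incr_int2 Kk' r0 rr r'T mxr ix'.
  transitivity (\int[P]_w ((x w * incr k l' r w) * (x' w * incr k' l' r w)
     + (x w * incr k l' r w) * (x' w * incr k' r r' w))).
    by apply: eq_Rintegral => w _; rewrite (incr_split k' l' r r'); ring.
  rewrite RintD; [|exact: int2_mul|exact: int2_mul].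
  rewrite (incr_pair_disjoint Kk Kk' l'0 (ltW lr2) (lexx _) rr r'T mxl' mxr ix ix') addr0.
  by rewrite (incr_pair_same Kk Kk' l'0 (ltW lr2) rT mxl' mx' ix ix') max_r// subr_ge0 ltW.
have r0 := le_trans l'0 lr'.
have mxr' : rmeas (F r') x by apply: (rmeas_mono hF l'0 lr' r'T mxl').
have i3 := incr_int2 Kk l'0 lr' r'T mxl' ix.
have i4 := incr_int2 Kk r0 (ltW rr) rT mxr' ix.
transitivity (\int[P]_w ((x w * incr k l' r' w) * (x' w * incr k' l' r' w)
   + (x w * incr k r' r w) * (x' w * incr k' l' r' w))).
  by apply: eq_Rintegral => w _; rewrite (incr_split k l' r' r); ring.
rewrite RintD; [|exact: int2_mul|exact: int2_mul].
rewrite (incr_pair_same Kk Kk' l'0 lr' r'T mxl' mx' ix ix') max_r ?subr_ge0//.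
rewrite -[RHS]addr0; congr (_ + _).
rewrite -(incr_pair_disjoint Kk' Kk l'0 lr' (lexx _) (ltW rr) rT mx' mxr' ix' ix).
by apply: eq_Rintegral => w _; rewrite mulrC.
Qed.

Lemma incr_pair k k' l r l' r' x x' : K k -> K k' ->
  0 <= l -> l <= r -> r <= T -> 0 <= l' -> l' <= r' -> r' <= T ->
  rmeas (F l) x -> rmeas (F l') x' -> int2 P x -> int2 P x' ->
  \int[P]_w ((x w * incr k l r w) * (x' w * incr k' l' r' w)) =
  gauss2 * ((k == k')%:R * overlap l r l' r') * \int[P]_w (x w * x' w).
Proof.
move=> Kk Kk' l0 lr rT l'0 lr' r'T mx mx' ix ix'.
case/orP: (le_total l l') => ll; first exact: incr_pair_le.
rewrite overlapC eq_sym.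
under [in RHS]eq_Rintegral do rewrite mulrC.
under eq_Rintegral do rewrite mulrC.
exact: incr_pair_le.
Qed.

End pairs.

(** * Ito isometry for scalar elementary integrals *)

Section isometry.
Context d (Om : measurableType d) (R : realType) (P : probability Om R) (T : R).
Variables (F : R -> set (set Om)) (K : set nat) (W : nat -> R -> Om -> R).
Hypothesis hF : complete_filtration P T F.
Hypothesis hW : cylindrical_wiener P T F K W.

Lemma eseries_finite (f : nat -> \bar R) (Q : pred nat) M :
  (forall c, Q c -> 0 <= f c)%E -> (forall c, (M <= c)%N -> f c = 0%E) ->
  (\sum_(c <oo | Q c) f c = \sum_(0 <= c < M | Q c) f c)%E.
Proof.
move=> f0 fM; rewrite (@nneseries_split_cond _ _ 0 M)// add0n eseries0 ?adde0//.
by move=> i Mi _; exact: fM.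
Qed.

Variables (J : finType) (l r : J -> R) (k : J -> nat) (x : J -> Om -> R).
Hypothesis Kk : forall j, K (k j).
Hypothesis lrT : forall j, 0 <= l j /\ l j <= r j <= T.
Hypothesis mx : forall j, rmeas (F (l j)) (x j).
Hypothesis ix : forall j, int2 P (x j).

Definition scalar_int w := \sum_j x j w * incr W (k j) (l j) (r j) w.
Definition scalar_proc t w c := \sum_(j | (k j == c) && (l j < t <= r j)) x j w.

(** Both sides of the isometry reduce to the expectation of this form: up to [gauss2], [overlap] is
    the covariance of two increments, and it is also the integral of the product of two interval
    indicators. *)
Let qform w := \sum_j \sum_j' (k j == k j')%:R * overlap (l j) (r j) (l j') (r j') * (x j w * x j' w).

Let l0 j : 0 <= l j. Proof. by have [] := lrT j. Qed.
Let lr j : l j <= r j. Proof. by have [_ /andP[]] := lrT j. Qed.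
Let rT j : r j <= T. Proof. by have [_ /andP[]] := lrT j. Qed.

Let ixW j : int2 P (fun w => x j w * incr W (k j) (l j) (r j) w).
Proof. exact: (incr_int2 hF hW). Qed.

Lemma scalar_int_int2 : int2 P scalar_int.
Proof. exact: int2_sum. Qed.

Let int1_qform : int1 P qform.
Proof.
by apply: int1_sum => j _; apply: int1_sum => j' _; apply/int1Z/int2_mul.
Qed.

Let scalar_int_sqr : \int[P]_w (scalar_int w ^+ 2) = gauss2 * \int[P]_w qform w.
Proof.
transitivity (\int[P]_w \sum_j \sum_j' ((x j w * incr W (k j) (l j) (r j) w) *
    (x j' w * incr W (k j') (l j') (r j') w))).
  apply: eq_Rintegral => w _; rewrite expr2 /scalar_int mulr_suml.
  by apply: eq_bigr => j _; rewrite mulr_sumr.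
rewrite Rint_sum; last by move=> j _; apply: int1_sum => j' _; exact: int2_mul.
rewrite Rint_sum; last by move=> j _; apply: int1_sum => j' _; apply/int1Z/int2_mul.
rewrite mulr_sumr; apply: eq_bigr => j _.
rewrite Rint_sum; last by move=> j' _; exact: int2_mul.
rewrite Rint_sum; last by move=> j' _; apply/int1Z/int2_mul.
rewrite mulr_sumr; apply: eq_bigr => j' _.
rewrite (incr_pair hF hW)// RintZ ?mulrA//; exact: int2_mul.
Qed.

Let ind j (t : R) : R := ((l j < t <= r j)%R : bool)%:R.

Let int1_ind j j' : int1 lebesgue_measure (fun t => ind j t * ind j' t) /\
  \int[lebesgue_measure]_t (ind j t * ind j' t) = overlap (l j) (r j) (l j') (r j').
Proof.
pose i := `]Num.max (l j) (l j'), Num.min (r j) (r j')] : interval R.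
have e t : ind j t * ind j' t = \1_[set` i] t.
  rewrite /ind indicE mem_setE /i in_itv/= gt_max le_min -natrM mulnb.
  congr (_%:R); congr nat_of_bool; by case: (_ < t); case: (_ < t); case: (t <= _); case: (t <= _).
have mi : measurable [set` i] by exact: measurable_itv.
have E : (\int[lebesgue_measure]_t (\1_[set` i] t)%:E = (overlap (l j) (r j) (l j') (r j'))%:E)%E.
  rewrite integral_indic// setIT; transitivity (lebesgue_measure [set` i]) => //.
  rewrite lebesgue_measure_itv/= lte_fin /overlap.
  case: ifPn => [h|]; first by rewrite (@max_r _ _ 0)// subr_ge0 ltW.
  by rewrite -leNgt => h; rewrite (@max_l _ _ 0)// subr_le0.
have -> : (fun t => ind j t * ind j' t) = \1_[set` i] by apply/funext => t; exact: e.
have i1 : int1 lebesgue_measure (\1_[set` i] : R -> R).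
  apply: int1P => //.
  have -> : (\int[lebesgue_measure]_t `|(\1_[set` i] t : R)|%:E = \int[lebesgue_measure]_t (\1_[set` i] t)%:E)%E.
    by apply: eq_integral => t _; rewrite ger0_norm// indicE.
  by rewrite E ltry.
split => //; apply: EFin_inj; rewrite RintE//.
Qed.

Lemma scalar_proc_sqr w :
  (\int[lebesgue_measure]_(t in `[0%R, T]) \sum_(c <oo | c \in K) ((scalar_proc t w c) ^+ 2)%:E
   = (qform w)%:E)%E.
Proof.
(* Only finitely many columns occur, so the series over columns is a finite sum below [M]. *)
pose M := (\max_j k j).+1.
pose g t := \sum_j \sum_j' (k j == k j')%:R * (x j w * x j' w) * (ind j t * ind j' t).
have E t : (\sum_(c <oo | c \in K) ((scalar_proc t w c) ^+ 2)%:E)%E = (g t)%:E.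
  have eP c : scalar_proc t w c = \sum_j (k j == c)%:R * ind j t * x j w.
    rewrite /scalar_proc big_mkcond; apply: eq_bigr => j _; rewrite /ind.
    by case: (k j == c); case: (l j < t); case: (t <= r j); rewrite /= ?mul1r ?mul0r.
  rewrite (@eseries_finite _ _ M); last 2 first.
  - by move=> c _; rewrite lee_fin sqr_ge0.
  - move=> c Mc; rewrite eP big1 ?expr0n// => j _.
    case: eqP => [e|]; last by rewrite !mul0r.
    by move: Mc; rewrite -e leqNgt ltnS leq_bigmax.
  rewrite sumEFin; congr EFin.
  transitivity (\sum_(0 <= c < M | c \in K) \sum_j \sum_j'
     ((k j == c)%:R * (k j == k j')%:R * (x j w * x j' w) * (ind j t * ind j' t))).
    apply: eq_bigr => c _; rewrite eP expr2 mulr_suml; apply: eq_bigr => j _.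
    rewrite mulr_sumr; apply: eq_bigr => j' _.
    case: (eqVneq (k j) c) => [->|_]; last by rewrite !mul0r.
    by rewrite (eq_sym c); case: eqP => _; ring.
  rewrite exchange_big; apply: eq_bigr => j _.
  rewrite exchange_big; apply: eq_bigr => j' _.
  rewrite -!mulr_suml; congr (_ * _ * _); rewrite -[RHS]mul1r; congr (_ * _).
  rewrite big_mkcond (bigD1_seq (k j)) ?iota_uniq//=; last by rewrite mem_index_iota ltnS leq_bigmax.
  rewrite mem_set// eqxx big1 ?addr0// => c; rewrite eq_sym => /negbTE ->; by case: ifP.
under eq_integral do rewrite E.
have g0 t : t \notin `[0%R, T] -> g t = 0.
  rewrite in_itv/= => tT; rewrite /g big1// => j _; rewrite big1// => j' _.
  rewrite /ind; case: andP => [[lt tr]|]; last by rewrite mul0r mulr0.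
  by move: tT; rewrite (le_trans (l0 j) (ltW lt)) (le_trans tr (rT j)).
have -> : (\int[lebesgue_measure]_(t in `[0%R, T]) (g t)%:E = \int[lebesgue_measure]_t (g t)%:E)%E.
  rewrite integral_mkcond; apply: eq_integral => t _; rewrite patchE.
  by case: ifPn => //; rewrite mem_setE => /g0 ->.
have i1 j j' : int1 lebesgue_measure
    (fun t => (k j == k j')%:R * (x j w * x j' w) * (ind j t * ind j' t)).
  by apply: int1Z; have [] := int1_ind j j'.
rewrite -RintE; last by apply: int1_sum => j _; apply: int1_sum => j' _; exact: i1.
congr EFin; rewrite Rint_sum; last by move=> j _; apply: int1_sum => j' _; exact: i1.
apply: eq_bigr => j _; rewrite Rint_sum; last by move=> j' _; exact: i1.
apply: eq_bigr => j' _; have [h1 h2] := int1_ind j j'.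
by rewrite RintZ// h2; ring.
Qed.

Lemma scalar_isometry :
  (\int[P]_w (scalar_int w ^+ 2)%:E = gauss2%:E *
   \int[P]_w \int[lebesgue_measure]_(t in `[0%R, T])
     \sum_(c <oo | c \in K) ((scalar_proc t w c) ^+ 2)%:E)%E.
Proof.
under [in RHS]eq_integral do rewrite scalar_proc_sqr.
have [_ i] := scalar_int_int2.
by rewrite -!RintE// scalar_int_sqr EFinM.
Qed.

End isometry.

(** * Measurability with respect to pseudometrics *)

Section ge0_integrals.
Context d (T : measurableType d) (R : realType) (mu : {measure set T -> \bar R}).

Import HBNNSimple.

(* No measurability is needed: the integral of a nonnegative function is a
   supremum over the simple functions below it. *)
Lemma ge0_integral_mono (A : set T) (f g : T -> \bar R) :
  (forall x, A x -> 0 <= f x)%E -> (forall x, A x -> f x <= g x)%E ->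
  (\int[mu]_(x in A) f x <= \int[mu]_(x in A) g x)%E.
Proof.
move=> f0 fg.
rewrite (ge0_integralE _ f0) ge0_integralE; last by move=> x Ax; exact: le_trans (f0 _ Ax) (fg _ Ax).
apply: ereal_sup_le => _ [h hf <-]; exists h => // x; apply: le_trans (hf x) _; rewrite !patchE.
by case: ifPn => // /set_mem; exact: fg.
Qed.

End ge0_integrals.

Section iterated.
Context d (Om : measurableType d) (R : realType) (P : probability Om R) (T : R).
Local Notation lam := (@lebesgue_measure R).
Local Notation II f := (\int[P]_w \int[lam]_(t in `[0%R, T]) f w t)%E.

Lemma iterated_eq (f g : Om -> R -> \bar R) :
  (forall w t, 0 <= t <= T -> f w t = g w t) -> II f = II g.
Proof.
move=> fg; apply: eq_integral => w _; apply: eq_integral => t.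
by rewrite mem_setE in_itv/= => /fg.
Qed.

Lemma measurable_iterated (f : Om -> R -> \bar R) :
  measurable_fun setT (fun z : Om * R => f z.1 z.2) -> (forall w t, 0 <= f w t)%E ->
  measurable_fun setT (fun w => \int[lam]_(t in `[0%R, T]) f w t)%E.
Proof.
move=> mf f0.
pose g (z : Om * R) := (f z.1 z.2 * (\1_(`[0, T]%classic : set R) z.2)%:E)%E.
have mg : measurable_fun setT g.
  apply: emeasurable_funM => //; apply/measurable_EFinP.
  by apply: (measurableT_comp (measurable_indic _)) => //; exact: measurable_itv.
have g0 z : (0 <= g z)%E by rewrite mule_ge0// lee_fin indicE.
have -> : (fun w => \int[lam]_(t in `[0%R, T]) f w t)%E = fubini_F lam g.
  apply/funext => w; rewrite /fubini_F [LHS]integral_mkcond; apply: eq_integral => t _.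
  rewrite /g patchE /= indicE; by case: ifPn => h; rewrite ?mule1 ?mule0.
exact: measurable_fun_fubini_tonelli_F.
Qed.

Lemma iterated_sub (f : Om -> R -> \bar R) :
  measurable_fun setT (fun z : Om * R => f z.1 z.2) ->
  forall w, measurable_fun setT (f w).
Proof.
move=> mf w.
have mp : measurable_fun setT (fun t : R => (w, t)) by exact: measurable_fun_pair.
exact: (measurableT_comp mf mp).
Qed.

(** Stands in, up to the factor 2, for the triangle inequality of squared norms in L^2 of the
    product of Om and [0, T]. *)
Lemma iterated_le2 (f g h : Om -> R -> \bar R) :
  measurable_fun setT (fun z : Om * R => g z.1 z.2) ->
  measurable_fun setT (fun z : Om * R => h z.1 z.2) ->
  (forall w t, 0 <= f w t)%E -> (forall w t, 0 <= g w t)%E -> (forall w t, 0 <= h w t)%E ->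
  (forall w t, f w t <= 2%:E * (g w t + h w t))%E ->
  (II f <= 2%:E * (II g + II h))%E.
Proof.
move=> mg mh f0 g0 h0 fgh.
have mI : measurable (`[0, T]%classic : set R) by exact: measurable_itv.
have Ig0 w : (0 <= \int[lam]_(t in `[0%R, T]) g w t)%E by apply: integral_ge0 => t _.
have Ih0 w : (0 <= \int[lam]_(t in `[0%R, T]) h w t)%E by apply: integral_ge0 => t _.
have mIg := measurable_iterated mg g0.
have mIh := measurable_iterated mh h0.
rewrite -ge0_integralD// -ge0_integralZl//; last 2 first.
- exact: emeasurable_funD.
- by move=> w _; rewrite adde_ge0.
apply: ge0_integral_mono => w _; first by apply: integral_ge0 => t _.
have mgw : measurable_fun `[0, T] (g w) by apply: measurable_funTS; exact: iterated_sub.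
have mhw : measurable_fun `[0, T] (h w) by apply: measurable_funTS; exact: iterated_sub.
rewrite -ge0_integralD// -ge0_integralZl//; last 2 first.
- exact: emeasurable_funD.
- by move=> t _; rewrite adde_ge0.
by apply: ge0_integral_mono.
Qed.

End iterated.

Section borel_tools.
Context {R : realType} (Om : Type) (F : set (set Om)).
Hypothesis sF : sigma_algebra setT F.

Lemma meas_wrt_gen (X : Type) (G : set (set X)) (f : Om -> X) :
  (forall B, G B -> F (f @^-1` B)) -> meas_wrt F <<s G >> f.
Proof.
move=> H; apply: smallest_sub; last exact: H.
case: sF => F0 FC FU; split => //=.
- by move=> A FA; rewrite setTD preimage_setC -setTD; exact: FC.
- by move=> A FA; rewrite preimage_bigcup; exact: FU.
Qed.

Definition open_in (X : Type) (dist : X -> X -> R) (B : set X) :=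
  forall x, B x -> exists2 r, 0 < r & forall y, dist x y < r -> B y.

Lemma open_borel (X : Type) (dist : X -> X -> R) B : open_in dist B -> borel dist B.
Proof. by move=> oB; exact: sub_sigma_algebra. Qed.

Definition dist_continuous (X Y : Type) (dX : X -> X -> R) (dY : Y -> Y -> R) (g : X -> Y) :=
  forall x (eps : R), 0 < eps ->
    exists2 del, 0 < del & forall x', dX x x' < del -> dY (g x) (g x') < eps.

Lemma open_preimage (X Y : Type) (dX : X -> X -> R) (dY : Y -> Y -> R) (g : X -> Y) B :
  dist_continuous dX dY g -> open_in dY B -> open_in dX (g @^-1` B).
Proof.
move=> cg oB x /oB[r r0 rB]; have [del d0 H] := cg x r r0.
by exists del => // y /H; exact: rB.
Qed.

Lemma borel_comp (X Y : Type) (dX : X -> X -> R) (dY : Y -> Y -> R) (g : X -> Y) f :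
  dist_continuous dX dY g -> meas_wrt F (borel dX) f ->
  meas_wrt F (borel dY) (fun w => g (f w)).
Proof.
move=> cg mf; apply: meas_wrt_gen => B oB.
by apply: (mf (g @^-1` B)); apply: open_borel; exact: open_preimage oB.
Qed.

(** For B open, the limit lies in B exactly when, for some k, the sequence is eventually outside
    [E k], the open neighbourhood of radius 1/(k+1) of the complement of B. This is a countable
    expression in preimages of open sets. *)
Lemma borel_lim (X : Type) (dX : X -> X -> R) (f : nat -> Om -> X) (g : Om -> X) :
  (forall x y, dX x y = dX y x) -> (forall x y z, dX x z <= dX x y + dX y z) ->
  (forall j, meas_wrt F (borel dX) (f j)) ->
  (forall w, dX (f j w) (g w) @[j --> \oo] --> 0) ->
  meas_wrt F (borel dX) g.
Proof.
move=> dC dT mf fg; apply: meas_wrt_gen => B oB.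
pose r (k : nat) : R := k.+1%:R^-1.
have r0 k : 0 < r k by rewrite invr_gt0.
pose E (k : nat) := [set x | exists2 y, ~ B y & dX x y < r k].
have oE k : open_in dX (E k).
  move=> x [y By xy]; exists (r k - dX x y); first by rewrite subr_gt0.
  move=> x' xx'; exists y => //; apply: le_lt_trans (dT _ x _) _.
  by rewrite (dC x') -ltrBrDr.
have -> : g @^-1` B = \bigcup_k \bigcup_K \bigcap_(j in [set j | (K <= j)%N]) (f j @^-1` (~` E k)).
  apply/seteqP; split=> w /=.
    move=> Bg; have [e e0 eB] := oB _ Bg.
    have [k] := @ltr_add_invr R 0 (e / 2) (divr_gt0 e0 (ltr0n _ 2)); rewrite add0r => ke.
    have [K _ HK] : \forall j \near \oo, dX (f j w) (g w) < e / 2.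
      apply: (cvgr_lt 0); [exact: fg|by rewrite divr_gt0].
    exists k => //; exists K => // j /= /HK jK [y By fy]; apply: By; apply: eB.
    apply: le_lt_trans (dT _ (f j w) _) _; rewrite (dC (g w)) (splitr e) ltrD//.
    exact: lt_trans fy ke.
  move=> [k _ [K _ H]].
  have [K' _ HK] : \forall j \near \oo, dX (f j w) (g w) < r k by apply: (cvgr_lt 0).
  apply: contrapT => Bg; apply: (H (maxn K K')); first by rewrite /= leq_maxl.
  by exists (g w) => //; apply: HK; rewrite /= leq_maxr.
case: (sF) => F0 FC FU; apply: (FU) => k; apply: (FU) => K.
rewrite -[X in F X]setCK setC_bigcap.
rewrite -setTD; apply: (FC); rewrite bigcup_mkcond; apply: (FU) => j.
case: ifP => // _; rewrite preimage_setC setCK.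
by apply: mf; exact: open_borel.
Qed.

End borel_tools.

Section borel_ae.
Context d (Om : measurableType d) (R : realType) (P : probability Om R).
Variables (F : set (set Om)) (sF : sigma_algebra setT F).
Hypothesis cF : forall A, P.-negligible A -> F A.

(** An open set of a pseudometric cannot separate two points at distance 0, so the preimages of open
    sets differ by a null set. *)
Lemma borel_ae_eq (X : Type) (dX : X -> X -> R) (f g : Om -> X) :
  (forall x y, dX x y = dX y x) ->
  {ae P, forall w, dX (f w) (g w) = 0} ->
  meas_wrt F (borel dX) f -> meas_wrt F (borel dX) g.
Proof.
move=> dC fg mf; apply: meas_wrt_gen => // B oB.
apply: (sub_sigma_ae sF cF (A := f @^-1` B)); last by apply: mf; exact: open_borel.
apply: ae_imp fg => w /= e; split=> /oB[r r0]; apply; first by rewrite e.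
by rewrite dC e.
Qed.

Lemma rmeas_lim_ae (f : nat -> Om -> R) (g : Om -> R) :
  (forall k, rmeas F (f k)) -> {ae P, forall w, f ^~ w @ \oo --> g w} -> rmeas F g.
Proof.
move=> mf fg.
have nN : P.-negligible (~` [set w | f ^~ w @ \oo --> g w]) by exact: fg.
set N := ~` _ in nN.
have mN : rmeas F (\1_(~` N) : Om -> R).
  apply/rmeasP => //; apply: measurable_indic.
  by rewrite /measurable/= sigma_algebra_id//; apply: sub_sigma_setC => //; exact: cF.
apply: (rmeas_ae sF cF (X := fun w => g w * \1_(~` N) w)).
  apply: ae_imp fg => w /= h.
  by rewrite indicE mem_set ?mulr1// => /(_ h).
apply: (rmeas_lim sF (f := fun k w => f k w * \1_(~` N) w)) => [k|w]; first exact: rmeasM.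
rewrite indicE; have [/set_mem|] := boolP (w \in ~` N).
  by move=> /contrapT h; under eq_fun do rewrite mulr1; rewrite mulr1.
by move=> _; under eq_fun do rewrite mulr0; rewrite mulr0; exact: cvg_cst.
Qed.

End borel_ae.

Section borel_real.
Context d (Om : measurableType d) (R : realType) (F : set (set Om)).
Hypothesis sF : sigma_algebra setT F.

Lemma borel_rmeas (X : Type) (dX : X -> X -> R) (f : Om -> X) (g : X -> R) :
  dist_continuous dX (fun x y => `|x - y|) g -> meas_wrt F (borel dX) f ->
  rmeas F (fun w => g (f w)).
Proof.
move=> cg mf; apply/rmeasP => //.
apply: (measurability _ (RGenOpens.measurableE R)).
move=> _ [_ [a [b ->]] <-]; rewrite setTI; apply: sub_sigma_algebra.
apply: (mf (g @^-1` `]a, b[%classic)); apply: open_borel.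
apply: open_preimage cg _ => x /=; rewrite in_itv/= => /andP[ax xb].
exists (Num.min (x - a) (b - x)); first by rewrite lt_min !subr_gt0 ax.
move=> y; rewrite lt_min => /andP[h1 h2] /=; rewrite in_itv/=.
move: h1 h2; rewrite !ltr_norml => /andP[_ h1] /andP[h2 _]; lra.
Qed.

(* Psi need only be jointly continuous: the first factor is second countable,
   so no separability of X or Y is required. *)
Lemma borel_joint (X Y : Type) (dX : X -> X -> R) (dY : Y -> Y -> R) m
    (Psi : 'rV[R]_m -> X -> Y) (c : Om -> 'rV[R]_m) (f : Om -> X) :
  (forall x, dX x x = 0) -> (forall x y z, dX x z <= 2 * (dX x y + dX y z)) ->
  (forall (a : 'rV[R]_m) x (eps : R), 0 < eps -> exists2 del, 0 < del &
     forall (a' : 'rV[R]_m) x', (forall j, `|a ord0 j - a' ord0 j| < del) -> dX x x' < del ->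
       dY (Psi a x) (Psi a' x') < eps) ->
  (forall j, rmeas F (fun w => c w ord0 j)) -> meas_wrt F (borel dX) f ->
  meas_wrt F (borel dY) (fun w => Psi (c w) (f w)).
Proof.
move=> d0 dT cPsi mc mf; apply: meas_wrt_gen => // B oB.
pose q (a : 'rV[rat]_m) : 'rV[R]_m := map_mx ratr a.
pose r (k : nat) : R := k.+1%:R^-1.
have r0 k : 0 < r k by rewrite invr_gt0.
pose box (z : 'rV[rat]_m * nat) := [set a : 'rV[R]_m | forall j, `|a ord0 j - q z.1 ord0 j| < r z.2].
(* The points x such that [Psi] sends the rational box z times some ball around x into B. These sets
   are open, and their products with the boxes cover the preimage of B by joint continuity. *)
pose O z := [set x | exists2 e : R, 0 < e & forall x', dX x x' < e -> forall a, box z a -> B (Psi a x')].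
have oO z : open_in dX (O z).
  (* The radius e / 4 compensates the factor 2 of the quasi-triangle inequality. *)
  move=> x [e e0 H]; exists (e / 4); first by rewrite divr_gt0.
  move=> y xy; exists (e / 4); first by rewrite divr_gt0.
  by move=> x' yx'; apply: H; have := dT x y x'; lra.
have -> : (fun w => Psi (c w) (f w)) @^-1` B =
    \bigcup_(z in [set: 'rV[rat]_m * nat]) ((c @^-1` box z) `&` (f @^-1` O z)).
  apply/seteqP; split=> w /=; last first.
    by move=> [z _ [zc [e e0 H]]]; apply: (H _ _ _ zc); rewrite d0.
  move=> /oB[eps eps0 hB]; have [del del0 hPsi] := cPsi (c w) (f w) eps eps0.
  have [k] := @ltr_add_invr R 0 (del / 2) (divr_gt0 del0 (ltr0n _ 2)); rewrite add0r => ke.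
  have H i : exists a : rat, `|c w ord0 i - ratr a| < r k.
    have [|a] := @rat_in_itvoo R (c w ord0 i - r k) (c w ord0 i + r k).
      by rewrite ltrBlDr -addrA ltrDl addr_gt0.
    rewrite in_itv/= => /andP[q1 q2]; exists a.
    by rewrite ltr_distl ltrBlDr q2 -ltrBlDr q1.
  have [a aP] := choice H.
  exists (\row_i a i, k) => //; split; first by move=> j; rewrite !mxE; exact: aP.
  exists del => // x' xx' b /= bb; apply: hB; apply: hPsi => // j.
  have h1 := bb j; rewrite !mxE in h1; have h2 := aP j.
  rewrite (le_lt_trans (ler_distD (ratr (a j)) _ _))// (splitr del) ltrD//.
    exact: lt_trans h2 ke.
  by rewrite distrC; exact: lt_trans h1 ke.
suff : measurable (\bigcup_(z in [set: 'rV[rat]_m * nat]) ((c @^-1` box z) `&` (f @^-1` O z))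
    : set (g_sigma_algebraType F)).
  by rewrite /measurable/= sigma_algebra_id.
apply: countable_bigcupT_measurable; first exact: countableP.
move=> z; apply: measurableI; last by apply: sub_sigma_algebra; apply: mf; exact: open_borel.
have -> : c @^-1` box z =
    \bigcap_(j in [set: 'I_m]) ((fun w => c w ord0 j) @^-1` ball (q z.1 ord0 j) (r z.2)).
  apply/seteqP; split=> w /= h j.
    by move=> _; rewrite /ball/= distrC; exact: h.
  by have := h j Logic.I; rewrite /ball/= distrC.
apply: fin_bigcap_measurable; first exact: finite_finset.
by move=> j _; apply: sub_sigma_algebra; apply: mc; exact: measurable_ball.
Qed.

End borel_real.

Section field_continuity.
Context {R : realType} {n : nat} (D : lipschitz_domain R n).
Local Notation dist := (@fdist R n D).

Lemma fdot_dist_continuous (b : vfield D) :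
  dist_continuous dist (fun x y => `|x - y|) (fun v => fdot v b).
Proof.
move=> v eps e0; exists (eps / (fnorm b + 1)).
  by rewrite divr_gt0// ltr_wpDl// fnorm_ge0.
move=> w; rewrite ltr_pdivlMr ?ltr_wpDl ?fnorm_ge0// => h.
rewrite -fdotBl (le_lt_trans (fdot_le _ _))// (le_lt_trans _ h)//.
by rewrite ler_wpM2l ?fnorm_ge0// lerDl.
Qed.

Lemma fnorm_dist_continuous : dist_continuous dist (fun x y => `|x - y|) (@fnorm R n D).
Proof.
move=> v eps e0; exists eps => // w h; rewrite (le_lt_trans _ h)// ler_norml.
have h1 := fnormD (v - w) w; rewrite subrK in h1.
have h2 := fnormD (w - v) v; rewrite subrK in h2.
have e : fnorm (w - v) = fnorm (v - w) by exact: fdistC.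
rewrite /fdist; move: h1 h2; rewrite e {h e}.
by move: (fnorm (v - w)) (fnorm v) (fnorm w) => a b c h1 h2; apply/andP; split; lra.
Qed.

Lemma fdist0 (v : vfield D) : fdist v v = 0.
Proof. by rewrite /fdist subrr /fnorm /fnormsq fdot0l sqrtr0. Qed.

Lemma fnorm_sum (I : Type) (s : seq I) (Q : pred I) (f : I -> vfield D) :
  fnorm (\sum_(i <- s | Q i) f i) <= \sum_(i <- s | Q i) fnorm (f i).
Proof.
elim/big_rec2: _ => [|i x y _ h]; first by rewrite /fnorm /fnormsq fdot0l sqrtr0.
by rewrite (le_trans (fnormD _ _))// lerD2l.
Qed.

Context d (Om : measurableType d) (F : set (set Om)).
Hypothesis sF : sigma_algebra setT F.

Lemma rmeas_fdot (X : Om -> vfield D) b : meas_wrt F (borel dist) X ->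
  rmeas F (fun w => fdot (X w) b).
Proof. by move=> mX; apply: (borel_rmeas sF (fdot_dist_continuous b) mX). Qed.

Lemma rmeas_fnormsq (X : Om -> vfield D) : meas_wrt F (borel dist) X ->
  rmeas F (fun w => fnormsq (X w)).
Proof.
move=> mX; under eq_fun do rewrite -sqr_fnorm expr2.
have h := borel_rmeas sF fnorm_dist_continuous mX.
exact: rmeasM.
Qed.

End field_continuity.

Section hs_continuity.
Context {R : realType} {n : nat} {U : hilbert R} (e : onb U) (D : lipschitz_domain R n).
Local Notation K := (onb_idx e).
Implicit Types A B : hs_op e D.

Lemma columns_le (f g h : nat -> vfield D) :
  (forall k, fnormsq (f k) <= 2 * (fnormsq (g k) + fnormsq (h k))) ->
  (columns_normsq e f <= 2%:E * (columns_normsq e g + columns_normsq e h))%E.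
Proof.
move=> H; rewrite /columns_normsq -nneseriesD; last 2 first.
- by move=> k _ _; rewrite lee_fin fnormsq_ge0.
- by move=> k _ _; rewrite lee_fin fnormsq_ge0.
rewrite -nneseriesZl; last by move=> k _; rewrite adde_ge0 ?lee_fin ?fnormsq_ge0.
apply: lee_nneseries => k _; first by rewrite lee_fin fnormsq_ge0.
by rewrite -EFinD -EFinM lee_fin.
Qed.

Lemma hs_distsq_ge0 A B : (0 <= hs_distsq A B)%E.
Proof. by apply: nneseries_ge0 => k _ _; rewrite lee_fin fnormsq_ge0. Qed.

Lemma hs_distsq_fin A B : hs_distsq A B \is a fin_num.
Proof.
rewrite ge0_fin_numE ?hs_distsq_ge0//; apply: le_lt_trans.
  apply: (@columns_le _ (fun k => A (e k)) (fun k => B (e k))) => k.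
  by rewrite -(fnormsqN (B _)) mulrDr; exact: fnormsqD_le.
by apply: lte_mul_pinfty => //; rewrite lte_add_pinfty//; exact: hs_finite.
Qed.

Lemma sqr_hs_dist A B : hs_dist A B ^+ 2 = fine (hs_distsq A B).
Proof. by rewrite /hs_dist sqr_sqrtr// fine_ge0// hs_distsq_ge0. Qed.

Lemma hs_distsqE A B : hs_distsq A B = (hs_dist A B ^+ 2)%:E.
Proof. by rewrite sqr_hs_dist fineK// hs_distsq_fin. Qed.

Lemma hs_distsq_le A B k : K k -> fnormsq (A (e k) - B (e k)) <= hs_dist A B ^+ 2.
Proof.
move=> Kk; rewrite sqr_hs_dist.
rewrite -lee_fin fineK ?hs_distsq_fin//.
have := @nneseries_lim_ge R (fun k => (fnormsq (A (e k) - B (e k)))%:E) (fun k => k \in K) 0 k.+1.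
move=> /(_ (fun i _ _ => fnormsq_ge0 _)); apply: le_trans.
rewrite big_mkcond big_nat_recr//= mem_set//; apply: leeDr.
by apply: sume_ge0 => i _; case: ifP => //; rewrite lee_fin fnormsq_ge0.
Qed.

Lemma hs_dist_col A B k : K k -> fdist (A (e k)) (B (e k)) <= hs_dist A B.
Proof.
move=> Kk; rewrite -(@ler_pXn2r _ 2)// ?nnegrE ?fnorm_ge0 ?sqrtr_ge0//.
by rewrite /fdist sqr_fnorm; exact: hs_distsq_le.
Qed.

Lemma hs_dist0 A : hs_dist A A = 0.
Proof.
rewrite /hs_dist /hs_distsq /columns_normsq eseries0 ?sqrtr0// => k _ _.
by rewrite subrr /fnormsq fdot0l.
Qed.

(** With the factor 2 this follows column by column from |a + b|^2 <= 2|a|^2 + 2|b|^2, and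
    [borel_joint] asks for no more. *)
Lemma hs_dist_trans A B C : hs_dist A C <= 2 * (hs_dist A B + hs_dist B C).
Proof.
rewrite -(@ler_pXn2r _ 2)// ?nnegrE ?mulr_ge0 ?addr_ge0 ?sqrtr_ge0//.
have H : hs_dist A C ^+ 2 <= 2 * (hs_dist A B ^+ 2 + hs_dist B C ^+ 2).
  have : (hs_distsq A C <= 2%:E * (hs_distsq A B + hs_distsq B C))%E.
    apply: columns_le => k; rewrite -[A _ - C _](subrKA (B (e k))) mulrDr.
    exact: fnormsqD_le.
  by rewrite !hs_distsqE -EFinD -EFinM lee_fin.
have a0 : 0 <= hs_dist A B by exact: sqrtr_ge0.
have b0 : 0 <= hs_dist B C by exact: sqrtr_ge0.
apply: le_trans H _; move: (hs_dist A B) (hs_dist B C) a0 b0 => a b a0 b0.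
have := mulr_ge0 a0 b0; have := sqr_ge0 a; have := sqr_ge0 b; rewrite exprMn sqrrD; lra.
Qed.

Lemma col_dist_continuous k : K k ->
  dist_continuous (@hs_dist R n U e D) (@fdist R n D) (fun A => A (e k)).
Proof.
by move=> Kk A eps e0; exists eps => // B; apply: le_lt_trans; exact: hs_dist_col.
Qed.

(** The integral of a step process with finitely many columns has this form, with sums of increments
    as coefficients; its joint continuity feeds [borel_joint]. *)
Definition col_comb m (c : 'rV[R]_m) A : vfield D :=
  \sum_(k < m | (k : nat) \in K) c ord0 k *: A (e k).

Lemma col_comb_continuous m (c : 'rV[R]_m) A (eps : R) : 0 < eps ->
  exists2 del, 0 < del & forall (c' : 'rV[R]_m) A', (forall j, `|c ord0 j - c' ord0 j| < del) ->
    hs_dist A A' < del -> fdist (col_comb c A) (col_comb c' A') < eps.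
Proof.
move=> eps0.
pose S := \sum_(k < m) (fnorm (A (e k)) + (`|c ord0 k| + 1)).
have S0 : 0 <= S by apply: sumr_ge0 => k _; rewrite !addr_ge0 ?fnorm_ge0.
exists (Num.min 1 (eps / (S + 1))).
  by rewrite lt_min ltr01 divr_gt0// ltr_wpDl.
set del := Num.min _ _ => c' A' cc AA.
have del0 : 0 < del by rewrite lt_min ltr01 divr_gt0// ltr_wpDl.
have del1 : del <= 1 by rewrite ge_min lexx.
have dele : del * (S + 1) <= eps.
  by rewrite -ler_pdivlMr ?ltr_wpDl// ge_min lexx orbT.
suff : fdist (col_comb c A) (col_comb c' A') <= del * S.
  by move=> h; apply: le_lt_trans h _; apply: lt_le_trans dele; rewrite ltr_pM2l// ltrDl.
rewrite /fdist /col_comb -sumrB (le_trans (fnorm_sum _ _ _))// /S mulr_sumr.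
rewrite big_mkcond; apply: ler_sum => k _; case: ifP => [/set_mem Kk|_]; last first.
  by rewrite mulr_ge0 ?(ltW del0)// !addr_ge0 ?fnorm_ge0.
have -> : c ord0 k *: A (e k) - c' ord0 k *: A' (e k) =
   (c ord0 k - c' ord0 k) *: A (e k) + c' ord0 k *: (A (e k) - A' (e k)).
  by rewrite scalerBl scalerBr addrA subrK.
rewrite (le_trans (fnormD _ _))// !fnormZ mulrDr lerD//.
  by rewrite ler_wpM2r ?fnorm_ge0// ltW.
rewrite mulrC ler_pM ?fnorm_ge0//.
  by apply: le_trans (ltW AA); exact: hs_dist_col.
have := cc k; have := ler_normD (c' ord0 k - c ord0 k) (c ord0 k).
by rewrite subrK distrC => h1 h2; lra.
Qed.

End hs_continuity.

Section composition.
Context {Om X Y : Type} (F : set (set Om)).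
Hypothesis sF : sigma_algebra setT F.

(** The graph map turns the joint measurability of an operator G in (w, v) into measurability of w
    |-> G w (v w). *)
Lemma meas_wrt_pair (B : set (set X)) (v : Om -> X) :
  (forall A1 A2, F A1 -> F A2 -> F (A1 `&` A2)) -> meas_wrt F B v ->
  meas_wrt F (prod_sigma F B) (fun w => (w, v w)).
Proof.
move=> FI mv; apply: meas_wrt_gen => // _ [A FA [A' BA' ->]].
by apply: (FI A (v @^-1` A')) => //; exact: mv.
Qed.

End composition.

(** * The stochastic integral *)

Section window.
Context d (Om : measurableType d) (R : realType) (P : probability Om R) (T : R).
Variables (F : R -> set (set Om)) (K : set nat) (W : nat -> R -> Om -> R).
Hypothesis hF : complete_filtration P T F.
Hypothesis hW : cylindrical_wiener P T F K W.
Variables (s0 s1 : R).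
Hypotheses (s0_ge0 : 0 <= s0) (s01 : s0 <= s1) (s1T : s1 <= T).
Variables (J : finType) (l r : J -> R) (k : J -> nat) (x : J -> Om -> R).
Hypothesis Kk : forall j, K (k j).
Hypothesis lrT : forall j, 0 <= l j /\ l j <= r j <= T.
Hypothesis mx : forall j, rmeas (F (l j)) (x j).
Hypothesis ix : forall j, int2 P (x j).

Definition clip t : R := Num.min (Num.max t s0) s1.
(** For l j > s1 the clipped interval is empty, but x j need not be known at time s1; the value 0
    keeps the clipped process adapted. *)
Definition cut_coef j w := if l j <= s1 then x j w else 0.
Definition cut_int w := \sum_j cut_coef j w * incr W (k j) (clip (l j)) (clip (r j)) w.

Lemma clip_ge t : s0 <= clip t.
Proof. by rewrite /clip le_min le_max lexx orbT s01. Qed.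

Lemma clip_le t : clip t <= s1.
Proof. by rewrite /clip ge_min lexx orbT. Qed.

Lemma clip_mono t t' : t <= t' -> clip t <= clip t'.
Proof.
move=> tt; rewrite /clip le_min !ge_min lexx orbT andbT ge_max !le_max lexx tt.
by rewrite orbT.
Qed.

Let clip0 t : 0 <= clip t. Proof. exact: le_trans (clip_ge t). Qed.
Let clipT t : clip t <= T. Proof. exact: le_trans (clip_le t) _. Qed.
Let clip_lr j : clip (l j) <= clip (r j).
Proof. by apply: clip_mono; have [_ /andP[]] := lrT j. Qed.

Lemma cut_coef_meas j : rmeas (F (clip (l j))) (cut_coef j).
Proof.
have sF : sigma_algebra setT (F (clip (l j))) by apply: (filtration_sigma hF); rewrite clip0 clipT.
rewrite /cut_coef; case: (leP (l j) s1) => h; last exact: rmeas_cst.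
apply: (rmeas_mono hF _ _ _ (mx j)) => //; first by have [] := lrT j.
by rewrite /clip le_min le_max lexx.
Qed.

Lemma cut_coef_int2 j : int2 P (cut_coef j).
Proof. by rewrite /cut_coef; case: (leP (l j) s1) => h //; exact: int2_0. Qed.

Lemma cut_int_int2 : int2 P cut_int.
Proof.
apply: int2_sum => j _; apply: (incr_int2 hF hW) => //.
  exact: cut_coef_meas.
exact: cut_coef_int2.
Qed.

Lemma cut_int_meas : rmeas (F s1) cut_int.
Proof.
have s1T' : 0 <= s1 <= T by rewrite (le_trans s0_ge0 s01).
have sF := filtration_sigma hF s1T'.
apply: rmeas_sum => // j _; apply: rmeasM => //.
  apply: (rmeas_mono hF _ _ _ (cut_coef_meas j)) => //; exact: clip_le.
apply: (rmeas_mono hF _ (clip_le (r j))) => //.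
exact: (rmeas_incr hF hW).
Qed.

(** No clipped interval starts before s0, so y can be merged into each coefficient and every term
    has mean zero. *)
Lemma cut_int_orth (y : Om -> R) : rmeas (F s0) y -> int2 P y ->
  \int[P]_w (cut_int w * y w) = 0.
Proof.
move=> my iy.
have i1 j : int2 P (fun w => cut_coef j w * incr W (k j) (clip (l j)) (clip (r j)) w).
  by apply: (incr_int2 hF hW) => //; [exact: cut_coef_meas|exact: cut_coef_int2].
transitivity (\int[P]_w \sum_j (cut_coef j w * incr W (k j) (clip (l j)) (clip (r j)) w * y w)).
  by apply: eq_Rintegral => w _; rewrite /cut_int mulr_suml.
rewrite Rint_sum; last by move=> j _; exact: int2_mul.
rewrite big1// => j _.
have lT : 0 <= clip (l j) <= T by rewrite clip0 clipT.
have sF := filtration_sigma hF lT.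
have mY : rmeas (F (clip (l j))) (fun w => cut_coef j w * y w).
  apply: rmeasM => //; first exact: cut_coef_meas.
  by apply: (rmeas_mono hF _ _ _ my) => //; exact: clip_ge.
have [_ <-] := incr_expect1 hF hW (Kk j) (clip0 _) (clip_lr j) (clipT _) mY
  (int2_mul (cut_coef_int2 j) iy).
by apply: eq_Rintegral => w _; ring.
Qed.

Let l2 (j : J + J) := match j with inl i => l i | inr i => clip (l i) end.
Let r2 (j : J + J) := match j with inl i => r i | inr i => clip (r i) end.
Let k2 (j : J + J) := match j with inl i => k i | inr i => k i end.
Let x2 (j : J + J) := match j with inl i => x i | inr i => fun w => - cut_coef i w end.

Lemma cut_term j w t : 0 <= t <= T ->
  (if clip (l j) < t <= clip (r j) then cut_coef j w else 0) =
  (if s0 < t <= s1 then if l j < t <= r j then x j w else 0 else 0).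
Proof.
move=> tT; rewrite /clip /cut_coef gt_min le_min gt_max le_max.
case: (ltP s0 t) => h0 /=; last first.
  by rewrite andbF ltNge (le_trans h0 s01).
case: (leP t s1) => h1 /=; last by rewrite andbF andbF.
rewrite !orbF !andbT.
by case: ltP => //= lt; case: ifP => // _; rewrite (le_trans (ltW lt) h1).
Qed.

(** The difference is itself an elementary integral, over the disjoint sum of two copies of the
    index set, so the isometry applies to it; its process is the original one outside the window. *)
Lemma cut_diff :
  (\int[P]_w ((scalar_int W l r k x w - cut_int w) ^+ 2)%:E = gauss2%:E *
   \int[P]_w \int[lebesgue_measure]_(t in `[0%R, T])
     \sum_(c <oo | c \in K)
       ((if s0 < t <= s1 then 0 else scalar_proc l r k x t w c) ^+ 2)%:E)%E.
Proof.
have E w : scalar_int W l r k x w - cut_int w = scalar_int W l2 r2 k2 x2 w.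
  rewrite /scalar_int big_sumType /= /cut_int -sumrN; congr (_ + _).
  by apply: eq_bigr => j _; rewrite mulNr.
under eq_integral do rewrite E.
rewrite (scalar_isometry hF hW); last 4 first.
- by case.
- by case=> j; [exact: lrT|rewrite /= clip0 clip_lr clipT].
- case=> j /=; first exact: mx.
  have sF : sigma_algebra setT (F (clip (l j))) by apply: (filtration_sigma hF); rewrite clip0 clipT.
  under eq_fun do rewrite -sub0r; apply: rmeasB => //; [exact: rmeas_cst|exact: cut_coef_meas].
- by case=> j /=; [exact: ix|apply: int2N; exact: cut_coef_int2].
suff EP w t c : 0 <= t <= T -> scalar_proc l2 r2 k2 x2 t w c =
    (if s0 < t <= s1 then 0 else scalar_proc l r k x t w c).
  apply: (f_equal (fun z => gauss2%:E * z)%E); apply: iterated_eq => w t tT.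
  by apply: eq_eseriesr => c _; rewrite EP.
move=> tT.
rewrite /scalar_proc big_sumType /= [X in _ + X]big_mkcondr /=.
rewrite [X in _ + X](eq_bigr (fun j => - (if s0 < t <= s1 then
    if l j < t <= r j then x j w else 0 else 0))); last first.
  by move=> j _; rewrite -cut_term//; case: ifP => //; rewrite oppr0.
rewrite sumrN; case: ifP => _; last by rewrite big1_eq subr0.
by rewrite -big_mkcondr subrr.
Qed.

End window.

(** * Coordinates of integrals whose integrand vanishes outside a time window *)

Section ito_properties.
Context d (Om : measurableType d) (R : realType) (P : probability Om R) (T : R).
Variables (F : R -> set (set Om)) (K : set nat) (W : nat -> R -> Om -> R).
Hypothesis hF : complete_filtration P T F.
Hypothesis hW : cylindrical_wiener P T F K W.
Context {n : nat} (D : lipschitz_domain R n).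
Variables (s0 s1 : R).
Hypotheses (s0_ge0 : 0 <= s0) (s01 : s0 <= s1) (s1T : s1 <= T).
Variables (wt : R -> R) (A : Om -> nat -> vfield D) (I : Om -> vfield D).
Hypothesis mwt : measurable_fun setT wt.
Hypothesis wt_out : forall t, 0 < t -> ~~ (s0 < t <= s1) -> wt t = 0.
Hypothesis hI : ito_integral P T F K W (fun t w k => wt t *: A w k) I.
Variable b : vfield D.
Hypothesis b1 : fnormsq b <= 1.
Hypothesis mA : forall c, K c -> measurable_fun setT (fun w => fdot (A w c) b).

Local Notation z := (fun w => fdot (I w) b).
Local Notation lam := (@lebesgue_measure R).

Let T0 : 0 <= T. Proof. exact: le_trans s0_ge0 (le_trans s01 s1T). Qed.

Lemma fdot_sqr_le v : fdot v b ^+ 2 <= fnormsq v.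
Proof.
by rewrite (le_trans (fdot_CS v b))// ler_piMr// fnormsq_ge0.
Qed.

Let mz : measurable_fun setT z.
Proof.
have TT : 0 <= T <= T by rewrite T0 lexx.
have [mI _] := hI.
apply: (rmeas_measurable hF TT); apply: rmeas_fdot => //; exact: (filtration_sigma hF).
Qed.

Section elementary_coordinates.
Variable q : elementary P T D F K.

Definition el_coord j w := fdot (@el_coef _ _ _ _ _ _ _ _ _ q j w) b.

Lemma el_timeT j : 0 <= el_left (e:=q) j <= T.
Proof. by have [h1 /andP[h2 h3]] := el_time (e:=q) j; rewrite h1 (le_trans h2). Qed.

Lemma el_coord_meas j : rmeas (F (el_left (e:=q) j)) (el_coord j).
Proof.
apply: rmeas_fdot; last exact: el_meas.
by apply: (filtration_sigma hF); exact: el_timeT.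
Qed.

Lemma el_coord_int2 j : int2 P (el_coord j).
Proof.
apply: int2P; first exact: (rmeas_measurable hF (el_timeT j) (el_coord_meas j)).
apply: le_lt_trans (el_fin (e:=q) j); apply: ge0_integral_mono => w _.
  by rewrite lee_fin sqr_ge0.
by rewrite lee_fin fdot_sqr_le.
Qed.

Let zq := scalar_int W (@el_left _ _ _ _ _ _ _ _ _ q) (@el_right _ _ _ _ _ _ _ _ _ q)
  (@el_idx _ _ _ _ _ _ _ _ _ q) el_coord.
Let pq := scalar_proc (@el_left _ _ _ _ _ _ _ _ _ q) (@el_right _ _ _ _ _ _ _ _ _ q)
  (@el_idx _ _ _ _ _ _ _ _ _ q) el_coord.

Lemma el_int_coord w : fdot (el_int W q w) b = zq w.
Proof.
rewrite /el_int fdot_suml; apply: eq_bigr => j _.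
by rewrite fdotZl mulrC.
Qed.

Lemma el_proc_coord t w c : fdot (el_proc q t w c) b = pq t w c.
Proof. by rewrite /el_proc fdot_suml. Qed.

End elementary_coordinates.


Lemma cvg_ereal0 (u : nat -> \bar R) : u @ \oo --> 0%E ->
  forall eps : R, 0 < eps -> \forall m \near \oo, (u m <= eps%:E)%E.
Proof.
move=> /fine_cvgP[fin c] eps e0.
have h : \forall m \near \oo, fine (u m) <= eps by exact: (cvgr_le _ c).
near=> m.
have f : u m \is a fin_num by near: m.
by rewrite -(fineK f) lee_fin; near: m.
Unshelve. all: by end_near.
Qed.

Local Notation II f := (\int[P]_w \int[lam]_(t in `[0%R, T]) f w t)%E.
Local Notation energy := (II (fun w t => \sum_(c <oo | c \in K) ((wt t * fdot (A w c) b) ^+ 2)%:E)%E).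

(** An approximating elementary integral is clipped to the window. As the integrand vanishes
    outside, what is cut away is part of the approximation error, so the clipped integral y is still
    close to z, and it has the adaptedness and orthogonality wanted for z. The factor 4 arises from
    applying |a + b|^2 <= 2|a|^2 + 2|b|^2 twice, once to the integrals and once to the processes. *)
Lemma ito_approx (eps : R) : 0 < eps -> exists y : Om -> R,
  [/\ rmeas (F s1) y, int2 P y, int2 P (fun w => y w - z w),
      \int[P]_w ((y w - z w) ^+ 2) <= eps &
      forall g, rmeas (F s0) g -> int2 P g -> \int[P]_w (y w * g w) = 0] /\
  (\int[P]_w (z w ^+ 2)%:E <= (4 * gauss2)%:E * energy + eps%:E)%E.
Proof.
move=> e0.
have g0 : 0 <= gauss2 :> R by apply: Rint_ge0 => x; exact: sqr_ge0.
(* The error of y is at most 2 del + 2 gauss2 del, and the excess of the energy bound is 2 del + 4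
   gauss2 del; eps covers both. *)
pose del := eps / (2 + 2 * gauss2 + 4 * gauss2).
have del0 : 0 < del by rewrite divr_gt0//; lra.
have delE : 2 * del + 2 * (gauss2 * del) + 4 * (gauss2 * del) = eps by rewrite /del; field; rewrite gt_eqF//; lra.
have [mI [q [q1 q2]]] := hI.
have [m [h1 h2]] : exists m : nat, 
   (\int[P]_w \int[lebesgue_measure]_(t in `[0%R, T])
        \sum_(k <oo | k \in K) (fnormsq (el_proc (q m) t w k - wt t *: A w k))%:E <= del%:E)%E /\
   (mean_normsq P (fun w => el_int W (q m) w - I w)%R <= del%:E)%E.
  have c1 := cvg_ereal0 q1 del0.
  have c2 := cvg_ereal0 q2 del0.
  have [M _ H] : \forall m \near \oo, _ := filterI c1 c2.
  by exists M; apply: H => /=.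
set Q := q m in h1 h2.
pose l := @el_left _ _ _ _ _ _ _ _ _ Q.
pose r := @el_right _ _ _ _ _ _ _ _ _ Q.
pose k := @el_idx _ _ _ _ _ _ _ _ _ Q.
pose x := @el_coord Q.
have Kk j : K (k j) by exact: el_idxK.
have lrT j : 0 <= l j /\ l j <= r j <= T by exact: el_time.
have mx j : rmeas (F (l j)) (x j) by exact: el_coord_meas.
have ix j : int2 P (x j) by exact: el_coord_int2.
pose y := cut_int W s0 s1 l r k x.
pose zq := scalar_int W l r k x.
have izq : int2 P zq by exact: (scalar_int_int2 hF hW).
have iy : int2 P y by exact: (cut_int_int2 hF hW).
have ep t w c : scalar_proc l r k x t w c = fdot (el_proc Q t w c) b.
  by rewrite el_proc_coord.
have ez w : zq w = fdot (el_int W Q w) b by rewrite el_int_coord.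
have b1' : (\int[P]_w ((zq w - y w) ^+ 2)%:E <= (gauss2 * del)%:E)%E.
  rewrite (cut_diff hF hW)// EFinM; apply: lee_wpmul2l; first by rewrite lee_fin.
  apply: le_trans h1; apply: ge0_integral_mono => w _.
    by apply: integral_ge0 => t _; apply: nneseries_ge0 => c _ _; rewrite lee_fin sqr_ge0.
  apply: ge0_integral_mono => t.
    by move=> _; apply: nneseries_ge0 => c _ _; rewrite lee_fin sqr_ge0.
  move=> tT; apply: lee_nneseries => c _; first by rewrite lee_fin sqr_ge0.
  rewrite lee_fin; case: ifPn => [_|out]; first by rewrite expr0n fnormsq_ge0.
  move: tT; rewrite /= in_itv/= => /andP[t0 tT].
  (* The time 0 is apart: [wt_out] says nothing there, but elementary processes live on left-open
     intervals and vanish at 0. *)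
  move: t0; rewrite le_eqVlt => /predU1P[t0|t0].
    rewrite /scalar_proc big_pred0 ?expr0n ?fnormsq_ge0// => j.
    have [l0 _] := lrT j; rewrite -t0 ltNge l0 andbF//.
  by rewrite wt_out// scale0r subr0 ep fdot_sqr_le.
have b2 : (\int[P]_w ((zq w - z w) ^+ 2)%:E <= del%:E)%E.
  apply: le_trans h2; apply: ge0_integral_mono => w _; first by rewrite lee_fin sqr_ge0.
  by rewrite lee_fin ez -fdotBl fdot_sqr_le.
have iB : int2 P (fun w => zq w - y w) by exact: int2B.
have iC : int2 P (fun w => zq w - z w).
  apply: int2P; first by apply: measurable_funB; [exact: (int2_meas izq)|exact: mz].
  by apply: le_lt_trans b2 _; rewrite ltry.
have [_ iB2] := iB; have [_ iC2] := iC; have [_ izq2] := izq.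
have iz : int2 P z.
  have := int2B izq iC; congr int2; apply/funext => w; ring.
have iyz : int2 P (fun w => y w - z w).
  have := int2B iC iB; congr int2; apply/funext => w; ring.
have [_ iyz2] := iyz; have [_ iz2] := iz.
exists y; split; first split => //.
- exact: (cut_int_meas hF hW).
- move: b1' b2; rewrite -!RintE// !lee_fin => b1' b2.
  apply: (@le_trans _ _ (\int[P]_w (2 * (zq w - y w) ^+ 2 + 2 * (zq w - z w) ^+ 2))).
    apply: Rint_le => // [|w]; first by apply: int1D; exact: int1Z.
    have := sqr_ge0 ((zq w - y w) + (zq w - z w)); nra.
  rewrite RintD; [|exact: int1Z|exact: int1Z]; rewrite !RintZ//.
  have := mulr_ge0 g0 (ltW del0); lra.
- by move=> g mg ig; exact: (cut_int_orth hF hW).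
have mp c : measurable_fun setT (fun u : Om * R => scalar_proc l r k x u.2 u.1 c).
  have -> : (fun u : Om * R => scalar_proc l r k x u.2 u.1 c) =
      (fun u => \sum_j (k j == c)%:R * (\1_(`]l j, r j]%classic : set R) u.2) * x j u.1).
    apply/funext => u; rewrite /scalar_proc big_mkcond; apply: eq_bigr => j _.
    rewrite indicE mem_setE in_itv/=.
    by case: (k j == c); case: (l j < u.2); case: (u.2 <= r j); rewrite /= ?mul1r ?mul0r.
  apply: measurable_sum => j; apply: measurable_funM.
    apply: measurable_funM => //; apply: (measurableT_comp (measurable_indic _)) => //.
  exact: (measurableT_comp (int2_meas (ix j)) measurable_fst).
have ma c : c \in K -> measurable_fun setT (fun u : Om * R => wt u.2 * fdot (A u.1 c) b).
  move=> /set_mem Kc; apply: measurable_funM; first exact: measurableT_comp.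
  exact: (measurableT_comp (mA Kc) measurable_fst).
have bq : (II (fun w t => \sum_(c <oo | c \in K) ((scalar_proc l r k x t w c) ^+ 2)%:E)%E
    <= 2%:E * (energy + del%:E))%E.
  apply: le_trans (@iterated_le2 _ Om R P T
    (fun w t => \sum_(c <oo | c \in K) ((scalar_proc l r k x t w c) ^+ 2)%:E)%E
    (fun w t => \sum_(c <oo | c \in K) ((wt t * fdot (A w c) b) ^+ 2)%:E)%E
    (fun w t => \sum_(c <oo | c \in K) ((scalar_proc l r k x t w c - wt t * fdot (A w c) b) ^+ 2)%:E)%E _ _ _ _ _ _) _.
  - apply: ge0_emeasurable_sum => c; first by move=> u _ _; rewrite lee_fin sqr_ge0.
    by move=> Kc; apply/measurable_EFinP; apply: measurable_funX; exact: ma.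
  - apply: ge0_emeasurable_sum => c; first by move=> u _ _; rewrite lee_fin sqr_ge0.
    by move=> Kc; apply/measurable_EFinP; apply: measurable_funX; apply: measurable_funB; [exact: mp|exact: ma].
  - by move=> w t; apply: nneseries_ge0 => c _ _; rewrite lee_fin sqr_ge0.
  - by move=> w t; apply: nneseries_ge0 => c _ _; rewrite lee_fin sqr_ge0.
  - by move=> w t; apply: nneseries_ge0 => c _ _; rewrite lee_fin sqr_ge0.
  - move=> w t; rewrite -nneseriesD; last 2 first.
    + by move=> c _ _; rewrite lee_fin sqr_ge0.
    + by move=> c _ _; rewrite lee_fin sqr_ge0.
    rewrite -nneseriesZl; last by move=> c _; rewrite adde_ge0// lee_fin sqr_ge0.
    apply: lee_nneseries => c _; first by rewrite lee_fin sqr_ge0.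
    rewrite -EFinD -EFinM lee_fin.
    by have := sqr_ge0 (scalar_proc l r k x t w c - 2 * (wt t * fdot (A w c) b)); nra.
  apply: lee_wpmul2l => //; apply: leeD2l.
  apply: le_trans h1; apply: ge0_integral_mono => w _.
    by apply: integral_ge0 => t _; apply: nneseries_ge0 => c _ _; rewrite lee_fin sqr_ge0.
  apply: ge0_integral_mono => t _.
    by apply: nneseries_ge0 => c _ _; rewrite lee_fin sqr_ge0.
  apply: lee_nneseries => c _; first by rewrite lee_fin sqr_ge0.
  by rewrite lee_fin ep -fdotZl -fdotBl fdot_sqr_le.
have bz : \int[P]_w (z w ^+ 2) <= 2 * \int[P]_w (zq w ^+ 2) + 2 * \int[P]_w ((zq w - z w) ^+ 2).
  rewrite -!RintZ// -RintD//; try exact: int1Z.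
  apply: Rint_le => // [|w]; first by apply: int1D; exact: int1Z.
  have := sqr_ge0 (zq w + (zq w - z w)); nra.
rewrite -RintE//.
have E0 : (0 <= energy)%E.
  apply: integral_ge0 => w _; apply: integral_ge0 => t _; apply: nneseries_ge0 => c _ _.
  by rewrite lee_fin sqr_ge0.
have isq := scalar_isometry hF hW Kk lrT mx ix.
rewrite -/zq -RintE// in isq.
move: b2; rewrite -RintE// lee_fin => b2.
move: bq isq; set X := II (fun w t => \sum_(c <oo | c \in K) ((scalar_proc l r k x t w c) ^+ 2)%:E)%E.
move=> bX isq; move: E0 bX; set Y := energy; move: X Y isq => X Y isq Y0 bX.
(* With infinite energy the bound is trivial unless [gauss2] is 0, in which case the product is 0
   and the isometry makes the elementary integral vanish. *)
case: Y Y0 bX => [Y| |] //= Y0 bX; last first.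
  have [k0|k0] := eqVneq (gauss2 : R) 0; last first.
    by rewrite gt0_muley ?lte_fin ?mulr_gt0// 1?lt_neqAle 1?eq_sym ?k0// addye// leey.
  have zq0 : \int[P]_w (zq w ^+ 2) = 0 by apply: EFin_inj; rewrite isq k0 mul0e.
  rewrite k0 mulr0 mul0e add0e lee_fin; move: bz delE b2; rewrite zq0 k0.
  by move: (\int[P]_w _) (\int[P]_w _) => u v; lra.
have bq2 : \int[P]_w (zq w ^+ 2) <= gauss2 * (2 * (Y + del)).
  by rewrite -lee_fin isq EFinM; apply: lee_wpmul2l; rewrite ?lee_fin.
by rewrite -EFinM -EFinD lee_fin; have := mulr_ge0 g0 (ltW del0); lra.
Qed.

Lemma ito_int2 : int2 P z.
Proof.
have [y [[_ iy iyz _ _] _]] := ito_approx (@ltr01 R).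
have := int2B iy iyz; congr int2; apply/funext => w; ring.
Qed.

Lemma ito_sqr_le : (\int[P]_w (z w ^+ 2)%:E <= (4 * gauss2)%:E * energy)%E.
Proof. by apply/lee_addgt0Pr => eps /ito_approx[y []]. Qed.

Lemma ito_orth (g : Om -> R) : rmeas (F s0) g -> int2 P g ->
  \int[P]_w (z w * g w) = 0.
Proof.
move=> mg ig; have iz := ito_int2.
apply/eqP; rewrite -sqrf_eq0 eq_le sqr_ge0 andbT; apply/ler_addgt0Pr => eps e0; rewrite add0r.
pose c := \int[P]_w (g w ^+ 2); have c0 : 0 <= c by apply: Rint_ge0 => w; exact: sqr_ge0.
have d0 : 0 < eps / (c + 1) by rewrite divr_gt0// ltr_wpDl.
have [y [[_ iy iyz yz orth] _]] := ito_approx d0.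
have -> : \int[P]_w (z w * g w) = - \int[P]_w ((y w - z w) * g w).
  have := orth g mg ig.
  have -> : \int[P]_w (y w * g w) = \int[P]_w ((y w - z w) * g w + z w * g w).
    by apply: eq_Rintegral => w _; ring.
  by rewrite RintD; [lra|exact: int2_mul|exact: int2_mul].
rewrite sqrrN (le_trans (Rint_CS iyz ig))//.
apply: le_trans (_ : eps / (c + 1) * c <= _); first by rewrite ler_wpM2r.
by rewrite -mulrA ler_piMr ?(ltW e0)// mulrC ler_pdivrMr ?mul1r ?lerDl ?ltr_wpDl.
Qed.

(** The approximations y are known at time s1 and converge fast in L^2, hence almost everywhere to a
    limit equal to z up to a null set; completeness of F_s1 concludes. The errors 4^-(j+1) leave
    room for the constants 2 when increments are compared with 4^-j. *)
Lemma ito_meas : rmeas (F s1) z.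
Proof.
have s1T' : 0 <= s1 <= T by rewrite (le_trans s0_ge0 s01).
have sF := filtration_sigma hF s1T'; have cF := filtration_null hF s1T'.
have H j : exists y : Om -> R, [/\ rmeas (F s1) y, int2 P y, int2 P (fun w => y w - z w) &
    \int[P]_w ((y w - z w) ^+ 2) <= 4^-1 ^+ j.+1].
  have e0 : 0 < 4^-1 ^+ j.+1 :> R by rewrite exprn_gt0.
  by have [y [[my iy iyz yz _] _]] := ito_approx e0; exists y.
have [y yP] := choice H.
have iz := ito_int2.
have step j : \int[P]_w ((y j.+1 w - y j w) ^+ 2) <= 4^-1 ^+ j.
  have [_ _ i1 h1] := yP j.+1; have [_ _ i2 h2] := yP j.
  have [_ j1] := i1; have [_ j2] := i2.
  apply: (@le_trans _ _ (\int[P]_w (2 * (y j.+1 w - z w) ^+ 2 + 2 * (y j w - z w) ^+ 2))).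
    apply: Rint_le; [|by apply: int1D; exact: int1Z|move=> w].
      by case: (yP j) => _ iy _ _; case: (yP j.+1) => _ iy' _ _; case: (int2B iy' iy).
    have := sqr_ge0 ((y j.+1 w - z w) + (y j w - z w)); nra.
  rewrite RintD; [|exact: int1Z|exact: int1Z]; rewrite !RintZ//.
  move: h1 h2; rewrite !exprS; have : 0 <= 4^-1 ^+ j :> R by rewrite exprn_ge0.
  by move: (4^-1 ^+ j) (\int[P]_w _) (\int[P]_w _) => a u v; lra.
have iy j : int2 P (y j) by case: (yP j).
have [g [ig gJ gae]] := L2_fast_cvg iy (fast_sum step).
have igz : int2 P (fun w => g w - z w) by exact: int2B.
have gz : \int[P]_w ((g w - z w) ^+ 2) = 0.
  apply/eqP; rewrite eq_le; apply/andP; split; last by apply: Rint_ge0 => w; exact: sqr_ge0.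
  apply/ler_addgt0Pr => eps e0; rewrite add0r.
  have [J hJ] : exists J, 16 * 2^-1 ^+ J <= eps.
    have c : 16 * 2^-1 ^+ J @[J --> \oo] --> (16 * 0 : R).
      by apply: cvgMr; apply: cvg_expr; rewrite ger0_norm// invf_lt1// ltr1n.
    rewrite mulr0 in c.
    have [J _ HJ] : \forall J \near \oo, 16 * 2^-1 ^+ J <= eps by exact: (cvgr_le _ c).
    by exists J; apply: HJ => /=.
  apply: le_trans hJ.
  have [_ _ i1 h1] := yP J; have i2 := int2B ig (iy J); have h2 := gJ J.
  have [_ j1] := i1; have [_ j2] := i2; have [_ j3] := igz.
  apply: (@le_trans _ _ (\int[P]_w (2 * (g w - y J w) ^+ 2 + 2 * (y J w - z w) ^+ 2))).
    apply: Rint_le => //; [by apply: int1D; exact: int1Z|move=> w].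
    have := sqr_ge0 ((g w - y J w) - (y J w - z w)); nra.
  rewrite RintD; [|exact: int1Z|exact: int1Z]; rewrite !RintZ//.
  have h3 : 4^-1 ^+ J.+1 <= 2^-1 ^+ J :> R.
    rewrite exprS; apply: (@le_trans _ _ (4^-1 ^+ J)).
      by rewrite ler_piMl ?exprn_ge0// invf_le1// ler1n.
    by rewrite lerXn2r ?nnegrE// lef_pV2 ?posrE// ler_nat.
  have h4 : 0 <= 2^-1 ^+ J :> R by rewrite exprn_ge0.
  move: h1 h2 h3 h4; move: (2^-1 ^+ J) (4^-1 ^+ J.+1) (\int[P]_w _) (\int[P]_w _) => a a' u v; lra.
have [_ igz2] := igz.
have gzae := Rint_eq0_ae igz2 (fun w => sqr_ge0 _) gz.
apply: (rmeas_lim_ae sF cF (f := y)); first by move=> j; case: (yP j).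
apply: ae_imp2 gae gzae => w c /eqP; rewrite sqrf_eq0 subr_eq0 => /eqP <-; exact: c.
Qed.

End ito_properties.

(** * Isometry for field-valued step integrals *)

Section vector_isometry.
Context d (Om : measurableType d) (R : realType) (P : probability Om R) (T : R).
Variables (F : R -> set (set Om)) (K : set nat) (W : nat -> R -> Om -> R).
Hypothesis hF : complete_filtration P T F.
Hypothesis hW : cylindrical_wiener P T F K W.
Context {n : nat} (D : lipschitz_domain R n).
Variables (s0 : R) (A : Om -> nat -> vfield D).
Hypothesis s0_ge0 : 0 <= s0.
Hypothesis s0T : s0 <= T.
Hypothesis mAA : forall c c', K c -> K c' -> rmeas (F s0) (fun w => fdot (A w c) (A w c')).
Hypothesis iA : forall c, K c -> (\int[P]_w (fnormsq (A w c))%:E < +oo)%E.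

Let sT : 0 <= s0 <= T. Proof. by rewrite s0_ge0. Qed.
Let sF : sigma_algebra setT (F s0). Proof. exact: (filtration_sigma hF sT). Qed.

Lemma col_norm_meas c : K c -> rmeas (F s0) (fun w => fnorm (A w c)).
Proof.
move=> Kc; apply: (rmeas_comp sF (f := Num.sqrt)); last exact: mAA.
by apply: continuous_measurable_fun; exact: sqrt_continuous.
Qed.

Lemma col_norm_int2 c : K c -> int2 P (fun w => fnorm (A w c)).
Proof.
move=> Kc; apply: int2P; first exact: (rmeas_measurable hF sT (col_norm_meas Kc)).
by under eq_integral do rewrite sqr_fnorm; exact: iA.
Qed.

(* The integrable function (A_c, A_c') factors through the square-integrable
   |A_c| and this ratio, as [incr_pair] requires. *)
Let ratio c c' w := fdot (A w c) (A w c') / fnorm (A w c).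

Let ratioE c c' w : fnorm (A w c) * ratio c c' w = fdot (A w c) (A w c').
Proof.
rewrite /ratio; have [h|h] := eqVneq (fnorm (A w c)) 0; last by rewrite mulrC divfK.
rewrite h mul0r; apply/eqP; rewrite eq_sym -sqrf_eq0 eq_le sqr_ge0 andbT.
by rewrite (le_trans (fdot_CS _ _))// -!sqr_fnorm h expr0n mul0r.
Qed.

Let ratio_meas c c' : K c -> K c' -> rmeas (F s0) (ratio c c').
Proof.
move=> Kc Kc'; apply: rmeasM => //; first exact: mAA.
under eq_fun do rewrite -powR_inv1 ?fnorm_ge0//.
apply: (rmeas_comp sF (f := fun y => y `^ (-1))); last exact: col_norm_meas.
exact: measurable_powR.
Qed.

Let ratio_int2 c c' : K c -> K c' -> int2 P (ratio c c').
Proof.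
move=> Kc Kc'.
apply: (int2_le _ _ (col_norm_int2 Kc')); first exact: (rmeas_measurable hF sT (ratio_meas Kc Kc')).
move=> w; rewrite (ger0_norm (fnorm_ge0 _)) /ratio.
have [h|h] := eqVneq (fnorm (A w c)) 0; first by rewrite h invr0 mulr0 normr0 fnorm_ge0.
have h0 : 0 < fnorm (A w c) by rewrite lt_neqAle eq_sym h fnorm_ge0.
by rewrite normrM normfV (gtr0_norm h0) ler_pdivrMr// mulrC; exact: fdot_le.
Qed.

Variables (J : finType) (l r : J -> R) (k : J -> nat) (c : J -> R).
Hypothesis Kk : forall j, K (k j).
Hypothesis lrT : forall j, s0 <= l j /\ l j <= r j <= T.

Definition vector_int w := \sum_j incr W (k j) (l j) (r j) w *: (c j *: A w (k j)).
Definition norm_coef j w := c j * fnorm (A w (k j)).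

Let l0 j : 0 <= l j. Proof. by have [h _] := lrT j; exact: le_trans h. Qed.
Let lr j : l j <= r j. Proof. by have [_ /andP[]] := lrT j. Qed.
Let rT j : r j <= T. Proof. by have [_ /andP[]] := lrT j. Qed.
Let lT j : 0 <= l j <= T. Proof. by rewrite l0 (le_trans (lr j) (rT j)). Qed.

Lemma norm_coef_meas j : rmeas (F (l j)) (norm_coef j).
Proof.
have sl := filtration_sigma hF (lT j).
apply: rmeasM => //; first exact: rmeas_cst.
apply: (rmeas_mono hF s0_ge0 _ _ (col_norm_meas (Kk j))); first by have [] := lrT j.
by have /andP[] := lT j.
Qed.

Lemma norm_coef_int2 j : int2 P (norm_coef j).
Proof. by apply: int2Z; exact: col_norm_int2. Qed.

Let x' j j' w := c j' * ratio (k j) (k j') w.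

Let x'_meas j j' : rmeas (F (l j')) (x' j j').
Proof.
have sl := filtration_sigma hF (lT j').
apply: rmeasM => //; first exact: rmeas_cst.
apply: (rmeas_mono hF s0_ge0 _ _ (ratio_meas (Kk j) (Kk j'))); first by have [] := lrT j'.
by have /andP[] := lT j'.
Qed.

Let x'_int2 j j' : int2 P (x' j j').
Proof. by apply: int2Z; exact: ratio_int2. Qed.

Let term j j' w := (norm_coef j w * incr W (k j) (l j) (r j) w) *
  (x' j j' w * incr W (k j') (l j') (r j') w).

Let term_int1 j j' : int1 P (term j j').
Proof.
apply: int2_mul; apply: (incr_int2 hF hW) => //.
- exact: norm_coef_meas.
- exact: norm_coef_int2.
Qed.

Let vector_sqr w : fnormsq (vector_int w) = \sum_j \sum_j' term j j' w.
Proof.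
rewrite /fnormsq /vector_int fdot_suml; apply: eq_bigr => j _.
rewrite fdot_sumr; apply: eq_bigr => j' _.
rewrite !fdotZl !fdotZr -ratioE /term /norm_coef /x'; ring.
Qed.

Lemma vector_int1 : int1 P (fun w => fnormsq (vector_int w)).
Proof.
have -> : (fun w => fnormsq (vector_int w)) = (fun w => \sum_j \sum_j' term j j' w).
  by apply/funext => w; exact: vector_sqr.
by apply: int1_sum => j _; apply: int1_sum => j' _; exact: term_int1.
Qed.

(** Terms with different columns are uncorrelated, and for equal columns the pairing is (A_c, A_c) =
    |A_c|^2; so each field may be replaced by its scalar norm, and the scalar isometry becomes
    available. *)
Lemma vector_isometry : \int[P]_w fnormsq (vector_int w) =
  \int[P]_w (scalar_int W l r k norm_coef w ^+ 2).
Proof.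
transitivity (\int[P]_w \sum_j \sum_j' term j j' w).
  by apply: eq_Rintegral => w _; exact: vector_sqr.
transitivity (\int[P]_w \sum_j \sum_j'
   ((norm_coef j w * incr W (k j) (l j) (r j) w) * (norm_coef j' w * incr W (k j') (l j') (r j') w))); last first.
  apply: eq_Rintegral => w _; rewrite expr2 /scalar_int mulr_suml.
  by apply: eq_bigr => j _; rewrite mulr_sumr.
have i2 j : int2 P (fun w => norm_coef j w * incr W (k j) (l j) (r j) w).
  by apply: (incr_int2 hF hW) => //; [exact: norm_coef_meas|exact: norm_coef_int2].
rewrite Rint_sum; last by move=> j _; apply: int1_sum => j' _; exact: term_int1.
rewrite Rint_sum; last by move=> j _; apply: int1_sum => j' _; exact: int2_mul.
apply: eq_bigr => j _.
rewrite Rint_sum; last by move=> j' _; exact: term_int1.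
rewrite Rint_sum; last by move=> j' _; exact: int2_mul.
apply: eq_bigr => j' _.
have m1 := norm_coef_meas j; have m2 := norm_coef_meas j'; have m3 := x'_meas j j'.
have e1 := norm_coef_int2 j; have e2 := norm_coef_int2 j'; have e3 := x'_int2 j j'.
rewrite (incr_pair hF hW)// (incr_pair hF hW)//.
case: (eqVneq (k j) (k j')) => [e|_]; last by rewrite !mul0r !mulr0 !mul0r.
congr (_ * _); apply: eq_Rintegral => w _.
have := ratioE (k j) (k j') w; rewrite -e => h.
by rewrite /norm_coef /x' -e mulrACA h -/(fnormsq _) -sqr_fnorm [RHS]mulrACA -expr2.
Qed.

End vector_isometry.

(** Completeness by components. It is applied to one realisation at a time, so the limit field is
    chosen separately for each w and its measurability is a matter for [borel_lim]. *)
Lemma field_fast_cvg (R : realType) (n : nat) (D : lipschitz_domain R n)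
    (Y : nat -> vfield D) (S : R) :
  (forall k, \sum_(0 <= j < k) 2 ^+ j * fnormsq (Y j.+1 - Y j) <= S) ->
  exists v : vfield D, forall j, fnormsq (v - Y j) <= n.+1%:R * (2 * 2^-1 ^+ j * S).
Proof.
move=> hS.
have S0 : 0 <= S by apply: le_trans (hS 0%N); rewrite big_geq.
have normE (v : vfield D) : fnormsq v = \sum_i \int[vol D]_x (v i x ^+ 2).
  by apply: eq_bigr => i _; apply: eq_Rintegral => x _; rewrite expr2.
have H i : exists g, int2 (vol D) g /\
    forall j, \int[vol D]_x ((g x - Y j i x) ^+ 2) <= 2 * 2^-1 ^+ j * S.
  have [||g [g1 g2 _]] := @L2_fast_cvg _ _ _ (vol D) (fun j => Y j i) S.
  - by move=> j; exact: vf_int2.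
  - move=> k; apply: le_trans (hS k); apply: ler_sum => j _.
    rewrite ler_wpM2l ?exprn_ge0// normE (bigD1 i)//=.
    rewrite (_ : \int[vol D]_x ((Y j.+1 - Y j) i x ^+ 2) = \int[vol D]_x ((Y j.+1 i x - Y j i x) ^+ 2)).
      by rewrite lerDl; apply: sumr_ge0 => i' _; apply: Rint_ge0 => x; exact: sqr_ge0.
    by apply: eq_Rintegral => x _; rewrite vfBE.
  - by exists g.
have [g gP] := choice H.
exists (vf_of (fun i => proj1 (gP i))) => j; rewrite normE.
apply: (@le_trans _ _ (\sum_(i < n) 2 * 2^-1 ^+ j * S)).
  apply: ler_sum => i _; have [_ /(_ j)] := gP i; apply: le_trans.
  by rewrite le_eqVlt; apply/orP; left; apply/eqP; apply: eq_Rintegral => x _; rewrite vfBE vf_ofE.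
rewrite sumr_const card_ord -[leLHS]mulr_natl ler_wpM2r ?ler_nat//.
by rewrite !mulr_ge0// exprn_ge0.
Qed.

(** * Existence of the stochastic integral *)

Section ito_existence.
Context d (Om : measurableType d) (R : realType) (P : probability Om R) (T : R).
Context {n : nat} {U : hilbert R} (e : onb U) (D : lipschitz_domain R n).
Variables (F : R -> set (set Om)) (W : nat -> R -> Om -> R).
Local Notation K := (onb_idx e).
Hypothesis hF : complete_filtration P T F.
Hypothesis hW : cylindrical_wiener P T F K W.
Variables (s0 s1 : R).
Hypotheses (s0_ge0 : 0 <= s0) (s01 : s0 <= s1) (s1T : s1 <= T).
Variable G : Om -> hs_op e D.
Hypothesis mG : meas_wrt (F s0) (borel (@hs_dist R n U e D)) G.
Hypothesis fG : (\int[P]_w hs_normsq (G w) < +oo)%E.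
Local Notation lam := (@lebesgue_measure R).
Local Notation II f := (\int[P]_w \int[lam]_(t in `[0%R, T]) f w t)%E.
Local Notation A w c := (G w (e c)).

Variables (wt : R -> R) (sg gm : nat -> nat -> R) (om : nat -> R).
Hypothesis mwt : measurable_fun setT wt.
Hypothesis wt2 : forall t, wt t ^+ 2 <= 4.
Hypothesis wt_out : forall t, 0 < t -> ~~ (s0 < t <= s1) -> wt t = 0.
Hypothesis sgP : forall m j, (j <= m)%N -> s0 <= sg m j /\ sg m j <= sg m j.+1 <= s1.
(** Deterministic step approximation of the weight on m + 1 intervals. The m-th approximating
    process is [step_fun m] times G, with only the columns below m. *)
Definition step_fun m (t : R) := \sum_(j < m.+1 | sg m j < t <= sg m j.+1) gm m j.
Hypothesis om_ge0 : forall m, 0 <= om m.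
Hypothesis step_wt : forall m, {ae lam, forall t, 0 <= t <= T -> (step_fun m t - wt t) ^+ 2 <= om m}.
Hypothesis om_cvg : om @ \oo --> 0.

Let s0T : s0 <= T. Proof. exact: le_trans s01 s1T. Qed.
Let sT : 0 <= s0 <= T. Proof. by rewrite s0_ge0. Qed.
Let T_ge0 : 0 <= T. Proof. exact: le_trans s0T. Qed.

Lemma meas_col s (g : hs_op e D -> vfield D) : s0 <= s -> s <= T ->
  dist_continuous (@hs_dist R n U e D) (@fdist R n D) g ->
  meas_wrt (F s) (borel (@fdist R n D)) (fun w => g (G w)).
Proof.
move=> s0s sT' cg B mB; apply: (filtration_mono hF s0_ge0 s0s sT').
exact: (borel_comp (filtration_sigma hF sT) cg mG mB).
Qed.

Lemma scale_col_continuous a c : K c ->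
  dist_continuous (@hs_dist R n U e D) (@fdist R n D) (fun B => a *: B (e c)).
Proof.
move=> Kc B eps eps0; exists (eps / (`|a| + 1)).
  by rewrite divr_gt0// ltr_wpDl.
move=> B'; rewrite ltr_pdivlMr ?ltr_wpDl// => h.
rewrite /fdist -scalerBr fnormZ (le_lt_trans _ h)// mulrC.
have := hs_dist_col B B' Kc; rewrite /fdist => h'.
by rewrite ler_pM ?fnorm_ge0// lerDl.
Qed.

Lemma add_col_continuous c c' : K c -> K c' ->
  dist_continuous (@hs_dist R n U e D) (@fdist R n D) (fun B => B (e c) + B (e c')).
Proof.
move=> Kc Kc' B eps eps0; exists (eps / 2); first by rewrite divr_gt0.
move=> B' h; have h1 := hs_dist_col B B' Kc; have h2 := hs_dist_col B B' Kc'.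
rewrite /fdist (_ : _ - _ = (B (e c) - B' (e c)) + (B (e c') - B' (e c'))); last first.
  by rewrite opprD addrACA.
apply: le_lt_trans (fnormD _ _) _; apply: le_lt_trans (lerD h1 h2) _.
by rewrite [ltRHS]splitr; exact: ltrD.
Qed.

Let mAA c c' : K c -> K c' -> rmeas (F s0) (fun w => fdot (A w c) (A w c')).
Proof.
move=> Kc Kc'; have sF := filtration_sigma hF sT.
have -> : (fun w => fdot (A w c) (A w c')) = (fun w => 2^-1 *
    (fnormsq (A w c + A w c') - fnormsq (A w c) - fnormsq (A w c'))).
  by apply/funext => w; rewrite fnormsqD; field.
apply: (rmeasM sF (rmeas_cst sF _)); apply: rmeasB => //; first apply: rmeasB => //.
- apply: rmeas_fnormsq => //; apply: (meas_col (g := fun B => B (e c) + B (e c'))) => //.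
  exact: add_col_continuous.
- by apply: rmeas_fnormsq => //; apply: (meas_col (g := fun B => B (e c))) => //; exact: col_dist_continuous.
- by apply: rmeas_fnormsq => //; apply: (meas_col (g := fun B => B (e c'))) => //; exact: col_dist_continuous.
Qed.

Let iA c : K c -> (\int[P]_w (fnormsq (A w c))%:E < +oo)%E.
Proof.
move=> Kc; apply: le_lt_trans fG; apply: ge0_integral_mono => w _.
  by rewrite lee_fin fnormsq_ge0.
have := @nneseries_lim_ge R (fun k => (fnormsq (A w k))%:E) (fun k => k \in K) 0 c.+1.
move=> /(_ (fun i _ _ => fnormsq_ge0 _)); apply: le_trans.
rewrite big_mkcond big_nat_recr//= mem_set//; apply: leeDr.
by apply: sume_ge0 => i _; case: ifP => //; rewrite lee_fin fnormsq_ge0.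
Qed.

(** Pairs of a time interval and an admissible column; they are enumerated by ordinals below, the
    index type of [elementary]. *)
Let J (m : nat) : pred ('I_m.+1 * 'I_m) := fun z => (z.2 : nat) \in K.
Arguments J : clear implicits.

Let st_left m (i : 'I_#|J m|) := sg m (enum_val i).1.
Let st_right m (i : 'I_#|J m|) := sg m (enum_val i).1.+1.
Let st_idx m (i : 'I_#|J m|) : nat := (enum_val i).2.
Let st_cst m (i : 'I_#|J m|) := gm m (enum_val i).1.

Let st_idxK m (i : 'I_#|J m|) : K (st_idx i).
Proof. by apply: set_mem; exact: (enum_valP i). Qed.

Let st_time0 m (i : 'I_#|J m|) : s0 <= st_left i /\ st_left i <= st_right i <= T.
Proof.
have [|h1 /andP[h2 h3]] := @sgP m (enum_val i).1; first by rewrite -ltnS.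
by rewrite h1 h2 (le_trans h3).
Qed.

Let st_time m (i : 'I_#|J m|) : 0 <= st_left i /\ st_left i <= st_right i <= T.
Proof. by have [h ->] := st_time0 i; rewrite (le_trans s0_ge0). Qed.

Let st_meas m (i : 'I_#|J m|) :
  meas_wrt (F (st_left i)) (borel (@fdist R n D)) (fun w => st_cst i *: A w (st_idx i)).
Proof.
have [h /andP[h1 h2]] := st_time0 i.
apply: (meas_col (g := fun B => st_cst i *: B (e (st_idx i)))) => //; first exact: le_trans h2.
by apply: scale_col_continuous; exact: st_idxK.
Qed.

Let st_fin m (i : 'I_#|J m|) : (mean_normsq P (fun w => st_cst i *: A w (st_idx i)) < +oo)%E.
Proof.
have i2 := col_norm_int2 hF s0_ge0 s0T mAA iA (st_idxK i).
have := int2_lty (int2Z (st_cst i) i2); congr (_ < _)%E.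
by apply: eq_integral => w _; rewrite fnormsqZ exprMn sqr_fnorm.
Qed.

Definition step_el m : elementary P T D F K :=
  Elementary (@st_time m) (@st_idxK m) (@st_meas m) (@st_fin m).

Let cf m t c := if (c < m)%N && (c \in K) then step_fun m t else 0.

Let cfE m t c : \sum_(i : 'I_#|J m| | (st_idx i == c) && (st_left i < t <= st_right i)) st_cst i = cf m t c.
Proof.
rewrite -(big_enum_val_cond (fun z : 'I_m.+1 * 'I_m => ((z.2 : nat) == c) && (sg m z.1 < t <= sg m z.1.+1))
  (fun z => gm m z.1)) /=.
rewrite (eq_bigl (fun z : 'I_m.+1 * 'I_m => (sg m z.1 < t <= sg m z.1.+1) && (((z.2 : nat) \in K) && ((z.2 : nat) == c)))); last first.
  by move=> z; rewrite unfold_in /J; case: (_ \in K); case: (_ == c); rewrite /= ?andbT ?andbF.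
rewrite -(pair_big_dep (fun j : 'I_m.+1 => sg m j < t <= sg m j.+1)
  (fun _ (k : 'I_m) => ((k : nat) \in K) && ((k : nat) == c)) (fun j _ => gm m j)) /=.
rewrite /cf /step_fun; case: ifP => [/andP[cm cK]|h].
  apply: eq_bigr => j _; rewrite (big_pred1 (Ordinal cm))// => k /=.
  by rewrite -val_eqE /=; case: eqP => [->|]; rewrite ?cK ?andbF.
rewrite big1// => j _; rewrite big_pred0// => k.
by apply/negbTE/negP => /andP[kK /eqP kc]; move: h; rewrite -kc ltn_ord kK.
Qed.

Let procE m t w c : el_proc (step_el m) t w c = cf m t c *: A w c.
Proof.
rewrite -cfE scaler_suml /el_proc /=; apply: eq_bigr => i /andP[/eqP <- _] //.
Qed.

Let normE m t w c : scalar_proc (@st_left m) (@st_right m) (@st_idx m)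
  (norm_coef (fun w c => A w c) (@st_idx m) (@st_cst m)) t w c = cf m t c * fnorm (A w c).
Proof.
by rewrite -cfE mulr_suml /scalar_proc; apply: eq_bigr => i /andP[/eqP <- _].
Qed.

Let eta m w : 'rV[R]_m := \row_(k < m) if (k : nat) \in K then
  \sum_(j < m.+1) gm m j * incr W k (sg m j) (sg m j.+1) w else 0.

Let el_intE m w : el_int W (step_el m) w = col_comb (eta m w) (G w).
Proof.
rewrite /el_int /= /col_comb.
rewrite -(big_enum_val (fun z : 'I_m.+1 * 'I_m =>
  (W z.2 (sg m z.1.+1) w - W z.2 (sg m z.1) w) *: (gm m z.1 *: A w z.2))) /=.
rewrite (eq_bigl (fun z : 'I_m.+1 * 'I_m => true && ((z.2 : nat) \in K)))//.
rewrite -(pair_big xpredT (fun k : 'I_m => (k : nat) \in K) (fun (j : 'I_m.+1) (k : 'I_m) =>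
  (W k (sg m j.+1) w - W k (sg m j) w) *: (gm m j *: A w k))) /=.
rewrite exchange_big; apply: eq_bigr => k kK; rewrite mxE kK scaler_suml.
by apply: eq_bigr => j _; rewrite scalerA mulrC.
Qed.

Let meas_X m : meas_wrt (F T) (borel (@fdist R n D)) (el_int W (step_el m)).
Proof.
have TT : 0 <= T <= T by rewrite T_ge0 lexx.
have sF := filtration_sigma hF TT.
rewrite (_ : el_int W (step_el m) = fun w => col_comb (eta m w) (G w)); last first.
  by apply/funext => w; exact: el_intE.
apply: (borel_joint (m := m) sF (@hs_dist0 R n U e D) (@hs_dist_trans R n U e D)).
- by move=> a B eps eps0; exact: col_comb_continuous.
- move=> k; rewrite (_ : (fun w => eta m w ord0 k) = fun w => if (k : nat) \in K then
      \sum_(j < m.+1) gm m j * incr W k (sg m j) (sg m j.+1) w else 0); last first.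
    by apply/funext => w; rewrite mxE.
  case: (boolP ((k : nat) \in K)) => [/set_mem Kk|_]; last exact: rmeas_cst.
  apply: rmeas_sum => // j _; apply: (rmeasM sF (rmeas_cst sF _)).
  have [|h1 /andP[h2 h3]] := @sgP m j; first by rewrite -ltnS.
  apply: (rmeas_mono hF (s := sg m j.+1)) => //.
  + by rewrite (le_trans s0_ge0)// (le_trans h1).
  + exact: le_trans h3 s1T.
  + apply: (rmeas_incr hF hW) => //; [exact: le_trans h1|exact: le_trans h3 s1T].
- by move=> B mB; apply: (filtration_mono hF s0_ge0 s0T (lexx _)); exact: mG.
Qed.


Let err m := II (fun w t => \sum_(c <oo | c \in K)
  (fnormsq (el_proc (step_el m) t w c - wt t *: A w c))%:E)%E.

Let errE m : err m = II (fun w t => \sum_(c <oo | c \in K)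
  (((cf m t c - wt t) * fnorm (A w c)) ^+ 2)%:E)%E.
Proof.
apply: eq_integral => w _; apply: eq_integral => t _; apply: eq_eseriesr => c _.
by rewrite procE -scalerBl fnormsqZ exprMn sqr_fnorm.
Qed.

Let meas_step m : measurable_fun setT (step_fun m).
Proof.
have -> : step_fun m = (fun t => \sum_(j < m.+1) \1_(`]sg m j, sg m j.+1]%classic : set R) t * gm m j).
  apply/funext => t; rewrite /step_fun big_mkcond; apply: eq_bigr => j _.
  by rewrite indicE mem_setE in_itv/=; case: ifP; rewrite ?mul1r ?mul0r.
by apply: measurable_sum => j; apply: measurable_funM.
Qed.

Let meas_cf m c : measurable_fun setT (cf m ^~ c).
Proof. by rewrite /cf; case: (_ && _); [exact: meas_step|exact: measurable_cst]. Qed.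

Let meas_err m : measurable_fun setT (fun z : Om * R => \sum_(c <oo | c \in K)
  (((cf m z.2 c - wt z.2) * fnorm (A z.1 c)) ^+ 2)%:E)%E.
Proof.
apply: ge0_emeasurable_sum => c; first by move=> u _ _; rewrite lee_fin sqr_ge0.
move=> /set_mem Kc; apply/measurable_EFinP; apply: measurable_funX; apply: measurable_funM.
  have h : measurable_fun setT (fun t => cf m t c - wt t) by apply: measurable_funB.
  exact: (measurableT_comp h measurable_snd).
exact: (measurableT_comp (int2_meas (col_norm_int2 hF s0_ge0 s0T mAA iA Kc)) measurable_fst).
Qed.

(** The difference of two step integrals is a step integral over the disjoint sum of their indices,
    with the coefficients of the second negated. The isometry then compares both processes with the
    target. *)
Let dist_err m m' : int1 P (fun w => fnormsq (el_int W (step_el m) w - el_int W (step_el m') w)) /\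
  (\int[P]_w (fnormsq (el_int W (step_el m) w - el_int W (step_el m') w))%:E
  <= gauss2%:E * (2%:E * (err m + err m')))%E.
Proof.
pose l2 (j : 'I_#|J m| + 'I_#|J m'|) := match j with inl i => st_left i | inr i => st_left i end.
pose r2 (j : 'I_#|J m| + 'I_#|J m'|) := match j with inl i => st_right i | inr i => st_right i end.
pose k2 (j : 'I_#|J m| + 'I_#|J m'|) := match j with inl i => st_idx i | inr i => st_idx i end.
pose c2 (j : 'I_#|J m| + 'I_#|J m'|) := match j with inl i => st_cst i | inr i => - st_cst i end.
have Kk2 j : K (k2 j) by case: j => i; exact: st_idxK.
have lr2 j : s0 <= l2 j /\ l2 j <= r2 j <= T by case: j => i; exact: st_time0.
have lr2' j : 0 <= l2 j /\ l2 j <= r2 j <= T by case: j => i; exact: st_time.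
have E w : el_int W (step_el m) w - el_int W (step_el m') w = vector_int W (fun w c => A w c) l2 r2 k2 c2 w.
  rewrite /vector_int big_sumType /= /el_int -sumrN; congr (_ + _).
  by apply: eq_bigr => i _; rewrite -scalerN -scaleNr.
have i1 := vector_int1 hF hW s0_ge0 s0T mAA iA c2 Kk2 lr2.
have vi := vector_isometry hF hW s0_ge0 s0T mAA iA c2 Kk2 lr2.
have m2 := norm_coef_meas hF s0_ge0 s0T mAA c2 Kk2 lr2.
have i2 := norm_coef_int2 hF s0_ge0 s0T mAA iA c2 Kk2.
have [_ i3] := scalar_int_int2 hF hW Kk2 lr2' m2 i2.
split.
  move: i1; congr int1; apply/funext => w; by rewrite (E w).
have -> : (\int[P]_w (fnormsq (el_int W (step_el m) w - el_int W (step_el m') w))%:E =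
    \int[P]_w (scalar_int W l2 r2 k2 (norm_coef (fun w c => A w c) k2 c2) w ^+ 2)%:E)%E.
  rewrite -[RHS](RintE i3) -vi (RintE i1).
  by apply: (@eq_integral _ _ _ P) => w _; rewrite (E w).
rewrite (scalar_isometry hF hW Kk2 lr2' m2 i2); apply: lee_wpmul2l.
  by rewrite lee_fin; apply: Rint_ge0 => x; exact: sqr_ge0.
rewrite (errE m) (errE m'); apply: (@iterated_le2 _ Om R P T _
  (fun w t => \sum_(c <oo | c \in K) (((cf m t c - wt t) * fnorm (A w c)) ^+ 2)%:E)%E
  (fun w t => \sum_(c <oo | c \in K) (((cf m' t c - wt t) * fnorm (A w c)) ^+ 2)%:E)%E
  (@meas_err m) (@meas_err m')).
- by move=> w t; apply: nneseries_ge0 => c _ _; rewrite lee_fin sqr_ge0.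
- by move=> w t; apply: nneseries_ge0 => c _ _; rewrite lee_fin sqr_ge0.
- by move=> w t; apply: nneseries_ge0 => c _ _; rewrite lee_fin sqr_ge0.
- move=> w t; rewrite -nneseriesD; last 2 first.
  + by move=> c _ _; rewrite lee_fin sqr_ge0.
  + by move=> c _ _; rewrite lee_fin sqr_ge0.
  rewrite -nneseriesZl; last by move=> c _; rewrite adde_ge0// lee_fin sqr_ge0.
  apply: lee_nneseries => c _; first by rewrite lee_fin sqr_ge0.
  rewrite -EFinD -EFinM lee_fin.
  have -> : scalar_proc l2 r2 k2 (norm_coef (fun w c => A w c) k2 c2) t w c =
      (cf m t c - wt t) * fnorm (A w c) - (cf m' t c - wt t) * fnorm (A w c).
    have -> : scalar_proc l2 r2 k2 (norm_coef (fun w c => A w c) k2 c2) t w c =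
        cf m t c * fnorm (A w c) - cf m' t c * fnorm (A w c).
      rewrite -!normE /scalar_proc big_sumType /= -sumrN; congr (_ + _).
      by apply: eq_bigr => i _; rewrite /norm_coef mulNr.
    by ring.
  move: (_ * _) (_ * _) => x y; have := sqr_ge0 (x + y); nra.
Qed.

Let tail m := (\sum_(m <= c <oo | c \in K) \int[P]_w (fnormsq (A w c))%:E)%E.
Let total := (\sum_(c <oo | c \in K) \int[P]_w (fnormsq (A w c))%:E)%E.

Let meas_A c : c \in K -> measurable_fun setT (fun w => (fnormsq (A w c))%:E).
Proof.
move=> /set_mem Kc; apply/measurable_EFinP.
under eq_fun do rewrite -sqr_fnorm; apply: measurable_funX.
exact: (int2_meas (col_norm_int2 hF s0_ge0 s0T mAA iA Kc)).
Qed.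

Let tl m w := (\sum_(c <oo | c \in K) if (m <= c)%N then (fnormsq (A w c))%:E else 0)%E.

Let integral_series (f : nat -> Om -> \bar R) :
  (forall c w, 0 <= f c w)%E -> (forall c, c \in K -> measurable_fun setT (f c)) ->
  (\int[P]_w (\sum_(c <oo | c \in K) f c w) = \sum_(c <oo | c \in K) \int[P]_w f c w)%E.
Proof.
move=> f0 mf; under eq_integral do rewrite eseries_mkcond.
rewrite integral_nneseries//; last 2 first.
- by move=> c; have [/mf//|_] := boolP (c \in K); exact: measurable_cst.
- by move=> c w _; case: ifP.
rewrite [RHS]eseries_mkcond; apply: eq_eseriesr => c _.
by case: ifP => // _; rewrite integral0.
Qed.

Let totalE : (\int[P]_w hs_normsq (G w))%E = total.
Proof.
by rewrite /hs_normsq /columns_normsq integral_series// => c w; rewrite lee_fin fnormsq_ge0.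
Qed.

Let tlE m : (\int[P]_w tl m w)%E = tail m.
Proof.
rewrite integral_series; last 2 first.
- by move=> c w; case: ifP => // _; rewrite lee_fin fnormsq_ge0.
- by move=> c cK; case: (leqP m c) => _; [exact: meas_A|exact: measurable_cst].
have a0 c : (0 <= \int[P]_w (fnormsq (A w c))%:E)%E.
  by apply: integral_ge0 => w _; rewrite lee_fin fnormsq_ge0.
rewrite (@nneseries_split_cond _ _ 0 m)//; last first.
  by move=> c _; apply: integral_ge0 => w _; case: ifP => // _; rewrite lee_fin fnormsq_ge0.
rewrite add0n big1_seq ?add0e; last first.
  move=> c /andP[_]; rewrite mem_index_iota /= => cm.
  by under eq_integral do rewrite leqNgt cm; rewrite integral0.
rewrite /tail eseries_cond [RHS]eseries_cond; apply: eq_eseriesr => c /andP[_ mc].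
by apply: eq_integral => w _; rewrite mc.
Qed.

Let tl_ge0 m w : (0 <= tl m w)%E.
Proof. by apply: nneseries_ge0 => c _ _; case: ifP => // _; rewrite lee_fin fnormsq_ge0. Qed.

Let hs_ge0 w : (0 <= hs_normsq (G w))%E.
Proof. by apply: nneseries_ge0 => c _ _; rewrite lee_fin fnormsq_ge0. Qed.

Let meas_tl m : measurable_fun setT (tl m).
Proof.
apply: ge0_emeasurable_sum => [c w _ _|c cK]; first by case: ifP => // _; rewrite lee_fin fnormsq_ge0.
by case: (leqP m c) => _; [exact: meas_A|exact: measurable_cst].
Qed.

Let meas_hs : measurable_fun setT (fun w => hs_normsq (G w)).
Proof.
apply: ge0_emeasurable_sum => [c w _ _|c cK]; first by rewrite lee_fin fnormsq_ge0.
exact: meas_A.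
Qed.

(** On the columns below m the error is that of the step approximation in time; on the others it is
    the whole weight, whose square is at most 4, times the tail of the Hilbert-Schmidt series. *)
Let err_le m : (err m <= T%:E * ((om m)%:E * total + 4%:E * tail m))%E.
Proof.
rewrite errE.
pose B w := ((om m)%:E * hs_normsq (G w) + 4%:E * tl m w)%E.
have B0 w : (0 <= B w)%E by rewrite adde_ge0// mule_ge0// lee_fin.
have mB : measurable_fun setT B.
  by apply: emeasurable_funD; apply: measurable_funeM.
have mI : measurable (`[0, T]%classic : set R) by exact: measurable_itv.
have le1 w : (\int[lam]_(t in `[0%R, T]) (\sum_(c <oo | c \in K)
    (((cf m t c - wt t) * fnorm (A w c)) ^+ 2)%:E) <= T%:E * B w)%E.
  apply: (@le_trans _ _ (\int[lam]_(t in `[0%R, T]) B w)%E); last first.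
    rewrite integral_cst// muleC; apply: (lee_wpmul2r (B0 w)).
    suff : (lebesgue_measure [set` `[0%R, T]] <= T%:E)%E by [].
    by rewrite lebesgue_measure_itv/= lte_fin; case: ifP => _; rewrite ?sube0// lee_fin.
  apply: ae_ge0_le_integral.
  - exact: mI.
  - by move=> t _; apply: nneseries_ge0 => c _ _; rewrite lee_fin sqr_ge0.
  - apply: measurable_funTS.
    exact: (iterated_sub (f := fun w t => \sum_(c <oo | c \in K)
      (((cf m t c - wt t) * fnorm (A w c)) ^+ 2)%:E)%E (@meas_err m)).
  - by move=> t _; exact: B0.
  - exact: measurable_cst.
  - apply: ae_imp (@step_wt m) => t ht; rewrite /= in_itv/= => tT.
    rewrite /B /hs_normsq /columns_normsq -nneseriesZl; last by move=> c _; rewrite lee_fin fnormsq_ge0.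
    rewrite -nneseriesZl; last by move=> c _; case: ifP => // _; rewrite lee_fin fnormsq_ge0.
    rewrite -nneseriesD; last 2 first.
    + by move=> c _ _; rewrite mule_ge0// lee_fin ?fnormsq_ge0.
    + by move=> c _ _; rewrite mule_ge0//; case: ifP => // _; rewrite lee_fin fnormsq_ge0.
    apply: lee_nneseries => c cK; first by rewrite lee_fin sqr_ge0.
    rewrite exprMn sqr_fnorm /cf cK andbT; case: leqP => mc.
      rewrite -!EFinM -EFinD lee_fin sub0r sqrrN -mulrDl ler_wpM2r ?fnormsq_ge0//.
      by rewrite (le_trans (wt2 t))// lerDr.
    rewrite mule0 adde0 -EFinM lee_fin ler_wpM2r ?fnormsq_ge0//; exact: ht.
apply: (@le_trans _ _ (\int[P]_w (T%:E * B w))%E).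
  apply: ge0_integral_mono => w _ //; apply: integral_ge0 => t _.
  by apply: nneseries_ge0 => c _ _; rewrite lee_fin sqr_ge0.
rewrite ge0_integralZl//; apply: lee_wpmul2l; rewrite ?lee_fin//.
rewrite /B ge0_integralD//; last 4 first.
- by move=> w _; rewrite mule_ge0// lee_fin.
- exact: measurable_funeM.
- by move=> w _; rewrite mule_ge0// lee_fin.
- exact: measurable_funeM.
by rewrite ge0_integralZl// ?ge0_integralZl// ?totalE ?tlE// lee_fin.
Qed.

Let err_cvg : err @ \oo --> 0%E.
Proof.
have a0 c : (0 <= \int[P]_w (fnormsq (A w c))%:E)%E.
  by apply: integral_ge0 => w _; rewrite lee_fin fnormsq_ge0.
have tot0 : (0 <= total)%E by apply: nneseries_ge0.
have toty : (total < +oo)%E by rewrite -totalE.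
have totf : total \is a fin_num by rewrite ge0_fin_numE.
have tc : tail @ \oo --> 0%E by apply: nneseries_tail_cvg.
have err0 m : (0 <= err m)%E.
  apply: integral_ge0 => w _; apply: integral_ge0 => t _.
  by apply: nneseries_ge0 => c _ _; rewrite lee_fin fnormsq_ge0.
have c0 : (fun m => T%:E * ((om m)%:E * total + 4%:E * tail m))%E @ \oo --> (T%:E * (0 * total + 4%:E * 0))%E.
  apply: cvgeZl => //; apply: cvgeD => //; last exact: cvgeZl.
    by rewrite mule0 fin_num_adde_defl.
  apply: cvgeZr => //; apply: cvg_EFin; [exact: nearW|exact: om_cvg].
move: c0; rewrite mul0e mule0 adde0 mule0 => c0.
apply: (squeeze_cvge _ (cvg_cst _) c0); apply: nearW => m.
by rewrite err0 err_le.
Qed.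


Let X m := el_int W (step_el m).
Let dX m m' := \int[P]_w fnormsq (X m w - X m' w).

Let TT : 0 <= T <= T. Proof. by rewrite T_ge0 lexx. Qed.
Let sFT : sigma_algebra setT (F T). Proof. exact: (filtration_sigma hF TT). Qed.

Let dX_small (eps : R) : 0 < eps -> exists M, forall m m', (M <= m)%N -> (M <= m')%N -> dX m m' <= eps.
Proof.
move=> eps0; have g0 : 0 <= gauss2 :> R by apply: Rint_ge0 => x; exact: sqr_ge0.
pose del := eps / (4 * gauss2 + 1).
have del0 : 0 < del by rewrite divr_gt0// ltr_wpDl// mulr_ge0.
have [M _ HM] := cvg_ereal0 err_cvg del0.
exists M => m m' /HM h /HM h'; have [i1 le1] := dist_err m m'.
rewrite -lee_fin /dX RintE//; apply: le_trans le1 _.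
apply: (@le_trans _ _ (gauss2%:E * (2%:E * (del%:E + del%:E)))%E).
  apply: lee_wpmul2l; first by rewrite lee_fin.
  by apply: lee_wpmul2l; [rewrite lee_fin|exact: (leeD h h')].
rewrite -!EFinD -!EFinM lee_fin.
have -> : gauss2 * (2 * (del + del)) = eps * (4 * gauss2 / (4 * gauss2 + 1)).
  by rewrite /del; field; rewrite gt_eqF// ltr_wpDl// mulr_ge0.
by rewrite ler_piMr ?(ltW eps0)// ler_pdivrMr ?mul1r ?lerDl// ltr_wpDl// mulr_ge0.
Qed.

(** Along a fast subsequence the weighted series S of squared increments is almost surely finite.
    Where it is, the realisations converge in L^2(D) at a rate governed by S; elsewhere the integral
    is set to 0. Integrating the rate gives convergence in mean square. *)
Theorem ito_exists : exists I, ito_integral P T F K W (fun t w c => wt t *: A w c) I.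
Proof.
have [phi [phi1 phi2 phi3]] := fast_subsequence dX_small.
pose Y j := X (phi j).
have iY j : int1 P (fun w => fnormsq (Y j.+1 w - Y j w)) by have [] := dist_err (phi j.+1) (phi j).
have stepY j : \int[P]_w fnormsq (Y j.+1 w - Y j w) <= 4^-1 ^+ j.
  have := phi2 j (phi j.+1) (phi3 j); apply: le_trans; rewrite /dX.
  rewrite le_eqVlt; apply/orP; left; apply/eqP; apply: eq_Rintegral => w _.
  exact: fnormsqBC.
pose S w := (\sum_(j <oo) (2 ^+ j * fnormsq (Y j.+1 w - Y j w))%:E)%E.
have D0 j w : 0 <= 2 ^+ j * fnormsq (Y j.+1 w - Y j w) by rewrite mulr_ge0 ?exprn_ge0 ?fnormsq_ge0.
have mD j : measurable_fun setT (fun w => (2 ^+ j * fnormsq (Y j.+1 w - Y j w))%:E).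
  by apply/measurable_EFinP; apply: measurable_funM => //; exact: (int1_meas (iY j)).
have S0 w : (0 <= S w)%E by apply: nneseries_ge0 => j _ _; rewrite lee_fin.
have mS : measurable_fun setT S.
  apply: (@ge0_emeasurable_sum _ _ _ setT (fun j w => (2 ^+ j * fnormsq (Y j.+1 w - Y j w))%:E) xpredT).
    by move=> j w _ _; rewrite lee_fin.
  by move=> j _; exact: mD.
have intS : (\int[P]_w S w <= 2%:E)%E.
  rewrite /S integral_nneseries; [|exact: measurableT|exact: mD|by move=> j w _; rewrite lee_fin].
  apply: lime_le; first by apply: is_cvg_nneseries => j _ _; apply: integral_ge0 => x _; rewrite lee_fin.
  apply: nearW => k.
  rewrite (_ : (\sum_(0 <= j < k) _)%E = (\sum_(0 <= j < k) 2 ^+ j * \int[P]_w fnormsq (Y j.+1 w - Y j w))%:E).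
    by rewrite lee_fin; exact: fast_sum.
  by rewrite -sumEFin; apply: eq_bigr => j _; rewrite -RintE ?RintZ//; exact: int1Z.
have aeS : {ae P, forall w, (S w < +oo)%E}.
  have iS : P.-integrable setT S.
    apply/integrableP; split => //.
    by under eq_integral do rewrite gee0_abs//; apply: le_lt_trans intS _; rewrite ltry.
  have := integrable_ae measurableT iS; apply: ae_imp => w /(_ Logic.I); rewrite fin_numElt => /andP[] //.
have H w : exists v : vfield D,
    ((S w < +oo)%E -> forall j, fnormsq (v - Y j w) <= n.+1%:R * (2 * 2^-1 ^+ j * fine (S w))) /\
    (~ (S w < +oo)%E -> v = 0).
  have [Sw|Sw] := pselect (S w < +oo)%E; last by exists 0.
  have [|v vP] := @field_fast_cvg _ _ D (Y ^~ w) (fine (S w)); last by exists v.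
  move=> k; rewrite -lee_fin fineK ?ge0_fin_numE// -sumEFin.
  by apply: (@nneseries_lim_ge _ (fun j => (2 ^+ j * fnormsq (Y j.+1 w - Y j w))%:E) xpredT 0) => j _ _; rewrite lee_fin.
have [I IP] := choice H.
have cvg_geo (c : R) : c * 2^-1 ^+ j @[j --> \oo] --> (0 : R).
  rewrite -[X in _ --> X](mulr0 c); apply: cvgMr; apply: cvg_expr.
  by rewrite ger0_norm// invf_lt1// ltr1n.
exists I; split.
  (* Set to 0 where S is infinite, the sequence converges to I for every w; it equals [Y] almost
     surely, so it keeps its measurability by completeness. *)
  pose Y' j w := if pselect (S w < +oo)%E then Y j w else 0.
  apply: (borel_lim sFT (f := Y')); [exact: fdistC|by move=> x y z; exact: fdist_trans| |].
    move=> j; apply: (borel_ae_eq (P := P) sFT (filtration_null hF TT) (f := Y j)).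
    - exact: fdistC.
    - by apply: ae_imp aeS => w Sw; rewrite /Y'; case: pselect => [a|/(_ Sw)//]; exact: fdist0.
    - exact: meas_X.
  move=> w; rewrite /Y'; case: pselect => Sw; last first.
    by have [_ /(_ Sw) ->] := IP w; under eq_fun do rewrite fdist0; exact: cvg_cst.
  have [/(_ Sw) h _] := IP w.
  have c0 : fnormsq (I w - Y j w) @[j --> \oo] --> (0 : R).
    apply: (squeeze_cvgr _ (cvg_cst 0) (cvg_geo (n.+1%:R * (2 * fine (S w))))).
    apply: nearW => j; rewrite fnormsq_ge0 (le_trans (h j))//.
    by rewrite le_eqVlt; apply/orP; left; apply/eqP; ring.
  have e1 : (fun j => fdist (Y j w) (I w)) = Num.sqrt \o (fun j => fnormsq (I w - Y j w)).
    by apply/funext => j; exact: fdistC.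
  suff : (fun j => fdist (Y j w) (I w)) @ \oo --> (0 : R) by [].
  rewrite e1 -(sqrtr0 R); apply: continuous_cvg c0; exact: sqrt_continuous.
exists (fun j => step_el (phi j)); split.
  have phioo : phi @ \oo --> \oo.
    move=> A [M _ HM]; exists M => // j /= Mj; apply: HM => /=.
    exact: leq_trans (phi1 j).
  suff : err \o phi @ \oo --> 0%E by [].
  exact: (cvg_comp _ _ phioo err_cvg).
have le2 j : (mean_normsq P (fun w => (el_int W (step_el (phi j)) w - I w)%R) <= (n.+1%:R * 4 * 2^-1 ^+ j)%:E)%E.
  apply: (@le_trans _ _ (\int[P]_w ((n.+1%:R * (2 * 2^-1 ^+ j))%:E * S w))%E).
    apply: ge0_integral_mono => w _; first by rewrite lee_fin fnormsq_ge0.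
    have c0 : 0 < n.+1%:R * (2 * 2^-1 ^+ j) :> R by rewrite !mulr_gt0// exprn_gt0.
    have [Sw|Sw] := pselect (S w < +oo)%E; last first.
      have -> : S w = +oo%E by apply/eqP; rewrite -leye_eq leNgt; exact/negP.
      by rewrite gt0_muley ?lte_fin// leey.
    have [/(_ Sw j) h _] := IP w.
    by rewrite -(@fineK _ (S w)) ?ge0_fin_numE// -EFinM lee_fin -fnormsqN opprB -!mulrA; rewrite -!mulrA in h.
  rewrite ge0_integralZl//.
  apply: (@le_trans _ _ ((n.+1%:R * (2 * 2^-1 ^+ j))%:E * 2%:E)%E).
    apply: lee_wpmul2l; last exact: intS.
    by rewrite lee_fin !mulr_ge0// exprn_ge0.
  by rewrite -EFinM lee_fin le_eqVlt; apply/orP; left; apply/eqP; ring.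
apply: (squeeze_cvge (f := fun=> 0%E) (h := fun j => (n.+1%:R * 4 * 2^-1 ^+ j)%:E)).
- apply: nearW => j; rewrite le2 andbT; apply: integral_ge0 => w _.
  by rewrite lee_fin fnormsq_ge0.
- exact: cvg_cst.
- by apply: cvg_EFin; [exact: nearW|exact: cvg_geo].
Qed.

End ito_existence.

Lemma ae_neq (R : realType) (x : R) : {ae @lebesgue_measure R, forall t, t != x}.
Proof.
exists [set x]; split; [exact: measurable_set1|exact: lebesgue_measure_set1|].
by move=> t /= /negP; rewrite negbK => /eqP.
Qed.

Lemma min_dist (R : realType) (a b c d x : R) : `|a - c| <= x -> `|b - d| <= x ->
  `|Num.min a b - Num.min c d| <= x.
Proof.
rewrite !ler_norml => /andP[h1 h2] /andP[h3 h4].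
by rewrite /Order.min; case: ifPn => h5; case: ifPn => h6; apply/andP; split; move: h5 h6; rewrite -?leNgt; lra.
Qed.

(** * The noise *)

Section weights.
Context {R : realType} (T : R) (N : nat).
Hypothesis T_gt0 : 0 < T.
Local Notation tau := (tau T N).
Local Notation tgrid := (tgrid T N).
Local Notation lam := (@lebesgue_measure R).

Lemma tau_gt0 : 0 < tau. Proof. by rewrite divr_gt0. Qed.

(** The weight of index i lives on [[win_left i], [win_right i]] and changes slope at [win_mid i].
    For i = 1 the window starts at 0 and the weight has no rising piece. *)
Definition win_left i : R := if (i <= 1)%N then 0 else tgrid i.-1 - tau / 2.
Definition win_right i : R := tgrid i + tau / 2.
Definition win_mid i : R := tgrid i - tau / 2.

Lemma tgrid_pred i : (0 < i)%N -> tgrid i.-1 = tgrid i - tau.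
Proof.
case: i => // i _; rewrite /tgrid /= (_ : i.+1%:R = i%:R + 1 :> R) ?mulrDl ?mul1r ?addrK//.
by rewrite -addn1 natrD.
Qed.

Lemma tgrid_ge i : (2 <= i)%N -> 2 * tau <= tgrid i.
Proof. by move=> i2; rewrite /tgrid ler_wpM2r ?(ltW tau_gt0)// ler_nat. Qed.

Lemma win_left_ge0 i : 0 <= win_left i.
Proof.
rewrite /win_left; case: leqP => // i1; rewrite tgrid_pred; last by rewrite (ltn_trans _ i1).
have := tgrid_ge i1; have := tau_gt0; lra.
Qed.

Lemma win_right_le i : (i <= N)%N -> win_right i <= T.
Proof.
move=> iN; have -> : T = N.+1%:R * tau by rewrite /tau mulrC divfK// pnatr_eq0.
have -> : N.+1%:R = N%:R + 1 :> R by rewrite -addn1 natrD.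
rewrite /win_right /tgrid mulrDl mul1r lerD//; last by have := tau_gt0; lra.
by rewrite ler_wpM2r ?(ltW tau_gt0)// ler_nat.
Qed.

Lemma win_length i : (0 < i)%N -> [/\ win_left i <= win_mid i, win_mid i - win_left i <= tau,
  win_right i - win_mid i = tau & win_mid i - win_left i = tau \/ i = 1%N].
Proof.
move=> i0; have t0 := tau_gt0; rewrite /win_left /win_right /win_mid.
case: leqP => i1.
  have -> : i = 1%N by apply/eqP; rewrite eqn_leq i1.
  by rewrite /tgrid mul1r; split; [lra|lra|lra|right].
by rewrite tgrid_pred//; split; [lra|lra|lra|left; lra].
Qed.

Lemma win_le i : (0 < i)%N -> win_left i <= win_right i.
Proof. by move=> /win_length[h1 _ h2 _]; have := tau_gt0; lra. Qed.

Definition rise i t : R := if (i <= 1)%N then 1 else (t - win_left i) / tau.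
Definition fall i t : R := (win_right i - t) / tau.
(** The weight as the minimum of its two affine pieces, which is Lipschitz with constant 1/[tau]. On
    ][win_left i], [win_right i]] the two differ at most at [win_mid i], a null set. *)
Definition tent i t : R := Num.min (rise i t) (fall i t).

Lemma weightE i t : (0 < i)%N -> weight T N i t =
  rise i t * (win_left i <= t <= win_mid i)%R%:R + fall i t * (win_mid i <= t <= win_right i)%R%:R.
Proof.
move=> i0; have t0 := tau_gt0.
rewrite /weight /rise /fall /win_left /win_mid /win_right; case: leqP => i1.
  have -> : i = 1%N by apply/eqP; rewrite eqn_leq i1.
  rewrite /Jint !indicE !mem_setE !in_itv/= mul1r; congr (_ + _).
  by rewrite /tgrid mul1r (_ : tau - tau / 2 = tau / 2)//; lra.
case: i i0 i1 => [|[|i]]// _ _; rewrite /Jint /= !indicE !mem_setE !in_itv/=.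
congr (_ * _ + _ ); congr (_%:R); congr nat_of_bool; congr (_ && (_ <= _)).
by rewrite /tgrid -[in RHS]addn1 natrD; lra.
Qed.

Lemma rise_bound i t : (0 < i)%N -> win_left i <= t <= win_mid i -> 0 <= rise i t <= 1.
Proof.
move=> i0 /andP[h1 h2]; have t0 := tau_gt0; have [_ h3 _ _] := win_length i0.
rewrite /rise; case: ifP => _; first by rewrite ler01 lexx.
by rewrite divr_ge0 ?subr_ge0 ?(ltW t0)//= ler_pdivrMr// mul1r; lra.
Qed.

Lemma fall_bound i t : (0 < i)%N -> win_mid i <= t <= win_right i -> 0 <= fall i t <= 1.
Proof.
move=> i0 /andP[h1 h2]; have t0 := tau_gt0; have [_ _ h3 _] := win_length i0.
by rewrite /fall divr_ge0 ?subr_ge0 ?(ltW t0)//= ler_pdivrMr// mul1r; lra.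
Qed.

(* Both closed intervals contain [win_mid i], so the weight may be 2 at that point. *)
Lemma weight_sqr_le i t : (0 < i)%N ->
  weight T N i t ^+ 2 <= 4 * (win_left i <= t <= win_right i)%R%:R.
Proof.
move=> i0; have [h1 _ h3 _] := win_length i0; have t0 := tau_gt0.
rewrite weightE//.
have h4 : win_mid i <= win_right i by lra.
case: (boolP (win_left i <= t <= win_mid i)) => hl; case: (boolP (win_mid i <= t <= win_right i)) => hr.
- have := rise_bound i0 hl; have := fall_bound i0 hr.
  move: hl hr => /andP[-> _] /andP[_ ->] /andP[f0 f1] /andP[r0 r1]; rewrite !mulr1; nra.
- have := rise_bound i0 hl; move: hl => /andP[-> ht] /andP[r0 r1].
  by rewrite (le_trans ht h4) !mulr1 mulr0 addr0; nra.
- have := fall_bound i0 hr; move: hr => /andP[ht ->] /andP[r0 r1].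
  by rewrite (le_trans h1 ht) !mulr1 mulr0 add0r; nra.
- by rewrite !mulr0 addr0 expr0n mulr_ge0.
Qed.

Lemma weight_out i t : (0 < i)%N -> 0 < t -> ~~ (win_left i < t <= win_right i) ->
  weight T N i t = 0.
Proof.
move=> i0 t0 out; have [h1 h2 h3 h5] := win_length i0; have tau0 := tau_gt0.
have h4 : win_mid i <= win_right i by lra.
rewrite weightE//; move: out; rewrite negb_and -leNgt -ltNge => /orP[tl|tr].
  (* The left endpoint counts as outside the window: there the rising piece is 0, except for i = 1,
     when the endpoint is time 0 and is excluded by 0 < t. *)
  have [tE|tl'] := eqVneq t (win_left i); last first.
    have {}tl : t < win_left i by rewrite lt_neqAle tl' tl.
    by rewrite !leNgt tl (lt_le_trans tl h1) /= !mulr0 addr0.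
  have i1 : i != 1%N by apply/eqP => e1; move: t0; rewrite tE e1 ltxx.
  have hm : t < win_mid i by case: h5 => [|/eqP]; [rewrite tE; lra|rewrite (negbTE i1)].
  rewrite (leNgt (win_mid i)) hm /= mulr0 addr0 /rise leqNgt.
  by rewrite ltn_neqAle eq_sym i1 i0 /= tE subrr !mul0r.
by rewrite (leNgt t (win_mid i)) (le_lt_trans h4 tr) (leNgt t (win_right i)) tr !andbF !mulr0 addr0.
Qed.

Lemma weight_meas i : (0 < i)%N -> measurable_fun setT (weight T N i).
Proof.
move=> i0; rewrite /weight.
have mJ k : measurable_fun setT (\1_(Jint T N k) : R -> R).
  by apply: measurable_indic; rewrite /Jint; case: k => [|k]; exact: measurable_itv.
case: (leqP i 1) => _; apply: measurable_funD => //; apply: measurable_funM => //;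
  apply: measurable_funM => //; apply: measurable_funB => //; exact: measurable_funB.
Qed.

Lemma weight_tent i t : (0 < i)%N -> win_left i < t <= win_right i -> t != win_mid i ->
  weight T N i t = tent i t.
Proof.
move=> i0 /andP[tl tr] tm; have [h1 h2 h3 h5] := win_length i0; have tau0 := tau_gt0.
rewrite weightE// /tent; case: (ltgtP t (win_mid i)) tm => // ht _.
  rewrite (ltW tl) /= mulr1 mulr0 addr0 min_l//.
  have /andP[_ r1] : 0 <= rise i t <= 1 by apply: rise_bound => //; rewrite !ltW.
  apply: le_trans r1 _; rewrite /fall ler_pdivlMr// mul1r; lra.
rewrite tr andbF /= mulr1 mulr0 add0r min_r//.
have /andP[_ r1] : 0 <= fall i t <= 1 by apply: fall_bound => //; rewrite (ltW ht).
apply: le_trans r1 _; rewrite /rise; case: ifPn => // i1; rewrite ler_pdivlMr// mul1r.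
by case: h5 => [|e1]; [lra|move: i1; rewrite e1].
Qed.

Lemma tent_lip i s t : `|tent i s - tent i t| <= `|s - t| / tau.
Proof.
have t0 := tau_gt0; apply: min_dist.
  rewrite /rise; case: ifP => _; first by rewrite subrr normr0 divr_ge0// ltW.
  by rewrite -mulrBl normrM normfV (gtr0_norm t0) opprD addrACA opprK addNr addr0.
rewrite /fall -mulrBl normrM normfV (gtr0_norm t0) (_ : _ - _ - _ = t - s); last by ring.
by rewrite distrC.
Qed.

Definition mesh i m j : R := win_left i + j%:R * ((win_right i - win_left i) / m.+1%:R).
(** Square of the mesh width times the Lipschitz constant 1/[tau] of [tent]. *)
Definition mesh_err i m : R := ((win_right i - win_left i) / m.+1%:R / tau) ^+ 2.

Lemma mesh_mono i m j : (0 < i)%N -> mesh i m j <= mesh i m j.+1.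
Proof.
by move=> /win_le h; rewrite /mesh lerD2l ler_wpM2r ?divr_ge0 ?subr_ge0// ler_nat.
Qed.

Lemma mesh0 i m : mesh i m 0 = win_left i. Proof. by rewrite /mesh mul0r addr0. Qed.

Lemma mesh_last i m : mesh i m m.+1 = win_right i.
Proof. by rewrite /mesh mulrC divfK ?pnatr_eq0// addrC subrK. Qed.

Lemma mesh_step i m j : mesh i m j.+1 - mesh i m j = (win_right i - win_left i) / m.+1%:R.
Proof. by rewrite /mesh -addn1 natrD; ring. Qed.

Lemma meshP i m j : (0 < i)%N -> (j <= m)%N ->
  win_left i <= mesh i m j /\ mesh i m j <= mesh i m j.+1 <= win_right i.
Proof.
move=> i0 jm.
have mono a b : (a <= b)%N -> mesh i m a <= mesh i m b.
  by move=> ab; rewrite /mesh lerD2l ler_wpM2r ?ler_nat// divr_ge0// subr_ge0 win_le.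
split; first by rewrite -(mesh0 i m) mono.
by rewrite mesh_mono// -(mesh_last i m) mono.
Qed.

Lemma mesh_cover i m t : (0 < i)%N ->
  \sum_(j < m.+1) (mesh i m j < t <= mesh i m j.+1)%R%:R = (win_left i < t <= win_right i)%R%:R :> R.
Proof.
move=> i0; rewrite -(mesh0 i m) -(mesh_last i m).
elim: m.+1 => [|k ih].
  by rewrite big_ord0; case: ltP => //= h; rewrite leNgt h.
rewrite big_ord_recr ih /=.
have h0k : mesh i m 0 <= mesh i m k.
  by rewrite /mesh lerD2l ler_wpM2r ?ler_nat// divr_ge0// subr_ge0 win_le.
have hk := @mesh_mono i m k i0.
case: (ltP (mesh i m 0) t) => h1 /=; last first.
  by rewrite ltNge (le_trans h1 h0k)/= addr0.
case: (ltP (mesh i m k) t) => h2 /=; first by rewrite add0r.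
by rewrite (le_trans h2 hk) addr0.
Qed.

Lemma step_weight i m : (0 < i)%N -> {ae lam, forall t, 0 <= t <= T ->
  (step_fun (mesh i) (fun m j => tent i (mesh i m j)) m t - weight T N i t) ^+ 2 <= mesh_err i m}.
Proof.
move=> i0; have tau0 := tau_gt0; have hw := win_le i0.
have d0 : 0 <= (win_right i - win_left i) / m.+1%:R by rewrite divr_ge0// subr_ge0.
apply: ae_imp2 (ae_neq 0) (ae_neq (win_mid i)) => t tn0 tnm /andP[t0 tT].
have {t0 tn0}t0 : 0 < t by rewrite lt_neqAle eq_sym tn0.
have stepE : step_fun (mesh i) (fun m j => tent i (mesh i m j)) m t =
    \sum_(j < m.+1) (mesh i m j < t <= mesh i m j.+1)%R%:R * tent i (mesh i m j).
  rewrite /step_fun big_mkcond; apply: eq_bigr => j _.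
  by case: ifP; rewrite ?mul1r ?mul0r.
have wE : weight T N i t = \sum_(j < m.+1) (mesh i m j < t <= mesh i m j.+1)%R%:R * tent i t.
  rewrite -mulr_suml mesh_cover//; case: (boolP (win_left i < t <= win_right i)) => h.
    by rewrite mul1r weight_tent.
  by rewrite mul0r weight_out.
rewrite stepE wE -sumrB /mesh_err -[leLHS]real_normK ?num_real// lerXn2r ?nnegrE//.
  by rewrite divr_ge0// ltW.
apply: le_trans (ler_norm_sum _ _ _) _.
apply: (@le_trans _ _ (\sum_(j < m.+1) (mesh i m j < t <= mesh i m j.+1)%R%:R *
    ((win_right i - win_left i) / m.+1%:R / tau))).
  apply: ler_sum => j _; rewrite -mulrBr normrM ger0_norm//.
  case: (boolP (mesh i m j < t <= mesh i m j.+1)) => [/andP[h1 h2]|_]; last by rewrite !mul0r.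
  rewrite !mul1r; apply: le_trans (tent_lip _ _ _) _.
  rewrite ler_pM2r ?invr_gt0// -(mesh_step i m j) distrC ger0_norm ?subr_ge0 ?(ltW h1)//.
  by rewrite lerB.
rewrite -mulr_suml mesh_cover// ler_piMl//; first by rewrite divr_ge0// ltW.
by case: (_ && _).
Qed.

Lemma mesh_err_cvg i : mesh_err i m @[m --> \oo] --> 0.
Proof.
pose c := ((win_right i - win_left i) / tau) ^+ 2.
have -> : mesh_err i = (fun m => c * (m.+1%:R^-1 ^+ 2)).
  by apply/funext => m; rewrite /mesh_err /c !exprMn; ring.
rewrite -(mulr0 c); apply: cvgMr.
have h : (m.+1%:R^-1 : R) @[m --> \oo] --> (0 : R) by exact: cvg_harmonic.
by rewrite -(mulr0 0); exact: (cvgM h h).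
Qed.

(** A window has length at most 2 [tau], and the squared weight is at most 4 on it. *)
Lemma weight_energy i : (1 <= i <= N)%N ->
  (\int[lam]_(t in `[0%R, T]) (weight T N i t ^+ 2)%:E <= (8 * tau)%:E)%E.
Proof.
move=> /andP[i0 iN]; have hw := win_le i0; have t0 := tau_gt0.
pose I := `[win_left i, win_right i]%classic : set R.
have mI : measurable I by exact: measurable_itv.
apply: (@le_trans _ _ (\int[lam]_t ((4 : R)%:E * (\1_I t)%:E))%E).
  rewrite integral_mkcond; apply: ge0_integral_mono => t _; rewrite patchE; case: ifP => _ //.
  - by rewrite lee_fin sqr_ge0.
  - by rewrite -EFinM lee_fin indicE mem_setE in_itv/= weight_sqr_le.
  - by rewrite -EFinM lee_fin indicE mulr_ge0.
rewrite ge0_integralZl//; last first.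
  by apply/measurable_EFinP; exact: measurable_indic.
rewrite integral_indic// setIT.
have E : (lebesgue_measure [set` `[win_left i, win_right i]] = (win_right i - win_left i)%:E)%E.
  rewrite lebesgue_measure_itv/= lte_fin; case: ifPn => //; rewrite -leNgt => h.
  by rewrite (@le_anti _ _ (win_left i) (win_right i)) ?hw ?h// subrr.
suff : (4%:E * lebesgue_measure [set` `[win_left i, win_right i]] <= (8 * tau)%:E)%E by [].
rewrite E.
rewrite -EFinM lee_fin; have [_ h2 h3 _] := win_length i0; lra.
Qed.

End weights.

(** * Existence, measurability, orthogonality and energy of the noise *)

Section noise_step.
Context d (Om : measurableType d) (R : realType) (P : probability Om R) (T : R).
Context {n : nat} {U : hilbert R} (e : onb U) (D : lipschitz_domain R n).
Variables (F : R -> set (set Om)) (W : nat -> R -> Om -> R) (N : nat) (C : R).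
Local Notation K := (onb_idx e).
Local Notation FN := (FN T F N).
Hypothesis hF : complete_filtration P T F.
Hypothesis hW : cylindrical_wiener P T F K W.
Hypothesis T_gt0 : 0 < T.
Variable G : nat -> Om -> vfield D -> hs_op e D.
Hypothesis hG : data_stability P T F N C G.

Definition FN_time i : R := if i is 0%N then 0 else win_right T N i.

Lemma FNE i : FN i = F (FN_time i). Proof. by case: i. Qed.

Lemma FN_time_bound i : (i <= N)%N -> 0 <= FN_time i <= T.
Proof.
case: i => [|i] iN /=; first by rewrite lexx ltW.
rewrite win_right_le// andbT (@le_trans _ _ (win_left T N i.+1))//; [exact: win_left_ge0|exact: win_le].
Qed.

Lemma FN_sigma i : (i <= N)%N -> sigma_algebra setT (FN i).
Proof. by move=> iN; rewrite FNE; exact/(filtration_sigma hF)/FN_time_bound. Qed.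

Lemma FN_null i : (i <= N)%N -> forall A, P.-negligible A -> FN i A.
Proof. by move=> iN; rewrite FNE; exact/(filtration_null hF)/FN_time_bound. Qed.

Lemma FN_measurable i : (i <= N)%N -> FN i `<=` measurable.
Proof. by move=> iN; rewrite FNE; exact/(filtration_measurable hF)/FN_time_bound. Qed.

Lemma FN_time_mono i j : (i <= j)%N -> FN_time i <= FN_time j.
Proof.
case: i j => [|i] [|j]//= ij; last by rewrite /win_right lerD2r ler_wpM2r ?ler_nat// ltW// tau_gt0.
by rewrite (@le_trans _ _ (win_left T N j.+1))//; [exact: win_left_ge0|exact: win_le].
Qed.

Lemma FN_mono i j : (i <= j <= N)%N -> FN i `<=` FN j.
Proof.
move=> /andP[ij jN]; rewrite !FNE.
have /andP[h1 _] := FN_time_bound (leq_trans ij jN); have /andP[_ h2] := FN_time_bound jN.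
exact: (filtration_mono hF h1 (FN_time_mono ij) h2).
Qed.

(** Here the lag of two becomes visible: t_(i-2) + tau/2 = t_(i-1) - tau/2 is the start of window i
    when i > 2, so F_(i-2) and the operator evaluated at u_(i-2) precede the noise of step i. *)
Lemma FN_start i : (1 <= i <= N)%N -> FN (i - 2) `<=` F (win_left T N i).
Proof.
move=> /andP[i0 iN]; rewrite FNE.
have /andP[h1 _] := FN_time_bound (leq_trans (leq_subr 2 i) iN).
have h2 : win_left T N i <= T by rewrite (le_trans (win_le N T_gt0 i0))// win_right_le.
apply: (filtration_mono hF h1 _ h2).
case: i i0 iN {h1 h2} => [|[|[|i]]]// _ _; first exact: win_left_ge0.
rewrite !subSS subn0 /win_left/= /win_right /tgrid.
have -> : i.+2%:R = i.+1%:R + 1 :> R by rewrite -addn1 natrD.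
by rewrite mulrDl mul1r; lra.
Qed.

Variables (i : nat) (v : Om -> vfield D).
Hypothesis iN : (1 <= i <= N)%N.
Hypothesis hv : square_int_at P T F N i v.

Let i0 : (0 < i)%N. Proof. by case/andP: iN. Qed.
Let iN' : (i <= N)%N. Proof. by case/andP: iN. Qed.
Let i2N : (i - 2 <= N)%N. Proof. exact: leq_trans (leq_subr 2 i) iN'. Qed.
Let s0_ge0 : 0 <= win_left T N i. Proof. exact: win_left_ge0. Qed.
Let s01 : win_left T N i <= win_right T N i. Proof. exact: win_le. Qed.
Let s1T : win_right T N i <= T. Proof. exact: win_right_le. Qed.

Let Gv w := G i w (v w).

Let mGv : meas_wrt (FN (i - 2)) (borel (@hs_dist R n U e D)) Gv.
Proof.
have [mG _ _] := hG iN; have [mv _] := hv => B mB.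
have sF := FN_sigma i2N.
have := meas_wrt_pair sF (fun A1 A2 => sub_sigma_setI sF (A:=A1) (B:=A2)) mv (mG B mB).
by [].
Qed.

Let mG0 : meas_wrt (F (win_left T N i)) (borel (@hs_dist R n U e D)) Gv.
Proof. by move=> B /mGv; exact: FN_start. Qed.

Let bG : (\int[P]_w hs_normsq (Gv w) <= C%:E * (1 + mean_normsq P v))%E.
Proof. by have [_ h _] := hG iN; exact: h. Qed.

Let meanv_fin : mean_normsq P v \is a fin_num.
Proof.
have [_ h] := hv; rewrite ge0_fin_numE//.
by apply: integral_ge0 => w _; rewrite lee_fin fnormsq_ge0.
Qed.

Lemma noise_exists : exists I, noise P T F W N G i v I.
Proof.
apply: (ito_exists hF hW s0_ge0 s01 s1T mG0 _ (sg := mesh T N i)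
   (gm := fun m j => tent T N i (mesh T N i m j)) (om := mesh_err T N i)).
- by apply: le_lt_trans bG _; rewrite -(fineK meanv_fin) -EFinD -EFinM ltry.
- exact: weight_meas.
- move=> t; apply: le_trans (weight_sqr_le N T_gt0 t i0) _.
  by rewrite ler_piMr// lern1 leq_b1.
- by move=> m j jm; exact: meshP.
- by move=> m; exact: sqr_ge0.
- by move=> m; exact: step_weight.
- exact: mesh_err_cvg.
Qed.

Variables (I : Om -> vfield D).
Hypothesis hI : noise P T F W N G i v I.

Let out t : 0 < t -> ~~ (win_left T N i < t <= win_right T N i) -> weight T N i t = 0.
Proof. exact: weight_out. Qed.

Let mwt : measurable_fun setT (weight T N i). Proof. exact: weight_meas. Qed.

Let hI' : ito_integral P T F K W (fun t w c => weight T N i t *: Gv w (e c)) I.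
Proof. exact: hI. Qed.

Let mA b c : K c -> measurable_fun setT (fun w => fdot (Gv w (e c)) b).
Proof.
move=> Kc _ A mA; rewrite setTI; apply: (FN_measurable i2N).
have sF := FN_sigma i2N.
apply: (rmeas_fdot sF (X := fun w => Gv w (e c)) b _ mA).
exact: (borel_comp sF (col_dist_continuous Kc) mGv).
Qed.

Section one_coordinate.
Variable b : vfield D.
Hypothesis b1 : fnormsq b <= 1.

Lemma noise_meas : rmeas (FN i) (fun w => fdot (I w) b).
Proof.
have -> : FN i = F (win_right T N i) by rewrite FNE; case: i i0.
exact: (ito_meas hF hW s0_ge0 s01 s1T mwt out hI' b1 (@mA b)).
Qed.

Lemma noise_int2 : int2 P (fun w => fdot (I w) b).
Proof.
exact: (ito_int2 hF hW s0_ge0 s01 s1T mwt out hI' b1 (@mA b)).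
Qed.

Lemma noise_orth g : rmeas (FN (i - 2)) g -> int2 P g ->
  \int[P]_w (fdot (I w) b * g w) = 0.
Proof.
move=> mg; apply: (ito_orth hF hW s0_ge0 s01 s1T mwt out hI' b1 (@mA b)).
by move=> B /mg; exact: FN_start.
Qed.

Let S b w := (\sum_(c <oo | c \in K) ((fdot (Gv w (e c)) b) ^+ 2)%:E)%E.

Lemma noise_sqr_le : (\int[P]_w (fdot (I w) b ^+ 2)%:E <=
  (32 * gauss2 * tau T N)%:E * \int[P]_w S b w)%E.
Proof.
have g0 : 0 <= gauss2 :> R by apply: Rint_ge0 => x; exact: sqr_ge0.
have t0 := tau_gt0 N T_gt0.
have S0 w : (0 <= S b w)%E by apply: nneseries_ge0 => c _ _; rewrite lee_fin sqr_ge0.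
have mS : measurable_fun setT (S b).
  apply: ge0_emeasurable_sum => [c w _ _|c /set_mem Kc]; first by rewrite lee_fin sqr_ge0.
  by apply/measurable_EFinP; apply: measurable_funX; exact: mA.
apply: le_trans (ito_sqr_le hF hW s0_ge0 s01 s1T mwt out hI' b1 (@mA b)) _.
(* The factor 4 gauss2 is that of [ito_sqr_le], and 8 tau that of [weight_energy]. *)
rewrite (_ : 32 * gauss2 * tau T N = 4 * gauss2 * (8 * tau T N)); last by ring.
rewrite [X in (_ <= X * _)%E]EFinM -muleA; apply: lee_wpmul2l; first by rewrite lee_fin mulr_ge0.
rewrite -ge0_integralZl//; last by rewrite lee_fin mulr_ge0// ltW.
apply: ge0_integral_mono => w _.
  apply: integral_ge0 => t _; apply: nneseries_ge0 => c _ _; by rewrite lee_fin sqr_ge0.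
apply: (@le_trans _ _ (\int[lebesgue_measure]_(t in `[0%R, T]) ((weight T N i t ^+ 2)%:E * S b w))%E).
  apply: ge0_integral_mono => t _.
    by apply: nneseries_ge0 => c _ _; rewrite lee_fin sqr_ge0.
  rewrite /S -nneseriesZl; last by move=> c _; rewrite lee_fin sqr_ge0.
  by apply: lee_nneseries => c _; rewrite -?EFinM lee_fin ?sqr_ge0// exprMn.
rewrite ge0_integralZr//; last 2 first.
- apply/measurable_EFinP; apply: measurable_funX; apply: measurable_funTS; exact: weight_meas.
- by move=> t _; rewrite lee_fin sqr_ge0.
by apply: lee_wpmul2r => //; exact: weight_energy.
Qed.

End one_coordinate.

(** The scalar bounds are summed before Bessel's inequality is applied to each column; the sum over
    columns is then the Hilbert-Schmidt norm, whatever the number r of coordinates. *)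
Lemma noise_energy r (o : 'I_r -> vfield D) :
  (forall j k, fdot (o j) (o k) = (j == k)%:R) ->
  (forall u, \sum_j fdot u (o j) ^+ 2 <= fnormsq u) ->
  \sum_j \int[P]_w (fdot (I w) (o j) ^+ 2) <=
  32 * gauss2 * tau T N * (C * (1 + fine (mean_normsq P v))).
Proof.
move=> oo bessel; have g0 : 0 <= gauss2 :> R by apply: Rint_ge0 => x; exact: sqr_ge0.
have t0 := tau_gt0 N T_gt0.
have o1 j : fnormsq (o j) <= 1 by rewrite /fnormsq oo eqxx.
have i2 j : int1 P (fun w => fdot (I w) (o j) ^+ 2) by case: (noise_int2 (o1 j)).
pose S b w := (\sum_(c <oo | c \in K) ((fdot (Gv w (e c)) b) ^+ 2)%:E)%E.
have S0 b w : (0 <= S b w)%E by apply: nneseries_ge0 => c _ _; rewrite lee_fin sqr_ge0.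
have mS b : measurable_fun setT (S b).
  apply: ge0_emeasurable_sum => [c w _ _|c /set_mem Kc]; first by rewrite lee_fin sqr_ge0.
  by apply/measurable_EFinP; apply: measurable_funX; exact: mA.
rewrite -lee_fin -sumEFin.
apply: (@le_trans _ _ (\sum_j (32 * gauss2 * tau T N)%:E * \int[P]_w S (o j) w)%E).
  by apply: lee_sum => j _; rewrite RintE//; exact: noise_sqr_le.
rewrite -ge0_sume_distrr; last by move=> j _; exact: integral_ge0.
rewrite [leRHS]EFinM; apply: lee_wpmul2l; first by rewrite lee_fin !mulr_ge0// ltW.
apply: (@le_trans _ _ (\int[P]_w hs_normsq (Gv w))%E); last first.
  by rewrite EFinM EFinD fineK.
rewrite -ge0_integral_sum//; apply: ge0_integral_mono => w _; first exact: sume_ge0.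
rewrite /hs_normsq /columns_normsq [leRHS]eseries_mkcond /S.
under eq_bigr do rewrite eseries_mkcond.
rewrite -nneseries_sum; last by move=> j c _; case: ifP => // _; rewrite lee_fin sqr_ge0.
apply: lee_nneseries => c _.
  by move=> _; apply: sume_ge0 => j _; case: ifP => // _; rewrite lee_fin sqr_ge0.
case: ifP => _; last by rewrite big1.
by rewrite sumEFin lee_fin; exact: bessel.
Qed.

End noise_step.

(** * The Davis inequality *)

Section davis.
Context {R : realType}.

Section one_step.
Variables (x m q d : R).
Hypotheses (q0 : 0 <= q) (xm : `|x| <= m).

Let m0 : 0 <= m. Proof. exact: le_trans xm. Qed.
Let f := Num.sqrt (q + m ^+ 2).
Let m' := Num.max m `|x + d|.
Let q' := q + d ^+ 2.
Let f' := Num.sqrt (q' + m' ^+ 2).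
Let psi (x m q f : R) := (x ^+ 2 + m ^+ 2 + 2 * q) / f.

Let f0 : 0 <= f. Proof. exact: sqrtr_ge0. Qed.
Let f'0 : 0 <= f'. Proof. exact: sqrtr_ge0. Qed.
Let q'0 : 0 <= q'. Proof. by rewrite addr_ge0// sqr_ge0. Qed.
Let f2 : f ^+ 2 = q + m ^+ 2. Proof. by rewrite sqr_sqrtr// addr_ge0// sqr_ge0. Qed.
Let f'2 : f' ^+ 2 = q' + m' ^+ 2. Proof. by rewrite sqr_sqrtr// addr_ge0// sqr_ge0. Qed.
Let s := Num.sqrt q.
Let s' := Num.sqrt q'.
Let s0 : 0 <= s. Proof. exact: sqrtr_ge0. Qed.
Let s'0 : 0 <= s'. Proof. exact: sqrtr_ge0. Qed.
Let s2 : s ^+ 2 = q. Proof. by rewrite sqr_sqrtr. Qed.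
Let s'2 : s' ^+ 2 = q + d ^+ 2. Proof. by rewrite sqr_sqrtr. Qed.
Let sf : s <= f. Proof. by rewrite ler_wsqrtr// lerDl sqr_ge0. Qed.
Let sf' : s' <= f'. Proof. by rewrite ler_wsqrtr// lerDl sqr_ge0. Qed.
Let mf : m <= f. Proof. by rewrite -(@ler_pXn2r _ 2)// ?nnegrE// f2 lerDr. Qed.
Let ss' : s <= s'. Proof. by rewrite ler_wsqrtr// lerDl sqr_ge0. Qed.
Let xm2 : x ^+ 2 <= m ^+ 2.
Proof. by rewrite -[x ^+ 2]real_normK ?num_real// lerXn2r ?nnegrE. Qed.
Let ds' : `|d| <= s'.
Proof. by rewrite -(@ler_pXn2r _ 2)// ?nnegrE// s'2 real_normK ?num_real// lerDr. Qed.
Let s'd : s' <= s + `|d|.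
Proof.
rewrite -(@ler_pXn2r _ 2)// ?nnegrE ?addr_ge0// s'2 sqrrD s2 real_normK ?num_real//.
by rewrite -addrA lerD2l lerDr mulrn_wge0// mulr_ge0.
Qed.
Let psiE : f != 0 -> psi x m q f = 2 * f - (m ^+ 2 - x ^+ 2) / f.
Proof.
move=> fn; rewrite /psi; apply: (mulIf fn); rewrite divfK// mulrBl divfK// -mulrA -expr2 f2.
by ring.
Qed.

Lemma davis_step : psi (x + d) m' q' f' - psi x m q f <=
  2 * (x / f * d) + 15 * (s' - s).
Proof.
have [fz|fn] := eqVneq f 0.
  have mz : m = 0 by apply/eqP; rewrite eq_le m0 andbT -fz.
  have sz : s = 0 by apply/eqP; rewrite eq_le s0 andbT -fz.
  have xz : x = 0 by apply/eqP; rewrite -normr_le0 -mz.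
  have qz : q = 0 by rewrite -s2 sz expr0n.
  rewrite xz mul0r mul0r mulr0 add0r sz subr0 fz /psi invr0 mulr0 subr0 add0r.
  have m'E : m' = `|d| by rewrite /m' mz xz add0r max_r.
  have q'E : q' = d ^+ 2 by rewrite /q' qz add0r.
  have s'E : s' = `|d| by rewrite /s' q'E sqrtr_sqr.
  have f'E : f' ^+ 2 = 2 * d ^+ 2.
    by rewrite f'2 q'E m'E real_normK ?num_real//; ring.
  have [dz|dn] := eqVneq d 0.
    by rewrite m'E q'E dz normr0 !expr0n /= !mulr0 !addr0 mul0r mulr_ge0.
  have f'p : 0 < f'.
    by rewrite lt_neqAle f'0 andbT eq_sym -sqrf_eq0 f'E mulf_neq0 ?pnatr_eq0// expf_neq0.
  rewrite ler_pdivrMr// m'E q'E s'E real_normK ?num_real//.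
  have df : `|d| <= f' by rewrite -s'E.
  have : d ^+ 2 <= `|d| * f' by rewrite -real_normK ?num_real// expr2 ler_wpM2l.
  nra.
have fp : 0 < f by rewrite lt_neqAle f0 andbT eq_sym.
have hx : `|x| / f <= 1 by rewrite ler_pdivrMr// mul1r (le_trans xm).
have dss : (s' - s) * (s' + s) = d ^+ 2 by rewrite -subr_sqr s'2 s2; ring.
rewrite psiE//.
have [small|big] := leP `|x + d| m.
  have m'E : m' = m by rewrite /m' max_l.
  have f'f : f' ^+ 2 = f ^+ 2 + d ^+ 2 by rewrite f'2 f2 m'E /q'; ring.
  have ff' : f <= f' by rewrite -(@ler_pXn2r _ 2)// ?nnegrE// f'f lerDl sqr_ge0.
  have f'p : 0 < f' by exact: lt_le_trans ff'.
  have -> : psi (x + d) m' q' f' = 2 * f' - (m ^+ 2 - (x + d) ^+ 2) / f'.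
    rewrite /psi; apply: (mulIf (lt0r_neq0 f'p)).
    rewrite divfK ?lt0r_neq0// mulrBl divfK ?lt0r_neq0// -mulrA -expr2 f'2 m'E; ring.
  set u := m ^+ 2 - (x + d) ^+ 2.
  have u0 : 0 <= u.
    by rewrite subr_ge0 -[leLHS]real_normK ?num_real// lerXn2r ?nnegrE.
  have um : u <= f ^+ 2.
    by rewrite f2 /u (@le_trans _ _ (m ^+ 2)) ?lerDr// gerBl sqr_ge0.
  have uf : u / f - u / f' <= f' - f.
    have -> : u / f - u / f' = u * (f' - f) / (f * f') by field; rewrite !lt0r_neq0.
    rewrite ler_pdivrMr ?mulr_gt0// [leRHS]mulrC ler_wpM2r ?subr_ge0//.
    by apply: le_trans um _; rewrite expr2 ler_wpM2l.
  have dd : d ^+ 2 / f <= 4 * (s' - s).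
    rewrite ler_pdivrMr// -dss.
    have s3 : s' + s <= 4 * f.
      have d2 : `|d| <= 2 * m.
        have := ler_normB (x + d) x; rewrite (_ : x + d - x = d); last by ring.
        by move: small xm; lra.
      by move: s'd sf mf; lra.
    rewrite (_ : 4 * (s' - s) * f = (s' - s) * (4 * f)); last by ring.
    by apply: ler_wpM2l => //; rewrite subr_ge0.
  have ffs : f' - f <= s' - s.
    have e1 : (f' - f) * (f' + f) = (s' - s) * (s' + s) by rewrite dss -subr_sqr f'f; ring.
    have sp : s' + s <= f' + f by exact: lerD.
    rewrite -(ler_pM2r (addr_gt0 f'p fp)) e1; apply: ler_wpM2l => //; rewrite subr_ge0//.
  have ex : (m ^+ 2 - x ^+ 2) / f = u / f + 2 * (x / f * d) + d ^+ 2 / f.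
    by rewrite /u; field.
  rewrite ex; lra.
have m'E : m' = `|x + d| by rewrite /m' max_r// ltW.
have f'E : f' ^+ 2 = q + d ^+ 2 + (x + d) ^+ 2.
  by rewrite f'2 m'E real_normK ?num_real.
have f'p : 0 < f'.
  rewrite lt_neqAle f'0 andbT eq_sym -sqrf_eq0 f'2 m'E gt_eqF//.
  by rewrite ltr_wpDl// exprn_gt0// (le_lt_trans m0).
have -> : psi (x + d) m' q' f' = 2 * f'.
  have nE : (x + d) ^+ 2 + m' ^+ 2 + 2 * q' = 2 * f' * f'.
    by rewrite m'E real_normK ?num_real// -mulrA -expr2 f'E /q'; ring.
  by rewrite /psi nE mulfK// lt0r_neq0.
have hmx : (m ^+ 2 - x ^+ 2) / f = m ^+ 2 / f - x ^+ 2 / f by rewrite mulrBl.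
(* For a moderate jump, f' is bounded by its tangent, 2 f' <= 2 f + (f'^2 - f^2)/f, which produces
   the martingale term exactly. *)
have [ds|dl] := leP `|d| (2 * f).
  have f'le : 2 * f' <= 2 * f + (f' ^+ 2 - f ^+ 2) / f.
    rewrite -subr_ge0 (_ : _ - _ = (f' - f) ^+ 2 / f); last by field.
    by rewrite divr_ge0// sqr_ge0.
  have fd : f' ^+ 2 - f ^+ 2 = 2 * d ^+ 2 + 2 * (x * d) - (m ^+ 2 - x ^+ 2).
    by rewrite f'E f2; ring.
  have dd : 2 * (d ^+ 2 / f) <= 8 * (s' - s).
    rewrite mulrA ler_pdivrMr// -dss.
    have s3 : s' + s <= 4 * f by move: ds s'd sf; lra.
    rewrite (_ : 2 * ((s' - s) * (s' + s)) = (s' - s) * (2 * (s' + s))); last by ring.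
    rewrite (_ : 8 * (s' - s) * f = (s' - s) * (8 * f)); last by ring.
    apply: ler_wpM2l; first by rewrite subr_ge0.
    by lra.
  have fdf : (f' ^+ 2 - f ^+ 2) / f = 2 * (d ^+ 2 / f) + 2 * (x / f * d) - (m ^+ 2 - x ^+ 2) / f.
    by rewrite fd; field.
  have ss0 : 0 <= s' - s by rewrite subr_ge0.
  rewrite fdf in f'le; move: f'le dd ss0; lra.
(* For a large jump, s' - s >= |d| - f > |d|/2, while the quantity to bound is at most 3 f + 6 |d| <
   7.5 |d|; this is the origin of the constant 15. *)
have xd : - (x / f * d) <= `|d|.
  rewrite (le_trans (ler_norm _))// normrN !normrM normfV (gtr0_norm fp).
  by rewrite ler_piMl.
have mm : (m ^+ 2 - x ^+ 2) / f <= f.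
  by rewrite ler_pdivrMr// -expr2 f2; have := sqr_ge0 x; move: q0; lra.
have f'u : f' <= 2 * f + 2 * `|d|.
  rewrite -(@ler_pXn2r _ 2)// ?nnegrE ?addr_ge0 ?mulr_ge0// f'E.
  have h1 : (x + d) ^+ 2 <= (f + `|d|) ^+ 2.
    rewrite -[leLHS]real_normK ?num_real// lerXn2r ?nnegrE ?addr_ge0//.
    by rewrite (le_trans (ler_normD _ _))// lerD2r (le_trans xm).
  have h2 : d ^+ 2 = `|d| ^+ 2 by rewrite real_normK ?num_real.
  have h3 : q <= f ^+ 2 by rewrite f2 lerDl sqr_ge0.
  have h4 : 0 <= f * `|d| by rewrite mulr_ge0.
  have h5 := sqr_ge0 f; have h6 := sqr_ge0 `|d|.
  by rewrite h2; lra.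
move: ds' sf xd mm f'u dl; lra.
Qed.

End one_step.

Variable d : nat -> R.

Definition psum n := \sum_(i < n) d i.
Definition qvar n := \sum_(i < n) d i ^+ 2.
Fixpoint pmax n := if n is k.+1 then Num.max (pmax k) `|psum k.+1| else 0.
Definition davis_den n := Num.sqrt (qvar n + pmax n ^+ 2).
(** Of modulus at most 1 and a function of d_0, .., d_(n-1) only: a bounded predictable integrand,
    so its sum against martingale differences has mean zero. *)
Definition davis_weight n := psum n / davis_den n.

Lemma qvar_ge0 n : 0 <= qvar n. Proof. by apply: sumr_ge0 => i _; exact: sqr_ge0. Qed.

Lemma psum_le_pmax n : `|psum n| <= pmax n.
Proof. by case: n => [|n]; rewrite ?/psum ?big_ord0 ?normr0//= le_max lexx orbT. Qed.

Lemma pmax_ge0 n : 0 <= pmax n. Proof. exact: le_trans (psum_le_pmax n). Qed.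

Lemma pmax_mono m n : (m <= n)%N -> pmax m <= pmax n.
Proof.
elim: n => [|n ih]; first by rewrite leqn0 => /eqP ->.
by rewrite leq_eqVlt => /predU1P[->//|/ih h] /=; rewrite le_max h.
Qed.

Lemma davis_weight_le1 n : `|davis_weight n| <= 1.
Proof.
have h : `|psum n| <= davis_den n.
  rewrite (le_trans (psum_le_pmax n))// -[leLHS](ger0_norm (pmax_ge0 n)) -sqrtr_sqr.
  by rewrite ler_wsqrtr// lerDr qvar_ge0.
rewrite /davis_weight normrM normfV (ger0_norm (sqrtr_ge0 _ : 0 <= davis_den n)).
have [->|n0] := eqVneq (davis_den n) 0; first by rewrite invr0 mulr0.
by rewrite ler_pdivrMr ?mul1r// lt_neqAle eq_sym n0 sqrtr_ge0.
Qed.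

(* Pathwise Davis inequality of Beiglboeck and Siorpaes, with a worse constant. *)
Lemma davis n : pmax n <= 15 * Num.sqrt (qvar n) + 2 * \sum_(i < n) davis_weight i * d i.
Proof.
pose psi n := (psum n ^+ 2 + pmax n ^+ 2 + 2 * qvar n) / davis_den n.
have bound k : psi k <= 15 * Num.sqrt (qvar k) + 2 * \sum_(i < k) davis_weight i * d i.
  elim: k => [|k ih].
    rewrite /psi /psum /qvar !big_ord0 /= !expr0n /= !mulr0 !addr0 mul0r.
    by rewrite sqrtr0 mulr0.
  have := @davis_step (psum k) (pmax k) (qvar k) (d k) (qvar_ge0 k) (psum_le_pmax k).
  have eS : psum k + d k = psum k.+1 by rewrite /psum big_ord_recr.
  have eQ : qvar k + d k ^+ 2 = qvar k.+1 by rewrite /qvar big_ord_recr.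
  rewrite eS eQ -/(davis_den k) -/(pmax k.+1) -/(davis_den k.+1) -/(psi k) -/(psi k.+1).
  rewrite -/(davis_weight k) big_ord_recr /= mulrDr; lra.
apply: le_trans (bound n); rewrite /psi.
have den2 : davis_den n ^+ 2 = qvar n + pmax n ^+ 2.
  by rewrite sqr_sqrtr// addr_ge0 ?qvar_ge0 ?sqr_ge0.
have md : pmax n <= davis_den n.
  rewrite -(@ler_pXn2r _ 2)// ?nnegrE ?pmax_ge0 ?sqrtr_ge0//.
  by rewrite den2 lerDr qvar_ge0.
have [e|n0] := eqVneq (davis_den n) 0.
  by rewrite e invr0 mulr0 -e.
have dp : 0 < davis_den n by rewrite lt_neqAle eq_sym n0 sqrtr_ge0.
rewrite ler_pdivlMr//; apply: (@le_trans _ _ (davis_den n ^+ 2)).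
  by rewrite expr2 ler_wpM2r// ltW.
by rewrite den2; have := sqr_ge0 (psum n); have := qvar_ge0 n; lra.
Qed.

End davis.

(** The delayed terms are bounded by the geometric majorant one index later, (1 + c)^(i-1), which
    also covers i = 1, where the truncated i - 2 is 0; the geometric sum then closes the
    induction. *)
Lemma gronwall (R : realType) (b : nat -> R) (c : R) N : 0 <= c -> 0 <= b 0%N ->
  (forall m, (m <= N)%N -> b m <= b 0%N + c * \sum_(1 <= i < m.+1) b (i - 2)%N) ->
  forall m, (m <= N)%N -> b m <= b 0%N * (1 + c) ^+ m.
Proof.
move=> c0 b0 H; elim/ltn_ind => m ih mN; apply: le_trans (H m mN) _.
have q1 : 1 <= 1 + c by rewrite lerDl.
have S : \sum_(1 <= i < m.+1) b (i - 2)%N <= \sum_(1 <= i < m.+1) b 0%N * (1 + c) ^+ i.-1.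
  rewrite !big_seq; apply: ler_sum => i; rewrite mem_index_iota => /andP[i1 im].
  have i2m : (i - 2 < m)%N.
    case: i i1 im => [//|[_ im|i _ im]]; first exact: im.
    by rewrite !subSS subn0 ltnW.
  apply: le_trans (ih _ i2m (leq_trans (ltnW i2m) mN)) _.
  rewrite ler_wpM2l//; apply: ler_weXn2l => //.
  by case: i i1 {im i2m} => [|[|i]]//= _; rewrite !subSS subn0.
have geo : c * \sum_(1 <= i < m.+1) b 0%N * (1 + c) ^+ i.-1 = b 0%N * ((1 + c) ^+ m - 1).
  elim: m {mN ih S} => [|k ihk]; first by rewrite big_geq// expr0 subrr !mulr0.
  by rewrite big_nat_recr//= mulrDr ihk exprS; ring.
have := ler_wpM2l c0 S; rewrite geo; lra.
Qed.

Lemma pow_le_exp (R : realType) (c : R) m : 0 <= c -> (1 + c) ^+ m <= expR (m%:R * c).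
Proof.
move=> c0; rewrite expRM_natl lerXn2r ?nnegrE ?expR_ge0 ?addr_ge0//.
exact: expR_ge1Dx.
Qed.

Lemma vdot_CS (R : realType) r (x y : 'rV[R]_r) : vdot x y ^+ 2 <= vdot x x * vdot y y.
Proof.
have [y0|yn] := eqVneq (vdot y y) 0.
  by rewrite (vdot_eq0 y0) !vdot0r expr0n mulr0.
have yp : 0 < vdot y y by rewrite lt_neqAle eq_sym yn vdot_ge0.
have := vdot_ge0 (vdot y y *: x - vdot x y *: y).
have -> : vdot (vdot y y *: x - vdot x y *: y) (vdot y y *: x - vdot x y *: y) =
    vdot y y * (vdot x x * vdot y y - vdot x y ^+ 2).
  rewrite vdotBl !vdotBr !vdotZl !vdotZr (vdotC y x); ring.
by rewrite pmulr_rge0// subr_ge0.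
Qed.

(** * Stability in coordinates *)

Section pathwise.
Context {R : realType} {r : nat} (A : 'rV[R]_r -> 'rV[R]_r) (Phi : 'rV[R]_r -> R).
Hypothesis Phi_ge0 : forall c, 0 <= Phi c.
Hypothesis A_le : forall c y, `|vdot (A c) y| <= Phi c + Phi y.
Hypothesis A_self : forall c, vdot (A c) c = Phi c.
Variables (tau : R) (N : nat).
Hypothesis tau_gt0 : 0 < tau.
Variables x z : nat -> 'rV[R]_r.
Hypothesis xz : forall i, (1 <= i <= N)%N -> x i - x i.-1 + tau *: A (x i) = z i.

Local Notation sq v := (vdot v v).
Let del i := x i - x i.-1.

(* Only z_i . x_(i-2) has mean zero, and x_i = x_(i-2) + del_(i-1) + del_i. *)
Let path_step i : (1 <= i <= N)%N ->
  sq (x i) - sq (x i.-1) + sq (del i) + 2 * tau * Phi (x i) <=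
  4^-1 * sq (del i) + 4^-1 * sq (del i.-1) + 8 * sq (z i) + 2 * vdot (z i) (x (i - 2)%N).
Proof.
move=> iN; have e2 : (i - 2)%N = i.-1.-1 by rewrite -subn2.
have h1 : 2 * vdot (z i) (x i) = sq (x i) - sq (x i.-1) + sq (del i) + 2 * tau * Phi (x i).
  rewrite -xz// vdotDl vdotZl A_self /del vdotBl (vdotBl (x i - x i.-1)) !(vdotBr (x _)).
  by rewrite (vdotC (x i.-1) (x i)); ring.
have h2 : vdot (z i) (x i) = vdot (z i) (del i) + vdot (z i) (del i.-1) + vdot (z i) (x (i - 2)%N).
  by rewrite -!vdotDr /del e2 addrA subrK subrK.
(* After doubling, each of the two inequalities costs 4 |z|^2 + |del|^2 / 4, hence the constant
   8. *)
have y1 := @vdot_young _ _ 2 (z i) (del i) (ltr0n _ 2).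
have y2 := @vdot_young _ _ 2 (z i) (del i.-1) (ltr0n _ 2).
rewrite -h1 h2; lra.
Qed.

Lemma path_energy m : (m <= N)%N ->
  sq (x m) + 2^-1 * \sum_(1 <= i < m.+1) sq (x i - x i.-1) +
    2 * tau * \sum_(1 <= i < m.+1) Phi (x i) <=
  sq (x 0%N) + 8 * \sum_(1 <= i < m.+1) sq (z i) +
    2 * \sum_(1 <= i < m.+1) vdot (z i) (x (i - 2)%N).
Proof.
(* The additional |del m|^2 / 4 is reserved to absorb the increment of index m that appears in step
   m + 1. For m = 0 it vanishes, since the predecessor of 0 is 0. *)
move=> mN; suff : sq (x m) + 2^-1 * \sum_(1 <= i < m.+1) sq (del i) + 4^-1 * sq (del m) +
    2 * tau * \sum_(1 <= i < m.+1) Phi (x i) <=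
    sq (x 0%N) + 8 * \sum_(1 <= i < m.+1) sq (z i) +
    2 * \sum_(1 <= i < m.+1) vdot (z i) (x (i - 2)%N).
  have := vdot_ge0 (del m); rewrite /del; lra.
elim: m mN => [|m ih] mN.
  by rewrite !big_geq// /del /= subrr vdot0r !mulr0 !addr0.
have := ih (ltnW mN); have := @path_step m.+1 mN.
rewrite ![\sum_(1 <= i < m.+2) _]big_nat_recr//= !mulrDr; lra.
Qed.

(** The strict inequality k < n keeps Phi (x 0) out of the bound: nothing controls the gradient of
    the initial value uniformly. *)
Lemma path_increment k n : (1 <= k)%N -> (k < n)%N -> (n <= N)%N ->
  sq (x n - x (n - k)%N) <=
  2 * tau * \sum_(l < k) (2 * Phi (x (n - l)%N) + Phi (x n) + Phi (x (n - k)%N)) +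
  sq (\sum_(l < k) z (n - l)%N).
Proof.
move=> k1 kn nN; set e := x n - x (n - k)%N.
have tele : e = \sum_(l < k) (x (n - l)%N - x (n - l).-1).
  rewrite -(big_mkord xpredT (fun l => x (n - l)%N - x (n - l).-1)).
  under eq_bigr do rewrite -subnS -opprB.
  rewrite sumrN telescope_sumr// subn0.
  by rewrite opprB.
have ze : \sum_(l < k) z (n - l)%N = e + tau *: \sum_(l < k) A (x (n - l)%N).
  rewrite scaler_sumr tele -big_split; apply: eq_bigr => l _; rewrite -xz//.
  by rewrite (leq_trans (leq_subr _ _) nN) andbT subn_gt0 (ltn_trans (ltn_ord l) kn).
set Z := \sum_(l < k) z _ in ze *.
have id : sq e = vdot Z e - tau * \sum_(l < k) vdot (A (x (n - l)%N)) e.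
  by rewrite ze vdotDl vdotZl -vdot_suml addrK.
have ya := @vdot_young _ _ (2^-1) Z e; rewrite invr_gt0 ltr0n in ya.
have {}ya := ya isT.
have aa : - \sum_(l < k) vdot (A (x (n - l)%N)) e <=
    \sum_(l < k) (2 * Phi (x (n - l)%N) + Phi (x n) + Phi (x (n - k)%N)).
  rewrite -sumrN; apply: ler_sum => l _; rewrite /e vdotBr.
  have := A_le (x (n - l)%N) (x n); have := A_le (x (n - l)%N) (x (n - k)%N).
  rewrite !ler_norml => /andP[h1 h2] /andP[h3 h4]; lra.
have ta := ler_wpM2l (ltW tau_gt0) aa.
rewrite mulrN in ta; rewrite id in ya *; lra.
Qed.

(* As z_i is F_i-measurable but orthogonal to F_(i-2) only, the even and the odd
   indices form two separate martingales. *)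
Let dd (par : bool) i := if (0 < i)%N && (odd i == par) then vdot (z i) (x (i - 2)%N) else 0.

(** The maximum of the energy inequality is bounded by the maxima of two martingales, whose
    quadratic variation is at most (|x_0|^2 + Mx) Z. Davis costs 2 * 2 * 15 square roots of it, or
    (|x_0|^2 + Mx)/2 + 1800 Z. Absorbing Mx/2 doubles the rest: 3 = 2 (1 + 1/2), 3616 = 2 (8 + 1800)
    and 8 = 2 * 4. *)
Lemma path_max :
  \big[Num.max/0]_(1 <= i < N.+1) sq (x i) <=
  3 * sq (x 0%N) + 3616 * \sum_(1 <= i < N.+1) sq (z i) +
  8 * (\sum_(i < N.+1) davis_weight (dd true) i * dd true i +
       \sum_(i < N.+1) davis_weight (dd false) i * dd false i).
Proof.
set Mx := \big[Num.max/0]_(_ <= _ < _) _; set Z := \sum_(_ <= _ < _) _.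
have Mx0 : 0 <= Mx by rewrite /Mx big_nat; elim/big_ind: _ => // [a b a0 b0|i _]; rewrite ?le_max ?a0 ?vdot_ge0.
have Z0 : 0 <= Z by apply: sumr_ge0 => i _; exact: vdot_ge0.
have x00 := vdot_ge0 (x 0%N).
have xM i : (i <= N)%N -> sq (x i) <= sq (x 0%N) + Mx.
  case: i => [|i] iN; first by rewrite lerDl.
  apply: (@le_trans _ _ Mx); last by rewrite lerDr.
  by apply: (@le_bigmax_seq _ _ _ _ _ i.+1); rewrite ?mem_index_iota.
have sumE m : \sum_(1 <= i < m.+1) vdot (z i) (x (i - 2)%N) =
    psum (dd true) m.+1 + psum (dd false) m.+1.
  rewrite /psum -big_split /= big_ord_recl /= {1 2}/dd /= !addr0 add0r big_add1 big_mkord.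
  apply: eq_bigr => i _; rewrite /dd /= /bump /= add1n /=.
  by case: (odd i) => /=; rewrite ?addr0 ?add0r.
have qb par : qvar (dd par) N.+1 <= (sq (x 0%N) + Mx) * Z.
  rewrite /qvar big_ord_recl /= {1}/dd /= expr0n add0r /Z big_add1 big_mkord mulr_sumr.
  apply: ler_sum => i _; rewrite /dd /= /bump /= add1n /=.
  have X0 : 0 <= (sq (x 0%N) + Mx) * sq (z i.+1) by rewrite mulr_ge0 ?addr_ge0 ?vdot_ge0.
  case: ifP => _; last by rewrite expr0n.
  rewrite (le_trans (vdot_CS _ _))// mulrC ler_wpM2r ?vdot_ge0//; apply: xM.
  by rewrite (leq_trans (leq_subr _ _))// ltn_ord.
(* The weight 1/120 is chosen so that 60 such terms leave Mx with the coefficient 1/2; 30 =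
   1/(4/120) is then forced. *)
have sb par : Num.sqrt (qvar (dd par) N.+1) <= 120^-1 * (sq (x 0%N) + Mx) + 30 * Z.
  have X0 : 0 <= sq (x 0%N) + Mx by rewrite addr_ge0.
  rewrite -(@ler_pXn2r _ 2)// ?nnegrE ?sqrtr_ge0 ?addr_ge0 ?mulr_ge0// ?invr_ge0//.
  rewrite sqr_sqrtr ?qvar_ge0//; apply: le_trans (qb par) _.
  by have := sqr_ge0 (120^-1 * (sq (x 0%N) + Mx) - 30 * Z); lra.
have Mb i : (1 <= i <= N)%N -> sq (x i) <= sq (x 0%N) + 8 * Z +
    2 * (pmax (dd true) N.+1 + pmax (dd false) N.+1).
  move=> /andP[i1 iN]; have := path_energy iN; rewrite sumE.
  have Zi : \sum_(1 <= j < i.+1) sq (z j) <= Z.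
    have -> : Z = \sum_(1 <= j < i.+1) sq (z j) + \sum_(i.+1 <= j < N.+1) sq (z j).
      by rewrite /Z -big_cat_nat.
    by rewrite lerDl; apply: sumr_ge0 => j _; exact: vdot_ge0.
  have p1 : 0 <= 2 * tau * \sum_(1 <= j < i.+1) Phi (x j).
    by rewrite !mulr_ge0 ?(ltW tau_gt0)//; exact: sumr_ge0.
  have p2 : 0 <= \sum_(1 <= j < i.+1) sq (x j - x j.-1).
    by apply: sumr_ge0 => j _; exact: vdot_ge0.
  have ps par : psum (dd par) i.+1 <= pmax (dd par) N.+1.
    rewrite (le_trans (ler_norm _))// (le_trans (psum_le_pmax _ _))//.
    by apply: pmax_mono; rewrite ltnS.
  have := ps true; have := ps false; lra.
have Mb' : Mx <= sq (x 0%N) + 8 * Z + 2 * (pmax (dd true) N.+1 + pmax (dd false) N.+1).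
  rewrite /Mx big_nat; elim/big_ind: _ => [|a b ha hb|i iN].
  - by rewrite !addr_ge0 ?mulr_ge0 ?addr_ge0 ?pmax_ge0.
  - by rewrite ge_max ha.
  - by apply: Mb; move: iN; rewrite ltnS.
have := davis (dd true) N.+1; have := davis (dd false) N.+1.
have := sb true; have := sb false; lra.
Qed.

End pathwise.

Section L1_tools.
Context d (Om : measurableType d) (R : realType) (P : {measure set Om -> \bar R}).

Lemma int1_le_ae (f g : Om -> R) : measurable_fun setT f ->
  {ae P, forall w, `|f w| <= g w} -> int1 P g -> int1 P f.
Proof.
move=> mf fg ig; apply: int1P => //.
have mg := int1_meas ig.
apply: le_lt_trans (int1_lty ig); apply: ae_ge0_le_integral => //.
- by apply/measurable_EFinP; exact: measurableT_comp.
- by apply/measurable_EFinP; exact: measurableT_comp.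
- by apply: ae_imp fg => w h _; rewrite lee_fin (le_trans h)// ler_norm.
Qed.

Lemma int1_vdot r (f g : Om -> 'rV[R]_r) : (forall j, int2 P (fun w => f w ord0 j)) ->
  (forall j, int2 P (fun w => g w ord0 j)) -> int1 P (fun w => vdot (f w) (g w)).
Proof. by move=> hf hg; apply: int1_sum => j _; exact: int2_mul. Qed.

Lemma Rint_vdot r (f g : Om -> 'rV[R]_r) : (forall j, int2 P (fun w => f w ord0 j)) ->
  (forall j, int2 P (fun w => g w ord0 j)) ->
  \int[P]_w vdot (f w) (g w) = \sum_j \int[P]_w (f w ord0 j * g w ord0 j).
Proof. by move=> hf hg; rewrite /vdot Rint_sum// => j _; exact: int2_mul. Qed.

Lemma int2_row_sum r (I : finType) (Q : pred I) (f : I -> Om -> 'rV[R]_r) j :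
  (forall i, Q i -> int2 P (fun w => f i w ord0 j)) ->
  int2 P (fun w => (\sum_(i | Q i) f i w) ord0 j).
Proof. by move=> h; under eq_fun do rewrite summxE; exact: int2_sum. Qed.

End L1_tools.

Section davis_measurable.
Context d (Om : measurableType d) (R : realType) (F : set (set Om)).
Hypothesis sF : sigma_algebra setT F.

Lemma rmeas_davis_weight (f : nat -> Om -> R) n : (forall i, (i < n)%N -> rmeas F (f i)) ->
  rmeas F (fun w => davis_weight (f ^~ w) n).
Proof.
move=> mf.
have mS k : (k <= n)%N -> rmeas F (fun w => psum (f ^~ w) k).
  by move=> kn; apply: rmeas_sum => // i _; apply: mf; exact: leq_trans (ltn_ord i) kn.
have mQ : rmeas F (fun w => qvar (f ^~ w) n).
  apply: rmeas_sum => // i _; under eq_fun do rewrite expr2.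
  by apply: rmeasM => //; exact: mf.
have mM k : (k <= n)%N -> rmeas F (fun w => pmax (f ^~ w) k).
  elim: k => [|k ih] kn /=; first exact: rmeas_cst.
  apply: rmeas_max => //; first by apply: ih; exact: ltnW.
  by apply: (rmeas_comp sF (f := Num.norm)); [exact: normr_measurable|exact: mS].
apply: rmeasM => //; first exact: mS.
under eq_fun do rewrite -powR_inv1 ?sqrtr_ge0//.
apply: (rmeas_comp sF (f := fun y => y `^ (-1))); first exact: measurable_powR.
apply: (rmeas_comp sF (f := Num.sqrt)).
  by apply: continuous_measurable_fun; exact: sqrt_continuous.
apply: rmeasD => //; under eq_fun do rewrite expr2.
by apply: rmeasM => //; exact: mM.
Qed.

Lemma rmeas_vdot r (x y : Om -> 'rV[R]_r) : (forall j, rmeas F (fun w => x w ord0 j)) ->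
  (forall j, rmeas F (fun w => y w ord0 j)) -> rmeas F (fun w => vdot (x w) (y w)).
Proof. by move=> mx my; apply: rmeas_sum => // j _; exact: rmeasM. Qed.

End davis_measurable.

(** * Stability in expectation *)

Section stability.
Context d (Om : measurableType d) (R : realType) (P : probability Om R).
Variables (N : nat) (H : nat -> set (set Om)).
Hypothesis sH : forall i, (i <= N)%N -> sigma_algebra setT (H i).
Hypothesis mH : forall i, (i <= N)%N -> H i `<=` measurable.
Hypothesis monoH : forall i j, (i <= j <= N)%N -> H i `<=` H j.
Context {r : nat} (A : 'rV[R]_r -> 'rV[R]_r) (Phi : 'rV[R]_r -> R).
Hypothesis Phi_ge0 : forall c, 0 <= Phi c.
Hypothesis A_le : forall c y, `|vdot (A c) y| <= Phi c + Phi y.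
Hypothesis A_self : forall c, vdot (A c) c = Phi c.
Hypothesis Phi_cont : continuous Phi.
Variables (tau Tt kap : R).
Hypotheses (tau_gt0 : 0 < tau) (tauN : N%:R * tau <= Tt) (kap_ge0 : 0 <= kap).
Variables x z : nat -> Om -> 'rV[R]_r.
Hypothesis mx : forall i j, (i <= N)%N -> rmeas (H i) (fun w => x i w ord0 j).
Hypothesis ix : forall i j, (i <= N)%N -> int2 P (fun w => x i w ord0 j).
Hypothesis mz : forall i j, (1 <= i <= N)%N -> rmeas (H i) (fun w => z i w ord0 j).
Hypothesis iz : forall i j, (1 <= i <= N)%N -> int2 P (fun w => z i w ord0 j).
Hypothesis oz : forall i j g, (1 <= i <= N)%N -> rmeas (H (i - 2)) g -> int2 P g ->
  \int[P]_w (z i w ord0 j * g w) = 0.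
Hypothesis ez : forall i, (1 <= i <= N)%N ->
  \int[P]_w vdot (z i w) (z i w) <= tau * kap * (1 + \int[P]_w vdot (x (i - 2)%N w) (x (i - 2)%N w)).
Hypothesis xz : forall i, (1 <= i <= N)%N ->
  {ae P, forall w, x i w - x i.-1 w + tau *: A (x i w) = z i w}.

Let a i := \int[P]_w vdot (x i w) (x i w).
Let zz i := \int[P]_w vdot (z i w) (z i w).

Let xz_all : {ae P, forall w, forall i, (1 <= i <= N)%N ->
  x i w - x i.-1 w + tau *: A (x i w) = z i w}.
Proof.
apply: (@ae_all _ _ _ P nat) => i; have [iN|iN] := boolP (1 <= i <= N)%N; first exact: ae_imp (xz iN).
exact: (ae_imp (P := fun=> True)) (aeW _ _).
Qed.

Let i2N i : (i <= N)%N -> (i - 2 <= N)%N. Proof. exact: leq_trans (leq_subr 2 i). Qed.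

Let orth i (y : Om -> 'rV[R]_r) : (1 <= i <= N)%N ->
  (forall j, rmeas (H (i - 2)) (fun w => y w ord0 j)) ->
  (forall j, int2 P (fun w => y w ord0 j)) -> \int[P]_w vdot (z i w) (y w) = 0.
Proof.
move=> iN my iy; rewrite Rint_vdot//; last by move=> j; exact: iz.
by rewrite big1// => j _; exact: oz.
Qed.

Let int1_xx i : (i <= N)%N -> int1 P (fun w => vdot (x i w) (x i w)).
Proof. by move=> iN; apply: int1_vdot => j; exact: ix. Qed.

Let int1_zz i : (1 <= i <= N)%N -> int1 P (fun w => vdot (z i w) (z i w)).
Proof. by move=> iN; apply: int1_vdot => j; exact: iz. Qed.

Let int1_zx i : (1 <= i <= N)%N -> int1 P (fun w => vdot (z i w) (x (i - 2)%N w)).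
Proof.
move=> iN; apply: int1_vdot => j; first exact: iz.
by apply: ix; apply: i2N; case/andP: iN.
Qed.

Let expect_zx i : (1 <= i <= N)%N -> \int[P]_w vdot (z i w) (x (i - 2)%N w) = 0.
Proof.
move=> iN; have iN' : (i - 2 <= N)%N by apply: i2N; case/andP: iN.
by apply: orth => // j; [exact: mx|exact: ix].
Qed.

Let int1_Zsum m : (m <= N)%N -> int1 P (fun w => \sum_(1 <= i < m.+1) vdot (z i w) (z i w)).
Proof.
move=> mN; under eq_fun do rewrite big_nat; apply: int1_sum => i /andP[i1 im].
by apply: int1_zz; rewrite i1 (leq_trans _ mN).
Qed.

Let int1_Msum m : (m <= N)%N -> int1 P (fun w => \sum_(1 <= i < m.+1) vdot (z i w) (x (i - 2)%N w)).
Proof.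
move=> mN; under eq_fun do rewrite big_nat; apply: int1_sum => i /andP[i1 im].
by apply: int1_zx; rewrite i1 (leq_trans _ mN).
Qed.

Let expect_energy m : (m <= N)%N ->
  int1 P (fun w => vdot (x 0%N w) (x 0%N w) + 8 * \sum_(1 <= i < m.+1) vdot (z i w) (z i w) +
    2 * \sum_(1 <= i < m.+1) vdot (z i w) (x (i - 2)%N w)) /\
  \int[P]_w (vdot (x 0%N w) (x 0%N w) + 8 * \sum_(1 <= i < m.+1) vdot (z i w) (z i w) +
    2 * \sum_(1 <= i < m.+1) vdot (z i w) (x (i - 2)%N w)) =
  a 0%N + 8 * \sum_(1 <= i < m.+1) zz i.
Proof.
move=> mN.
have i1 := int1_xx (leq0n N); have i2 := int1Z 8 (int1_Zsum mN); have i3 := int1Z 2 (int1_Msum mN).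
split; first by apply: int1D => //; exact: int1D.
rewrite RintD//; last exact: int1D.
rewrite RintD// !RintZ; [|exact: int1_Msum|exact: int1_Zsum].
have -> : \int[P]_w \sum_(1 <= i < m.+1) vdot (z i w) (x (i - 2)%N w) = 0.
  under eq_Rintegral do rewrite big_nat.
  rewrite Rint_sum => [|i /andP[i1' im]]; last by apply: int1_zx; rewrite i1' (leq_trans _ mN).
  by rewrite big1// => i /andP[i1' im]; apply: expect_zx; rewrite i1' (leq_trans _ mN).
rewrite mulr0 addr0; congr (_ + _ * _).
under eq_Rintegral do rewrite big_nat.
rewrite Rint_sum => [|i /andP[i1' im]]; last by apply: int1_zz; rewrite i1' (leq_trans _ mN).
by rewrite [RHS]big_nat.
Qed.

Let lam := expR (8 * kap * Tt).
Let B := lam * (1 + a 0%N).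

Let a_ge0 i : 0 <= a i. Proof. by apply: Rint_ge0 => w; exact: vdot_ge0. Qed.

Let a_le m : (m <= N)%N -> 1 + a m <= B.
Proof.
(* Gronwall is applied to 1 + a i, which absorbs the inhomogeneous term 1 of the noise bound. *)
move=> mN; pose b i := 1 + a i.
have c0 : 0 <= 8 * (tau * kap) by rewrite !mulr_ge0// ltW.
have b0 : 0 <= b 0%N by rewrite addr_ge0.
have step k : (k <= N)%N -> b k <= b 0%N + 8 * (tau * kap) * \sum_(1 <= i < k.+1) b (i - 2)%N.
  move=> kN; rewrite /b -addrA lerD2l.
  have [iE eE] := expect_energy kN.
  apply: (@le_trans _ _ (a 0%N + 8 * \sum_(1 <= i < k.+1) zz i)).
    rewrite -eE; apply: Rint_le_ae => //; first exact: int1_xx.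
    apply: ae_imp xz_all => w hw.
    have := path_energy A_self (tau := tau) hw kN.
    have p1 : 0 <= 2 * tau * \sum_(1 <= j < k.+1) Phi (x j w).
      by rewrite !mulr_ge0 ?(ltW tau_gt0)//; exact: sumr_ge0.
    have p2 : 0 <= \sum_(1 <= j < k.+1) vdot (x j w - x j.-1 w) (x j w - x j.-1 w).
      by apply: sumr_ge0 => j _; exact: vdot_ge0.
    lra.
  rewrite lerD2l -mulrA ler_pM2l// mulr_sumr !big_nat; apply: ler_sum => i /andP[i1 ik].
  by apply: ez; rewrite i1 (leq_trans _ kN).
apply: le_trans (gronwall c0 b0 step mN) _.
rewrite /B mulrC ler_wpM2r//; apply: le_trans (pow_le_exp m c0) _.
rewrite ler_expR mulrCA -mulrA ler_pM2l// mulrA mulrC ler_wpM2l//.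
by apply: le_trans tauN; rewrite ler_wpM2r ?ler_nat// ltW.
Qed.

Let B_ge1 : 1 <= B. Proof. by apply: le_trans (a_le (leq0n N)); rewrite lerDl. Qed.

Let zz_le i : (1 <= i <= N)%N -> zz i <= tau * kap * B.
Proof.
move=> iN; apply: le_trans (ez iN) _; rewrite ler_wpM2l ?mulr_ge0 ?(ltW tau_gt0)//.
by apply: a_le; apply: i2N; case/andP: iN.
Qed.

Let Z_le : \sum_(1 <= i < N.+1) zz i <= kap * Tt * B.
Proof.
apply: (@le_trans _ _ (\sum_(1 <= i < N.+1) tau * kap * B)).
  by rewrite !big_nat; apply: ler_sum => i iN; apply: zz_le; move: iN; rewrite ltnS.
rewrite sumr_const_nat subn1 /= -[leLHS]mulr_natl mulrA.
apply: ler_wpM2r; first exact: le_trans ler01 B_ge1.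
by rewrite mulrA mulrC ler_wpM2l.
Qed.

Let mPhi i : (i <= N)%N -> measurable_fun setT (fun w => Phi (x i w)).
Proof.
move=> iN; have := rmeas_row (sH iN) Phi_cont (fun j => mx j iN) => h _ B' mB'.
by rewrite setTI; apply: (mH iN); exact: h.
Qed.

Lemma stability_Phi : (forall i, (1 <= i <= N)%N -> int1 P (fun w => Phi (x i w))) /\
  tau * \sum_(1 <= i < N.+1) \int[P]_w Phi (x i w) <= (1 + 8 * kap * Tt) * B.
Proof.
have [iE eE] := expect_energy (leqnn N).
have bound : {ae P, forall w, 2 * tau * \sum_(1 <= i < N.+1) Phi (x i w) <=
    vdot (x 0%N w) (x 0%N w) + 8 * \sum_(1 <= i < N.+1) vdot (z i w) (z i w) +
    2 * \sum_(1 <= i < N.+1) vdot (z i w) (x (i - 2)%N w)}.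
  apply: ae_imp xz_all => w hw.
  have := path_energy A_self (tau := tau) hw (leqnn N).
  have p1 := vdot_ge0 (x N w).
  have p2 : 0 <= \sum_(1 <= j < N.+1) vdot (x j w - x j.-1 w) (x j w - x j.-1 w).
    by apply: sumr_ge0 => j _; exact: vdot_ge0.
  lra.
have iPhi i : (1 <= i <= N)%N -> int1 P (fun w => Phi (x i w)).
  move=> iN; have iN' : (i <= N)%N by case/andP: iN.
  (* Integrability of Phi is a conclusion: a single term of the sum is dominated by the integrable
     right-hand side of the energy inequality. *)
  apply: (int1_le_ae (mPhi iN') _ (int1Z (2 * tau)^-1 iE)).
  apply: ae_imp bound => w hw; rewrite ger0_norm//.
  have t2 : 0 < 2 * tau by rewrite mulr_gt0.
  rewrite ler_pdivlMl//; apply: le_trans hw; rewrite ler_pM2l//.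
  rewrite (bigD1_seq i)/=; last exact: iota_uniq.
    by rewrite lerDl; exact: sumr_ge0.
  by rewrite mem_index_iota ltnS.
split => //.
have iS : int1 P (fun w => \sum_(1 <= i < N.+1) Phi (x i w)).
  by under eq_fun do rewrite big_nat; apply: int1_sum => i iN; apply: iPhi; move: iN; rewrite ltnS.
have eS : \int[P]_w \sum_(1 <= i < N.+1) Phi (x i w) = \sum_(1 <= i < N.+1) \int[P]_w Phi (x i w).
  under eq_Rintegral do rewrite big_nat.
  by rewrite Rint_sum ?[RHS]big_nat// => i iN; apply: iPhi; move: iN; rewrite ltnS.
have := Rint_le_ae (int1Z (2 * tau) iS) iE bound; rewrite RintZ// eS eE.
have := Z_le; have := a_le (leq0n N); have := B_ge1.
have : 0 <= tau * \sum_(1 <= i < N.+1) \int[P]_w Phi (x i w).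
  rewrite mulr_ge0 ?(ltW tau_gt0)//; apply: sumr_ge0 => i _; exact: Rint_ge0.
rewrite -(mulrA 2); lra.
Qed.

Let dd (par : bool) i w := if (0 < i)%N && (odd i == par) then vdot (z i w) (x (i - 2)%N w) else 0.

(** The earlier nonzero terms of the same parity have index at most i - 2, so the weight is
    H_(i-2)-measurable. It is bounded by 1, and [orth] applies to the weighted x_(i-2). *)
Let dd_expect par i : (i < N.+1)%N ->
  int1 P (fun w => davis_weight (dd par ^~ w) i * dd par i w) /\
  \int[P]_w (davis_weight (dd par ^~ w) i * dd par i w) = 0.
Proof.
rewrite ltnS => iN.
have [/andP[i1 ipar]|h] := boolP ((0 < i)%N && (odd i == par)); last first.
  have -> : (fun w => davis_weight (dd par ^~ w) i * dd par i w) = (fun=> 0).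
    by apply/funext => w; rewrite /dd (negbTE h) mulr0.
  by split; [exact: int1_0|exact: Rint_zero].
have iN1 : (1 <= i <= N)%N by rewrite i1.
have sH2 := sH (i2N iN).
pose g w := davis_weight (dd par ^~ w) i.
have mg : rmeas (H (i - 2)) g.
  apply: rmeas_davis_weight => // j ji.
  have [/andP[j1 jpar]|hj] := boolP ((0 < j)%N && (odd j == par)); last first.
    rewrite (_ : dd par j = fun=> 0); first exact: rmeas_cst.
    by apply/funext => w; rewrite /dd (negbTE hj).
  have j2 : (j <= i - 2)%N.
    rewrite leq_subRL; last by case: i i1 ji {ipar iN iN1 sH2 g} => [|[|i]]//; case: j j1 jpar.
    rewrite add2n ltn_neqAle ji andbT; apply: contraTneq ipar => <- /=.
    by rewrite /= -(eqP jpar); case: (odd j).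
  have jN := leq_trans j2 (i2N iN).
  rewrite (_ : dd par j = fun w => vdot (z j w) (x (j - 2)%N w)); last first.
    by apply/funext => w; rewrite /dd j1 jpar.
  apply: rmeas_vdot => // k B' mB'; apply: (monoH (i := j)); rewrite ?j2 ?i2N//.
    by apply: mz => //; rewrite j1.
  by apply: (monoH (i := j - 2)%N); [rewrite leq_subr|apply: mx => //; exact: i2N].
have g1 w : `|g w| <= 1 by exact: davis_weight_le1.
pose y w := g w *: x (i - 2)%N w.
have my j : rmeas (H (i - 2)) (fun w => y w ord0 j).
  by under eq_fun do rewrite mxE; apply: rmeasM => //; apply: mx; exact: i2N.
have iy j : int2 P (fun w => y w ord0 j).
  apply: (int2_le _ _ (ix j (i2N iN))).
    by move=> _ B' mB'; rewrite setTI; apply: (mH (i2N iN)); exact: my.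
  by move=> w; rewrite mxE normrM ler_piMl.
have -> : (fun w => davis_weight (dd par ^~ w) i * dd par i w) = (fun w => vdot (z i w) (y w)).
  by apply/funext => w; rewrite /dd i1 ipar /y vdotZr.
by split; [apply: int1_vdot => // j; exact: iz|exact: orth].
Qed.

Lemma stability_max :
  int1 P (fun w => \big[Num.max/0]_(1 <= i < N.+1) vdot (x i w) (x i w)) /\
  \int[P]_w \big[Num.max/0]_(1 <= i < N.+1) vdot (x i w) (x i w) <= (3 + 3616 * kap * Tt) * B.
Proof.
have mM : measurable_fun setT (fun w => \big[Num.max/0]_(1 <= i < N.+1) vdot (x i w) (x i w)).
  have sHN := sH (leqnn N).
  suff : rmeas (H N) (fun w => \big[Num.max/0]_(1 <= i < N.+1) vdot (x i w) (x i w)).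
    by move=> h _ B' mB'; rewrite setTI; apply: (mH (leqnn N)); exact: h.
  have mxx i : (i <= N)%N -> rmeas (H N) (fun w => vdot (x i w) (x i w)).
    move=> iN; have mxN j : rmeas (H N) (fun w => x i w ord0 j).
      by move=> B' mB'; apply: (monoH (i := i)); [rewrite iN leqnn|exact: (mx j iN mB')].
    exact: rmeas_vdot.
  have : forall i, i \in index_iota 1 N.+1 -> (i <= N)%N.
    by move=> i; rewrite mem_index_iota ltnS => /andP[].
  elim: (index_iota 1 N.+1) => [|i s ih] hs.
    by under eq_fun do rewrite big_nil; exact: rmeas_cst.
  under eq_fun do rewrite big_cons; apply: rmeas_max => //.
    by apply: mxx; apply: hs; rewrite mem_head.
  by apply: ih => k ks; apply: hs; rewrite in_cons ks orbT.
have i1 := int1_xx (leq0n N); have i2 := int1_Zsum (leqnn N).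
have idd par : int1 P (fun w => \sum_(i < N.+1) davis_weight (dd par ^~ w) i * dd par i w) /\
    \int[P]_w \sum_(i < N.+1) davis_weight (dd par ^~ w) i * dd par i w = 0.
  split; first by apply: int1_sum => i _; have [] := dd_expect par (ltn_ord i).
  rewrite Rint_sum => [|i _]; last by have [] := dd_expect par (ltn_ord i).
  by rewrite big1// => i _; have [] := dd_expect par (ltn_ord i).
have [it et] := idd true; have [jf ef] := idd false.
pose g w := 3 * vdot (x 0%N w) (x 0%N w) + 3616 * \sum_(1 <= i < N.+1) vdot (z i w) (z i w) +
  8 * (\sum_(i < N.+1) davis_weight (dd true ^~ w) i * dd true i w +
       \sum_(i < N.+1) davis_weight (dd false ^~ w) i * dd false i w).
have ig : int1 P g.
  by apply: int1D; [apply: int1D; exact: int1Z|apply: int1Z; exact: int1D].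
have eg : \int[P]_w g w = 3 * a 0%N + 3616 * \sum_(1 <= i < N.+1) zz i.
  rewrite /g RintD; [|by apply: int1D; exact: int1Z|by apply: int1Z; exact: int1D].
  rewrite RintD; [|exact: int1Z|exact: int1Z].
  rewrite RintZ// RintZ// RintZ; last exact: int1D.
  rewrite RintD// et ef addr0 mulr0 addr0; congr (_ + _ * _).
  under eq_Rintegral do rewrite big_nat.
  by rewrite Rint_sum ?[RHS]big_nat// => i iN; apply: int1_zz; move: iN; rewrite ltnS.
have bound : {ae P, forall w, \big[Num.max/0]_(1 <= i < N.+1) vdot (x i w) (x i w) <= g w}.
  apply: ae_imp xz_all => w hw; exact: (path_max Phi_ge0 A_self tau_gt0 hw).
have M0 w : 0 <= \big[Num.max/0]_(1 <= i < N.+1) vdot (x i w) (x i w).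
  elim/big_ind: _ => // [u v u0 v0|i _]; [by rewrite le_max u0|exact: vdot_ge0].
have iM : int1 P (fun w => \big[Num.max/0]_(1 <= i < N.+1) vdot (x i w) (x i w)).
  by apply: (int1_le_ae mM _ ig); apply: ae_imp bound => w hw; rewrite ger0_norm.
split => //; apply: le_trans (Rint_le_ae iM ig bound) _.
rewrite eg -(mulrA 3616); move: Z_le (a_le (leq0n N)) B_ge1.
by move: (\sum_(1 <= i < N.+1) zz i) (a 0%N) B => s a0 b; move: (kap * Tt) => k; lra.
Qed.


Let zz_ge0 i : 0 <= zz i. Proof. by apply: Rint_ge0 => w; exact: vdot_ge0. Qed.

Let sep (k n l l' : nat) : (k <= n)%N -> (l < l')%N -> (l' < k)%N -> odd l = odd l' ->
  (1 <= n - l')%N /\ (n - l' <= n - l - 2)%N.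
Proof.
move=> kn ll lk e; have ll2 : (l.+2 <= l')%N.
  by rewrite ltn_neqAle ll andbT; apply: contraPneq e => <- /=; case: odd.
split; first by rewrite subn_gt0 (leq_trans lk).
by rewrite -subnDA addn2 leq_sub2l.
Qed.

Let cross k n l l' : (k <= n)%N -> (n <= N)%N -> (l < l')%N -> (l' < k)%N -> odd l = odd l' ->
  \int[P]_w vdot (z (n - l)%N w) (z (n - l')%N w) = 0.
Proof.
move=> kn nN ll lk e; have [h1 h2] := sep kn ll lk e.
have lN : (1 <= n - l <= N)%N.
  by rewrite (leq_trans (leq_subr _ _) nN) andbT subn_gt0 (leq_trans (ltn_trans ll lk)).
have lN' : (1 <= n - l' <= N)%N by rewrite h1 (leq_trans (leq_subr _ _) nN).
apply: orth => // j; last exact: iz.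
move=> B' mB'; apply: (monoH (i := (n - l')%N)).
  by rewrite h2 /=; apply: i2N; case/andP: lN.
exact: (mz j lN' mB').
Qed.

(** Indices of equal parity that differ do so by at least 2, so within a parity class the noises are
    orthogonal. Joining the two classes costs the factor 2 instead of a factor k. *)
Let window k n : (1 <= k)%N -> (k <= n)%N -> (n <= N)%N ->
  int1 P (fun w => vdot (\sum_(l < k) z (n - l)%N w) (\sum_(l < k) z (n - l)%N w)) /\
  \int[P]_w vdot (\sum_(l < k) z (n - l)%N w) (\sum_(l < k) z (n - l)%N w) <=
    2 * \sum_(l < k) zz (n - l)%N.
Proof.
move=> k1 kn nN.
have lN (l : 'I_k) : (1 <= n - l <= N)%N.
  by rewrite (leq_trans (leq_subr _ _) nN) andbT subn_gt0 (leq_trans (ltn_ord l)).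
have i2 (l : 'I_k) j : int2 P (fun w => z (n - l)%N w ord0 j) by apply: iz.
pose Z (Q : pred 'I_k) w := \sum_(l < k | Q l) z (n - l)%N w.
have iZ Q j : int2 P (fun w => Z Q w ord0 j) by apply: int2_row_sum => l _; exact: i2.
have i1 Q : int1 P (fun w => vdot (Z Q w) (Z Q w)) by apply: int1_vdot => j; exact: iZ.
split; first exact: (i1 xpredT).
pose O (l : 'I_k) := odd l.
have part par : \int[P]_w vdot (Z (fun l => O l == par) w) (Z (fun l => O l == par) w) =
    \sum_(l < k | O l == par) zz (n - l)%N.
  rewrite /Z; under eq_Rintegral do rewrite vdot_suml.
  rewrite Rint_sum; last by move=> l _; apply: int1_vdot => j //; exact: iZ.
  apply: eq_bigr => l lpar; under eq_Rintegral do rewrite vdot_sumr.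
  rewrite Rint_sum; last by move=> l' _; exact: int1_vdot.
  rewrite (bigD1 l)//= big1 ?addr0// => l' /andP[l'par l'l].
  have e : odd l = odd l' by rewrite (eqP lpar : odd l = par) (eqP l'par : odd l' = par).
  case: (ltngtP l l') => ll; last by rewrite (val_inj ll) eqxx in l'l.
    exact: (cross kn nN ll (ltn_ord l') e).
  under eq_Rintegral do rewrite vdotC.
  exact: (cross kn nN ll (ltn_ord l) (esym e)).
apply: (@le_trans _ _ (\int[P]_w (2 * vdot (Z (fun l => O l == true) w) (Z (fun l => O l == true) w) +
    2 * vdot (Z (fun l => O l == false) w) (Z (fun l => O l == false) w)))).
  apply: Rint_le; [exact: (i1 xpredT)|by apply: int1D; exact: int1Z|move=> w].
  have -> : \sum_(l < k) z (n - l)%N w = Z (fun l => O l == true) w + Z (fun l => O l == false) w.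
    rewrite /Z (bigID O) /=; congr (_ + _); apply: eq_bigl => l; by case: (O l).
  move: (Z _ w) (Z _ w) => u v; have := vdot_ge0 (u - v).
  by rewrite vdotBl !vdotBr vdotDl !vdotDr (vdotC v u); lra.
rewrite RintD ?RintZ//; try exact: int1Z.
rewrite !part -mulrDr ler_pM2l// le_eqVlt; apply/orP; left; apply/eqP.
rewrite [RHS](bigID O) /=; congr (_ + _); apply: eq_bigl => l; by case: (O l).
Qed.

(** The term n = k involves x_0 and is bounded by the energies alone, 4 B. In the others, summing
    over n turns each of the k shifts into at most a full sum, and the resulting factor k cancels
    the division by k. Altogether 4 + 8 (1 + 8 kap Tt) + 2 kap Tt = 12 + 66 kap Tt. *)
Lemma stability_increments k : (1 <= k <= N)%N ->
  (forall n, (k <= n <= N)%N -> int1 P (fun w => vdot (x n w - x (n - k)%N w) (x n w - x (n - k)%N w))) /\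
  \sum_(k <= n < N.+1) (\int[P]_w vdot (x n w - x (n - k)%N w) (x n w - x (n - k)%N w)) / k%:R <=
    (12 + 66 * kap * Tt) * B.
Proof.
move=> /andP[k1 kN]; have kp : 0 < k%:R :> R by rewrite ltr0n.
pose E n := \int[P]_w vdot (x n w - x (n - k)%N w) (x n w - x (n - k)%N w).
have iE n : (k <= n <= N)%N -> int1 P (fun w => vdot (x n w - x (n - k)%N w) (x n w - x (n - k)%N w)).
  move=> /andP[kn nN]; apply: int1_vdot => j; under eq_fun do rewrite !mxE; apply: int2B;
    apply: ix => //; exact: leq_trans (leq_subr _ _) nN.
split => //.
have [iPhi PhiB] := stability_Phi.
pose ph i := \int[P]_w Phi (x i w).
have ph0 i : 0 <= ph i by exact: Rint_ge0.
pose S := \sum_(1 <= i < N.+1) ph i.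
pose Z := \sum_(1 <= i < N.+1) zz i.
(* Since n starts at k + 1, the shifted index n - l stays within 1, .., N for every l <= k. *)
have shift (f : nat -> R) l : (forall i, 0 <= f i) -> (l <= k)%N ->
    \sum_(k.+1 <= n < N.+1) f (n - l)%N <= \sum_(1 <= i < N.+1) f i.
  move=> f0 lk; rewrite -{1}(subnK (leqW lk)) big_addn.
  under eq_bigr do rewrite addnK.
  rewrite (big_nat_widen _ _ N.+1) ?leq_subr// (big_nat_widenl _ 1) ?subn_gt0 ?ltnS//.
  by rewrite big_mkcond; apply: ler_sum => i _; case: ifP.
have En n : (k.+1 <= n < N.+1)%N -> E n <=
    2 * tau * \sum_(l < k) (2 * ph (n - l)%N + ph n + ph (n - k)%N) + 2 * \sum_(l < k) zz (n - l)%N.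
  rewrite ltnS => /andP[kn nN]; have [iW leW] := window k1 (ltnW kn) nN.
  have iPl l : (l <= k)%N -> int1 P (fun w => Phi (x (n - l)%N w)).
    move=> lk; apply: iPhi; rewrite (leq_trans (leq_subr _ _) nN) andbT subn_gt0.
    exact: leq_ltn_trans kn.
  have iPn : int1 P (fun w => Phi (x n w)) by have := iPl 0%N (leq0n _); rewrite subn0.
  have iP3 (l : 'I_k) : int1 P (fun w => 2 * Phi (x (n - l)%N w) + Phi (x n w) + Phi (x (n - k)%N w)).
    by apply: int1D; [apply: int1D => //; apply: int1Z|]; apply: iPl => //; exact: ltnW.
  have iS : int1 P (fun w => \sum_(l < k) (2 * Phi (x (n - l)%N w) + Phi (x n w) + Phi (x (n - k)%N w))).
    exact: int1_sum.
  apply: (@le_trans _ _ (\int[P]_w (2 * tau * \sum_(l < k) (2 * Phi (x (n - l)%N w) + Phi (x n w) + Phi (x (n - k)%N w))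
      + vdot (\sum_(l < k) z (n - l)%N w) (\sum_(l < k) z (n - l)%N w)))).
    apply: Rint_le_ae; [by apply: iE; rewrite ltnW|by apply: int1D => //; exact: int1Z|].
    by apply: ae_imp xz_all => w hw; exact: (path_increment A_le tau_gt0 hw k1 kn nN).
  rewrite RintD//; last exact: int1Z.
  rewrite RintZ//; apply: lerD => //; rewrite Rint_sum//.
  rewrite ler_pM2l ?mulr_gt0//; apply: ler_sum => l _.
  have i3 : int1 P (fun w => 2 * Phi (x (n - l)%N w)) by apply/int1Z/iPl/ltnW.
  rewrite RintD//; [|exact: int1D|exact: iPl].
  by rewrite RintD// RintZ//; apply/iPl/ltnW.
have Ek : E k <= 4 * B.
  apply: (@le_trans _ _ (\int[P]_w (2 * vdot (x k w) (x k w) + 2 * vdot (x 0%N w) (x 0%N w)))).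
    apply: Rint_le; [by apply: iE; rewrite leqnn|by apply: int1D; apply: int1Z; exact: int1_xx|].
    move=> w; rewrite subnn; have := vdot_ge0 (x k w + x 0%N w).
    by rewrite !vdotDl !vdotDr !vdotNl !vdotNr; lra.
  rewrite RintD; [|by apply: int1Z; exact: int1_xx|by apply: int1Z; exact: int1_xx].
  rewrite RintZ; last exact: int1_xx.
  rewrite RintZ; last exact: int1_xx.
  by have := a_le kN; have := a_le (leq0n N); rewrite /a; lra.
rewrite -mulr_suml ler_pdivrMr// big_ltn ?ltnS//.
have k1R : 1 <= k%:R :> R by rewrite ler1n.
have B0 : 0 <= B by rewrite (le_trans ler01).
have rest : \sum_(k.+1 <= n < N.+1) E n <= k%:R * (8 * (tau * S) + 2 * Z).
  apply: (@le_trans _ _ (\sum_(k.+1 <= n < N.+1) (2 * tau * \sum_(l < k) (2 * ph (n - l)%N + ph n + ph (n - k)%N)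
      + 2 * \sum_(l < k) zz (n - l)%N))).
    by rewrite !big_nat; apply: ler_sum => n nk; exact: En.
  rewrite big_split /= -!mulr_sumr exchange_big /= [X in _ + 2 * X]exchange_big /=.
  have b1 : \sum_(l < k) \sum_(k.+1 <= n < N.+1) (2 * ph (n - l)%N + ph n + ph (n - k)%N) <= k%:R * (4 * S).
    rewrite mulr_natl -[k in leRHS]card_ord -sumr_const; apply: ler_sum => l _.
    rewrite !big_split /= -mulr_sumr.
    have := shift ph l ph0 (ltnW (ltn_ord l)); have := shift ph 0%N ph0 (leq0n k).
    have := shift ph k ph0 (leqnn k); under [X in _ -> X <= _ -> _]eq_bigr do rewrite subn0.
    by rewrite -/S; lra.
  have b2 : \sum_(l < k) \sum_(k.+1 <= n < N.+1) zz (n - l)%N <= k%:R * Z.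
    rewrite mulr_natl -[k in leRHS]card_ord -sumr_const; apply: ler_sum => l _.
    exact: (shift zz l zz_ge0 (ltnW (ltn_ord l))).
  rewrite (_ : k%:R * (8 * (tau * S) + 2 * Z) = 2 * tau * (k%:R * (4 * S)) + 2 * (k%:R * Z)); last by ring.
  by apply: lerD; [rewrite ler_pM2l ?mulr_gt0|rewrite ler_pM2l].
have PB : tau * S <= (1 + 8 * kap * Tt) * B by exact: PhiB.
have ZB : Z <= kap * Tt * B by exact: Z_le.
apply: (@le_trans _ _ (k%:R * (4 * B) + k%:R * (8 * (tau * S) + 2 * Z))).
  apply: lerD => //; apply: le_trans Ek _; rewrite ler_peMl// mulr_ge0//.
rewrite -mulrDr mulrC ler_pM2r//; lra.
Qed.

End stability.

(** * Solutions of the scheme *)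

Section random_step.
Context d (Om : measurableType d) (R : realType) (P : probability Om R).
Context {n : nat} (D : lipschitz_domain R n) (V : set (vfield D)) (Q : set (L2 D)).
Local Notation Vd := (div_free V Q).
Hypothesis hV : velocity_space V.
Context (r : nat) (o : 'I_r -> vfield D).
Hypothesis ho : orthonormal_in V Q o.
Hypothesis basis : forall v, Vd v -> vfield_eq v (\sum_j fdot v (o j) *: o j).
Variables (p : R) (p_gt1 : 1 < p) (tau : R) (tau_gt0 : 0 < tau).
Local Notation co := (coords o).
Local Notation A := (stress_mx o p).
Local Notation rho := (resolvent A tau).

Let p_gt0 : 0 < p. Proof. exact: lt_trans ltr01 p_gt1. Qed.

Let Phi_ge0 c : 0 <= spow p (comb o c). Proof. exact: spow_ge0. Qed.

Lemma galerkin_resolventP g : rho g + tau *: A (rho g) = g.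
Proof.
exact: (resolventP p_gt0 Phi_ge0 (stress_sub hV ho p_gt1) (stress_mx_le hV ho p_gt1)
  (spow_comb_bounded hV ho p_gt1) (stress_mx_line hV ho p_gt1) tau_gt0 g).
Qed.

Lemma galerkin_resolvent_unique c g : c + tau *: A c = g -> c = rho g.
Proof.
exact: (resolvent_unique p_gt0 Phi_ge0 (stress_sub hV ho p_gt1) (stress_mx_le hV ho p_gt1)
  (spow_comb_bounded hV ho p_gt1) (stress_mx_line hV ho p_gt1) tau_gt0).
Qed.

Lemma galerkin_resolvent_continuous : continuous rho.
Proof.
exact: (resolvent_continuous p_gt0 Phi_ge0 (stress_sub hV ho p_gt1) (stress_mx_le hV ho p_gt1)
  (spow_comb_bounded hV ho p_gt1) (stress_mx_line hV ho p_gt1) tau_gt0).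
Qed.

(** Comparison with the value at 0 turns the contraction into linear growth, which makes the new
    iterate square integrable. *)
Lemma galerkin_resolvent_le g :
  vdot (rho g) (rho g) <= 2 * vdot g g + 2 * vdot (rho 0) (rho 0).
Proof.
have := resolvent_contract p_gt0 (stress_sub hV ho p_gt1) tau_gt0 (rho g) (rho 0).
rewrite !galerkin_resolventP subr0.
have := vdot_ge0 (rho g - rho 0 - rho 0).
rewrite !(vdotBl, vdotBr) (vdotC (rho 0) (rho g)).
move: (vdot _ _) (vdot _ _) (vdot _ _) (vdot _ _) => a b c e; lra.
Qed.

Lemma vfield_refl (v : vfield D) : vfield_eq v v.
Proof. exact: (fnormsq_eq0 (etrans (congr1 (@fnormsq R n D) (subrr v)) (fdot0l 0))). Qed.

(** Testing with the finitely many basis fields already determines the coordinates, which is why an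
    exceptional set depending on the test field is harmless. *)
Lemma coords_step v v' w : Vd v ->
  (forall j, fdot (v - v') (o j) + tau * stress_dot p v (o j) = fdot w (o j)) ->
  co v = rho (co v' + co w).
Proof.
move=> hv eqn; apply: galerkin_resolvent_unique.
apply/rowP => j; move: (eqn j); rewrite fdotBl !mxE.
rewrite -(stress_dot_eq p (combP basis hv) (fun i => vfield_refl _ i)).
by move: (fdot v _) (fdot v' _) (fdot w _) (stress_dot _ _ _) => a b c e h; rewrite -h; ring.
Qed.

Lemma comb_step v' w xi : Vd xi ->
  let v := comb o (rho (co v' + co w)) in
  fdot (v - v') xi + tau * stress_dot p v xi = fdot w xi.
Proof.
move=> hxi v; have hv : Vd v by exact: comb_div.
have fE u : fdot u xi = vdot (co u) (co xi) by rewrite -fdot_comb; apply: fdot_eq; [exact: vfield_refl|exact: (combP basis hxi)].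
rewrite fdotBl !fE (stress_dot_coords hV ho basis p_gt1 hv hxi) (coords_comb ho).
have := congr1 (vdot^~ (co xi)) (galerkin_resolventP (co v' + co w)).
rewrite /= !vdotDl vdotZl; lra.
Qed.

Section measurability.
Variable F : set (set Om).
Hypothesis sF : sigma_algebra setT F.

Lemma comb_meas (c : Om -> 'rV[R]_r) : (forall j, rmeas F (fun w => c w ord0 j)) ->
  meas_wrt F (borel (@fdist R n D)) (fun w => comb o (c w)).
Proof.
(* The second factor is the one-point space; only the countable cover of the coordinate space is
   used. *)
move=> mc; apply: (@borel_joint _ _ _ F sF unit (vfield D) (fun _ _ => 0) (@fdist R n D) r
  (fun a _ => comb o a) c (fun _ => tt)) => //.
- move=> a _ eps eps0; have r0 : 0 < r.+1%:R :> R by [].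
  exists (eps / r.+1%:R); first exact: divr_gt0.
  move=> a' _ h _; rewrite /fdist /fnorm -combB (fnormsq_coords basis (comb_div hV ho _)) (coords_comb ho).
  rewrite -[ltRHS]gtr0_norm// -sqrtr_sqr ltr_sqrt ?exprn_gt0//.
  apply: (@le_lt_trans _ _ (\sum_(j < r) (eps / r.+1%:R) ^+ 2)).
    apply: ler_sum => j _; rewrite !mxE -expr2 -real_normK ?num_real//.
    by rewrite lerXn2r ?nnegrE// ?divr_ge0// ltW.
  rewrite sumr_const card_ord -[ltLHS]mulr_natl expr_div_n mulrCA -[ltRHS]mulr1 ltr_pM2l ?exprn_gt0//.
  rewrite ltr_pdivrMr ?exprn_gt0// mul1r expr2 -natrM ltr_nat.
  by rewrite (@leq_trans r.+1)// leq_pmulr.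
- have F0 : F set0 by case: sF.
  move=> B mB; have [AB|AB] := pselect (B tt).
    by rewrite (_ : _ @^-1` _ = setT); [rewrite -setC0; exact: (sub_sigma_setC sF F0)|apply/seteqP; split].
  by rewrite (_ : _ @^-1` _ = set0); [exact: F0|apply/seteqP; split].
Qed.

Hypothesis subF : F `<=` measurable.

Lemma resolvent_meas (g : Om -> 'rV[R]_r) : (forall j, rmeas F (fun w => g w ord0 j)) ->
  forall j, rmeas F (fun w => rho (g w) ord0 j).
Proof.
move=> mg j; apply: (rmeas_row sF (f := fun c => rho c ord0 j) _ mg) => c.
apply: (@continuous_comp _ _ _ rho (fun c : 'rV[R]_r => c ord0 j)); last exact: coord_continuous.
exact: galerkin_resolvent_continuous.
Qed.

Lemma step_meas (g : Om -> 'rV[R]_r) : (forall j, rmeas F (fun w => g w ord0 j)) ->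
  meas_wrt F (borel (@fdist R n D)) (fun w => comb o (rho (g w))).
Proof. by move=> mg; apply: comb_meas; exact: resolvent_meas. Qed.

Lemma rmeas_meas (f : Om -> R) : rmeas F f -> measurable_fun setT f.
Proof. by move=> mf _ B mB; rewrite setTI; exact/subF/mf. Qed.

Lemma step_fin (g : Om -> 'rV[R]_r) : (forall j, rmeas F (fun w => g w ord0 j)) ->
  (forall j, int2 P (fun w => g w ord0 j)) ->
  (mean_normsq P (fun w => comb o (rho (g w))) < +oo)%E.
Proof.
move=> mg ig; rewrite /mean_normsq.
have mr := resolvent_meas mg.
have ir : int1 P (fun w => vdot (rho (g w)) (rho (g w))).
  apply: (@int1_le _ _ _ _ _ (fun w => 2 * vdot (g w) (g w) + 2 * vdot (rho 0) (rho 0))).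
  - by apply: rmeas_meas; exact: rmeas_vdot.
  - by move=> w; rewrite ger0_norm ?vdot_ge0//; exact: galerkin_resolvent_le.
  - by apply: int1D; [apply: int1Z; exact: int1_vdot|exact: finite_measure_integrable_cst].
have := int1_lty ir; congr (_ < _)%E; apply: eq_integral => w _.
rewrite (fnormsq_coords basis (comb_div hV ho _)) (coords_comb ho).
by rewrite ger0_norm// vdot_ge0.
Qed.

Lemma coords_meas (X : Om -> vfield D) : meas_wrt F (borel (@fdist R n D)) X ->
  forall j, rmeas F (fun w => co (X w) ord0 j).
Proof.
move=> mX j; under eq_fun do rewrite mxE; exact: rmeas_fdot.
Qed.

Lemma coords_int2 (X : Om -> vfield D) : meas_wrt F (borel (@fdist R n D)) X ->
  (mean_normsq P X < +oo)%E -> forall j, int2 P (fun w => co (X w) ord0 j).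
Proof.
move=> mX fX j; apply: int2P; first by apply: rmeas_meas; exact: coords_meas.
apply: le_lt_trans fX; apply: ge0_integral_mono => w _; first by rewrite lee_fin sqr_ge0.
by rewrite lee_fin (le_trans (coord_sqr_le _ j))// (coords_le hV ho basis).
Qed.

End measurability.
End random_step.

(** * Existence and adaptedness of solutions *)

Section solutions.
Context d (Om : measurableType d) (R : realType) (P : probability Om R) (T : R).
Context {n : nat} {U : hilbert R} (e : onb U) (D : lipschitz_domain R n).
Variables (F : R -> set (set Om)) (W : nat -> R -> Om -> R) (N : nat) (C : R).
Local Notation K := (onb_idx e).
Local Notation FN := (FN T F N).
Hypothesis hF : complete_filtration P T F.
Hypothesis hW : cylindrical_wiener P T F K W.
Hypothesis T_gt0 : 0 < T.
Variable G : nat -> Om -> vfield D -> hs_op e D.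
Hypothesis hG : data_stability P T F N C G.
Variables (V : set (vfield D)) (Q : set (L2 D)).
Local Notation Vd := (div_free V Q).
Hypothesis hV : velocity_space V.
Context (r : nat) (o : 'I_r -> vfield D).
Hypothesis ho : orthonormal_in V Q o.
Hypothesis basis : forall v, Vd v -> vfield_eq v (\sum_j fdot v (o j) *: o j).
Variables (p : R) (p_gt1 : 1 < p).
Local Notation tau := (tau T N).
Local Notation co := (coords o).
Local Notation rho := (resolvent (stress_mx o p) tau).
Variable u0 : Om -> vfield D.
Hypothesis u0_meas : meas_wrt (F 0) (borel (@fdist R n D)) u0.
Hypothesis u0_fin : (mean_normsq P u0 < +oo)%E.
Hypothesis u0_div : forall w, Vd (u0 w).

(** The invariant carried from step to step: measurability and square integrability let
    [data_stability] apply two steps later, and membership in V_h,div lets the coordinates determine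
    the field. *)
Definition admissible i (X : Om -> vfield D) :=
  [/\ meas_wrt (FN i) (borel (@fdist R n D)) X, (mean_normsq P X < +oo)%E &
      forall w, Vd (X w)].

Lemma admissible_square_int i u : (i <= N)%N -> admissible (i - 2) u ->
  square_int_at P T F N i u.
Proof. by move=> _ []. Qed.

Lemma admissible0 : admissible 0 u0. Proof. by []. Qed.

Lemma admissible_coords i X : (i <= N)%N -> admissible i X -> forall j,
  rmeas (FN i) (fun w => co (X w) ord0 j) /\ int2 P (fun w => co (X w) ord0 j).
Proof.
move=> iN [mX fX _] j; split; first exact: (coords_meas o (FN_sigma hF T_gt0 iN) mX j).
exact: (coords_int2 hV ho basis (FN_sigma hF T_gt0 iN) (FN_measurable hF T_gt0 iN) mX fX j).
Qed.

Let o1 j : fnormsq (o j) <= 1.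
Proof. by rewrite /fnormsq ho.2 eqxx. Qed.

Lemma noise_coords i v I : (1 <= i <= N)%N -> square_int_at P T F N i v ->
  noise P T F W N G i v I -> forall j,
  rmeas (FN i) (fun w => co (I w) ord0 j) /\ int2 P (fun w => co (I w) ord0 j).
Proof.
move=> iN hv hI j; have E : (fun w => co (I w) ord0 j) = (fun w => fdot (I w) (o j)).
  by apply/funext => w; rewrite mxE.
rewrite E; split; first exact: (noise_meas hF hW T_gt0 hG iN hv hI (o1 j)).
exact: (noise_int2 hF hW T_gt0 hG iN hv hI (o1 j)).
Qed.

Section step.
Variables (i : nat) (u' v I : Om -> vfield D).
Hypothesis iN : (1 <= i <= N)%N.
Hypothesis hu : admissible i.-1 u'.
Hypothesis hv : square_int_at P T F N i v.
Hypothesis hI : noise P T F W N G i v I.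

Let iN' : (i <= N)%N. Proof. by case/andP: iN. Qed.
Let i1N : (i.-1 <= N)%N. Proof. exact: leq_trans (leq_pred i) iN'. Qed.

Let g w := co (u' w) + co (I w).

Let g_meas j : rmeas (FN i) (fun w => g w ord0 j) /\ int2 P (fun w => g w ord0 j).
Proof.
have [m1 i1] := admissible_coords i1N hu j; have [m2 i2] := noise_coords iN hv hI j.
have E : (fun w => g w ord0 j) = (fun w => co (u' w) ord0 j + co (I w) ord0 j).
  by apply/funext => w; rewrite mxE.
rewrite E; split; last exact: int2D.
apply: (rmeasD (FN_sigma hF T_gt0 iN')) => // B mB.
by apply: (FN_mono hF T_gt0 (i := i.-1)); [rewrite leq_pred|exact: m1].
Qed.

Lemma admissible_step : admissible i (fun w => comb o (rho (co (u' w) + co (I w)))).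
Proof.
have t0 := tau_gt0 N T_gt0.
split; last by move=> w; exact: comb_div.
- exact: (step_meas hV ho basis p_gt1 t0 (FN_sigma hF T_gt0 iN') (fun j => (g_meas j).1)).
- exact: (step_fin hV ho basis p_gt1 t0 (FN_sigma hF T_gt0 iN')
    (FN_measurable hF T_gt0 iN') (fun j => (g_meas j).1) (fun j => (g_meas j).2)).
Qed.

(** Almost surely, [u] agrees up to a null set of D with the resolvent formula, which is
    F_i-measurable; completeness and the insensitivity of the pseudometric to such changes transfer
    this to [u]. *)
Lemma admissible_solution u : meas_wrt measurable (borel (@fdist R n D)) u ->
  (forall w, Vd (u w)) ->
  (forall xi, Vd xi -> {ae P, forall w,
     fdot (u w - u' w) xi + tau * stress_dot p (u w) xi = fdot (I w) xi}) ->
  admissible i u.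
Proof.
move=> mu du hu_eq; have [mX fX _] := admissible_step.
have ae_eq : {ae P, forall w, vfield_eq (comb o (rho (co (u' w) + co (I w)))) (u w)}.
  have H := ae_all (fun j => hu_eq (o j) (ho.1 j)).
  apply: ae_imp H => w /= H; apply: vfield_eq_sym.
  rewrite -(coords_step hV ho basis p_gt1 (tau_gt0 N T_gt0) (du w) H).
  exact: (combP basis (du w)).
split; last exact: du.
- apply: (borel_ae_eq (FN_sigma hF T_gt0 iN') (FN_null hF T_gt0 iN') _ _ mX).
    exact: fdistC.
  apply: ae_imp ae_eq => w E.
  by rewrite /fdist /fnorm (vfield_eq_fnormsq E) sqrtr0.
- apply: le_lt_trans fX; rewrite le_eqVlt; apply/orP; left; apply/eqP.
  have sM : sigma_algebra setT (@measurable _ Om) by exact: sigma_algebra_measurable.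
  apply: ae_eq_integral => //.
  + by apply/measurable_EFinP => _ B mB; rewrite setTI; exact: (rmeas_fnormsq sM mu mB).
  + apply/measurable_EFinP => _ B mB; rewrite setTI.
    exact: (FN_measurable hF T_gt0 iN' (rmeas_fnormsq (FN_sigma hF T_gt0 iN') mX mB)).
  + by apply: ae_imp ae_eq => w E _; rewrite /fnormsq (fdot_eq E E).
Qed.

End step.

Lemma solution_admissible u : scheme_solution P T F W N p G Vd u0 u ->
  forall i, (i <= N)%N -> admissible i (u i).
Proof.
move=> [u00 hu]; elim/ltn_ind => -[_ _|i IH iN]; first by rewrite u00; exact: admissible0.
have [mu du [I hI eqI]] := hu i.+1 iN.
have a1 : admissible i (u i) by apply: IH => //; exact: ltnW.
have a2 : admissible (i.+1 - 2) (u (i.+1 - 2)%N).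
  by apply: IH; [rewrite subSS ltnS leq_subr|exact: leq_trans (leq_subr _ _) iN].
exact: (@admissible_solution i.+1 (u i) _ I iN a1 (admissible_square_int iN a2) hI).
Qed.

(** The iterates are built one at a time because the noise of step m + 1 is only given by an
    existence statement about the iterate of index m - 1. The inductive claim is stronger than the
    scheme: the equations hold for every w. *)
Lemma solution_exists : exists u, scheme_solution P T F W N p G Vd u0 u.
Proof.
suff [u [u00 hu]] : exists u, u 0%N = u0 /\ forall i, (i <= N)%N ->
    admissible i (u i) /\ ((0 < i)%N -> exists2 I, noise P T F W N G i (u (i - 2)%N) I &
      forall xi, Vd xi -> forall w, fdot (u i w - u i.-1 w) xi +
        tau * stress_dot p (u i w) xi = fdot (I w) xi).
  exists u; split; first exact: u00.
  move=> i /andP[i0 iN]; have [[mu _ du] /(_ i0)[I hI eqI]] := hu _ iN.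
  split; [by move=> B /mu; exact: (FN_measurable hF T_gt0 iN)|exact: du|].
  exists I; first exact: hI.
  move=> xi hxi; apply: aeW => w; exact: eqI.
suff H m : (m <= N)%N -> exists u, u 0%N = u0 /\ forall i, (i <= m)%N ->
    admissible i (u i) /\ ((0 < i)%N -> exists2 I, noise P T F W N G i (u (i - 2)%N) I &
      forall xi, Vd xi -> forall w, fdot (u i w - u i.-1 w) xi +
        tau * stress_dot p (u i w) xi = fdot (I w) xi) by exact: H.
elim: m => [_|m IH mN].
  exists (fun=> u0); split; first by [].
  by move=> i; rewrite leqn0 => /eqP ->; split; [exact: admissible0|rewrite ltnn].
have [u [u00 hu]] := IH (ltnW mN).
have [a1 _] := hu m (leqnn m).
have m2 : (m.+1 - 2 <= m)%N by rewrite subSS leq_subr.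
have [a2 _] := hu _ m2.
have sq := admissible_square_int mN a2.
have [I hI] := noise_exists hF hW T_gt0 hG (i := m.+1) mN sq.
pose X w := comb o (rho (co (u m w) + co (I w))).
exists (fun i => if i == m.+1 then X else u i); split; first exact: u00.
move=> i.
rewrite leq_eqVlt => /orP[/eqP ->|im].
  rewrite eqxx; split; first exact: (@admissible_step m.+1 (u m) _ I mN a1 sq hI).
  move=> _; rewrite (ltn_eqF (leq_ltn_trans m2 (ltnSn m))) /= (ltn_eqF (ltnSn m)).
  exists I => // xi hxi w.
  exact: (comb_step hV ho basis p_gt1 (tau_gt0 N T_gt0) (u m w) (I w) hxi).
rewrite (ltn_eqF im) (ltn_eqF (leq_ltn_trans (leq_subr 2 i) im)).
rewrite (ltn_eqF (leq_ltn_trans (leq_pred i) im)).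
exact: hu.
Qed.

End solutions.

(** * The stability estimate for solutions *)

Section solution_stability.
Context d (Om : measurableType d) (R : realType) (P : probability Om R) (T : R).
Context {n : nat} {U : hilbert R} (e : onb U) (D : lipschitz_domain R n).
Variables (F : R -> set (set Om)) (W : nat -> R -> Om -> R) (N : nat) (C : R).
Local Notation K := (onb_idx e).
Local Notation FN := (FN T F N).
Hypothesis hF : complete_filtration P T F.
Hypothesis hW : cylindrical_wiener P T F K W.
Hypothesis T_gt0 : 0 < T.
Hypothesis C_gt0 : 0 < C.
Variable G : nat -> Om -> vfield D -> hs_op e D.
Hypothesis hG : data_stability P T F N C G.
Variables (V : set (vfield D)) (Q : set (L2 D)).
Local Notation Vd := (div_free V Q).
Hypothesis hV : velocity_space V.
Context (r : nat) (o : 'I_r -> vfield D).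
Hypothesis ho : orthonormal_in V Q o.
Hypothesis basis : forall v, Vd v -> vfield_eq v (\sum_j fdot v (o j) *: o j).
Variables (p : R) (p_gt1 : 1 < p).
Local Notation tau := (tau T N).
Local Notation co := (coords o).
Variable u0 : Om -> vfield D.
Variable u : nat -> Om -> vfield D.
Hypothesis u_adm : forall i, (i <= N)%N -> admissible P T F N V Q i (u i).
Hypothesis u_sol : scheme_solution P T F W N p G Vd u0 u.

Let p_gt0 : 0 < p. Proof. exact: lt_trans ltr01 p_gt1. Qed.
Let t0 : 0 < tau. Proof. exact: tau_gt0. Qed.
Let kap : R := 32 * gauss2 * C.
Let kap_ge0 : 0 <= kap.
Proof.
have g0 : 0 <= gauss2 :> R by apply: Rint_ge0 => y; exact: sqr_ge0.
by rewrite /kap; apply: mulr_ge0; [exact: mulr_ge0|exact: ltW].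
Qed.
Let Phi c := spow p (comb o c).
Let A := stress_mx o p.
Let x i w := co (u i w).
Let u_sq i : (i <= N)%N -> square_int_at P T F N i (u (i - 2)%N).
Proof. by move=> iN; exact/(admissible_square_int iN)/u_adm/(leq_trans (leq_subr 2 i)). Qed.

Let fnormsqE i w : (i <= N)%N -> fnormsq (u i w) = vdot (x i w) (x i w).
Proof. by move=> iN; have [_ _ du] := u_adm iN; exact: (fnormsq_coords basis). Qed.

Let meanE i : (i <= N)%N -> fine (mean_normsq P (u i)) = \int[P]_w vdot (x i w) (x i w).
Proof. by move=> iN; apply: eq_Rintegral => w _; exact: fnormsqE. Qed.

Let coords_noise_equation : exists z : nat -> Om -> 'rV[R]_r,
  [/\ forall i j, (1 <= i <= N)%N -> rmeas (FN i) (fun w => z i w ord0 j),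
      forall i j, (1 <= i <= N)%N -> int2 P (fun w => z i w ord0 j),
      forall i j g, (1 <= i <= N)%N -> rmeas (FN (i - 2)) g -> int2 P g ->
        \int[P]_w (z i w ord0 j * g w) = 0,
      forall i, (1 <= i <= N)%N -> \int[P]_w vdot (z i w) (z i w) <=
        tau * kap * (1 + \int[P]_w vdot (x (i - 2)%N w) (x (i - 2)%N w)) &
      forall i, (1 <= i <= N)%N ->
        {ae P, forall w, x i w - x i.-1 w + tau *: A (x i w) = z i w}].
Proof.
have [_ hu] := u_sol.
have sol_ex i : exists X : Om -> vfield D, (1 <= i <= N)%N ->
    noise P T F W N G i (u (i - 2)%N) X /\
    forall xi, Vd xi -> {ae P, forall w, fdot (u i w - u i.-1 w) xi +
      tau * stress_dot p (u i w) xi = fdot (X w) xi}.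
  have [iN|iN] := boolP (1 <= i <= N)%N; last by exists (u 0%N).
  by have [_ _ [I h1 h2]] := hu _ iN; exists I.
have [I hI] := choice sol_ex.
have le_N i : (1 <= i <= N)%N -> (i <= N)%N by case/andP.
exists (fun i w => co (I i w)); split.
- move=> i j iN.
  by have [] := noise_coords hF hW T_gt0 hG ho iN (u_sq (le_N _ iN)) (hI _ iN).1 j.
- move=> i j iN.
  by have [] := noise_coords hF hW T_gt0 hG ho iN (u_sq (le_N _ iN)) (hI _ iN).1 j.
- move=> i j g iN mg ig.
  rewrite -[RHS](noise_orth hF hW T_gt0 hG iN (u_sq (le_N _ iN)) (hI _ iN).1 (b := o j) _ mg ig).
    by apply: eq_Rintegral => w _; rewrite mxE.
  by rewrite /fnormsq ho.2 eqxx.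
- move=> i iN; have iz j := (noise_coords hF hW T_gt0 hG ho iN (u_sq (le_N _ iN)) (hI _ iN).1 j).2.
  rewrite (Rint_vdot iz iz) -meanE; last exact: leq_trans (leq_subr 2 i) (le_N _ iN).
  apply: (@le_trans _ _ (\sum_j \int[P]_w (fdot (I i w) (o j) ^+ 2))).
    apply: ler_sum => j _; rewrite le_eqVlt; apply/orP; left; apply/eqP.
    by apply: eq_Rintegral => w _; rewrite mxE expr2.
  have bessel v : \sum_j fdot v (o j) ^+ 2 <= fnormsq v.
    apply: le_trans (coords_le hV ho basis v); rewrite le_eqVlt; apply/orP; left; apply/eqP.
    by apply: eq_bigr => j _; rewrite mxE expr2.
  apply: le_trans (noise_energy hF hW T_gt0 hG iN (u_sq (le_N _ iN)) (hI _ iN).1 ho.2 bessel) _.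
  rewrite /kap le_eqVlt; apply/orP; left; apply/eqP; ring.
- move=> i iN; have H := ae_all (fun j => (hI _ iN).2 (o j) (ho.1 j)).
  have [_ _ du] := u_adm (le_N _ iN).
  apply: ae_imp H => w H; apply/rowP => j.
  have := H j; rewrite fdotBl !mxE.
  by rewrite -(stress_dot_eq p (combP basis (du w)) (fun i => vfield_refl _ i)).
Qed.

Let B : R := expR (8 * kap * T) * (1 + \int[P]_w vdot (x 0%N w) (x 0%N w)).

Let bounds :
  [/\ (forall i, (1 <= i <= N)%N -> int1 P (fun w => Phi (x i w))) /\
        tau * \sum_(1 <= i < N.+1) \int[P]_w Phi (x i w) <= (1 + 8 * kap * T) * B,
      int1 P (fun w => \big[Num.max/0]_(1 <= i < N.+1) vdot (x i w) (x i w)) /\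
        \int[P]_w \big[Num.max/0]_(1 <= i < N.+1) vdot (x i w) (x i w) <= (3 + 3616 * kap * T) * B &
      forall k, (1 <= k <= N)%N ->
        (forall m, (k <= m <= N)%N ->
           int1 P (fun w => vdot (x m w - x (m - k)%N w) (x m w - x (m - k)%N w))) /\
        \sum_(k <= m < N.+1)
          (\int[P]_w vdot (x m w - x (m - k)%N w) (x m w - x (m - k)%N w)) / k%:R <=
        (12 + 66 * kap * T) * B].
Proof.
have [z [mz iz oz ez xz]] := coords_noise_equation.
have sH i : (i <= N)%N -> sigma_algebra setT (FN i) by move=> iN; exact: (FN_sigma hF T_gt0 iN).
have mH i : (i <= N)%N -> FN i `<=` measurable by move=> iN; exact: (FN_measurable hF T_gt0 iN).
have monoH i j : (i <= j <= N)%N -> FN i `<=` FN j by move=> iN; exact: (FN_mono hF T_gt0 iN).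
have Phi_ge0 c : 0 <= Phi c by exact: spow_ge0.
have A_self c : vdot (A c) c = Phi c by exact: (stress_mx_self hV ho p_gt1).
have A_le c y : `|vdot (A c) y| <= Phi c + Phi y by exact: (stress_mx_le hV ho p_gt1).
have Phi_cont : continuous Phi.
  exact: (Phi_continuous p_gt0 (stress_sub hV ho p_gt1) (stress_mx_le hV ho p_gt1)
    (spow_comb_bounded hV ho p_gt1)).
have tauN : N%:R * tau <= T.
  by rewrite mulrCA ler_piMr ?ltW// ltr_pdivrMr// mul1r ltr_nat.
have mx i j : (i <= N)%N -> rmeas (FN i) (fun w => x i w ord0 j).
  by move=> iN; have [] := admissible_coords hF T_gt0 hV ho basis iN (u_adm iN) j.
have ix i j : (i <= N)%N -> int2 P (fun w => x i w ord0 j).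
  by move=> iN; have [] := admissible_coords hF T_gt0 hV ho basis iN (u_adm iN) j.
split.
- exact: (stability_Phi sH mH Phi_ge0 A_self Phi_cont t0 tauN kap_ge0 mx ix iz oz ez xz).
- exact: (stability_max sH mH monoH Phi_ge0 A_self t0 tauN kap_ge0 mx ix mz iz oz ez xz).
- move=> k hk; exact: (stability_increments sH mH monoH Phi_ge0 A_le A_self Phi_cont t0 tauN
    kap_ge0 mx ix mz iz oz ez xz hk).
Qed.

Let B_ge0 : 0 <= B.
Proof.
rewrite mulr_ge0 ?expR_ge0// addr_ge0// Rint_ge0// => w; exact: vdot_ge0.
Qed.

Lemma solution_stable : (stability_lhs P T N p u <=
  ((16 + 3690 * kap * T) * expR (8 * kap * T))%:E * (mean_normsq P u0 + 1))%E.
Proof.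
have [[iPhi bPhi] [imax bmax] bincr] := bounds.
have mE : (mean_normsq P u0 + 1 = (1 + \int[P]_w vdot (x 0%N w) (x 0%N w))%:E)%E.
  have [u00 _] := u_sol; have [_ fin _] := u_adm (leq0n N).
  rewrite -(meanE (leq0n N)) u00 addrC EFinD fineK// -u00 ge0_fin_numE//.
  by apply: integral_ge0 => w _; rewrite lee_fin fnormsq_ge0.
(* The constant collects the three bounds, for the maximum, the gradients and the increments: 16 = 3
   + 1 + 12 and 3690 = 3616 + 8 + 66. *)
have -> : (((16 + 3690 * kap * T) * expR (8 * kap * T))%:E * (mean_normsq P u0 + 1) = ((
   (3 + 3616 * kap * T) * B + (1 + 8 * kap * T) * B)
    + (12 + 66 * kap * T) * B)%:E)%E.
  rewrite mE -EFinM; congr (_%:E); rewrite /B; move: (expR _) (\int[P]_w _) => E I.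
  move: kap => k; ring.
rewrite EFinD; apply: leeD.
  have isum : int1 P (fun w => \sum_(1 <= i < N.+1) tau * Phi (x i w)).
    rewrite (_ : (fun w => _) = (fun w => \sum_(1 <= i < N.+1 | (1 <= i <= N)%N) tau * Phi (x i w))).
      by apply: int1_sum => i iN; apply: int1Z; exact: iPhi.
    by apply/funext => w; rewrite big_nat_cond [RHS]big_nat_cond; apply: eq_bigl => i; rewrite ltnS andbT andbb.
  apply: (@le_trans _ _ (\int[P]_w (\big[Num.max/0]_(1 <= i < N.+1) vdot (x i w) (x i w)
      + \sum_(1 <= i < N.+1) tau * Phi (x i w))%:E)%E).
    rewrite le_eqVlt; apply/orP; left; apply/eqP; apply: eq_integral => w _.
    rewrite EFinD -sumEFin; congr (_%:E + _)%E.
      by apply: eq_big_nat => i /andP[_ iN]; exact: fnormsqE.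
    apply: eq_big_nat => i /andP[_ iN]; have [_ _ du] := u_adm (iN : (i <= N)%N).
    have E := combP basis (du w).
    rewrite EFinM (sgrad_powE p_gt1); last exact: (nice_eq (vfield_eq_sym E) (comb_nice hV ho _)).
    by rewrite (spow_eq p E).
  rewrite -RintE; last exact: int1D.
  rewrite lee_fin RintD//; apply: lerD => //.
  apply: le_trans bPhi; rewrite big_distrr/= le_eqVlt; apply/orP; left; apply/eqP.
  transitivity (\sum_(1 <= i < N.+1 | (1 <= i <= N)%N) \int[P]_w (tau * Phi (x i w))).
    rewrite -Rint_sum; last by move=> i iN; apply: int1Z; exact: iPhi.
    by apply: eq_Rintegral => w _; rewrite big_nat_cond [RHS]big_nat_cond; apply: eq_bigl => i; rewrite ltnS andbT andbb.
  rewrite [RHS]big_nat_cond big_nat_cond; apply: eq_big => [i|i iN].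
    by rewrite ltnS andbT andbb.
  by rewrite RintZ//; exact: iPhi.
rewrite big_nat; apply: (big_ind (fun y => (y <= ((12 + 66 * kap * T) * B)%:E)%E)).
- rewrite lee_fin; apply: mulr_ge0 => //; apply: addr_ge0 => //.
  by apply: mulr_ge0; [exact: mulr_ge0|exact: ltW].
- by move=> y y' h h'; rewrite ge_max h h'.
move=> k kN; have [iincr le_incr] := bincr k kN.
rewrite -lee_fin in le_incr; apply: le_trans le_incr.
rewrite -sumEFin le_eqVlt; apply/orP; left; apply/eqP.
apply: eq_big_nat => m /andP[km mN]; have {}mN : (m <= N)%N by [].
have im := iincr m; rewrite km mN /= in im; have {}im := im isT.
rewrite [in RHS]mulrC -RintZ// RintE; last exact: int1Z.
apply: eq_integral => w _; rewrite mulrC; congr (_ * _)%:E.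
have [_ _ du] := u_adm mN; have [_ _ du'] := u_adm (leq_trans (leq_subr k m) mN).
have E := combP basis (du w); have E' := combP basis (du' w).
rewrite fnormsqB (fnormsqE w mN) (fnormsqE w (leq_trans (leq_subr k m) mN)).
have -> : fdot (u m w) (u (m - k)%N w) = vdot (x m w) (x (m - k)%N w).
  by rewrite -fdot_comb; apply: fdot_eq => // i; exact: vfield_refl.
rewrite !(vdotBl, vdotBr) (vdotC (x (m - k)%N w)).
move: (vdot _ _) (vdot _ _) (vdot _ _) => a b c; ring.
Qed.

End solution_stability.

(** * Uniformity in h, N, G and u0 *)

Theorem theorem3 (R : realType) (n : nat) (n_gt0 : (0 < n)%N)
    (D : lipschitz_domain R n) (T p : R) (T_gt0 : 0 < T) (p_gt1 : 1 < p)
    (d : measure_display) (Om : measurableType d) (P : probability Om R)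
    (F : R -> set (set Om)) (F_filtration : complete_filtration P T F)
    (U : hilbert R) (U_separable : separable U) (e : onb U)
    (W : nat -> R -> Om -> R)
    (W_wiener : cylindrical_wiener P T F (onb_idx e) W)
    (V : R -> set (vfield D)) (Q : R -> set (L2 D))
    (V_space : forall h, 0 < h <= 1 -> velocity_space (V h))
    (Q_space : forall h, 0 < h <= 1 -> pressure_space (Q h))
    (C : R) (C_gt0 : 0 < C) :
  exists2 c : R, 0 < c &
    forall (h : R) (N : nat) (G : nat -> Om -> vfield D -> hs_op e D)
      (u0 : Om -> vfield D),
    0 < h <= 1 -> (0 < N)%N ->
    data_stability P T F N C G ->
    meas_wrt (F 0) (borel (@fdist R n D)) u0 ->
    (mean_normsq P u0 < +oo)%E ->
    (forall w, div_free (V h) (Q h) (u0 w)) ->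
    (exists u, scheme_solution P T F W N p G (div_free (V h) (Q h)) u0 u) /\
    (forall u, scheme_solution P T F W N p G (div_free (V h) (Q h)) u0 u ->
      (forall i, (1 <= i <= N)%N ->
        meas_wrt (FN T F N i) (borel (@fdist R n D)) (u i)) /\
      (stability_lhs P T N p u <= c%:E * (mean_normsq P u0 + 1))%E).
Proof.
pose kap : R := 32 * gauss2 * C.
have kap_ge0 : 0 <= kap.
  have g0 : 0 <= gauss2 :> R by apply: Rint_ge0 => y; exact: sqr_ge0.
  by rewrite /kap; apply: mulr_ge0; [exact: mulr_ge0|exact: ltW].
(* Chosen before h, N, G and u0: it depends on T, C and [gauss2] only. *)
exists ((16 + 3690 * kap * T) * expR (8 * kap * T)).
  apply: mulr_gt0; last exact: expR_gt0.
  have kT_ge0 : 0 <= kap * T by apply: mulr_ge0 => //; exact: ltW.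
  by rewrite -mulrA; move: (kap * T) kT_ge0 => k; lra.
move=> h N G u0 h01 N_gt0 hG u0_meas u0_fin u0_div.
have [r [b [ho basis]]] := orthonormal_basis (Q h) (V_space h h01).
split.
  exact: (solution_exists F_filtration W_wiener T_gt0 hG (V_space h h01) ho basis p_gt1
    u0_meas u0_fin u0_div).
move=> u u_sol.
have u_adm := solution_admissible F_filtration W_wiener T_gt0 hG (V_space h h01) ho basis p_gt1
  u0_meas u0_fin u0_div u_sol.
split; first by move=> i /andP[_ iN]; have [mu _ _] := u_adm i iN.
exact: (solution_stable F_filtration W_wiener T_gt0 C_gt0 hG (V_space h h01) ho basis p_gt1
  u_adm u_sol).
Qed.
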